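(* Let $(M,\mathcal F)$ be a foliated manifold of codimension $q\ge2$ and $\nabla(\mathcal F)$ a foliated torsion-free connection. Set $$C_{k,0}=1,\qquad C_{k,l}=\frac{(k-1)\cdots(k-l)}{(q+2k-1)\cdots(q+2k-l)}\binom{k}{l}\quad (l\ge 1).$$ For a foliated symbol $S\in\mathcal S^k(M,\mathcal F)$ of degree $k$ and a basic function $f\in C^\infty(M,\mathcal F)$, the formula $$Q(\mathcal F)(\nabla(\mathcal F),S)(f)=(p^{2}(\mathcal F)^{*})^{-1}\Big(\sum_{l=0}^kC_{k,l}\,\big\langle(\mathrm{Div}^{\omega(\mathcal F)})^{l}\,p^2(\mathcal F)^{*}S,\ (\nabla^{\omega(\mathcal F)})^{k-l}\,p^2(\mathcal F)^{*}f\big\rangle\Big)$$ gives a (well-defined) natural and projectively invariant quantization $Q(\mathcal F)$ in the foliated situation.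
   Context: Meaning of the claim. $S$ and $f$ are identified with their equivariant component functions on the normal linear frame bundle $L(M,\mathcal F)$, and $p^2(\mathcal F)^*$ is pullback to $P(\mathcal F)$ (all defined below). Well-defined: the sum is an $H(q+1,\mathbb R)$-invariant foliated function on $P(\mathcal F)$, hence descends to a basic function on $M$. Quantization: $Q(\mathcal F)(\nabla(\mathcal F),S)$ is a foliated differential operator with principal symbol $S$, i.e. in adapted coordinates it is $S^{a_1\dots a_k}(y)\,\partial_{y^{a_1}}\cdots\partial_{y^{a_k}}$ plus terms of order $<k$ in $\partial_{y}$ with coefficients that are basic functions. Projectively invariant: it depends only on the projective class of $\nabla(\mathcal F)$. Natural: $Q(\mathcal F)(\phi^*\nabla(\mathcal F),\phi^*S)(\phi^*f)=\phi^*(Q(\mathcal F)(\nabla(\mathcal F),S)(f))$ for every local diffeomorphism $\phi$ between foliated manifolds preserving the foliations. Foliations. $T\mathcal F\subset TM$ is the tangent bundle of the foliation and $N=TM/T\mathcal F$. Adapted coordinates $(x^1,\dots,x^p,y^1,\dots,y^q)$ are coordinates in which the leaves are locally $y=$ const. $\mathrm{Vect}_{\mathcal F}(M)=\{X:[X,Y]\in\Gamma(T\mathcal F)\ \forall Y\in\Gamma(T\mathcal F)\}$; $\mathrm{Vect}(M,\mathcal F)=\mathrm{Vect}_{\mathcal F}(M)/\Gamma(T\mathcal F)$ (foliated vector fields, acting on basic functions by $L_{[X]}f=L_Xf$). Basic functions, forming $C^\infty(M,\mathcal F)$, are those locally constant along the leaves. A foliated torsion-free connection is an $\mathbb R$-bilinear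 map $\nabla(\mathcal F)$ on $\mathrm{Vect}(M,\mathcal F)$ that is $C^\infty(M,\mathcal F)$-linear in the first argument, satisfies $\nabla(\mathcal F)_{[X]}(f[Y])=(L_{[X]}f)[Y]+f\nabla(\mathcal F)_{[X]}[Y]$ for basic $f$, and $\nabla(\mathcal F)_{[X]}[Y]=\nabla(\mathcal F)_{[Y]}[X]+[[X],[Y]]$; $\Gamma(\mathcal F)^c_{ab}$, given by $\nabla(\mathcal F)_{[\partial_{y^a}]}[\partial_{y^b}]=\Gamma(\mathcal F)^c_{ab}[\partial_{y^c}]$, are its Christoffel symbols. Two are projectively equivalent if their difference is $\alpha([X])[Y]+\alpha([Y])[X]$ for a 1-form $\alpha$ on $M$ with $i_Y\alpha=i_Yd\alpha=0$ for all $Y\in\Gamma(T\mathcal F)$. Normal frames. $P^r(M,\mathcal F)$ is the principal bundle, with group $G^r_q$ of $r$-jets at $0$ of local diffeomorphisms of $(\mathbb R^q,0)$, of classes $J^r_0(f)$ of smooth maps $f$ from a neighbourhood of $0\in\mathbb R^q$ into $M$ with $\mathrm{im}\,Tf\oplus T\mathcal F=TM$; $J^r_0(f)$ is determined by $f(0)$ and the $r$-jet at $0$ of $y\circ f$. $L(M,\mathcal F)=P^1(M,\mathcal F)$ is the bundle of frames of $N$. $H(q+1,\mathbb R)$ is the group, modulo nonzero scalars, of matrices $\begin{pmatrix}\mathcal A&0\\ \alpha&a\end{pmatrix}$, $\mathcal A\in\mathrm{GL}(q,\mathbb R)$, $\alpha\in\mathbb R^{q*}$, $a\ne0$, embedded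 in $G^2_q$ by taking the 2-jet at $0$ of $z\mapsto\mathcal Az/(\alpha z+a)$. $P(\mathcal F)\subset P^2(M,\mathcal F)$ is the reduction to $H(q+1,\mathbb R)$ (depending only on the projective class) whose fibre at $m$ is $J^2_0(f)\cdot H(q+1,\mathbb R)$ with $f(0)=m$, $y^c(f(z))=y^c(m)+z^c-\tfrac12\Gamma(\mathcal F)^c_{ab}(m)z^az^b$. $p^2(\mathcal F):P(\mathcal F)\to L(M,\mathcal F)$, $J^2_0(f)\mapsto J^1_0(f)$. $\mathcal F_{P^2N}$ is the foliation of $P(\mathcal F)$ whose leaves are locally the fibres of $J^2_0(f)\mapsto j^2_0(f_i\circ f)$, for a cocycle $(U_i,f_i,g_{ij})$ of submersions $f_i:U_i\to N_i$ ($\dim N_i=q$) with connected fibres defining $\mathcal F$. Functions on $P(\mathcal F)$ locally constant along its leaves are called foliated. Symbols. $\mathcal S^k(M,\mathcal F)$ is the space of sections of $S^kN$ whose components in adapted coordinates depend only on $y$; such a section is identified with the $\mathrm{GL}(q,\mathbb R)$-equivariant function $L(M,\mathcal F)\to S^k\mathbb R^q$ giving its components in a frame. Cartan connection. $\omega(\mathcal F)$ is the $\mathrm{sl}(q+1,\mathbb R)=\mathbb R^q\oplus\mathrm{gl}(q,\mathbb R)\oplus\mathbb R^{q*}$-valued 1-form on $P(\mathcal F)$ which over $U_i$ is the pullback, by $J^2_0(f)\mapsto j^2_0(f_i\circ f)$, of the normal projective Cartan connection of the image of $P(\mathcal F)|_{U_i}$, a reduction of the second order frame bundle $P^2N_i$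 to $H(q+1,\mathbb R)$. (The normal projective Cartan connection of such a reduction is the unique Cartan connection whose $\mathbb R^q\oplus\mathrm{gl}(q,\mathbb R)$-part is the canonical form of $P^2N_i$ and whose $\mathrm{gl}(q)$-curvature $\Omega^i_j=\frac12\sum K^i_{jkl}\omega^k\wedge\omega^l$ satisfies $\sum_iK^i_{jil}=0$.) Operators (on foliated functions on $P(\mathcal F)$). For $v\in\mathbb R^q$, $\omega(\mathcal F)^{-1}(v)$ is any vector field whose image under $\omega(\mathcal F)$ is $v$ (the result below does not depend on the choice). $\nabla^{\omega(\mathcal F)}_vf=L_{\omega(\mathcal F)^{-1}(v)}f$ and $(\nabla^{\omega(\mathcal F)})^kf(v_1,\dots,v_k)=\frac1{k!}\sum_\nu L_{\omega(\mathcal F)^{-1}(v_{\nu_1})}\cdots L_{\omega(\mathcal F)^{-1}(v_{\nu_k})}f$ (sum over permutations). $\mathrm{Div}^{\omega(\mathcal F)}S=\sum_{j=1}^qi(\epsilon^j)\nabla^{\omega(\mathcal F)}_{e_j}S$ for foliated $S\in C^\infty(P(\mathcal F),S^k\mathbb R^q)$, where $(e_j),(\epsilon^j)$ are canonical dual bases and $i(\epsilon)$ is insertion into one slot of the symmetric tensor. $\langle\cdot,\cdot\rangle$ is the pairing with $\langle v_1\vee\dots\vee v_k,T\rangle=T(v_1,\dots,v_k)$. *)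

(* Defs.v *)
(* MathComp / MathComp-Analysis. *)
From mathcomp Require Import all_boot all_order all_algebra all_fingroup.
From mathcomp Require Import all_classical all_reals all_analysis.

Set Implicit Arguments.
Unset Strict Implicit.
Unset Printing Implicit Defensive.

Import Order.TTheory GRing.Theory Num.Theory.
Import numFieldNormedType.Exports.

Local Open Scope classical_set_scope.
Local Open Scope ring_scope.

Section Smooth.
Context {R : realType} {V W : normedModType R}.
Implicit Types (f : V -> W) (U : set V).

Definition iterD (vs : seq V) f : V -> W := foldr (fun v g => 'D_v g) f vs.

(* [C^oo] on an open subset of a finite-dimensional [V]: all iterated
   directional derivatives exist and are continuous. *)
Definition smooth_on U f : Prop :=
  open U /\
  forall (vs : seq V) (z : V), U z ->
    {for z, continuous (iterD vs f)} /\ forall v, derivable (iterD vs f) z v.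

End Smooth.

(** * Foliated manifolds *)

Notation bmod R p q := ('cV[R]_p * 'cV[R]_q)%type.

(* A manifold of dimension [p + q] with a foliation of codimension [q], given by
   any atlas of adapted charts [m |-> (x, y)] with connected plaques (so that
   the [y]'s are submersions with connected fibres defining the foliation).
   [chart i] and [par i] are inverse bijections between [par i @` dom i] and
   [dom i] and are meaningless elsewhere. The topology of the manifold is the
   one defined by the atlas ([mopen] below); it is Hausdorff and second
   countable. *)
Record folmfd (R : realType) (p q : nat) := FolMfd {
  car :> Type;
  idx : Type;
  dom : idx -> set (bmod R p q);
  par : idx -> bmod R p q -> car;
  chart : idx -> car -> bmod R p q;
  dom_open : forall i, open (dom i);
  parK : forall i z, dom i z -> chart i (par i z) = z;
  trans_smooth : forall i j,
    smooth_on (dom i `&` par i @^-1` (par j @` dom j)) (chart j \o par i);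
  trans_fol : forall i j z, (dom i `&` par i @^-1` (par j @` dom j)) z ->
    \forall x \near z.1, (chart j (par i (x, z.2))).2 = (chart j (par i z)).2;
  plaque_connected : forall i y, connected [set x | dom i (x, y)];
  second_countable : exists2 C : set idx, countable C &
    forall m, exists2 i, C i & (par i @` dom i) m;
  hausdorff : forall m m' : car, m <> m' ->
    exists O O' : set car,
      [/\ O m, O' m', O `&` O' = set0,
          forall i, open (dom i `&` par i @^-1` O) &
          forall i, open (dom i `&` par i @^-1` O')]
}.

(* [R^q + gl(q,R) + R^q*]; also the model space of reductions to [H(q+1,R)] of
   second order frame bundles in dimension [q], with coordinates
   [(y, A, alpha)] relative to a section ([a] being normalized to 1). *)
Notation slq R q := ('cV[R]_q * 'M[R]_q * 'rV[R]_q)%type.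

Notation pmod R p q := ('cV[R]_p * ('cV[R]_q * 'M[R]_q * 'rV[R]_q))%type.

Section Manifold.
Context {R : realType} {p q : nat}.
Implicit Types (M : folmfd R p q).

Definition mopen M (O : set M) : Prop :=
  forall i : idx M, open (dom i `&` par i @^-1` O).

Definition udom M (i : idx M) : set M := par i @` dom i.

(* basic functions on an open set [O] *)
Definition basic M (O : set M) (f : M -> R) : Prop :=
  forall i, let D := dom i `&` par i @^-1` O in
    smooth_on D (f \o par i : bmod R p q -> R) /\
    forall z, D z -> \forall x \near z.1, f (par i (x, z.2)) = f (par i z).

(* Vector fields, possibly only on an open set, given by their components in
   the charts: [X i m] is meaningful for [m] in the domain of chart [i]. *)
Definition vf M : Type := idx M -> M -> bmod R p q.

Definition vfield M (O : set M) (X : vf M) : Prop :=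
  (forall i, smooth_on (dom i `&` par i @^-1` O) (fun z => X i (par i z))) /\
  (forall i j m, O m -> udom i m -> udom j m ->
     X j m = 'D_(X i m) (chart j \o par i) (chart i m)).

Definition brk M (X Y : vf M) : vf M := fun i m =>
  'D_(X i m) (fun z => Y i (par i z)) (chart i m)
  - 'D_(Y i m) (fun z => X i (par i z)) (chart i m).

(* equality modulo [T F], i.e. equality of the classes in [N] *)
Definition eqN M (O : set M) (X Y : vf M) : Prop :=
  forall i m, O m -> udom i m -> (X i m).2 = (Y i m).2.

Definition tangent_to_leaves M (O : set M) (Y : vf M) : Prop :=
  eqN O Y (fun _ _ => 0).

(* [Vect_F(O)] *)
Definition folvf M (O : set M) (X : vf M) : Prop :=
  vfield O X /\
  forall (O' : set M) (Y : vf M), mopen O' -> O' `<=` O ->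
    vfield O' Y -> tangent_to_leaves O' Y -> tangent_to_leaves O' (brk X Y).

Definition addvf M (X Y : vf M) : vf M := fun i m => X i m + Y i m.
Definition scalevf M (f : M -> R) (X : vf M) : vf M := fun i m => f m *: X i m.

(* [L_X f] computed in chart [i] *)
Definition lie M (X : vf M) (f : M -> R) (i : idx M) (m : M) : R :=
  'D_(X i m) (f \o par i : bmod R p q -> R) (chart i m).

(* A foliated torsion-free connection, as an operator on representatives of
   foliated vector fields over every open set, compatible with restriction
   (global foliated fields need not have any prescribed germ, so Christoffel
   symbols only make sense for such a family). *)
Definition conn M : Type := set M -> vf M -> vf M -> vf M.

Record is_folconn M (nab : conn M) : Prop := IsFolConn {
  nab_fol : forall O X Y, mopen O -> folvf O X -> folvf O Y ->
    folvf O (nab O X Y);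
  nab_eqN : forall O X X' Y Y', mopen O -> folvf O X -> folvf O X' ->
    folvf O Y -> folvf O Y' -> eqN O X X' -> eqN O Y Y' ->
    eqN O (nab O X Y) (nab O X' Y');
  nab_restr : forall O O' X Y, mopen O -> mopen O' -> O' `<=` O ->
    folvf O X -> folvf O Y -> eqN O' (nab O' X Y) (nab O X Y);
  nab_addl : forall O X X' Y, mopen O -> folvf O X -> folvf O X' ->
    folvf O Y -> eqN O (nab O (addvf X X') Y) (addvf (nab O X Y) (nab O X' Y));
  nab_addr : forall O X Y Y', mopen O -> folvf O X -> folvf O Y ->
    folvf O Y' -> eqN O (nab O X (addvf Y Y')) (addvf (nab O X Y) (nab O X Y'));
  nab_scalel : forall O f X Y, mopen O -> basic O f -> folvf O X ->
    folvf O Y -> eqN O (nab O (scalevf f X) Y) (scalevf f (nab O X Y));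
  nab_leibniz : forall O f X Y, mopen O -> basic O f -> folvf O X ->
    folvf O Y -> eqN O (nab O X (scalevf f Y))
      (addvf (fun i m => lie X f i m *: Y i m) (scalevf f (nab O X Y)));
  nab_torsion : forall O X Y, mopen O -> folvf O X -> folvf O Y ->
    eqN O (nab O X Y) (addvf (nab O Y X) (brk X Y))
}.

(** A 1-form on [M] by its components in the charts, with
    [i_Y alpha = i_Y d alpha = 0] for [Y] tangent to the leaves. *)
Definition basic_form M (alpha : idx M -> M -> bmod R p q -> R) : Prop :=
  (forall i m c X Y, udom i m ->
     alpha i m (c *: X + Y) = c * alpha i m X + alpha i m Y) /\
  (forall i X, smooth_on (dom i) (fun z => alpha i (par i z) X : R)) /\
  (forall i j m X, udom i m -> udom j m ->
     alpha i m X = alpha j m ('D_X (chart j \o par i) (chart i m))) /\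
  (forall i m x, udom i m -> alpha i m (x, 0) = 0) /\
  (forall i z x X, dom i z ->
     'D_(x, 0) (fun z => alpha i (par i z) X : R) z
     - 'D_X (fun z => alpha i (par i z) (x, 0) : R) z = 0).

Definition proj_equiv M (nab nab' : conn M) : Prop :=
  exists2 alpha, basic_form alpha &
  forall O X Y, mopen O -> folvf O X -> folvf O Y ->
    eqN O (nab' O X Y) (addvf (nab O X Y)
      (fun i m => alpha i m (X i m) *: Y i m + alpha i m (Y i m) *: X i m)).

(** * Normal frames *)

Definition transversal M (f : 'cV[R]_q -> M) : Prop :=
  exists W : set 'cV[R]_q, W 0 /\ open W /\
  forall i, let V := W `&` f @^-1` udom i in let g := chart i \o f in
    smooth_on V g /\
    forall z, V z ->
      (forall w : bmod R p q, exists v x, w = 'D_v g z + (x, 0)) /\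
      (forall v x, 'D_v g z = (x, 0) -> 'D_v g z = 0).

Definition jet_eq M (r : nat) (f g : 'cV[R]_q -> M) : Prop :=
  f 0 = g 0 /\
  forall i, udom i (f 0) -> forall vs : seq 'cV[R]_q, (size vs <= r)%N ->
    iterD vs (fun z => (chart i (f z)).2) 0
    = iterD vs (fun z => (chart i (g z)).2) 0.

(* Jets are equivalence classes of germs; the elements of [P^r(M, F)] are the
   [jet_of r f] with [f] transversal. *)
Definition jet M : Type := set ('cV[R]_q -> M).

Definition jet_of M (r : nat) (f : 'cV[R]_q -> M) : jet M :=
  [set g | transversal g /\ jet_eq r f g].

Definition jmap M M' (r : nat) (F : ('cV[R]_q -> M) -> ('cV[R]_q -> M'))
  (u : jet M) : jet M' := [set g | exists2 f, u f & jet_of r (F f) g].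

Definition p2 M (u : jet M) : jet M := jmap 1 id u.

Definition lies_over M (u : jet M) (m : M) : Prop := exists2 f, u f & f 0 = m.

(* Elements of [H(q+1,R)] are represented by matrices
   [block_mx A 0 alpha a%:M] with [A] and [a] invertible. *)
Definition hmap (A : 'M[R]_q) (alpha : 'rV[R]_q) (a : R) (z : 'cV[R]_q) :
  'cV[R]_q := ((alpha *m z) 0 0 + a)^-1 *: (A *m z).

Definition ract M (A : 'M[R]_q) (alpha : 'rV[R]_q) (a : R) (u : jet M) :
  jet M := jmap 2 (fun f => f \o hmap A alpha a) u.

Definition evec (a : 'I_q) : 'cV[R]_q := delta_mx a 0.

(* the field [d/dy^a] of chart [i] *)
Definition dyvf M (i : idx M) (a : 'I_q) : vf M := fun j m =>
  'D_(0, evec a) (chart j \o par i) (chart i m).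

Definition christoffel M (nab : conn M) (i : idx M) (m : M) (c a b : 'I_q) : R
  := (nab (udom i) (dyvf i a) (dyvf i b) i m).2 c 0.

Definition Gam M (nab : conn M) (i : idx M) (m : M) (u v : 'cV[R]_q) :
  'cV[R]_q :=
  \col_c \sum_a \sum_b christoffel nab i m c a b * u a 0 * v b 0.

Definition pframe M (nab : conn M) (i : idx M) (z : bmod R p q) :
  'cV[R]_q -> M := fun v =>
  par i (z.1, z.2 + v - 2^-1 *: Gam nab i (par i z) v v).

(* [P(F)] over [O] *)
Definition PF M (nab : conn M) (O : set M) : set (jet M) :=
  [set u | exists i z A alpha a,
     [/\ dom i z, O (par i z), A \in unitmx, a != 0 &
         u = ract A alpha a (jet_of 2 (pframe nab i z))]].

(** * The normal projective Cartan connection *)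

(* Identification with [gl(q+1,R) / R Id]: the class of
   [(A, v; xi, b)] is [(v, A - b Id, xi)]. *)
Definition to_mx (x : slq R q) : 'M[R]_(q + 1) := block_mx x.1.2 x.1.1 x.2 0.
Definition of_mx (X : 'M[R]_(q + 1)) : slq R q :=
  ((ursubmx X, ulsubmx X - (drsubmx X 0 0)%:M), dlsubmx X).

Definition sl_brk (x y : slq R q) : slq R q :=
  of_mx (to_mx x *m to_mx y - to_mx y *m to_mx x).
Definition Ad (h : 'M[R]_(q + 1)) (x : slq R q) : slq R q :=
  of_mx (h *m to_mx x *m invmx h).

(* right translation in the coordinates [(y, A, alpha)]: the product of
   [(A, 0; alpha, 1)] and [(B, 0; beta, b)], divided by [b] *)
Definition Rh (B : 'M[R]_q) (beta : 'rV[R]_q) (b : R) (u : slq R q) : slq R q :=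
  ((u.1.1, b^-1 *: (u.1.2 *m B)), b^-1 *: (u.2 *m B + beta)).

Definition form1 : Type := slq R q -> slq R q -> slq R q.

(* [frame2 G u] has the second order frame with coordinates [u] as 2-jet at 0,
   where [G y] is the value at [y] of the Christoffel symbols defining the
   section. *)
Definition frame2 (G : 'cV[R]_q -> 'cV[R]_q -> 'cV[R]_q -> 'cV[R]_q)
  (u : slq R q) (z : 'cV[R]_q) : 'cV[R]_q :=
  let h := hmap u.1.2 u.2 1 z in u.1.1 + h - 2^-1 *: G u.1.1 h h.

Definition curv (om : form1) (u X Y : slq R q) : slq R q :=
  'D_X (fun w => om w Y) u - 'D_Y (fun w => om w X) u
  + sl_brk (om u X) (om u Y).

(* The canonical form of the second order frame bundle at [j^2_0 f] sends a
   tangent vector whose image in the first order frame bundle is [(dy, dA)] to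
   the [(v, a)] with image [(dy, dA)] under the differential at the identity of
   [j^1_0 g |-> j^1_0 (f \o g)], i.e. of [(x, c) |-> (f x, Df(x) c)]. *)
Record normal_cartan (D : set (slq R q))
  (G : 'cV[R]_q -> 'cV[R]_q -> 'cV[R]_q -> 'cV[R]_q) (om : form1) : Prop :=
NormalCartan {
  nc_smooth : forall X, smooth_on D (fun u => om u X);
  nc_linear : forall u c X Y, D u -> om u (c *: X + Y) = c *: om u X + om u Y;
  nc_bij : forall u, D u -> bijective (om u);
  nc_fund : forall u (a : 'M[R]_q) (xi : 'rV[R]_q), D u ->
    om u ('D_1 (fun t : R => Rh (1%:M + t *: a) (t *: xi) 1 u) 0)
    = ((0, a), xi);
  nc_equiv : forall u X (B : 'M[R]_q) (beta : 'rV[R]_q) (b : R), D u ->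
    B \in unitmx -> b != 0 ->
    om (Rh B beta b u) ('D_X (Rh B beta b) u)
    = Ad (invmx (block_mx B 0 beta b%:M)) (om u X);
  nc_canonical : forall u X, D u ->
    let f := frame2 G u in let v := (om u X).1.1 in let a := (om u X).1.2 in
    X.1.1 = 'D_v f 0 /\
    forall w, X.1.2 *m w = 'D_v ('D_w f) 0 + 'D_(a *m w) f 0;
  nc_normal : exists K : slq R q -> 'I_q -> 'I_q -> 'I_q -> 'I_q -> R,
    forall u, D u ->
    [/\ forall i j k l, K u i j k l = - K u i j l k,
        forall X Y i j, (curv om u X Y).1.2 i j =
          2^-1 * \sum_k \sum_l K u i j k l *
            ((om u X).1.1 k 0 * (om u Y).1.1 l 0
             - (om u Y).1.1 k 0 * (om u X).1.1 l 0) &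
        forall j l, \sum_i K u i j i l = 0]
}.

(* The image of [P(F)] over chart [i] in the second order frame bundle of the
   local leaf space [N_i := y(U_i)]. *)
Definition Ndom M (i : idx M) : set (slq R q) :=
  [set u | (exists x, dom i (x, u.1.1)) /\ u.1.2 \in unitmx].

Definition NGam M (nab : conn M) (i : idx M) (y : 'cV[R]_q) :
  'cV[R]_q -> 'cV[R]_q -> 'cV[R]_q :=
  Gam nab i (par i (get [set x | dom i (x, y)], y)).

Definition omega M (nab : conn M) (i : idx M) : form1 :=
  get [set om | normal_cartan (Ndom i) (NGam nab i) om].

(* Parametrization of [P(F)] by [(x, (y, A, alpha))]; in the parameters the map
   [J^2_0 f |-> j^2_0 (y \o f)] is [snd], so that the leaves of [P(F)] are
   locally [x |-> (x, (y, A, alpha))] and [omegaF] is the pullback of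
   [omega]. *)
Definition pbase (w : pmod R p q) : bmod R p q := (w.1, w.2.1.1).

Definition Pdom M (i : idx M) (O : set M) : set (pmod R p q) :=
  [set w | [/\ dom i (pbase w), O (par i (pbase w)) & w.2.1.2 \in unitmx]].

Definition psi M (nab : conn M) (i : idx M) (w : pmod R p q) : jet M :=
  ract w.2.1.2 w.2.2 1 (jet_of 2 (pframe nab i (pbase w))).

Definition omegaF M (nab : conn M) (i : idx M) (w X : pmod R p q) : slq R q :=
  omega nab i w.2 X.2.

(* foliated functions on the part of [P(F)] over [O] *)
Definition foliated M (nab : conn M) (O : set M) (F : jet M -> R) : Prop :=
  forall i,
    smooth_on (Pdom i O) (F \o psi nab i : pmod R p q -> R) /\
    forall w, Pdom i O w ->
      \forall x \near w.1, F (psi nab i (x, w.2)) = F (psi nab i w).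

Definition Hinvariant M (nab : conn M) (O : set M) (F : jet M -> R) : Prop :=
  forall u A alpha a, PF nab O u -> A \in unitmx -> a != 0 ->
    F (ract A alpha a u) = F u.

(** * Operators *)

(* the value of [F] differentiated along some [X] with [omegaF X = v] *)
Definition nabla M (nab : conn M) (v : 'cV[R]_q) (F : jet M -> R) :
  jet M -> R := fun u =>
  get [set d : R | exists i w X,
    [/\ Pdom i setT w, psi nab i w = u, omegaF nab i w X = ((v, 0), 0) &
        d = 'D_X (F \o psi nab i : pmod R p q -> R) w]].

Definition nabla_well_defined M (nab : conn M) (O : set M) (F : jet M -> R) :
  Prop := forall v : 'cV[R]_q,
  foliated nab O (nabla nab v F) /\
  forall i w, Pdom i O w ->
    (exists X, omegaF nab i w X = ((v, 0), 0)) /\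
    (forall X, omegaF nab i w X = ((v, 0), 0) ->
       nabla nab v F (psi nab i w) = 'D_X (F \o psi nab i : pmod R p q -> R) w).

Definition nablak M (nab : conn M) (k : nat) (F : jet M -> R)
  (v : 'I_k -> 'cV[R]_q) : jet M -> R := fun u =>
  (k`!)%:R^-1 * \sum_(s : {perm 'I_k})
    foldr (nabla nab) F [seq v (s j) | j <- enum 'I_k] u.

(* Symmetric tensors of degree [k] are given by their components
   [T [:: a_1; ...; a_k]]; lists of other lengths are irrelevant, and insertion
   of [epsilon^j] is [fun s => T (j :: s)]. *)
Definition tens : Type := seq 'I_q -> R.

Definition Div M (nab : conn M) (S : jet M -> tens) : jet M -> tens :=
  fun u s => \sum_(j < q) nabla nab (evec j) (fun u => S u (j :: s)) u.

(* the frame [d/dy^1, ..., d/dy^q] of chart [i] *)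
Definition dyframe M (i : idx M) (m : M) : jet M :=
  jet_of 1 (fun v => par i ((chart i m).1, (chart i m).2 + v)).

(* Foliated symbols of degree [k], as [GL(q,R)]-equivariant functions on
   [L(M, F)]. *)
Record is_symbol M (k : nat) (S : jet M -> tens) : Prop := IsSymbol {
  symbol_sym : forall f (s t : seq 'I_q), transversal f -> size s = k ->
    perm_eq s t -> S (jet_of 1 f) s = S (jet_of 1 f) t;
  symbol_equiv : forall f (A : 'M[R]_q) (s : k.-tuple 'I_q),
    transversal f -> A \in unitmx ->
    S (jet_of 1 f) s =
    \sum_(t : k.-tuple 'I_q) (\prod_(r < k) A (tnth s r) (tnth t r)) *
      S (jet_of 1 (f \o mulmx A)) t;
  symbol_fol : forall i (s : k.-tuple 'I_q),
    basic (udom i) (fun m => S (dyframe i m) s)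
}.

Definition pull_sym M (S : jet M -> tens) : jet M -> tens := S \o @p2 M.

Definition pull_fun M (f : M -> R) : jet M -> R := fun u =>
  get [set d : R | exists2 g, u g & d = f (g 0)].

(* for [l = 0] this is 1 (empty product) *)
Definition Ckl (k l : nat) : R :=
  (\prod_(1 <= j < l.+1)
     ((k%:R - j%:R) / (q%:R + (2 * k)%:R - j%:R))) * ('C(k, l))%:R.

(* [<v_1 \/ ... \/ v_k, T> = T(v_1, ..., v_k)]: full contraction *)
Definition Qsum M (nab : conn M) (k : nat) (S : jet M -> tens) (f : M -> R) :
  jet M -> R := fun u =>
  \sum_(l < k.+1) Ckl k l *
    \sum_(t : (k - l).-tuple 'I_q)
      iter l (Div nab) (pull_sym S) u t *
      nablak nab (pull_fun f) (fun j => evec (tnth t j)) u.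

Definition quant M (nab : conn M) (k : nat) (S : jet M -> tens) (f : M -> R) :
  M -> R := fun m =>
  get [set d : R | exists u,
    [/\ PF nab setT u, lies_over u m & d = Qsum nab k S f u]].

(* [d_{y^{t_1}} ... d_{y^{t_r}} f] in chart [i] *)
Definition dys M (i : idx M) (t : seq 'I_q) (f : M -> R) (m : M) : R :=
  iterD [seq (0, evec a) : bmod R p q | a <- t] (f \o par i : bmod R p q -> R)
    (chart i m).

(** * Naturality *)

Definition smooth_map M M' (O : set M) (phi : M -> M') : Prop :=
  forall i j, smooth_on
    (dom i `&` par i @^-1` (O `&` phi @^-1` udom j))
    (chart j \o phi \o par i).

Definition local_diffeo M M' (phi : M -> M') : Prop :=
  forall m, exists (O : set M) (O' : set M') (phi' : M' -> M),
    [/\ O m, mopen O & mopen O'] /\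
    [/\ phi @` O = O', forall x, O x -> phi' (phi x) = x,
        smooth_map O phi & smooth_map O' phi'].

Definition preserves_fol M M' (phi : M -> M') : Prop :=
  forall i j z, dom i z -> udom j (phi (par i z)) ->
    \forall x \near z.1,
      (chart j (phi (par i (x, z.2)))).2 = (chart j (phi (par i z))).2.

Definition relN M M' (phi : M -> M') (O : set M) (X : vf M) (X' : vf M') :
  Prop := forall i j m, O m -> udom i m -> udom j (phi m) ->
    (X' j (phi m)).2 = ('D_(X i m) (chart j \o phi \o par i) (chart i m)).2.

(* [nab = phi^* nab'], for [phi] a local diffeomorphism preserving the
   foliations: [phi]-related classes have [phi]-related derivatives. *)
Definition is_pull_conn M M' (phi : M -> M') (nab' : conn M') (nab : conn M) :
  Prop := forall (O : set M) (O' : set M') X Y X' Y',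
    mopen O -> mopen O' -> phi @` O `<=` O' ->
    folvf O X -> folvf O Y -> folvf O' X' -> folvf O' Y' ->
    relN phi O X X' -> relN phi O Y Y' ->
    relN phi O (nab O X Y) (nab' O' X' Y').

Definition pull_symbol M M' (phi : M -> M') (S' : jet M' -> tens) :
  jet M -> tens := fun u => S' (jmap 1 (fun f => phi \o f) u).

End Manifold.

(* Main.v *)
From HB Require Import structures.
Require Import Defs.
From mathcomp Require Import all_boot all_order all_algebra all_fingroup.
From mathcomp Require Import all_classical all_reals all_analysis.
From mathcomp Require Import ring lra zify.

(* Over a chart, P(F) is parametrized by (x, (y, A, alpha)), and the normal Cartan
   connection is h^-1 theta h + h^-1 dh, where h = (A, 0; alpha, 1) and
   theta = (Gamma, dy; P, 0): normality is a linear system whose only solution P is the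
   Schouten tensor of the Christoffel symbols Gamma. Hence the fields
   E_v = omega^-1(v) are explicit, and the changes of chart, the foliated local
   diffeomorphisms and the changes of connection in a projective class, which act by
   (y, A, alpha) |-> (th y, Dth A, alpha) and (y, A, alpha) |-> (y, A, alpha + c(y) A),
   map E_v to E_v by the transformation laws of Gamma and P.

   The bracket of the fundamental field of beta in R^q* with E_v is minus the
   fundamental field of v beta + (beta v) Id in gl(q). By induction the derivative
   along beta of Div^l S is l (q + 2k - l) i(beta) Div^(l-1) S, while that of
   nabla^m f, paired with a symmetric tensor T, is
   - m (m - 1) <i(beta) T, nabla^(m-1) f>. The recursion satisfied by C_{k,l} makes
   these terms cancel, so the sum is invariant under R^q*; it is invariant under
   GL(q) because its ingredients are equivariant, and so it descends to M. Symbols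
   being symmetric, the symmetrization in nabla^m f plays no role. *)

Set Implicit Arguments.
Unset Strict Implicit.
Unset Printing Implicit Defensive.
Import Order.TTheory GRing.Theory Num.Theory.
Import numFieldNormedType.Exports.
Local Open Scope classical_set_scope.
Local Open Scope ring_scope.

(* These names are also used by the libraries. *)
Local Notation dom := Defs.dom.
Local Notation second_countable := Defs.second_countable.
Local Notation transversal := Defs.transversal.
Local Notation ract := Defs.ract.
Local Notation addvf := Defs.addvf.

(** * Smooth maps between finite-dimensional spaces *)

(** [GL(q)] is not connected, so vanishing derivatives along its Lie algebra would not give
    invariance. It is therefore treated by a finite change of variables, and only the vector group
    [R^q*] infinitesimally: its orbits are affine spaces, along whose lines a vanishing derivative
    integrates. The change of variables is proved for any map of the coordinates that intertwines
    horizontal derivatives up to a constant matrix; right translations, changes of connection and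
    foliated maps are instances, and a change of chart is the foliated map [id].

    The connection form, the derivative along it and the value on the base are all selected by
    [get]. Nothing can be computed before the selected object is known to be unique; for the
    connection form this requires uniqueness of the normal Cartan connection, not only its
    existence.

    The leaf variable [x] is a parameter. Connected plaques let the Christoffel symbols descend to
    an open set of [R^q], where all curvature is computed.

    Smoothness is given by iterated directional derivatives, while the chain rule needs
    differentials; this accounts for the initial calculus. *)

Class findim {R : realType} (V : normedModType R) : Prop := Findim {
  fd_basis : exists n (e : 'I_n -> V) (c : 'I_n -> V -> R),
    [/\ forall i, linear (c i), forall i, continuous (c i) &
        forall x, x = \sum_i c i x *: e i] }.

(* Unification may unfold [derive] down to filters when comparing derivatives, hence the lock. *)
HB.lock Definition dv {R : realType} {V W : normedModType R} (v : V) (f : V -> W) (z : V) : W :=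
  'D_v f z.

Lemma dvE {R : realType} {V W : normedModType R} (v : V) (f : V -> W) z : dv v f z = 'D_v f z.
Proof. by rewrite dv.unlock. Qed.

Lemma dvF {R : realType} {V W : normedModType R} (v : V) (f : V -> W) : dv v f = 'D_v f.
Proof. by apply/funext => z; exact: dvE. Qed.

Section Lin.
Context {R : realType}.
Implicit Types (V W U : normedModType R).

Lemma lin_pack V W (f : V -> W) : linear f -> exists g : {linear V -> W}, f = g.
Proof. by move=> lf; pose m := GRing.isLinear.Build _ _ _ _ _ lf; exists (HB.pack_for {linear V -> W} f m). Qed.

Lemma linP V W (f : V -> W) : linear f ->
  [/\ f 0 = 0, forall x y, f (x + y) = f x + f y, forall a x, f (a *: x) = a *: f x,
      forall x, f (- x) = - f x & forall n (F : 'I_n -> V), f (\sum_i F i) = \sum_i f (F i)].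
Proof.
move=> /lin_pack[g ->]; split=> *; rewrite ?linear0 ?linearD ?linearZ ?linearN ?linear_sum //.
Qed.

Lemma lin_cont V W (f : V -> W) : findim V -> linear f -> continuous f.
Proof.
move=> [[n [e [c [lc cc ex]]]]] lf.
have -> : f = (fun x => \sum_i c i x *: f (e i)).
  apply/funext => x; have [_ _ fZ _ fS] := linP lf.
  by rewrite {1}(ex x) fS; apply: eq_bigr => i _; rewrite fZ.
move=> x; have -> : (fun x => \sum_i c i x *: f (e i)) = \sum_i (fun x => c i x *: f (e i)).
  by apply/funext => y; rewrite fct_sumE.
have : forall i, {for x, continuous (fun x => c i x *: f (e i))}.
  by move=> i; apply: cvgZr_tmp; exact: cc.
rewrite /prop_for; elim/big_ind : _ => [|F G hF hG H|i _ H] //.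
- by move=> _; apply: cst_continuous.
- by apply: continuousD; [exact: hF|exact: hG].
Qed.

Lemma lin_diff V W (f : V -> W) z : findim V -> linear f -> differentiable f z.
Proof.
move=> fV lf; have cf := lin_cont fV lf; have [g e] := lin_pack lf.
by rewrite e; apply: linear_differentiable; rewrite -e.
Qed.

Lemma derive_lin V W (f : V -> W) z v : findim V -> linear f -> dv v f z = f v.
Proof.
move=> fV lf; have cf := lin_cont fV lf; have [g e] := lin_pack lf.
rewrite dvE deriveE; last exact: lin_diff.
by rewrite e diff_lin // -e.
Qed.

Lemma dv_cst V W (a : W) (v z : V) : dv v (fun=> a) z = 0.
Proof. by rewrite dvE; exact: derive_cst. Qed.

Lemma derive_dir V W (f : V -> W) z : differentiable f z -> linear (fun v => dv v f z).
Proof. by move=> df a u v; rewrite !dvE !deriveE // linearP. Qed.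

Lemma derive_dirD V W (f : V -> W) z u v : differentiable f z ->
  dv (u + v) f z = dv u f z + dv v f z.
Proof. by move=> /derive_dir/linP[]. Qed.

Lemma derive_dirZ V W (f : V -> W) z a v : differentiable f z ->
  dv (a *: v) f z = a *: dv v f z.
Proof. by move=> /derive_dir/linP[]. Qed.

Lemma derive_dirN V W (f : V -> W) z v : differentiable f z ->
  dv (- v) f z = - dv v f z.
Proof. by move=> /derive_dir/linP[]. Qed.

Lemma derive_dir_sum V W (f : V -> W) z n (F : 'I_n -> V) : differentiable f z ->
  dv (\sum_i F i) f z = \sum_i dv (F i) f z.
Proof. by move=> /derive_dir/linP[]. Qed.

Lemma derive_comp V W U (g : V -> W) (f : W -> U) z v :
  differentiable g z -> differentiable f (g z) ->
  dv v (f \o g) z = dv (dv v g z) f (g z).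
Proof.
move=> dg df; rewrite !dvE deriveE; last exact: differentiable_comp.
by rewrite diff_comp //= deriveE // deriveE.
Qed.

Lemma scaler_bilin V : bilinear_for
  (GRing.Scale.Law.clone _ _ *:%R _) (GRing.Scale.Law.clone _ _ *:%R _)
  (@GRing.scale R V : R -> V -> V).
Proof.
split=> [u'|u] a x y /=; first by rewrite scalerDl scalerA.
by rewrite scalerDr !scalerA mulrC.
Qed.

Lemma diff_scale V W (k : V -> R) (f : V -> W) z :
  differentiable k z -> differentiable f z ->
  differentiable (fun x => k x *: f x) z /\
  forall v, dv v (fun x => k x *: f x) z = dv v k z *: f z + k z *: dv v f z.
Proof.
move=> dk df.
pose b : {bilinear R -> W -> W} := HB.pack (@GRing.scale R W : R -> W -> W)
  (bilinear_isBilinear.Build R R W W _ _ _ (scaler_bilin W)).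
have cb : continuous (fun p : R * W => b p.1 p.2) by move=> p; apply: scale_continuous.
have dp : differentiable (fun x => (k x, f x)) z by apply: differentiable_pair.
have e : (fun x => k x *: f x) = (fun p : R * W => b p.1 p.2) \o (fun x => (k x, f x)) by [].
have d : differentiable (fun x => k x *: f x) z.
  rewrite e; apply: differentiable_comp => //; exact: differentiable_bilin.
split=> // v; rewrite !dvE deriveE // e diff_comp //; last exact: differentiable_bilin.
rewrite (@diff_bilin R R W W b (k z, f z) cb) /= diff_pair //= !deriveE //; by rewrite addrC.
Qed.

Lemma diff_sum V W n (f : 'I_n -> V -> W) z : (forall i, differentiable (f i) z) ->
  differentiable (fun x => \sum_i f i x) z /\
  forall v, dv v (fun x => \sum_i f i x) z = \sum_i dv v (f i) z.
Proof.
move=> df; have -> : (fun x => \sum_i f i x) = \sum_i f i by apply/funext => x; rewrite fct_sumE.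
split; first exact: differentiable_sum.
by move=> v; rewrite dvE derive_sum //; [apply: eq_bigr => i _; rewrite dvE|move=> i; apply: diff_derivable].
Qed.

Lemma derive_lincomp V W U (g : V -> W) (f : W -> U) z v : findim W -> linear f ->
  differentiable g z -> differentiable (f \o g) z /\ dv v (f \o g) z = f (dv v g z).
Proof.
move=> fW lf dg; split; first by apply: differentiable_comp => //; exact: lin_diff.
by rewrite derive_comp ?derive_lin //; exact: lin_diff.
Qed.

Lemma diff_coord V W (f : V -> W) n (e : 'I_n -> W) (c : 'I_n -> W -> R) z :
  (forall x, x = \sum_i c i x *: e i) -> (forall i, differentiable (c i \o f) z) ->
  differentiable f z.
Proof.
move=> ex d; have -> : f = (fun x => \sum_i (c i \o f) x *: e i).
  by apply/funext => x; rewrite -ex.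
apply: (diff_sum _).1 => i; apply: (diff_scale _ _).1 => //.
Qed.

(** Mere directional derivability is assumed: the lemma serves to reduce the differentiability of
    vector-valued maps to that of their coordinates. *)
Lemma derivable_lincomp V W (f : V -> W) (L : W -> R) z v :
  linear L -> continuous L -> derivable f z v ->
  derivable (L \o f) z v /\ dv v (L \o f) z = L (dv v f z).
Proof.
move=> lL cL df; have [_ LD LZ LN _] := linP lL.
have h : (fun h => h^-1 *: (((L \o f) \o shift z) (h *: v) - (L \o f) z)) @ 0^' --> L (dv v f z).
  rewrite dvE.
  have -> : (fun h => h^-1 *: (((L \o f) \o shift z) (h *: v) - (L \o f) z)) =
    L \o (fun h => h^-1 *: ((f \o shift z) (h *: v) - f z)).
    by apply/funext => h /=; rewrite LZ LD LN.
  by apply: (cvg_comp _ _ df); apply: cL.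
split; first by apply/cvg_ex; eexists; exact: h.
by rewrite dvE; exact: cvg_lim h.
Qed.

End Lin.

(** * Continuous directional derivatives imply differentiability *)

Section C1.
Context {R : realType} {V : normedModType R}.

Lemma derive_line {W : normedModType R} (f : V -> W) z v (t : R) :
  derivable f (z + t *: v) v -> is_derive t 1 (fun s : R => f (z + s *: v)) ('D_v f (z + t *: v)).
Proof.
move=> df.
have e : (fun h => h^-1 *: (((fun s : R => f (z + s *: v)) \o shift t) (h *: 1%R) - f (z + t *: v)))
  = (fun h => h^-1 *: ((f \o shift (z + t *: v)) (h *: v) - f (z + t *: v))).
  apply/funext => h /=; congr (_ *: (f _ - _)).
  by rewrite scalerDl addrCA [_%:A]mulr1.
by split; rewrite /derivable /derive e.
Qed.

Lemma ball_line (z v : V) (d t : R) : `|t| * `|v| < d -> ball z d (z + t *: v).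
Proof. by move=> h; rewrite -ball_normE /= opprD addNKr normrN normrZ. Qed.

(** Since [t] may be negative, the one-variable theorem is applied on [[0, t]] or on [[t, 0]], and
    the intermediate point is located only by its absolute value. *)
Lemma MVT_line (f : V -> R) z v (t : R) :
  (forall s : R, `|s| <= `|t| -> derivable f (z + s *: v) v) ->
  exists2 s : R, `|s| <= `|t| & f (z + t *: v) - f z = t * 'D_v f (z + s *: v).
Proof.
move=> df; pose g (s : R) := f (z + s *: v).
have dg (s : R) : `|s| <= `|t| -> is_derive s 1 g ('D_v f (z + s *: v)).
  by move=> /df; apply: derive_line.
have cg (a b : R) : `|a| <= `|t| -> `|b| <= `|t| -> {within `[a, b], continuous g}.
  move=> ha hb; apply: derivable_within_continuous => s; rewrite in_itv /= => /andP[h1 h2].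
  apply: ex_derive; apply: dg; rewrite ler_norml.
  by move: ha hb; rewrite !ler_norml => /andP[? ?] /andP[? ?]; apply/andP; split; lra.
have n0 : `|0 : R| <= `|t| by rewrite normr0.
have [t0|t0] := leP 0 t.
  have [|c hc e] := @MVT_segment R g (fun s => 'D_v f (z + s *: v)) 0 t t0 _ (cg _ _ n0 (lexx _)).
  - move=> s; rewrite in_itv /= => /andP[h1 h2]; apply: dg.
    by rewrite !ger0_norm // ltW.
  exists c; first by move: hc; rewrite in_itv /= => /andP[h1 h2]; rewrite !ger0_norm.
  by move: e; rewrite /g scale0r addr0 subr0 mulrC.
have [|c hc e] := @MVT_segment R g (fun s => 'D_v f (z + s *: v)) t 0 (ltW t0) _ (cg _ _ (lexx _) n0).
- move=> s; rewrite in_itv /= => /andP[h1 h2]; apply: dg.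
  by rewrite !ltr0_norm // lerN2 ltW.
exists c; first by move: hc; rewrite in_itv /= => /andP[h1 h2]; rewrite (ltr0_norm t0) ler0_norm // lerN2.
by move: e; rewrite /g scale0r addr0 => e; rewrite -opprB e; lra.
Qed.

(** The increment along [h] is split into steps along the spanning vectors [e i], one at a time. On
    each step the mean value theorem compares the increment with the partial derivative at [z],
    where that derivative is continuous. *)
Lemma C1_diff_real (U : set V) (f : V -> R) z : findim V -> open U -> U z ->
  (forall x v, U x -> derivable f x v) ->
  (forall v, {for z, continuous ('D_v f)}) -> differentiable f z.
Proof.
move=> [[n [e [c [lc cc ex]]]]] oU Uz df cf.
pose L (k : nat) (h : V) := \sum_(i < n | (i < k)%N) c i h * 'D_(e i) f z.
pose P (k : nat) (h : V) := \sum_(i < n | (i < k)%N) c i h *: e i.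
have fV : findim V by split; exists n, e, c.
have [C C0 hC] : exists2 C : R, 0 < C & forall i h, `|c i h| <= C * `|h|.
  have hk i : exists2 k : R, 0 < k & forall h, `|c i h| <= k * `|h|.
    have [g eg] := lin_pack (lc i).
    have cg : continuous g by rewrite -eg; apply: cc.
    have [k k0 hk] := linear_lipschitz cg; exists k => // h; by rewrite eg.
  have [k hk'] := @choice _ _ (fun i k => 0 < k /\ forall h, `|c i h| <= k * `|h|)
    (fun i => let: ex_intro2 k a b := hk i in ex_intro _ k (conj a b)).
  exists (1 + \sum_i k i).
    by apply: ltr_pwDl => //; apply: sumr_ge0 => i _; apply: ltW; exact: (hk' i).1.
  move=> i h; apply: (le_trans ((hk' i).2 h)); apply: ler_wpM2r => //.
  rewrite (bigD1 i) //= addrCA lerDl addr_ge0 // sumr_ge0 // => j _; apply: ltW; exact: (hk' j).1.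
have main k : (k <= n)%N -> forall eps : R, 0 < eps -> exists2 d : R, 0 < d & forall x h,
    `|x| < d -> `|h| < d -> `|f (z + x + P k h) - f (z + x) - L k h| <= eps * `|h|.
  elim: k => [_ eps eps0|k IH kn eps eps0].
    exists 1 => // x h _ _; rewrite /P /L !big_pred0 // addr0 subrr subr0 normr0 mulr_ge0 //; exact: ltW.
  pose i := Ordinal kn.
  have Pk h : P k.+1 h = P k h + c i h *: e i.
    rewrite /P (bigD1 i) //= addrC; congr (_ + _); apply: eq_bigl => j.
    by rewrite ltnS -val_eqE /= ltn_neqAle andbC.
  have Lk h : L k.+1 h = L k h + c i h * 'D_(e i) f z.
    rewrite /L (bigD1 i) //= addrC; congr (_ + _); apply: eq_bigl => j.
    by rewrite ltnS -val_eqE /= ltn_neqAle andbC.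
  have [d1 d10 h1] := IH (ltnW kn) (eps / 2) (divr_gt0 eps0 (ltr0Sn _ _)).
  have [d2 d20 h2] : exists2 d : R, 0 < d & forall y, `|y| < d -> U (z + y) /\
      `|'D_(e i) f (z + y) - 'D_(e i) f z| <= eps / 2 / C.
    have : \forall y \near z, U y /\ `|'D_(e i) f y - 'D_(e i) f z| <= eps / 2 / C.
      apply: filterI; first exact: open_nbhs_nbhs.
      have /cvgrPdist_le := cf (e i); move=> /(_ (eps / 2 / C)); rewrite !divr_gt0 // => /(_ isT).
      by apply: filterS => y; rewrite distrC.
    move=> /nbhs_ballP[d d0 hd]; exists d => // y yd; apply: hd.
    by rewrite -ball_normE /= opprD addNKr normrN.
  have [B B0 hB] : exists2 B : R, 0 < B & forall h, `|P k h| + `|c i h| * `|e i| <= B * `|h|.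
    exists (1 + C * \sum_j `|e j| + C * `|e i|).
      apply: ltr_wpDr; first by rewrite mulr_ge0 // ltW.
      by apply: ltr_pwDl => //; rewrite mulr_ge0 ?sumr_ge0 // ltW.
    move=> h; rewrite !mulrDl mul1r -addrA -[leLHS]add0r lerD //.
    apply: lerD; last by rewrite mulrAC ler_wpM2r.
    rewrite /P; apply: (le_trans (ler_norm_sum _ _ _)).
    rewrite mulrAC mulr_sumr [leLHS]big_mkcond /=; apply: ler_sum => j _.
    case: ifP => _; first by rewrite normrZ ler_wpM2r.
    by rewrite !mulr_ge0 // ltW.
  (* If [|x|] and [|h|] are below [d2 / (1 + B)], then [|x| + B |h| < d2], so all points between two
     consecutive partial sums stay where the partial derivative is controlled. *)
  exists (Num.min d1 (d2 / (1 + B))).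
    by rewrite lt_min d10 /= divr_gt0 // addr_gt0.
  move=> x h; rewrite !lt_min => /andP[x1 x2] /andP[y1 y2].
  have B1 : 0 < 1 + B by rewrite addr_gt0.
  have hy s : `|s| <= `|c i h| -> `|x + P k h + s *: e i| < d2.
    move=> hs; move: x2 y2; rewrite !ltr_pdivlMr // => x2 y2.
    apply: (le_lt_trans (ler_normD _ _)); apply: (@le_lt_trans _ _ (`|x| + (`|P k h| + `|c i h| * `|e i|))).
      rewrite addrA; apply: lerD; first exact: ler_normD.
      by rewrite normrZ ler_wpM2r.
    apply: (@le_lt_trans _ _ (`|x| + B * `|h|)); first by rewrite lerD2l.
    have : 0 <= `|x| by []. have : 0 <= `|h| by []. nra.
  have dl (s : R) : `|s| <= `|c i h| -> derivable f (z + x + P k h + s *: e i) (e i).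
    by move=> hs; apply: df; have [+ _] := h2 _ (hy s hs); rewrite !addrA.
  have [s hs es] := MVT_line dl.
  rewrite Pk Lk addrA.
  have -> : f (z + x + P k h + c i h *: e i) - f (z + x) - (L k h + c i h * 'D_(e i) f z) =
    (f (z + x + P k h) - f (z + x) - L k h) + (f (z + x + P k h + c i h *: e i) - f (z + x + P k h) - c i h * 'D_(e i) f z) by ring.
  apply: (le_trans (ler_normD _ _)).
  have -> : eps * `|h| = eps / 2 * `|h| + eps / 2 * `|h| by field.
  apply: lerD; first exact: h1.
  rewrite es -mulrBr normrM.
  have -> : eps / 2 * `|h| = (C * `|h|) * (eps / 2 / C) by field; apply: lt0r_neq0.
  apply: ler_pM => //.
  by have [_] := h2 _ (hy s hs); rewrite !addrA.
pose df0 h := \sum_i c i h * 'D_(e i) f z.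
have ldf : linear df0.
  move=> a x y; rewrite /df0 scaler_sumr -big_split /=; apply: eq_bigr => i _.
  by rewrite lc mulrDl -scalerAl.
have [g eg] := lin_pack ldf.
have cg : continuous g by rewrite -eg; exact: lin_cont.
have E : f \o shift z = cst (f z) + g +o_ 0 id.
  apply/eqaddoP => _/posnumP[eps].
  have [d d0 hd] := main n (leqnn n) eps%:num [gt0 of eps%:num].
  apply/nbhs_ballP; exists d => // h; rewrite -ball_normE /= sub0r normrN => hh.
  have := hd 0 h; rewrite normr0 => /(_ d0 hh); rewrite addr0.
  have -> : P n h = h.
    by rewrite [RHS]ex /P; apply: eq_bigl => i; rewrite ltn_ord.
  have -> : L n h = g h.
    by rewrite -eg /df0 /L; apply: eq_bigl => i; rewrite ltn_ord.
  by rewrite /cst /= -[(_ - _) h]/(f (h + z) - (f z + g h)) opprD addrA (addrC h z).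
apply/diff_locallyP; have -> := diff_unique cg E; split=> //.
Qed.

Lemma C1_diff (W : normedModType R) (U : set V) (f : V -> W) z :
  findim V -> findim W -> open U -> U z ->
  (forall x v, U x -> derivable f x v) ->
  (forall v, {for z, continuous ('D_v f)}) -> differentiable f z.
Proof.
move=> fV [[n [e [c [lc cc ex]]]]] oU Uz df cf.
apply: (diff_coord ex) => i; apply: (@C1_diff_real U) => //.
  by move=> x v Ux; have [] := derivable_lincomp (lc i) (@cc i) (df x v Ux).
move=> v; have h : {for z, continuous (c i \o 'D_v f)}.
  by apply: continuous_comp; [exact: cf | exact: cc].
have E : \forall x \near z, (c i \o 'D_v f) x = 'D_v (c i \o f) x.
  apply: filterS (open_nbhs_nbhs (conj oU Uz)) => x Ux.
  by have [_] := derivable_lincomp (lc i) (@cc i) (df x v Ux); rewrite !dvE => ->.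
rewrite /prop_for /continuous_at -(nbhs_singleton E); apply: cvg_trans h.
by apply: near_eq_cvg; apply: filterS E.
Qed.

End C1.

(** * Symmetry of second derivatives *)

Section Schwarz.
Context {R : realType} {V : normedModType R}.

(** Mean value theorem twice: along [v] for the difference [g], then along [w] for ['D_v f]. The
    second difference is symmetric in [v] and [w], which is the source of the symmetry of second
    derivatives. *)
Lemma second_difference (U : set V) (f : V -> R) z v w : open U -> U z ->
  (forall x u, U x -> derivable f x u) ->
  (forall x u u', U x -> derivable ('D_u' f) x u) ->
  exists2 d : R, 0 < d & forall h : R, 0 < h < d -> exists s s' : R,
    [/\ `|s| <= h, `|s'| <= h &
     f (z + h *: v + h *: w) - f (z + h *: v) - (f (z + h *: w) - f z) =
     h * h * 'D_w ('D_v f) (z + s *: v + s' *: w)].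
Proof.
move=> oU Uz df ddf.
have /nbhs_ballP[r r0 hr] := open_nbhs_nbhs (conj oU Uz).
have B0 : 0 < 1 + `|v| + `|w| by rewrite -addrA ltr_pwDl // addr_ge0.
exists (r / (1 + `|v| + `|w|)); first by rewrite divr_gt0.
move=> h /andP[h0]; rewrite ltr_pdivlMr // => hh.
have inU (s s' : R) : `|s| <= h -> `|s'| <= h -> U (z + s *: v + s' *: w).
  move=> hs hs'; apply: hr; rewrite -ball_normE /= -addrA opprD addNKr normrN.
  apply: le_lt_trans hh; apply: (le_trans (ler_normD _ _)); rewrite !normrZ.
  rewrite !mulrDr mulr1 -addrA -[leLHS]add0r lerD ?(ltW h0) //.
  by apply: lerD; apply: ler_wpM2r.
have hn : `|h| = h by rewrite gtr0_norm.
pose g x := f (x + h *: w) - f x.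
have dg (s : R) : `|s| <= h -> is_derive (z + s *: v) v g
    ('D_v f (z + s *: v + h *: w) - 'D_v f (z + s *: v)).
  move=> hs; apply: is_deriveB.
    have U1 := inU s h hs (eq_ind _ (fun x => x <= h) (lexx h) _ (esym hn)).
    have e : (fun h0 => h0^-1 *: (((fun x => f (x + h *: w)) \o shift (z + s *: v)) (h0 *: v)
        - f (z + s *: v + h *: w)))
      = (fun h0 => h0^-1 *: ((f \o shift (z + s *: v + h *: w)) (h0 *: v) - f (z + s *: v + h *: w))).
      by apply/funext => h1 /=; rewrite -!addrA.
    split; rewrite /derivable /derive e //; exact: df.
  apply: derivableP; apply: df.
  by rewrite -[_ + _]addr0 -(scale0r w); apply: inU => //; rewrite normr0 ltW.
have [|s hs es] := @MVT_line _ _ g z v h.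
  by move=> s; rewrite hn => /dg [].
rewrite hn in hs.
have [|s' hs' es'] := @MVT_line _ _ ('D_v f) (z + s *: v) w h.
  by move=> s'; rewrite hn => hs'; apply: ddf; exact: inU.
rewrite hn in hs'.
exists s, s'; split=> //.
rewrite -mulrA -es'; have [_ <-] := dg s hs; rewrite -es /g; ring.
Qed.

Lemma second_difference_dv (U : set V) (f : V -> R) z v w : open U -> U z ->
  (forall x u, U x -> derivable f x u) ->
  (forall x u u', U x -> derivable (dv u' f) x u) ->
  exists2 d : R, 0 < d & forall h : R, 0 < h < d -> exists s s' : R,
    [/\ `|s| <= h, `|s'| <= h &
     f (z + h *: v + h *: w) - f (z + h *: v) - (f (z + h *: w) - f z) =
     h * h * dv w (dv v f) (z + s *: v + s' *: w)].
Proof.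
move=> oU Uz df ddf; rewrite !dvF; apply: second_difference oU Uz df _.
by move=> x u u'; rewrite -dvF; exact: ddf.
Qed.

(** The values are compared at two different points [x] and [y], because the two evaluations of a
    second difference have different intermediate points. *)
Lemma cont_coincide (F G : V -> R) z : {for z, continuous F} -> {for z, continuous G} ->
  (forall d, 0 < d -> exists x y, [/\ `|x| < d, `|y| < d & F (z + x) = G (z + y)]) ->
  F z = G z.
Proof.
move=> cF cG h; apply/eqP; rewrite -subr_eq0 -normr_eq0; apply: contraT => N0.
set e := `|_| in N0; have e0 : 0 < e by rewrite lt_def N0 normr_ge0.
have e20 : 0 < e / 2 by rewrite divr_gt0.
have : \forall x \near z, `|F z - F x| < e / 2 /\ `|G z - G x| < e / 2.
  by apply: filterI; [move/cvgrPdist_lt : cF; exact|move/cvgrPdist_lt : cG; exact].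
move=> /nbhs_ballP[d d0 hd]; have [x [y [hx hy E]]] := h d d0.
have [|A1 _] := hd (z + x); first by rewrite -ball_normE /= opprD addNKr normrN.
have [|_ A2] := hd (z + y); first by rewrite -ball_normE /= opprD addNKr normrN.
suff : e < e / 2 + e / 2 by rewrite -splitr ltxx.
apply: le_lt_trans (ltrD A1 A2); rewrite /e -(subrKA (F (z + x))).
by rewrite (le_trans (ler_normD _ _)) // {2}E lerD2l distrC.
Qed.

Lemma schwarz_real (U : set V) (f : V -> R) z v w : open U -> U z ->
  (forall x u, U x -> derivable f x u) ->
  (forall x u u', U x -> derivable (dv u' f) x u) ->
  (forall u u', {for z, continuous (dv u (dv u' f))}) ->
  dv v (dv w f) z = dv w (dv v f) z.
Proof.
move=> oU Uz df ddf cf; apply: cont_coincide (cf v w) (cf w v) _ => d3 d30.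
have [d1 d10 h1] := second_difference_dv v w oU Uz df ddf.
have [d2 d20 h2] := second_difference_dv w v oU Uz df ddf.
have B0 : 0 < 1 + `|v| + `|w| by rewrite -addrA ltr_pwDl // addr_ge0.
pose h := Num.min d1 (Num.min d2 (d3 / (1 + `|v| + `|w|))) / 2.
have m0 : 0 < Num.min d1 (Num.min d2 (d3 / (1 + `|v| + `|w|))).
  by rewrite !lt_min d10 d20 divr_gt0.
have h0 : 0 < h by rewrite divr_gt0.
have : h < Num.min d1 (Num.min d2 (d3 / (1 + `|v| + `|w|))).
  by rewrite /h ltr_pdivrMr // mulr_natr mulr2n ltrDl.
rewrite !lt_min ltr_pdivlMr // => /and3P[hd1 hd2 hd3].
have small (s s' : R) : `|s| <= h -> `|s'| <= h -> `|s *: v + s' *: w| < d3.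
  move=> hs hs'; apply: le_lt_trans hd3; apply: (le_trans (ler_normD _ _)); rewrite !normrZ.
  rewrite !mulrDr mulr1 -addrA -[leLHS]add0r lerD ?(ltW h0) //.
  by apply: lerD; apply: ler_wpM2r.
have [|s [s' [hs hs' E1]]] := h1 h; first by rewrite h0.
have [|t [t' [ht ht' E2]]] := h2 h; first by rewrite h0.
exists (t *: w + t' *: v), (s *: v + s' *: w); split; [|exact: small|].
  by rewrite addrC; apply: small.
rewrite !addrA; apply: (@mulfI _ (h * h)); first by rewrite mulf_neq0 // lt0r_neq0.
rewrite -E1 -E2 (addrAC z); move: (f _) (f _) (f _) (f _) => a1 a2 a3 a4; ring.
Qed.

End Schwarz.

(** * Smooth maps through differentials *)

Section Sm.
Context {R : realType}.
Implicit Types (V W X : normedModType R).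

(** Unlike [smooth_on], this asks for differentials at every order, so that each closure property is
    an induction on [n] with the function varying. [Cn 0] is void, which is harmless since [sm]
    quantifies over all [n]. *)
Fixpoint Cn V W (n : nat) (U : set V) (f : V -> W) : Prop :=
  if n is n'.+1 then (forall z, U z -> differentiable f z) /\ forall v, Cn n' U (dv v f)
  else True.

Definition sm V W (U : set V) (f : V -> W) : Prop := open U /\ forall n, Cn n U f.

Lemma derive_eq_on V W (U : set V) (f g : V -> W) z v : open U -> U z ->
  (forall x, U x -> f x = g x) -> dv v f z = dv v g z.
Proof.
by move=> oU Uz e; rewrite !dvE; apply: near_eq_derive; apply: filterS (open_nbhs_nbhs (conj oU Uz)).
Qed.

(** The differential is a selected value, so locality goes through its uniqueness: the directional
    derivatives of [f] form a continuous linear map that approximates [g] to first order as well. *)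
Lemma diff_eq_on V W (U : set V) (f g : V -> W) z : open U -> U z ->
  (forall x, U x -> f x = g x) -> differentiable f z -> differentiable g z.
Proof.
move=> oU Uz e df; apply/diff_locallyP.
have [g' eg'] := lin_pack (derive_dir df).
have eg v : g' v = 'd f z v by rewrite -deriveE // -dvE -eg'.
have cg : continuous g'.
  have -> : (g' : V -> W) = 'd f z by apply/funext.
  exact: diff_continuous.
have E : g \o shift z = cst (g z) + g' +o_ 0 id.
  have /diff_locallyP[_ /eqaddoP h] := df.
  apply/eqaddoP => eps eps0; have := h eps eps0.
  have h1 : \forall x \near (0 : V), f (x + z) = g (x + z).
    have : \forall x \near z, f x = g x by apply: filterS (open_nbhs_nbhs (conj oU Uz)).
    by rewrite (near_shift 0) subr0.
  apply: filterS2 h1 => x E.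
  rewrite -[(_ - _) x]/(f (x + z) - (f z + 'd f z x)).
  by rewrite E (e z Uz) -eg; apply.
by rewrite (diff_unique cg E).
Qed.

Lemma Cn_eq V W n (U : set V) (f g : V -> W) : open U ->
  (forall x, U x -> f x = g x) -> Cn n U f -> Cn n U g.
Proof.
move=> oU; elim: n f g => [//|n IH] f g e [df Df]; split.
  by move=> z Uz; apply: (diff_eq_on oU Uz e); apply: df.
by move=> v; apply: IH (Df v) => x Ux; apply: (derive_eq_on _ oU Ux).
Qed.

Lemma CnW V W n (U : set V) (f : V -> W) : Cn n.+1 U f -> Cn n U f.
Proof.
elim: n f => [//|n IH] f [df Df]; split => // v; exact: IH.
Qed.

Lemma Cn_sub V W n (U U' : set V) (f : V -> W) : U' `<=` U -> Cn n U f -> Cn n U' f.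
Proof.
move=> s; elim: n f => [//|n IH] f [df Df]; split; first by move=> z /s /df.
by move=> v; exact: (IH _ (Df v)).
Qed.

Lemma Cn_lincomp V W X n (U : set V) (f : V -> W) (L : W -> X) : findim W -> open U ->
  linear L -> Cn n U f -> Cn n U (L \o f).
Proof.
move=> fW oU lL; elim: n f => [//|n IH] f [df Df]; split.
  by move=> z Uz; have [] := derive_lincomp 0 fW lL (df z Uz).
move=> v; apply: Cn_eq (IH _ (Df v)) => // z Uz.
by have [_ ->] := derive_lincomp v fW lL (df z Uz).
Qed.

Lemma Cn_cst V W n (U : set V) (a : W) : Cn n U (cst a).
Proof.
elim: n a => [//|n IH] a; split; first by [].
move=> v; have -> : dv v (cst a) = cst 0 :> (V -> W) by apply/funext => z; rewrite dvE derive_cst.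
exact: IH.
Qed.

Lemma Cn_sum V W n (U : set V) m (F : 'I_m -> V -> W) : open U ->
  (forall i, Cn n U (F i)) -> Cn n U (fun z => \sum_i F i z).
Proof.
move=> oU; elim: n F => [//|n IH] F hF; split.
  by move=> z Uz; apply: (diff_sum _).1 => i; apply: (hF i).1.
move=> v; apply: Cn_eq (IH (fun i => dv v (F i)) _) => //.
  by move=> z Uz; rewrite (diff_sum _).2 // => i; apply: (hF i).1.
by move=> i; apply: (hF i).2.
Qed.

Lemma Cn_add V W n (U : set V) (f g : V -> W) : open U ->
  Cn n U f -> Cn n U g -> Cn n U (fun z => f z + g z).
Proof.
move=> oU hf hg.
have := @Cn_sum V W n U 2 (fun i => if i == ord0 then f else g) oU.
move=> /(_ (fun i => _)) H; apply: Cn_eq (H _) => //; last by move=> i; case: ifP.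
by move=> x _; rewrite big_ord_recl big_ord1.
Qed.

Lemma Cn_scale V W n (U : set V) (k : V -> R) (f : V -> W) : open U ->
  Cn n U k -> Cn n U f -> Cn n U (fun z => k z *: f z).
Proof.
move=> oU; elim: n k f => [//|n IH] k f hk hf; split.
  by move=> z Uz; apply: (diff_scale _ _).1; [apply: hk.1|apply: hf.1].
move=> v; apply: (@Cn_eq _ _ _ _ (fun z => dv v k z *: f z + k z *: dv v f z)) => //.
  by move=> z Uz; rewrite (diff_scale _ _).2 //; [apply: hk.1|apply: hf.1].
apply: Cn_add => //; apply: IH => //; [exact: hk.2|exact: CnW|exact: CnW|exact: hf.2].
Qed.

Lemma Cn_comp V W X n (U : set V) (U' : set W) (g : V -> W) (f : W -> X) :
  findim W -> open U -> (forall z, U z -> U' (g z)) ->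
  Cn n U g -> Cn n U' f -> Cn n U (f \o g).
Proof.
move=> fW oU s; have [[m [e [c [lc cc ex]]]]] := fW.
elim: n f => [//|n IH] f hg hf; split.
  by move=> z Uz; apply: differentiable_comp; [apply: hg.1|apply: hf.1; apply: s].
move=> v; apply: (@Cn_eq _ _ _ _ (fun z => \sum_i (c i \o dv v g) z *: (dv (e i) f \o g) z)) => //.
  move=> z Uz; rewrite derive_comp; [|exact: hg.1|apply: hf.1; exact: s].
  rewrite [in RHS](ex (dv v g z)) derive_dir_sum; last by apply: hf.1; exact: s.
  by apply: eq_bigr => i _; rewrite /= derive_dirZ //; apply: hf.1; exact: s.
apply: Cn_sum => // i; apply: Cn_scale => //.
  by apply: Cn_lincomp => //; exact: hg.2.
by apply: IH; [exact: CnW|exact: hf.2].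
Qed.

Lemma smE V W (U : set V) (f : V -> W) : sm U f <->
  [/\ open U, forall z, U z -> differentiable f z & forall v, sm U (dv v f)].
Proof.
split=> [[oU h]|[oU d h]].
  split=> //; first exact: (h 1).1.
  by move=> v; split=> // n; exact: (h n.+1).2.
by split=> // -[//|n]; split=> // v; apply: (h v).2.
Qed.

Lemma sm_open V W (U : set V) (f : V -> W) : sm U f -> open U.
Proof. by case. Qed.

Lemma sm_diff V W (U : set V) (f : V -> W) z : sm U f -> U z -> differentiable f z.
Proof. by move=> /smE[_ + _]; apply. Qed.

Lemma sm_derive V W (U : set V) (f : V -> W) v : sm U f -> sm U (dv v f).
Proof. by move=> /smE[]. Qed.

Lemma sm_cont V W (U : set V) (f : V -> W) z : sm U f -> U z -> {for z, continuous f}.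
Proof. by move=> h Uz; apply: differentiable_continuous; exact: sm_diff h Uz. Qed.

Lemma sm_eq V W (U : set V) (f g : V -> W) :
  (forall x, U x -> f x = g x) -> sm U f -> sm U g.
Proof. by move=> e [oU h]; split=> // n; apply: Cn_eq (h n). Qed.

Lemma sm_sub V W (U U' : set V) (f : V -> W) : U' `<=` U -> open U' -> sm U f -> sm U' f.
Proof. by move=> s o [_ h]; split=> // n; exact: Cn_sub (h n). Qed.

Lemma sm_cst V W (U : set V) (a : W) : open U -> sm U (fun _ : V => a).
Proof. by move=> oU; split=> // n; exact: Cn_cst. Qed.

Lemma sm_lincomp V W X (U : set V) (L : W -> X) (f : V -> W) : findim W ->
  linear L -> sm U f -> sm U (fun z => L (f z)).
Proof. by move=> fW lL [oU h]; split=> // n; exact: (Cn_lincomp fW oU lL (h n)). Qed.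

Lemma sm_id V (U : set V) : findim V -> open U -> sm U (fun z => z).
Proof.
move=> fV oU; split=> // -[//|n]; split; first by [].
by move=> v; apply: (Cn_eq oU _ (Cn_cst n U v)) => x _; rewrite dvE derive_id.
Qed.

Lemma sm_lin V W (U : set V) (L : V -> W) : findim V -> open U -> linear L -> sm U L.
Proof. by move=> fV oU lL; apply: (sm_lincomp fV lL); exact: sm_id. Qed.

Lemma sm_sum V W (U : set V) m (F : 'I_m -> V -> W) : open U ->
  (forall i, sm U (F i)) -> sm U (fun z => \sum_i F i z).
Proof. by move=> oU h; split=> // n; apply: Cn_sum => // i; exact: (h i).2. Qed.

Lemma sm_add V W (U : set V) (f g : V -> W) :
  sm U f -> sm U g -> sm U (fun z => f z + g z).
Proof. by move=> [oU h] [_ h']; split=> // n; exact: Cn_add. Qed.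

Lemma sm_scale V W (U : set V) (k : V -> R) (f : V -> W) :
  sm U k -> sm U f -> sm U (fun z => k z *: f z).
Proof. by move=> [oU h] [_ h']; split=> // n; exact: Cn_scale. Qed.

Lemma sm_scalec V W (U : set V) (k : R) (f : V -> W) :
  sm U f -> sm U (fun z => k *: f z).
Proof. by move=> h; apply: sm_scale => //; apply: sm_cst; exact: sm_open h. Qed.

Lemma sm_opp V W (U : set V) (f : V -> W) : sm U f -> sm U (fun z => - f z).
Proof. by move=> h; apply: sm_eq (sm_scalec (-1) h) => x _; rewrite scaleN1r. Qed.

Lemma sm_sub' V W (U : set V) (f g : V -> W) :
  sm U f -> sm U g -> sm U (fun z => f z - g z).
Proof. by move=> h h'; apply: sm_add => //; exact: sm_opp. Qed.

Lemma sm_mul V (U : set V) (f g : V -> R) :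
  sm U f -> sm U g -> sm U (fun z => f z * g z).
Proof. exact: sm_scale. Qed.

Lemma sm_comp V W X (U : set V) (U' : set W) (g : V -> W) (f : W -> X) :
  findim W -> (forall z, U z -> U' (g z)) ->
  sm U g -> sm U' f -> sm U (fun z => f (g z)).
Proof.
by move=> fW s [oU h] [_ h']; split=> // n; apply: (@Cn_comp _ _ _ n U U' g f).
Qed.

Lemma sm_inv V (U : set V) (f : V -> R) : (forall z, U z -> f z != 0) -> sm U f ->
  sm U (fun z => (f z)^-1).
Proof.
move=> f0 [oU h]; split=> //; elim=> [//|n IH]; split.
  by move=> z Uz; apply: differentiableV; [apply: (h 1).1|apply: f0].
move=> v; apply: (@Cn_eq _ _ _ _ (fun z => (- (f z)^-1 * (f z)^-1) *: dv v f z)) => //.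
  move=> z Uz; rewrite !dvE [in RHS]deriveV //; [|exact: f0|].
    by rewrite mulNr -invfM -expr2.
  by apply: diff_derivable; apply: (h 1).1.
have hN : Cn n U (fun z => - (f z)^-1).
  have -> : (fun z => - (f z)^-1) = (fun z => cst (-1) z *: (f z)^-1).
    by apply/funext => z; rewrite /cst scaleN1r.
  by apply: Cn_scale => //; exact: Cn_cst.
apply: Cn_scale => //; last exact: (h n.+1).2.
exact: Cn_scale.
Qed.

(** [C1_diff], applied to every iterated directional derivative, turns the definition of the
    statement into one to which the chain rule applies. *)
Lemma smooth_onP V W (U : set V) (f : V -> W) : findim V -> findim W ->
  (smooth_on U f <-> sm U f).
Proof.
move=> fV fW; split.
  move=> [oU h]; split=> // n.
  have {}h : forall (vs : seq V) z, U z -> {for z, continuous (Defs.iterD vs f)} /\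
    forall v, derivable (Defs.iterD vs f) z v by exact: h.
  suff H : forall vs : seq V, Cn n U (Defs.iterD vs f) by exact: (H [::]).
  elim: n => [//|n IH] vs; split; last by move=> v; rewrite dvF; apply: (IH (v :: vs)).
  move=> z Uz; apply: (@C1_diff R V W U) => //.
    by move=> x v Ux; apply: (h vs x Ux).2.
  by move=> v; apply: (h (v :: vs) z Uz).1.
move=> h; split; first exact: sm_open h.
move=> vs z Uz; suff H : sm U (Defs.iterD vs f).
  split; first exact: sm_cont H Uz.
  by move=> v; apply: diff_derivable; exact: sm_diff H Uz.
by elim: vs => [//|v vs IH] /=; rewrite -dvF; exact: sm_derive.
Qed.

Lemma schwarz V W (U : set V) (f : V -> W) z v w : findim W -> sm U f -> U z ->
  dv v (dv w f) z = dv w (dv v f) z.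
Proof.
move=> fW; have [[m [e [c [lc cc ex]]]]] := fW => h Uz.
have oU := sm_open h.
rewrite (ex (dv v (dv w f) z)) (ex (dv w (dv v f) z)); apply: eq_bigr => i _; congr (_ *: _).
have C u u' x : U x -> c i (dv u (dv u' f) x) = dv u (dv u' (c i \o f)) x.
  move=> Ux; have [_ <-] := derive_lincomp u fW (lc i) (sm_diff (sm_derive u' h) Ux).
  apply: (derive_eq_on _ oU Ux) => y Uy.
  by have [_ ->] := derive_lincomp u' fW (lc i) (sm_diff h Uy).
rewrite !C //.
have hc : sm U (c i \o f) by apply: (sm_lincomp fW (lc i)).
apply: (@schwarz_real R V U) => //.
- by move=> x u Ux; apply: diff_derivable; exact: sm_diff hc Ux.
- by move=> x u u' Ux; apply: diff_derivable; exact: sm_diff (sm_derive u' hc) Ux.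
- by move=> u u'; apply: sm_cont (sm_derive u (sm_derive u' hc)) Uz.
Qed.

(** Expanding [X] in a finite spanning family reduces a derivative along a variable field to
    derivatives along fixed directions. *)
Lemma sm_derive_vf V W (U : set V) (F : V -> W) (X : V -> V) : findim V ->
  sm U F -> sm U X -> sm U (fun w => dv (X w) F w).
Proof.
move=> fV hF hX; have [[m [e [c [lc cc ex]]]]] := fV; have oU := sm_open hF.
apply: (@sm_eq _ _ _ (fun w => \sum_i c i (X w) *: dv (e i) F w)).
  move=> x Ux; rewrite [in RHS](ex (X x)) derive_dir_sum; last exact: sm_diff hF Ux.
  by apply: eq_bigr => i _; rewrite derive_dirZ //; exact: sm_diff hF Ux.
apply: sm_sum => // i; apply: sm_scale; first exact: sm_lincomp.
exact: sm_derive.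
Qed.

(** All commutators of fields below come from this formula: the bracket is the term in which the
    field itself is differentiated, the other one using the symmetry of second derivatives. *)
Lemma derive_vf V W (U : set V) (F : V -> W) (X : V -> V) b z : findim V -> findim W ->
  sm U F -> sm U X -> U z ->
  dv b (fun w => dv (X w) F w) z = dv (X z) (dv b F) z + dv (dv b X z) F z.
Proof.
move=> fV fW hF hX Uz; have [[m [e [c [lc cc ex]]]]] := fV; have oU := sm_open hF.
have dF := sm_diff hF; have dF' v := sm_diff (sm_derive v hF).
rewrite (@derive_eq_on _ _ U _ (fun w => \sum_i (c i \o X) w *: dv (e i) F w) z b oU Uz); last first.
  move=> x Ux; rewrite [in LHS](ex (X x)) derive_dir_sum; last exact: dF.
  by apply: eq_bigr => i _; rewrite derive_dirZ //; exact: dF.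
have dc i : differentiable (c i \o X) z.
  by have [] := derive_lincomp b fV (lc i) (sm_diff hX Uz).
rewrite (diff_sum _).2; last first.
  by move=> i; apply: (diff_scale _ _).1 => //; exact: dF'.
rewrite [in X in X + _](ex (X z)) [in X in _ + X](ex (dv b X z)).
rewrite derive_dir_sum; last exact: dF'.
rewrite derive_dir_sum; last exact: dF.
rewrite -big_split /=; apply: eq_bigr => i _.
rewrite (diff_scale (dc i) (dF' _ _ Uz)).2.
rewrite derive_dirZ; last exact: dF'.
rewrite derive_dirZ; last exact: dF.
have [_ ->] := derive_lincomp b fV (lc i) (sm_diff hX Uz).
by rewrite (schwarz _ _ fW hF Uz) addrC.
Qed.

Lemma derive2_comp V W X (U : set V) (U' : set W) (g : V -> W) (f : W -> X) z v w :
  findim V -> findim W -> findim X -> (forall z, U z -> U' (g z)) ->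
  sm U g -> sm U' f -> U z ->
  dv v (dv w (f \o g)) z =
  dv (dv v g z) (dv (dv w g z) f) (g z) + dv (dv v (dv w g) z) f (g z).
Proof.
move=> fV fW fX s hg hf Uz; have oU := sm_open hg.
have [[m [e [c [lc cc ex]]]]] := fW.
have dg := sm_diff hg; have dg' v := sm_diff (sm_derive v hg).
have df x (Ux : U x) : differentiable f (g x) := sm_diff hf (s _ Ux).
have df' u x (Ux : U x) : differentiable (dv u f) (g x) := sm_diff (sm_derive u hf) (s _ Ux).
rewrite (@derive_eq_on _ _ U _ (fun x => \sum_i (c i \o dv w g) x *: (dv (e i) f \o g) x) z v oU Uz); last first.
  move=> x Ux; rewrite derive_comp; [|exact: dg|exact: df].
  rewrite [in LHS](ex (dv w g x)) derive_dir_sum; last exact: df.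
  by apply: eq_bigr => i _; rewrite /= derive_dirZ //; exact: df.
have dc i : differentiable (c i \o dv w g) z.
  by have [] := derive_lincomp v fW (lc i) (dg' z w Uz).
have dfg i : differentiable (dv (e i) f \o g) z.
  by apply: differentiable_comp; [exact: dg|exact: df'].
rewrite (diff_sum _).2; last by move=> i; apply: (diff_scale _ _).1.
rewrite -(schwarz _ _ fX hf (s _ Uz)) [in X in X + _](ex (dv w g z)) [in X in _ + X](ex (dv v (dv w g) z)).
rewrite derive_dir_sum; last exact: df'.
rewrite derive_dir_sum; last exact: df.
rewrite -big_split /=; apply: eq_bigr => i _.
rewrite (diff_scale (dc i) (dfg i)).2 derive_comp; [|exact: dg|exact: df'].
have [_ ->] := derive_lincomp v fW (lc i) (dg' z w Uz).
rewrite (derive_dirZ _ _ (df' (dv v g z) z Uz)) (derive_dirZ _ _ (df z Uz)) addrC /=.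
by rewrite (schwarz _ _ fX hf (s _ Uz)).
Qed.

End Sm.

Section Findim.
Context {R : realType}.

#[global] Instance findimR : findim (R : normedModType R).
Proof.
split; exists 1%N, (fun _ => 1), (fun _ x => x); split.
- by move=> _ a x y.
- by move=> _ x; exact: cvg_id.
- by move=> x; rewrite big_ord1 [RHS]mulr1.
Qed.

#[global] Instance findim_mx m n : findim ('M[R]_(m, n) : normedModType R).
Proof.
pose P := ('I_m * 'I_n)%type.
split; exists #|{: P}|, (fun k => delta_mx (enum_val k).1 (enum_val k).2 : 'M[R]_(m, n)),
  (fun k (A : 'M[R]_(m, n)) => A (enum_val k).1 (enum_val k).2); split.
- by move=> k a x y; rewrite !mxE.
- by move=> k; exact: coord_continuous.
- move=> x; rewrite [LHS]matrix_sum_delta pair_bigA /=.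
  by rewrite (reindex_onto (@enum_val {: P} predT) enum_rank) /=; [apply: eq_bigl => k; rewrite enum_valK eqxx|move=> i _; rewrite enum_rankK].
Qed.

#[global] Instance findim_prod (V W : normedModType R) : findim V -> findim W ->
  findim ((V * W)%type : normedModType R).
Proof.
move=> [[n [e [c [lc cc ex]]]]] [[n' [e' [c' [lc' cc' ex']]]]].
split; exists (n + n')%N,
  (fun k => match fintype.split k with inl i => (e i, 0) | inr j => (0, e' j) end),
  (fun k x => match fintype.split k with inl i => c i x.1 | inr j => c' j x.2 end); split.
- by move=> k a x y; case: (fintype.split k) => i /=; rewrite ?lc ?lc'.
- move=> k x; case: (fintype.split k) => i.
    by apply: continuous_comp; [exact: cvg_fst|exact: cc].
  by apply: continuous_comp; [exact: cvg_snd|exact: cc'].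
- move=> x; rewrite big_split_ord /=.
  have -> : \sum_(i < n) match fintype.split (lshift n' i) with inl i => c i x.1 | inr j => c' j x.2 end
     *: match fintype.split (lshift n' i) with inl i => (e i, 0) | inr j => (0, e' j) end = (x.1, 0) :> V * W.
    rewrite [in RHS](ex x.1); elim/big_rec2: _ => [//|i y z _ ->].
    by rewrite (unsplitK (inl i)) /=; congr (_, _); rewrite /= scaler0 addr0.
  have -> : \sum_(i < n') match fintype.split (rshift n i) with inl i => c i x.1 | inr j => c' j x.2 end
     *: match fintype.split (rshift n i) with inl i => (e i, 0) | inr j => (0, e' j) end = (0, x.2) :> V * W.
    rewrite [in RHS](ex' x.2); elim/big_rec2: _ => [//|i y z _ ->].
    by rewrite (unsplitK (inr i)) /=; congr (_, _); rewrite /= scaler0 addr0.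
  by case: x => a b; rewrite -[RHS]/(a + 0, 0 + b) addr0 add0r.
Qed.

End Findim.

Section Sm2.
Context {R : realType}.
Implicit Types (V W X : normedModType R).

Lemma sm_pair V W X (U : set V) (f : V -> W) (g : V -> X) : findim W -> findim X ->
  sm U f -> sm U g -> sm U (fun z => (f z, g z)).
Proof.
move=> fW fX hf hg.
have h1 : sm U (fun z => (f z, 0) : W * X).
  apply: (@sm_lincomp R V W _ U (fun x => (x, 0) : W * X)) hf => // a x y.
  by rewrite -[RHS]/(a *: x + y, a *: 0 + 0) scaler0 addr0.
have h2 : sm U (fun z => (0, g z) : W * X).
  apply: (@sm_lincomp R V X _ U (fun x => (0, x) : W * X)) hg => // a x y.
  by rewrite -[RHS]/(a *: 0 + 0, a *: x + y) scaler0 addr0.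
by apply: sm_eq (sm_add h1 h2) => x _; rewrite -[LHS]/(f x + 0, 0 + g x) addr0 add0r.
Qed.

Lemma linear_fst V W : linear (fst : V * W -> V).
Proof. by move=> a [x x'] [y y']. Qed.

Lemma linear_snd V W : linear (snd : V * W -> W).
Proof. by move=> a [x x'] [y y']. Qed.

Lemma sm_fst V W X (U : set V) (f : V -> W * X) : findim W -> findim X ->
  sm U f -> sm U (fun z => (f z).1).
Proof. by move=> fW fX; apply: (@sm_lincomp _ _ _ _ _ fst); exact: linear_fst. Qed.

Lemma sm_snd V W X (U : set V) (f : V -> W * X) : findim W -> findim X ->
  sm U f -> sm U (fun z => (f z).2).
Proof. by move=> fW fX; apply: (@sm_lincomp _ _ _ _ _ snd); exact: linear_snd. Qed.

Lemma sm_coord V m n (U : set V) (f : V -> 'M[R]_(m, n)) i j :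
  sm U f -> sm U (fun z => f z i j).
Proof. by apply: (@sm_lincomp _ _ _ _ _ (fun A : 'M[R]_(m, n) => A i j)) => a x y; rewrite !mxE. Qed.

Lemma sm_mx V m n (U : set V) (f : V -> 'M[R]_(m, n)) : open U ->
  (forall i j, sm U (fun z => f z i j)) -> sm U f.
Proof.
move=> oU h; apply: (@sm_eq _ _ _ _ (fun z => \sum_i \sum_j f z i j *: delta_mx i j)).
  by move=> z _; rewrite -matrix_sum_delta.
apply: sm_sum => // i; apply: sm_sum => // j; apply: sm_scale => //; exact: sm_cst.
Qed.

Lemma sm_prod V (U : set V) m (F : 'I_m -> V -> R) : open U ->
  (forall i, sm U (F i)) -> sm U (fun z => \prod_i F i z).
Proof.
move=> oU; elim: m F => [|m IH] F hF.
  by apply: sm_eq (sm_cst (1 : R) oU) => x _; rewrite big_ord0.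
apply: (@sm_eq _ _ _ _ (fun z => F ord0 z * \prod_i F (lift ord0 i) z)).
  by move=> z _; rewrite big_ord_recl.
by apply: sm_mul => //; apply: IH.
Qed.

Lemma sm_bilin V W X (Y : normedModType R) (U : set V) (b : W -> X -> Y)
  (f : V -> W) (g : V -> X) : findim W -> findim X ->
  (forall x, linear (b x)) -> (forall y, linear (b^~ y)) ->
  sm U f -> sm U g -> sm U (fun z => b (f z) (g z)).
Proof.
move=> fW fX l1 l2 hf hg; have oU := sm_open hf.
have [[n [e [c [lc cc ex]]]]] := fW; have [[n' [e' [c' [lc' cc' ex']]]]] := fX.
apply: (@sm_eq _ _ _ _ (fun z => \sum_i \sum_j (c i (f z) * c' j (g z)) *: b (e i) (e' j))).
  move=> z _; rewrite [in RHS](ex (f z)) [in RHS](ex' (g z)).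
  have [_ _ _ _ S1] := linP (l2 (\sum_i c' i (g z) *: e' i)); rewrite S1; apply: eq_bigr => i _.
  have [_ _ Z2 _ _] := linP (l2 (\sum_i c' i (g z) *: e' i)); rewrite Z2.
  have [_ _ Z3 _ S3] := linP (l1 (e i)).
  by rewrite S3 scaler_sumr; apply: eq_bigr => j _; rewrite Z3 scalerA.
apply: sm_sum => // i; apply: sm_sum => // j; apply: sm_scale; last exact: sm_cst.
by apply: sm_mul; [apply: sm_lincomp hf|apply: sm_lincomp hg].
Qed.

Lemma diff_bil V W X (Y : normedModType R) (b : W -> X -> Y)
  (f : V -> W) (g : V -> X) z : findim W -> findim X ->
  (forall x, linear (b x)) -> (forall y, linear (b^~ y)) ->
  differentiable f z -> differentiable g z ->
  differentiable (fun z => b (f z) (g z)) z /\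
  forall v, dv v (fun z => b (f z) (g z)) z = b (dv v f z) (g z) + b (f z) (dv v g z).
Proof.
move=> fW fX l1 l2 hf hg.
have [[n [e [c [lc cc ex]]]]] := fW; have [[n' [e' [c' [lc' cc' ex']]]]] := fX.
have E x y : b x y = \sum_i \sum_j (c i x *: (c' j y *: b (e i) (e' j))).
  rewrite [in LHS](ex x) [in LHS](ex' y).
  have [_ _ _ _ S1] := linP (l2 (\sum_i c' i y *: e' i)); rewrite S1; apply: eq_bigr => i _.
  have [_ _ Z2 _ _] := linP (l2 (\sum_i c' i y *: e' i)); rewrite Z2.
  have [_ _ Z3 _ S3] := linP (l1 (e i)).
  by rewrite S3 scaler_sumr; apply: eq_bigr => j _; rewrite Z3.
have -> : (fun z => b (f z) (g z)) =
    (fun z => \sum_i \sum_j ((c i \o f) z *: ((c' j \o g) z *: b (e i) (e' j)))).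
  by apply/funext => x; rewrite E.
have d1 i v := derive_lincomp v fW (lc i) hf.
have d2 i v := derive_lincomp v fX (lc' i) hg.
have d3 i j : differentiable (fun x => (c' j \o g) x *: b (e i) (e' j)) z.
  by apply: (diff_scale _ _).1 => //; exact: (d2 j 0).1.
have d4 i j : differentiable (fun z => ((c i \o f) z *: ((c' j \o g) z *: b (e i) (e' j)))) z.
  by apply: (diff_scale _ _).1 => //; exact: (d1 i 0).1.
have d5 i : differentiable (fun z => \sum_j ((c i \o f) z *: ((c' j \o g) z *: b (e i) (e' j)))) z.
  by apply: (diff_sum _).1.
split; first by apply: (diff_sum _).1.
move=> v; rewrite (diff_sum d5).2 !E -big_split /=; apply: eq_bigr => i _.
rewrite (diff_sum (d4 i)).2 -big_split /=; apply: eq_bigr => j _.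
rewrite (diff_scale (d1 i 0).1 (d3 i j)).2 (d1 i v).2; congr (_ + _ *: _).
rewrite (@diff_scale R V Y (c' j \o g) (fun=> b (e i) (e' j)) z (d2 j 0).1 _).2 //.
by rewrite (d2 j v).2 dv_cst scaler0 addr0.
Qed.

Lemma mulmx_lin1 m n p (A : 'M[R]_(m, n)) : linear (mulmx A : 'M[R]_(n, p) -> _).
Proof. by move=> a x y; rewrite mulmxDr scalemxAr. Qed.

Lemma mulmx_lin2 m n p (B : 'M[R]_(n, p)) : linear ((fun A => mulmx A B) : 'M[R]_(m, n) -> _).
Proof. by move=> a x y; rewrite mulmxDl scalemxAl. Qed.

Lemma sm_mulmx V m n p (U : set V) (f : V -> 'M[R]_(m, n)) (g : V -> 'M[R]_(n, p)) :
  sm U f -> sm U g -> sm U (fun z => f z *m g z).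
Proof.
by apply: (@sm_bilin V _ _ _ U (@mulmx R m n p)); [exact: mulmx_lin1|exact: mulmx_lin2].
Qed.

Lemma sm_det V n (U : set V) (f : V -> 'M[R]_n) : sm U f -> sm U (fun z => \det (f z)).
Proof.
move=> h; have oU := sm_open h; apply: (@sm_eq _ _ _ _ (fun z =>
  \sum_(k < #|{: 'S_n}|) (-1) ^+ enum_val k * \prod_i f z i ((enum_val k : 'S_n) i))).
  move=> z _; rewrite /determinant [RHS](reindex_onto (@enum_val {: 'S_n} predT) enum_rank) /=.
    by apply: eq_bigl => k; rewrite enum_valK eqxx.
  by move=> i _; rewrite enum_rankK.
apply: sm_sum => // k; apply: sm_mul; first exact: sm_cst.
by apply: sm_prod => // i; exact: sm_coord.
Qed.

Lemma sm_invmx V n (U : set V) (f : V -> 'M[R]_n) : sm U f ->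
  (forall z, U z -> f z \in unitmx) -> sm U (fun z => invmx (f z)).
Proof.
move=> h u; have oU := sm_open h.
apply: (@sm_eq _ _ _ _ (fun z => (\det (f z))^-1 *: \adj (f z))).
  by move=> z Uz; rewrite /invmx u.
apply: sm_scale.
  by apply: sm_inv (sm_det h) => z Uz; rewrite -unitfE -unitmxE u.
apply: sm_mx => // i j.
apply: (@sm_eq _ _ _ _ (fun z => (-1) ^+ (j + i) * \det (row' j (col' i (f z))))).
  by move=> z _; rewrite !mxE.
apply: sm_mul; first exact: sm_cst.
apply: sm_det; apply: sm_mx => // k l.
apply: (@sm_eq _ _ _ _ (fun z => f z (lift j k) (lift i l))); first by move=> z _; rewrite !mxE.
exact: sm_coord.
Qed.

Lemma unitmx_open n : open [set A : 'M[R]_n | A \in unitmx].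
Proof.
have -> : [set A : 'M[R]_n | A \in unitmx] = (fun A => \det A) @^-1` [set x : R | x != 0].
  by apply/seteqP; split=> A /=; rewrite unitmxE unitfE.
apply: open_comp; last exact: open_neq.
by move=> A _; apply: sm_cont (sm_det (sm_id _ openT)) I.
Qed.

(** Being locally constant along the leaves becomes a differential equation, which is stable under
    all the operations used. Conversely, balls of the product are products of balls, so a segment in
    the direction of [V] stays in [D] and the mean value theorem applies to each coordinate. *)
Lemma flatP (V W X : normedModType R) (D : set (V * W)) (f : V * W -> X) :
  findim V -> findim W -> findim X -> sm D f ->
  ((forall z, D z -> \forall x \near z.1, f (x, z.2) = f z) <->
   (forall z x, D z -> dv (x, 0) f z = 0)).
Proof.
move=> fV fW fX hf; have oD := sm_open hf; split.
  move=> h z x Dz; have := h z Dz; case: z Dz => z1 z2 Dz /= hn.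
  have di : differentiable (fun x => (x, z2) : V * W) z1.
    by apply: differentiable_pair.
  have e : f \o (fun x => (x, z2)) = fun x => f (x, z2) by [].
  have df : differentiable f (z1, z2) by exact: sm_diff hf Dz.
  have E : dv x (f \o (fun x => (x, z2))) z1 = dv (x, 0) f (z1, z2).
    rewrite derive_comp //; congr (dv _ _ _).
    by rewrite dvE deriveE // diff_pair // diff_val diff_cst.
  rewrite -E dvE; rewrite (near_eq_derive x (_ : \forall y \near z1, (f \o (fun x => (x, z2))) y = cst (f (z1, z2)) y)).
    by rewrite derive_cst.
  by [].
move=> h [z1 z2] Dz /=.
have [[n [e [c [lc cc ex]]]]] := fX.
have /nbhs_ballP[r r0 hr] := open_nbhs_nbhs (conj oD Dz).
apply/nbhs_ballP; exists r => // y yr.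
rewrite (ex (f (y, z2))) (ex (f (z1, z2))); apply: eq_bigr => i _; congr (_ *: _).
have hl (s : R) : `|s| <= `|1 : R| -> D ((z1, z2) + s *: (y - z1, 0)).
  move=> s1; apply: hr; apply: ball_line; move: yr; rewrite -ball_normE /= => yr.
  rewrite prod_normE /= normr0.
  have m0 : Num.max `|y - z1| (0:R) = `|y - z1| by apply/max_idPl.
  rewrite m0 distrC; apply: le_lt_trans yr.
  by rewrite normr1 in s1; rewrite ler_piMl.
have [|s hs] := @MVT_line R _ (c i \o f) (z1, z2) (y - z1, 0) 1.
  move=> s /hl Ds; have [d _] := derive_lincomp 0 fX (lc i) (sm_diff hf Ds).
  exact: diff_derivable.
rewrite scale1r mul1r -dvE (derive_lincomp _ fX (lc i) (sm_diff hf (hl _ hs))).2.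
have [c0 _ _ _ _] := linP (lc i).
rewrite h ?c0; last exact: hl.
move=> /eqP; rewrite subr_eq0 => /eqP /= <-.
by rewrite -[(z1, z2) + (y - z1, 0)]/(z1 + (y - z1), z2 + 0) addr0 subrKC.
Qed.

Lemma dv_line0 V (f : V -> R) z v : (forall s : R, `|s| <= 1 -> differentiable f (z + s *: v)) ->
  (forall s : R, dv v f (z + s *: v) = 0) -> f (z + v) = f z.
Proof.
move=> df d0; have [|s hs] := @MVT_line R _ f z v 1.
  by move=> s; rewrite normr1 => /df; apply: diff_derivable.
by rewrite -dvE d0 mulr0 scale1r => /eqP; rewrite subr_eq0 => /eqP.
Qed.

End Sm2.

(** * Rules computing derivatives *)

Section Isd.
Context {R : realType}.
Implicit Types (V W X : normedModType R).

(** Differentiability is carried along with the value of the derivative, so that the derivative of a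
    composite expression is read off from the rules used to build it. *)
Definition isd V W (f : V -> W) z (L : V -> W) := differentiable f z /\ forall v, dv v f z = L v.

Lemma isd_sm V W (U : set V) (f : V -> W) z : sm U f -> U z -> isd f z (fun v => dv v f z).
Proof. by move=> h Uz; split=> //; exact: sm_diff h Uz. Qed.

Lemma isd_cst V W (a : W) z : isd (fun _ : V => a) z (fun _ => 0).
Proof. by split=> // v; rewrite dv_cst. Qed.

Lemma isd_lin V W (f : V -> W) z : findim V -> linear f -> isd f z f.
Proof. by move=> fV lf; split; [exact: lin_diff|move=> v; exact: derive_lin]. Qed.

Lemma isd_id V z : isd (fun x : V => x) z (fun v => v).
Proof. by split=> // v; rewrite dvE derive_id. Qed.

Lemma isd_lincomp V W X (f : V -> W) (L : W -> X) z df : findim W -> linear L ->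
  isd f z df -> isd (fun x => L (f x)) z (fun v => L (df v)).
Proof.
move=> fW lL [d e]; split; first exact: (derive_lincomp 0 fW lL d).1.
by move=> v; rewrite -e; exact: (derive_lincomp v fW lL d).2.
Qed.

Lemma isd_comp V W X (f : V -> W) (g : W -> X) z df dg :
  isd f z df -> isd g (f z) dg -> isd (fun x => g (f x)) z (fun v => dg (df v)).
Proof.
move=> [d e] [d' e']; split; first exact: differentiable_comp.
by move=> v; rewrite -e -e'; exact: derive_comp.
Qed.

Lemma isd_fst V W X (f : V -> W * X) z df : findim W -> findim X ->
  isd f z df -> isd (fun x => (f x).1) z (fun v => (df v).1).
Proof. move=> fW fX; apply: (@isd_lincomp _ _ _ _ fst); exact: linear_fst. Qed.

Lemma isd_snd V W X (f : V -> W * X) z df : findim W -> findim X ->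
  isd f z df -> isd (fun x => (f x).2) z (fun v => (df v).2).
Proof. move=> fW fX; apply: (@isd_lincomp _ _ _ _ snd); exact: linear_snd. Qed.

Lemma isd_scale V W (k : V -> R) (f : V -> W) z dk df :
  isd k z dk -> isd f z df -> isd (fun x => k x *: f x) z (fun v => dk v *: f z + k z *: df v).
Proof.
move=> [d e] [d' e']; have [h1 h2] := diff_scale d d'.
by split=> // v; rewrite h2 e e'.
Qed.

Lemma isd_scalec V W (k : R) (f : V -> W) z df :
  isd f z df -> isd (fun x => k *: f x) z (fun v => k *: df v).
Proof.
move=> h; have [d e] := isd_scale (isd_cst k z) h.
by split=> // v; rewrite e scale0r add0r.
Qed.

Lemma isd_eq V W (f : V -> W) z df dg : isd f z df -> (forall v, df v = dg v) -> isd f z dg.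
Proof. by move=> [d e] E; split=> // v; rewrite e. Qed.

Lemma isd_eqf V W (U : set V) (f g : V -> W) z df : open U -> U z ->
  (forall x, U x -> f x = g x) -> isd f z df -> isd g z df.
Proof.
move=> oU Uz E [d e]; split; first exact: (diff_eq_on oU Uz E d).
by move=> v; rewrite -e; apply/esym; exact: (derive_eq_on _ oU Uz E).
Qed.

Lemma isd_add V W (f g : V -> W) z df dg :
  isd f z df -> isd g z dg -> isd (fun x => f x + g x) z (fun v => df v + dg v).
Proof.
move=> [d e] [d' e']; split; first exact: differentiableD.
move=> v; rewrite dvE (_ : (fun x => f x + g x) = f + g) // deriveD; try exact: diff_derivable.
by rewrite -!dvE e e'.
Qed.

Lemma isd_opp V W (f : V -> W) z df : isd f z df -> isd (fun x => - f x) z (fun v => - df v).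
Proof.
move=> h; have -> : (fun x => - f x) = (fun x => -1 *: f x).
  by apply/funext => x; rewrite scaleN1r.
by apply: isd_eq (isd_scalec (-1) h) _ => v; rewrite scaleN1r.
Qed.

Lemma isd_sub V W (f g : V -> W) z df dg :
  isd f z df -> isd g z dg -> isd (fun x => f x - g x) z (fun v => df v - dg v).
Proof. by move=> h h'; apply: isd_add => //; exact: isd_opp. Qed.

Lemma isd_sum V W n (F : 'I_n -> V -> W) z dF : (forall i, isd (F i) z (dF i)) ->
  isd (fun x => \sum_i F i x) z (fun v => \sum_i dF i v).
Proof.
move=> h; have [d e] := diff_sum (fun i => (h i).1).
by split=> // v; rewrite e; apply: eq_bigr => i _; exact: (h i).2.
Qed.

Lemma isd_bil V W X (Y : normedModType R) (b : W -> X -> Y)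
  (f : V -> W) (g : V -> X) z df dg : findim W -> findim X ->
  (forall x, linear (b x)) -> (forall y, linear (b^~ y)) ->
  isd f z df -> isd g z dg ->
  isd (fun z => b (f z) (g z)) z (fun v => b (df v) (g z) + b (f z) (dg v)).
Proof.
move=> fW fX l1 l2 [d e] [d' e']; have [h1 h2] := diff_bil fW fX l1 l2 d d'.
by split=> // v; rewrite h2 e e'.
Qed.

Lemma isd_mulmx V m n p (f : V -> 'M[R]_(m, n)) (g : V -> 'M[R]_(n, p)) z df dg :
  isd f z df -> isd g z dg ->
  isd (fun z => f z *m g z) z (fun v => df v *m g z + f z *m dg v).
Proof. apply: isd_bil; [exact: mulmx_lin1|exact: mulmx_lin2]. Qed.

Lemma isd_mul V (f g : V -> R) z df dg :
  isd f z df -> isd g z dg -> isd (fun z => f z * g z) z (fun v => df v * g z + f z * dg v).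
Proof. exact: isd_scale. Qed.

Lemma isd_pair V W X (f : V -> W) (g : V -> X) z df dg :
  isd f z df -> isd g z dg -> isd (fun z => (f z, g z)) z (fun v => (df v, dg v)).
Proof.
move=> [d e] [d' e']; split; first exact: differentiable_pair.
by move=> v; rewrite dvE deriveE ?diff_pair //= -?deriveE -?dvE ?e ?e' //; exact: differentiable_pair.
Qed.

Lemma isd_coord V m n (f : V -> 'M[R]_(m, n)) z df i j :
  isd f z df -> isd (fun x => f x i j) z (fun v => df v i j).
Proof. by apply: (@isd_lincomp _ _ _ _ (fun A : 'M[R]_(m, n) => A i j)) => a x y; rewrite !mxE. Qed.

(** Differentiation of [f f^-1 = 1]; that the inverse is differentiable is already known from the
    formula with the adjugate. *)
Lemma isd_inv V n (f : V -> 'M[R]_n) z df (U : set V) :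
  sm U f -> (forall x, U x -> f x \in unitmx) -> U z -> isd f z df ->
  isd (fun x => invmx (f x)) z (fun v => - (invmx (f z) *m df v *m invmx (f z))).
Proof.
move=> hf u Uz h; have hi := isd_sm (sm_invmx hf u) Uz; split; first exact: hi.1.
move=> v; have [_ E] := isd_mulmx h hi.
have E0 : dv v (fun x => f x *m invmx (f x)) z = 0.
  rewrite (derive_eq_on (g := fun=> 1%:M) v (sm_open hf) Uz) ?dv_cst // => x Ux.
  by rewrite mulmxV // u.
move: (E v); rewrite E0 => /esym/eqP; rewrite addrC addr_eq0 => /eqP E1.
by have := congr1 (mulmx (invmx (f z))) E1; rewrite mulmxA mulVmx ?u // mul1mx mulmxN mulmxA.
Qed.

End Isd.

(** * Christoffel symbols and connection forms *)

Section Chr.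
Context {R : realType} {q : nat}.
Notation cV := 'cV[R]_q.
Notation rV := 'rV[R]_q.
Notation slq := (slq R q).

(** A torsion-free connection on an open set [V] of the local leaf space. Linearity in the first
    argument follows over [V] from the symmetry. *)
Record chrsym (V : set cV) (G : cV -> cV -> cV -> cV) : Prop := Chr {
  chrsym_open : open V;
  chrsym_lin : forall y v, linear (G y v);
  chrsym_sym : forall y v w, V y -> G y v w = G y w v;
  chrsym_sm : forall v w, sm V (fun y => G y v w)
}.

Lemma cV_delta (v : cV) : v = \sum_j v j 0 *: evec j.
Proof.
rewrite [LHS]matrix_sum_delta; apply: eq_bigr => i _; by rewrite big_ord1.
Qed.

Lemma lin_mulmx_ext m (A B : 'M[R]_(m, q)) : (forall w : cV, A *m w = B *m w) -> A = B.
Proof.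
move=> h; apply/matrixP => i j; have := congr1 (fun M : 'cV[R]_m => M i 0) (h (delta_mx j 0)).
by rewrite -!colE !mxE.
Qed.

Definition chrmx (G : cV -> cV -> cV -> cV) (y v : cV) : 'M[R]_q :=
  \matrix_(i, j) G y v (evec j) i 0.

Lemma lin_mxE (L : cV -> cV) (v : cV) : linear L ->
  (\matrix_(i, j) L (evec j) i 0) *m v = L v.
Proof.
move=> lL; rewrite [in RHS](cV_delta v); have [_ _ Z _ S] := linP lL; rewrite S.
apply/matrixP => i j; rewrite !mxE summxE ord1; apply: eq_bigr => k _.
by rewrite !mxE Z !mxE mulrC.
Qed.

Section Local.
Variables (V : set cV) (G : cV -> cV -> cV -> cV).
Hypothesis hG : chrsym V G.

Lemma GmE y v w : chrmx G y v *m w = G y v w.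
Proof. by rewrite lin_mxE //; exact: chrsym_lin hG y v. Qed.

Lemma chrmx_sym y v w : V y -> chrmx G y v *m w = chrmx G y w *m v.
Proof. by move=> Vy; rewrite !GmE (chrsym_sym hG). Qed.

Lemma chrmx_lin y : V y -> linear (chrmx G y).
Proof.
move=> Vy a v w; apply: lin_mulmx_ext => x; rewrite mulmxDl -scalemxAl !GmE.
by rewrite !(chrsym_sym hG _ x) // (chrsym_lin hG).
Qed.

Lemma chrmx_sm v : sm V (chrmx G ^~ v).
Proof.
apply: sm_mx => [|i j]; first exact: chrsym_open hG.
apply: (@sm_eq _ _ _ _ (fun y => G y v (evec j) i 0)); first by move=> x _; rewrite !mxE.
apply: sm_coord; exact: chrsym_sm hG v _.
Qed.

Lemma chrmx_dlinr y w : V y -> linear (fun v => dv w (chrmx G ^~ v) y).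
Proof.
move=> Vy a v v'; rewrite (derive_eq_on (g := fun z => a *: chrmx G z v + chrmx G z v') _ (chrsym_open hG) Vy).
  have [_ ->] := isd_add (isd_scalec a (isd_sm (chrmx_sm v) Vy)) (isd_sm (chrmx_sm v') Vy); by [].
by move=> z Vz; rewrite (chrmx_lin Vz).
Qed.

End Local.

(** Curvature of the linear connection [d + Gamma] on the constant fields [X] and [Y]. *)
Definition curvmx G (y X Y : cV) : 'M[R]_q :=
  dv X (chrmx G ^~ Y) y - dv Y (chrmx G ^~ X) y + (chrmx G y X *m chrmx G y Y - chrmx G y Y *m chrmx G y X).

Definition ric G (y Z Y : cV) : R := \sum_i (curvmx G y (evec i) Y *m Z) i 0.

(** The projective Schouten tensor, with the sign it has as the [R^q*] part of the connection form.
    Both orders of the arguments of [ric] occur because the Ricci tensor of a torsion-free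
    connection need not be symmetric. *)
Definition schouten G (y X : cV) : rV :=
  \row_j - ((q%:R * ric G y (evec j) X + ric G y X (evec j)) / (q%:R ^+ 2 - 1)).

Section Local2.
Variables (V : set cV) (G : cV -> cV -> cV -> cV).
Hypothesis hG : chrsym V G.

Lemma curvmx_lin1 y Y : V y -> linear (fun X => curvmx G y X Y).
Proof.
move=> Vy a X X'; rewrite /curvmx (chrmx_lin hG Vy) (chrmx_dlinr hG Y Vy).
rewrite (derive_dirD _ _ (sm_diff (chrmx_sm hG Y) Vy)) (derive_dirZ _ _ (sm_diff (chrmx_sm hG Y) Vy)).
rewrite mulmxDl mulmxDr -scalemxAl -scalemxAr.
move: (_ *m _) (_ *m _) (_ *m _) (_ *m _) => m1 m2 m3 m4.
move: (dv _ _ _) (dv _ _ _) (dv _ _ _) (dv _ _ _) => n1 n2 n3 n4.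
by apply/matrixP => i j; rewrite !mxE; ring.
Qed.

Lemma curvmx_anti y X Y : curvmx G y X Y = - curvmx G y Y X.
Proof. by rewrite /curvmx opprD !opprB. Qed.

Lemma curvmx_lin2 y X : V y -> linear (fun Y => curvmx G y X Y).
Proof.
move=> Vy a Y Y'; rewrite !(curvmx_anti y X) (curvmx_lin1 _ Vy) opprD scalerN //.
Qed.

Lemma curvmx_sm X Y : sm V (fun y => curvmx G y X Y).
Proof.
apply: sm_add.
  by apply: sm_sub'; apply: sm_derive; exact: chrmx_sm.
by apply: sm_sub'; apply: sm_mulmx; exact: chrmx_sm.
Qed.

Lemma ric_lin1 y Y : linear (fun Z => ric G y Z Y : R^o).
Proof.
move=> a Z Z'; rewrite /ric scaler_sumr -big_split; apply: eq_bigr => i _ /=.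
by rewrite mulmxDr -scalemxAr !mxE.
Qed.

Lemma ric_lin2 y Z : V y -> linear (fun Y => ric G y Z Y : R^o).
Proof.
move=> Vy a Y Y'; rewrite /ric scaler_sumr -big_split; apply: eq_bigr => i _ /=.
by rewrite (curvmx_lin2 _ Vy) mulmxDl -scalemxAl !mxE.
Qed.

Lemma ric_sm Z Y : sm V (fun y => ric G y Z Y).
Proof.
apply: sm_sum => [|i]; first exact: chrsym_open hG.
apply: sm_coord; apply: sm_mulmx; first exact: curvmx_sm.
apply: sm_cst; exact: chrsym_open hG.
Qed.

Lemma schouten_mul y X Z : V y -> (schouten G y X *m Z) 0 0 =
  - ((q%:R * ric G y Z X + ric G y X Z) / (q%:R ^+ 2 - 1)).
Proof.
move=> Vy; rewrite mxE [in RHS](cV_delta Z).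
have [_ _ Z1 _ S1] := linP (ric_lin1 y X); rewrite S1.
have [_ _ Z2 _ S2] := linP (ric_lin2 X Vy); rewrite S2.
rewrite mulr_sumr -big_split /= mulr_suml -sumrN; apply: eq_bigr => i _.
rewrite !mxE Z1 Z2 /GRing.scale /=; ring.
Qed.

Lemma schouten_lin y : V y -> linear (schouten G y).
Proof.
move=> Vy a X X'; apply: lin_mulmx_ext => Z; apply/matrixP => i j; rewrite !ord1.
rewrite mulmxDl -scalemxAl [in RHS]mxE [X in _ = X + _]mxE !schouten_mul // (ric_lin2 _ Vy) (ric_lin1 y Z).
rewrite /GRing.scale /=; ring.
Qed.

Lemma schouten_sm X : sm V (fun y => schouten G y X).
Proof.
apply: sm_mx => [|i j]; first exact: chrsym_open hG.
apply: (@sm_eq _ _ _ _ (fun y => - ((q%:R * ric G y (evec j) X + ric G y X (evec j)) * (q%:R ^+ 2 - 1)^-1))).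
  by move=> y _; rewrite mxE.
have oV := chrsym_open hG.
apply: sm_opp; apply: sm_mul; last exact: sm_cst.
apply: sm_add; last exact: ric_sm.
by apply: sm_mul; [exact: sm_cst|exact: ric_sm].
Qed.

(* This linear system expresses the normality of [omP]. *)
Lemma schouten_eq y Z Y : (2 <= q)%N -> V y ->
  q%:R * (schouten G y Y *m Z) 0 0 - (schouten G y Z *m Y) 0 0 + ric G y Z Y = 0.
Proof.
move=> hq Vy; rewrite !schouten_mul //.
have q2 : (2 : R) <= q%:R by rewrite (ler_nat _ 2 q).
have : (q%:R ^+ 2 - 1 : R) != 0 by apply/lt0r_neq0; nra.
move=> ?; field; done.
Qed.

(** The equations for [(j, l)] and [(l, j)] form a two by two system: [q] times the one plus the
    other isolates a single component with coefficient [q^2 - 1], which is not zero. *)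
Lemma schouten_unique y (P : cV -> rV) : (2 <= q)%N -> V y -> linear P ->
  (forall j l, q%:R * (P (evec l) *m evec j) 0 0 - (P (evec j) *m evec l) 0 0
     + ric G y (evec j) (evec l) = 0) ->
  forall Y, P Y = schouten G y Y.
Proof.
move=> hq Vy lP h Y.
have q2 : (2 : R) <= q%:R by rewrite (ler_nat _ 2 q).
have N : (q%:R ^+ 2 - 1 : R) != 0 by apply/lt0r_neq0; nra.
rewrite (cV_delta Y); have [_ _ Z1 _ ->] := linP lP; have [_ _ Z2 _ ->] := linP (schouten_lin Vy).
apply: eq_bigr => l _; rewrite Z1 Z2; congr (_ *: _); apply/rowP => j.
have e (r : rV) m : r 0 m = (r *m evec m) 0 0 by rewrite /evec -colE mxE.
rewrite !e; have h1 := h j l; have h2 := h l j.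
have h3 := schouten_eq (evec j) (evec l) hq Vy; have h4 := schouten_eq (evec l) (evec j) hq Vy.
have : (q%:R ^+ 2 - 1) * ((P (evec l) *m evec j) 0 0 - (schouten G y (evec l) *m evec j) 0 0) = 0.
  rewrite -[RHS](subrr (q%:R * 0 + 0)) -{1}h1 -{1}h2 -{1}h3 -h4; ring.
by move/eqP; rewrite mulf_eq0 (negbTE N) subr_eq0 => /eqP.
Qed.

End Local2.

(** * The connection form attached to a tensor [P], and its curvature *)

Section Cartan.
Hypothesis hq : (2 <= q)%N.
Variables (V : set cV) (G : cV -> cV -> cV -> cV).
Hypothesis hG : chrsym V G.

Definition Dn : set slq := [set u | V u.1.1 /\ u.1.2 \in unitmx].

Lemma Dn_open : open Dn.
Proof.
have -> : Dn = ((fun u : slq => u.1.1) @^-1` V) `&` ((fun u : slq => u.1.2) @^-1` [set A | A \in unitmx]).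
  by [].
apply: openI; (apply: open_comp; [|first [exact: chrsym_open hG|exact: unitmx_open]]) => u _.
  by apply: sm_cont (sm_fst _ _ (sm_fst _ _ (sm_id _ openT))) I.
by apply: sm_cont (sm_snd _ _ (sm_fst _ _ (sm_id _ openT))) I.
Qed.

Lemma of_mx_lin : linear (@of_mx R q).
Proof.
move=> a X Y; rewrite /of_mx; congr (_, _, _); apply/matrixP => i j; rewrite !mxE //.
by case: (i == j); rewrite ?mulr1n ?mulr0n; ring.
Qed.

Lemma of_mx_scalar (X : 'M[R]_(q + 1)) c : of_mx (X + c%:M) = of_mx X.
Proof.
rewrite /of_mx; congr (_, _, _); apply/matrixP => i j; rewrite !mxE.
- by rewrite eq_lrshift mulr0n addr0.
- rewrite eq_lshift eqxx; by case: (i == j); rewrite ?mulr1n ?mulr0n; ring.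
- by rewrite eq_rlshift mulr0n addr0.
Qed.

Lemma to_mxK (X : 'M[R]_(q + 1)) : to_mx (of_mx X) = X - (drsubmx X 0 0)%:M.
Proof.
rewrite /to_mx /of_mx /= -[X in RHS]submxK (scalar_mx_block q 1) opp_block_mx add_block_mx !oppr0 !addr0.
rewrite block_mxKdr; congr block_mx.
by apply/matrixP => i j; rewrite !ord1 !mxE eqxx mulr1n subrr.
Qed.

(** Scalars are central, so any representatives modulo [R Id] compute the bracket, and the
    calculations can be done with plain matrices. *)
Lemma sl_brk_of (X Y : 'M[R]_(q + 1)) : sl_brk (of_mx X) (of_mx Y) = of_mx (X *m Y - Y *m X).
Proof.
rewrite /sl_brk !to_mxK; congr of_mx.
move: (drsubmx X 0 0) (drsubmx Y 0 0) => x y.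
rewrite !mulmxBl !mulmxBr !mul_scalar_mx !mul_mx_scalar; move: (_ *m _) (_ *m _) => a b.
by apply/matrixP => i j; rewrite !mxE; case: (i == j); rewrite ?mulr1n ?mulr0n; ring.
Qed.

Section Forms.
Variable P : cV -> cV -> rV.

(* [cA] is the connection along the section [A = 1, alpha = 0], and [Om] its gauge
   transform by [hm = (A, 0; alpha, 1)], with inverse [hi]. *)
Definition hm (u : slq) : 'M[R]_(q + 1) := block_mx u.1.2 0 u.2 1%:M.
Definition dh (X : slq) : 'M[R]_(q + 1) := block_mx X.1.2 0 X.2 0.
Definition hi (u : slq) : 'M[R]_(q + 1) :=
  block_mx (invmx u.1.2) 0 (- (u.2 *m invmx u.1.2)) 1%:M.
Definition cA (y v : cV) : 'M[R]_(q + 1) := block_mx (chrmx G y v) v (P y v) 0.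
Definition Om (u X : slq) := hi u *m (cA u.1.1 X.1.1 *m hm u + dh X).
Definition omP : form1 := fun u X => of_mx (Om u X).

(* the field on which [omP] takes the value [(v, 0, 0)] *)
Definition hfield (v : cV) (u : slq) : slq :=
  let A := u.1.2 in let al := u.2 in let av := (al *m v) 0 0 in
  (A *m v, - (A *m v *m al) - av *: A - chrmx G u.1.1 (A *m v) *m A,
   - (av *: al) - P u.1.1 (A *m v) *m A).

Lemma hiK u : u.1.2 \in unitmx -> hi u *m hm u = 1%:M.
Proof.
move=> uA; rewrite /hi /hm mulmx_block !mulmx0 !mul0mx !addr0 !add0r mulVmx // mulNmx -mulmxA mulVmx //.
by rewrite !mulmx1 !mul1mx addNr -scalar_mx_block.
Qed.

Lemma hmK u : u.1.2 \in unitmx -> hm u *m hi u = 1%:M.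
Proof. by move=> uA; apply: mulmx1C; exact: hiK. Qed.

Lemma OmE u X : u.1.2 \in unitmx ->
  let B := invmx u.1.2 in
  let C := chrmx G u.1.1 X.1.1 *m u.1.2 + X.1.1 *m u.2 + X.1.2 in
  Om u X = block_mx (B *m C) (B *m X.1.1)
    (P u.1.1 X.1.1 *m u.1.2 + X.2 - u.2 *m (B *m C)) (- (u.2 *m (B *m X.1.1))).
Proof.
move=> uA B C; rewrite /Om /hi /cA /hm /dh !mulmx_block add_block_mx mulmx_block.
rewrite !mulmx0 !mulmx1 !mul0mx !addr0 !add0r mul1mx mulNmx -!mulmxA -/B -/C.
by congr block_mx; [rewrite addrC|rewrite mulmx0 addr0 mulNmx mulmxA].
Qed.

Lemma omPE u X : u.1.2 \in unitmx ->
  let B := invmx u.1.2 in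
  let v := B *m X.1.1 in
  let C := B *m (chrmx G u.1.1 X.1.1 *m u.1.2 + X.1.1 *m u.2 + X.1.2) in
  omP u X = (v, C + ((u.2 *m v) 0 0)%:M, P u.1.1 X.1.1 *m u.1.2 + X.2 - u.2 *m C).
Proof.
move=> uA B v C; rewrite /omP OmE // /of_mx block_mxKur block_mxKul block_mxKdr block_mxKdl.
congr (_, _, _); rewrite -/B -/v -/C; congr (_ + _).
by apply/matrixP => i j; rewrite !mxE -mulNrn opprK.
Qed.

Lemma omP_hfield v u : u.1.2 \in unitmx -> omP u (hfield v u) = ((v, 0), 0).
Proof.
move=> uA; rewrite omPE // /hfield /= (mulmxA _ u.1.2 v) mulVmx // mul1mx.
have -> : chrmx G u.1.1 (u.1.2 *m v) *m u.1.2 + u.1.2 *m v *m u.2 + (- (u.1.2 *m v *m u.2) -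
    (u.2 *m v) 0 0 *: u.1.2 - chrmx G u.1.1 (u.1.2 *m v) *m u.1.2) = - ((u.2 *m v) 0 0 *: u.1.2).
  move: (_ *m _) (_ *m _) (_ *: _) => a b c; by apply/matrixP => i j; rewrite !mxE; ring.
rewrite mulmxN -scalemxAr mulVmx // scalemx1 addNr mulmxN mul_mx_scalar opprK; congr (_, _).
by move: (_ *m _) (_ *: _) => a b; apply/matrixP => i j; rewrite !mxE; ring.
Qed.

Hypothesis hP : forall y, V y -> linear (P y).

Lemma dh_lin : linear dh.
Proof.
move=> a X Y; rewrite /dh scale_block_mx add_block_mx !scaler0 !addr0 //.
Qed.

Lemma cA_lin y : V y -> linear (cA y).
Proof.
move=> Vy a X Y; rewrite /cA scale_block_mx add_block_mx !scaler0 !addr0.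
by rewrite (chrmx_lin hG Vy) (hP Vy).
Qed.

Lemma Om_lin u : V u.1.1 -> linear (Om u).
Proof.
move=> Vu a X Y; rewrite /Om (cA_lin Vu) dh_lin !mulmxDl !mulmxDr -!scalemxAl -!scalemxAr.
rewrite scalerDr; move: (_ *: _) (_ *: _) => A B; rewrite -!addrA; congr (_ + _).
by rewrite addrCA.
Qed.

Lemma omP_lin u : V u.1.1 -> linear (omP u).
Proof. by move=> Vu a X Y; rewrite /omP (Om_lin Vu) of_mx_lin. Qed.

Lemma omP_inj u X : u.1.2 \in unitmx -> V u.1.1 -> omP u X = 0 -> X = 0.
Proof.
move=> uA Vu; rewrite omPE //; case: X => [[y a] xi] /=.
move=> [e1 e2 e3].
have uy : y = 0 by rewrite -[y](mulKVmx uA) e1 mulmx0.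
move: e2 e3; rewrite uy; have [P0 _ _ _ _] := linP (hP Vu); have [G0 _ _ _ _] := linP (chrmx_lin hG Vu).
rewrite P0 G0 !mulmx0 !mul0mx !add0r mxE raddf0 addr0 => e2.
have -> : a = 0 by rewrite -[a](mulKVmx uA) e2 mulmx0.
by rewrite !mulmx0 subr0 => ->.
Qed.

Lemma omP_surj u : u.1.2 \in unitmx -> V u.1.1 -> forall t, exists X, omP u X = t.
Proof.
(* The second summand is the value at [u] of the fundamental field of [(a, xi)]. *)
move=> uA Vu [[v a] xi]; exists (hfield v u + ((0, u.1.2 *m a), xi + u.2 *m a)).
have [_ -> _ _ _] := linP (omP_lin Vu); rewrite omP_hfield // omPE //=.
have [P0 _ _ _ _] := linP (hP Vu); have [G0 _ _ _ _] := linP (chrmx_lin hG Vu).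
rewrite P0 G0 !mulmx0 !mul0mx !add0r mulKmx // mxE raddf0 addr0 addrK.
by rewrite -[LHS]/(v + 0, 0 + a, 0 + xi) addr0 !add0r.
Qed.

Lemma omP_bij u : u.1.2 \in unitmx -> V u.1.1 -> bijective (omP u).
Proof.
move=> uA Vu; have sj := omP_surj uA Vu.
have [g hg] := choice sj.
exists g; last exact: hg.
move=> X; apply/eqP; rewrite -subr_eq0; apply/eqP; apply: (omP_inj uA Vu).
have [_ D _ N _] := linP (omP_lin Vu).
by rewrite D N hg subrr.
Qed.

Lemma Rh_lin B beta (b : R) : exists L : slq -> slq, linear L /\
  (forall u, Rh B beta b u = L u + ((0, 0), b^-1 *: beta)) /\
  forall u, L u = ((u.1.1, b^-1 *: (u.1.2 *m B)), b^-1 *: (u.2 *m B)).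
Proof.
exists (fun u => ((u.1.1, b^-1 *: (u.1.2 *m B)), b^-1 *: (u.2 *m B))); split; last split=> //.
  move=> a u v /=; rewrite !mulmxDl -!scalemxAl !scalerDr !scalerA ![b^-1 * a]mulrC.
  by rewrite -!scalerA.
move=> u; rewrite /Rh.
rewrite -[RHS]/((u.1.1 + 0, b^-1 *: (u.1.2 *m B) + 0), b^-1 *: (u.2 *m B) + b^-1 *: beta).
by rewrite !addr0 scalerDr.
Qed.

Lemma dv_Rh B beta (b : R) (u X : slq) :
  dv X (Rh B beta b) u = ((X.1.1, b^-1 *: (X.1.2 *m B)), b^-1 *: (X.2 *m B)).
Proof.
have [L [lL [e1 e2]]] := Rh_lin B beta b.
have -> : Rh B beta b = fun u => L u + ((0, 0), b^-1 *: beta) by apply/funext.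
have [_ ->] := isd_add (isd_lin u _ lL) (isd_cst (((0, 0), b^-1 *: beta) : slq) u).
by rewrite addr0 e2.
Qed.

(** Right translation multiplies both [hm] and [dh] by [b^-1 H] on the right; the scalar factors
    cancel in [h^-1 theta h + h^-1 dh], which is thereby conjugated by [H]. *)
Lemma omP_equiv u X (B : 'M[R]_q) (beta : rV) (b : R) : u.1.2 \in unitmx ->
  V u.1.1 -> B \in unitmx -> b != 0 ->
  omP (Rh B beta b u) (dv X (Rh B beta b) u) =
  Ad (invmx (block_mx B 0 beta b%:M)) (omP u X).
Proof.
move=> uA Vu uB b0; rewrite dv_Rh /Ad {2}/omP to_mxK mulmxBr mulmxBl mul_mx_scalar.
set H : 'M[R]_(q + 1) := block_mx B 0 beta b%:M.
have uH : H \in unitmx.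
  by rewrite unitmxE det_lblock det_scalar1 unitrM -unitmxE uB unitfE.
rewrite -scalemxAl mulmxV ?unitmx_inv // scalemx1 -raddfN /= of_mx_scalar invmxK.
set u' := Rh B beta b u.
have e1 : hm u' = b^-1 *: (hm u *m H).
  rewrite /hm /H /u' /Rh /= mulmx_block scale_block_mx !mulmx0 !mul0mx !addr0 !add0r !mul1mx scaler0.
  by congr block_mx; apply/matrixP => i j; rewrite !mxE mulrnAr mulVf.
set Y : slq := (X.1.1, _, _).
have e2 : dh Y = b^-1 *: (dh X *m H).
  by rewrite /dh /H mulmx_block scale_block_mx !mulmx0 !mul0mx !addr0 !scaler0.
have u'A : u'.1.2 \in unitmx.
  by rewrite /u' /Rh /= unitmxZ ?unitmx_mul ?uA // unitfE invr_neq0.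
have e3 : hi u' = b *: (invmx H *m hi u).
  have h1 : hm u' *m (b *: (invmx H *m hi u)) = 1%:M.
    by rewrite e1 -scalemxAl -scalemxAr scalerA mulVf // scale1r mulmxA mulmxK // hmK.
  by rewrite -[LHS]mulmx1 -h1 mulmxA hiK // mul1mx.
rewrite /omP /Om e1 e2 e3 -scalemxAr -scalerDr mulmxA -mulmxDl -scalemxAl -scalemxAr scalerA.
by rewrite mulfV // scale1r !mulmxA.
Qed.

Lemma dv_fund (u : slq) (a : 'M[R]_q) (xi : rV) :
  dv (1 : R) (fun t : R => Rh (1%:M + t *: a) (t *: xi) 1 u) 0 = (0, u.1.2 *m a, u.2 *m a + xi).
Proof.
have e : (fun t : R => Rh (1%:M + t *: a) (t *: xi) 1 u) =
   (fun t : R => u + t *: (((0, u.1.2 *m a), u.2 *m a + xi) : slq)).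
  apply/funext => t; rewrite /Rh invr1 !scale1r !mulmxDr !mulmx1 -!scalemxAr.
  case: (u) => [[y A] al] /=.
  rewrite -[RHS]/((y + t *: 0, A + t *: (A *m a)), al + t *: (al *m a + xi)).
  by rewrite scaler0 addr0 scalerDr addrA.
rewrite e; set w : slq := (_, _, _).
have [_ ->] := isd_add (isd_cst u (0 : R)) (isd_scale (isd_id (0 : R)) (isd_cst w (0 : R))).
by rewrite scaler0 addr0 add0r scale1r.
Qed.

Lemma omP_fund u (a : 'M[R]_q) (xi : rV) : u.1.2 \in unitmx -> V u.1.1 ->
  omP u (dv (1 : R) (fun t : R => Rh (1%:M + t *: a) (t *: xi) 1 u) 0) = ((0, a), xi).
Proof.
move=> uA Vu; rewrite dv_fund omPE //=.
have [P0 _ _ _ _] := linP (hP Vu); have [G0 _ _ _ _] := linP (chrmx_lin hG Vu).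
rewrite P0 G0 !mulmx0 !mul0mx !add0r mulKmx // mxE raddf0 addr0.
by congr (_, _); rewrite [_ + xi]addrC addrK.
Qed.

Hypothesis smP : forall v, sm V (fun y => P y v).

Lemma hm_isd u : isd hm u dh.
Proof.
have e : hm = fun u => dh u + block_mx 0 0 0 1%:M.
  by apply/funext => x; rewrite /dh add_block_mx !addr0 add0r.
by rewrite e; apply: isd_eq (isd_add (isd_lin u _ dh_lin) (isd_cst _ u)) _ => v; rewrite addr0.
Qed.

Lemma sm_block (W : normedModType R) (U : set W) (a : W -> 'M[R]_q) (b : W -> cV) (c : W -> rV) (d : W -> 'M[R]_1) :
  sm U a -> sm U b -> sm U c -> sm U d -> sm U (fun z => block_mx (a z) (b z) (c z) (d z) : 'M[R]_(q + 1)).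
Proof.
move=> ha hb hc hd; apply: sm_mx => [|i j]; first exact: sm_open ha.
have [oi|oi] := boolP (i < q)%N.
  have [oj|oj] := boolP (j < q)%N.
    have ei : i = lshift 1 (Ordinal oi) by apply/val_inj.
    have ej : j = lshift 1 (Ordinal oj) by apply/val_inj.
    rewrite ei ej; apply: sm_eq (sm_coord (Ordinal oi) (Ordinal oj) ha) => x _; by rewrite block_mxEul.
  have ei : i = lshift 1 (Ordinal oi) by apply/val_inj.
  have ej : j = rshift q 0 by apply/val_inj => /=; have := ltn_ord j; lia.
  rewrite ei ej; apply: sm_eq (sm_coord (Ordinal oi) 0 hb) => x _; by rewrite block_mxEur.
have ei : i = rshift q 0 by apply/val_inj => /=; have := ltn_ord i; lia.
have [oj|oj] := boolP (j < q)%N.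
  have ej : j = lshift 1 (Ordinal oj) by apply/val_inj.
  rewrite ei ej; apply: sm_eq (sm_coord 0 (Ordinal oj) hc) => x _; by rewrite block_mxEdl.
have ej : j = rshift q 0 by apply/val_inj => /=; have := ltn_ord j; lia.
rewrite ei ej; apply: sm_eq (sm_coord 0 0 hd) => x _; by rewrite block_mxEdr.
Qed.

Lemma cA_sm v : sm V (cA ^~ v).
Proof.
have oV := chrsym_open hG.
apply: sm_block; [exact: chrmx_sm|exact: sm_cst|exact: smP|exact: sm_cst].
Qed.

Lemma sm_uy : sm Dn (fun u : slq => u.1.1).
Proof. by apply: sm_fst; apply: sm_fst; apply: sm_id; exact: Dn_open. Qed.

Lemma sm_uA : sm Dn (fun u : slq => u.1.2).
Proof. by apply: sm_snd; apply: sm_fst; apply: sm_id; exact: Dn_open. Qed.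

Lemma sm_ual : sm Dn (fun u : slq => u.2).
Proof. by apply: sm_snd; apply: sm_id; exact: Dn_open. Qed.

Lemma hm_unit u : Dn u -> hm u \in unitmx.
Proof. by move=> [_ uA]; have [] := mulmx1_unit (hmK uA). Qed.

Lemma hm_sm : sm Dn hm.
Proof.
apply: sm_block; [exact: sm_uA|apply: sm_cst; exact: Dn_open|exact: sm_ual|].
apply: sm_cst; exact: Dn_open.
Qed.

Lemma hiE u : Dn u -> hi u = invmx (hm u).
Proof. by move=> Du; rewrite -[RHS]mulmx1 -(hmK Du.2) mulmxA mulVmx ?hm_unit // mul1mx. Qed.

Lemma hi_sm : sm Dn hi.
Proof.
apply: (@sm_eq _ _ _ _ (fun u => invmx (hm u))); first by move=> u /hiE.
apply: sm_invmx hm_sm _; exact: hm_unit.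
Qed.

Lemma hi_isd u : Dn u -> isd hi u (fun v => - (hi u *m dh v *m hi u)).
Proof.
move=> Du; rewrite hiE //; apply: (isd_eqf Dn_open Du) (isd_inv hm_sm hm_unit Du (hm_isd u)).
by move=> x Dx; rewrite hiE.
Qed.

Lemma Om_sm X : sm Dn (fun u => Om u X).
Proof.
apply: sm_mulmx; first exact: hi_sm.
apply: sm_add; last by apply: sm_cst; exact: Dn_open.
apply: sm_mulmx; last exact: hm_sm.
by apply: (@sm_comp _ _ _ _ _ V (fun u : slq => u.1.1) (cA ^~ X.1.1)) sm_uy (cA_sm _) => u [].
Qed.

Lemma omP_sm X : sm Dn (fun u => omP u X).
Proof. apply: sm_lincomp (Om_sm X); exact: of_mx_lin. Qed.

(** Curvature, on constant fields, of the connection along the section. *)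
Definition F2 (y X Y : cV) : 'M[R]_(q + 1) :=
  dv X (cA ^~ Y) y - dv Y (cA ^~ X) y + (cA y X *m cA y Y - cA y Y *m cA y X).

(** A gauge transform conjugates the curvature: the terms containing [dh] are symmetric in the two
    fields and disappear on antisymmetrization. *)
Lemma curv_omP u X Y : Dn u -> curv omP u X Y = of_mx (hi u *m F2 u.1.1 X.1.1 Y.1.1 *m hm u).
Proof.
move=> Du.
have dOm Z W : dv Z (fun w => Om w W) u =
    - (hi u *m dh Z *m Om u W) + hi u *m (dv Z.1.1 (cA ^~ W.1.1) u.1.1 *m hm u + cA u.1.1 W.1.1 *m dh Z).
  have dc : isd (fun w : slq => cA w.1.1 W.1.1) u (fun Z => dv Z.1.1 (cA ^~ W.1.1) u.1.1).
    have h1 : isd (fun u : slq => u.1.1) u (fun Z => Z.1.1).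
      by apply: isd_fst; apply: isd_fst; exact: isd_id.
    exact: (isd_comp h1 (isd_sm (cA_sm W.1.1) Du.1)).
  have [_ ->] := isd_mulmx (hi_isd Du) (isd_add (isd_mulmx dc (hm_isd u)) (isd_cst (dh W) u)).
  by rewrite addr0 mulNmx !mulmxA.
have dom Z W : dv Z (fun w => omP w W) u = of_mx (dv Z (fun w => Om w W) u).
  by have [_ ->] := isd_lincomp _ of_mx_lin (isd_sm (Om_sm W) Du).
have H Z W : dv Z (fun w => Om w W) u + Om u Z *m Om u W =
    hi u *m (dv Z.1.1 (cA ^~ W.1.1) u.1.1 + cA u.1.1 Z.1.1 *m cA u.1.1 W.1.1) *m hm u
    + hi u *m (cA u.1.1 W.1.1 *m dh Z + cA u.1.1 Z.1.1 *m dh W).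
  rewrite dOm {2}/Om mulmxDr mulmxDl.
  have -> : hi u *m (cA u.1.1 Z.1.1 *m hm u) *m Om u W =
      hi u *m (cA u.1.1 Z.1.1 *m (cA u.1.1 W.1.1 *m hm u + dh W)).
    by rewrite {1}/Om -!mulmxA (mulmxA (hm u)) hmK ?mul1mx //; exact: Du.2.
  rewrite !mulmxDr !mulmxDl !mulmxA; move: (_ *m _) (_ *m _) (_ *m _) (_ *m _) => a b c d.
  by move: (_ *m _) => e; apply/matrixP => i j; rewrite !mxE; ring.
rewrite /curv -!dvE !dom sl_brk_of; have [_ D _ N _] := linP of_mx_lin.
rewrite -N -!D; congr of_mx; rewrite addrACA -opprD.
rewrite [X in _ - X]H H [X in _ - (_ + _ *m X)]addrC opprD addrACA subrr addr0.
rewrite -mulmxBl -mulmxBr /F2; congr (_ *m _ *m _); by rewrite opprD addrACA.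
Qed.

(** The upper right block is the torsion, zero by the symmetry of [G]. The lower left block, a
    derivative of [P], is left unevaluated since it does not enter the [gl(q)] part. *)
Lemma F2E y X Y : V y -> F2 y X Y = block_mx (curvmx G y X Y + X *m P y Y - Y *m P y X) 0
  (dlsubmx (F2 y X Y)) (P y X *m Y - P y Y *m X).
Proof.
move=> Vy.
have dcA W : isd (cA ^~ W) y (fun Z => block_mx (dv Z (chrmx G ^~ W) y) 0 (dv Z (fun y => P y W) y) 0).
  have e : cA ^~ W = fun y => block_mx (chrmx G y W) 0 0 0 + block_mx 0 0 (P y W) 0 + block_mx 0 W 0 0.
    by apply/funext => x; rewrite !add_block_mx !addr0 !add0r.
  have l1 : linear (fun A : 'M[R]_q => block_mx A 0 0 0 : 'M[R]_(q + 1)).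
    by move=> a A B; rewrite scale_block_mx add_block_mx !scaler0 !addr0.
  have l2 : linear (fun A : rV => block_mx 0 0 A 0 : 'M[R]_(q + 1)).
    by move=> a A B; rewrite scale_block_mx add_block_mx !scaler0 !addr0.
  rewrite e; apply: isd_eq (isd_add (isd_add (isd_lincomp _ l1 (isd_sm (chrmx_sm hG W) Vy))
    (isd_lincomp _ l2 (isd_sm (smP W) Vy))) (isd_cst _ y)) _ => v.
  by rewrite /= addr0 add_block_mx !addr0 !add0r.
have E : F2 y X Y = block_mx (curvmx G y X Y + X *m P y Y - Y *m P y X) 0
    (dv X (fun y => P y Y) y - dv Y (fun y => P y X) y + (P y X *m chrmx G y Y - P y Y *m chrmx G y X)) (P y X *m Y - P y Y *m X).
  rewrite /F2 (dcA Y).2 (dcA X).2 /cA !mulmx_block !opp_block_mx !add_block_mx.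
  rewrite !mulmx0 !addr0 (chrmx_sym hG X Y Vy) !subrr addr0 add0r; congr block_mx.
  - rewrite /curvmx; move: (_ *m _) (_ *m _) (_ *m _) (_ *m _) => a b c d.
    by apply/matrixP => i j; rewrite !mxE; ring.
  - by rewrite !mul0mx !addr0.
by rewrite {1}E E block_mxKdl.
Qed.

(** The [gl(q)] part of the curvature along the section; the scalar subtracted is the lower right
    entry, by the normalization modulo [R Id]. For [P] the Schouten tensor it is the projective Weyl
    tensor. *)
Definition Mt y X Y : 'M[R]_q := curvmx G y X Y + X *m P y Y - Y *m P y X
   - ((P y X *m Y) 0 0 - (P y Y *m X) 0 0)%:M.

Lemma curv_gl u X Y : Dn u -> (curv omP u X Y).1.2 = invmx u.1.2 *m
  Mt u.1.1 X.1.1 Y.1.1 *m u.1.2.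
Proof.
move=> Du; rewrite /Mt curv_omP // F2E; last exact: Du.1.
set a := _ + _ - _; set c := dlsubmx _; set d := P _ _ *m _ - _.
rewrite /hi /hm !mulmx_block !(mulmx0, mul0mx, addr0, add0r, mulmx1, mul1mx) /of_mx /=.
rewrite block_mxKul block_mxKdr.
have -> : (P u.1.1 X.1.1 *m Y.1.1) 0 0 - (P u.1.1 Y.1.1 *m X.1.1) 0 0 = d 0 0.
  by rewrite /d; move: (_ *m _) (_ *m _) => m1 m2; rewrite !mxE.
move: a d => a d; rewrite mulmxBr mulmxBl mul_mx_scalar -scalemxAl mulVmx; last exact: Du.2.
by rewrite scalemx1.
Qed.

Lemma Mt_anti y X Y : Mt y X Y = - Mt y Y X.
Proof.
rewrite /Mt (curvmx_anti G y X); move: (curvmx _ _ _ _) (X *m _) (Y *m _) ((_ *m _) 0 0) ((_ *m _) 0 0) => a b c d e.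
by apply/matrixP => i j; rewrite !mxE; case: (i == j); rewrite ?mulr1n ?mulr0n; ring.
Qed.

Lemma Mt_lin1 y Y : V y -> linear (Mt y ^~ Y).
Proof.
move=> Vy a x x'; rewrite /Mt (curvmx_lin1 hG Y Vy) (hP Vy) !mulmxDl !mulmxDr -!scalemxAl -!scalemxAr.
move: (curvmx G y x Y) (curvmx G y x' Y) (x *m P y Y) (x' *m P y Y) (Y *m P y x) (Y *m P y x').
move: (P y x *m Y) (P y x' *m Y) (P y Y *m x) (P y Y *m x') => m1 m2 m3 m4 m5 m6 m7 m8 m9 m10.
by apply/matrixP => i j; rewrite !mxE; case: (i == j); rewrite ?mulr1n ?mulr0n; ring.
Qed.

Lemma Mt_lin2 y X : V y -> linear (Mt y X).
Proof.
by move=> Vy a Y Y'; rewrite !(Mt_anti y X) (Mt_lin1 _ Vy) opprD scalerN.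
Qed.

Lemma rV_sum (r : rV) (v : cV) : (r *m v) 0 0 = \sum_i v i 0 * r 0 i.
Proof. by rewrite mxE; apply: eq_bigr => i _; rewrite mulrC. Qed.

Lemma rV_evec (r : rV) j : (r *m evec j) 0 0 = r 0 j.
Proof. by rewrite /evec -colE mxE. Qed.

Lemma lin_cV_sum (L : cV -> R) (v : cV) : linear (L : cV -> R^o) ->
  L v = \sum_k v k 0 * L (evec k).
Proof.
move=> l; rewrite [in LHS](cV_delta v); have [_ _ Z _ ->] := linP l.
by apply: eq_bigr => k _; rewrite Z.
Qed.

(** Besides the [q]-fold term, [P(Y) Z] occurs twice with opposite signs, once from the curvature
    block and once from the scalar part. What remains is the left-hand side of the system solved by
    [schouten]. *)
Lemma Mt_trace y Z Y : V y -> \sum_i (Mt y (evec i) Y *m Z) i 0 =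
  ric G y Z Y + q%:R * (P y Y *m Z) 0 0 - (P y Z *m Y) 0 0.
Proof.
move=> Vy; have PZ (W W' : cV) : \sum_i W i 0 * (P y (evec i) *m W') 0 0 = (P y W *m W') 0 0.
  have l : linear ((fun W => (P y W *m W') 0 0) : cV -> R^o).
    by move=> a x x'; rewrite (hP Vy) mulmxDl -scalemxAl !mxE.
  exact: (esym (lin_cV_sum W l)).
have E i : (Mt y (evec i) Y *m Z) i 0 = (curvmx G y (evec i) Y *m Z) i 0 + (P y Y *m Z) 0 0
   - Y i 0 * (P y (evec i) *m Z) 0 0 - (Z i 0 * (P y (evec i) *m Y) 0 0 - Z i 0 * P y Y 0 i).
  have e (v : cV) (r : rV) : (v *m r *m Z) i 0 = v i 0 * (r *m Z) 0 0.
    by rewrite -mulmxA mxE big_ord1.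
  rewrite /Mt !mulmxBl mulmxDl mul_scalar_mx rV_evec.
  have e3 (m1 m2 m3 m4 : cV) : (m1 + m2 - m3 - m4) i 0 = m1 i 0 + m2 i 0 - m3 i 0 - m4 i 0 by rewrite !mxE.
  have e4 (c : R) (m : cV) : (c *: m) i 0 = c * m i 0 by rewrite mxE.
  have e5 : evec i i 0 = 1 :> R by rewrite mxE !eqxx.
  by rewrite e3 !e e4 e5; ring.
under eq_bigr do rewrite E.
rewrite !sumrB big_split /= !PZ -rV_sum sumr_const card_ord.
by rewrite /ric -[_ *+ q]mulr_natl; ring.
Qed.

End Forms.

(** Invariance of the trace under a change of frame, phrased on vectors so as to apply to
    contractions such as [ric]. *)
Lemma trace_conj (L : cV -> cV) (A : 'M[R]_q) : linear L -> A \in unitmx ->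
  \sum_i (invmx A *m L (A *m evec i)) i 0 = \sum_i L (evec i) i 0.
Proof.
move=> lL uA; pose M := \matrix_(i, j) L (evec j) i 0.
have -> : \sum_i L (evec i) i 0 = \tr M by apply: eq_bigr => i _; rewrite mxE.
have -> : \tr M = \tr (invmx A *m (M *m A)).
  by rewrite mxtrace_mulC -mulmxA mulmxV // mulmx1.
apply: eq_bigr => i _; rewrite -[X in invmx A *m X](lin_mxE _ lL) -/M !mulmxA.
by rewrite /evec -colE mxE.
Qed.

(** * Two-jets of projective frames *)

Definition Hdom (al : rV) (a : R) : set cV := [set z | (al *m z) 0 0 + a != 0].

Lemma sm_rv (al : rV) (a : R) U : open U -> sm U (fun z : cV => (al *m z) 0 0 + a).
Proof.
move=> oU; apply: sm_add; last exact: sm_cst.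
apply: sm_coord; apply: sm_mulmx; [exact: sm_cst|exact: sm_id].
Qed.

Lemma Hdom_open al a : open (Hdom al a).
Proof.
have -> : Hdom al a = (fun z : cV => (al *m z) 0 0 + a) @^-1` [set x : R | x != 0] by [].
apply: open_comp; last exact: open_neq.
by move=> z _; apply: sm_cont (sm_rv al a openT) I.
Qed.

Lemma hmap_sm A al a : sm (Hdom al a) (hmap A al a).
Proof.
have oU := @Hdom_open al a; apply: sm_scale; first by apply: (sm_inv _ (sm_rv al a oU)).
by apply: sm_mulmx; [exact: sm_cst|exact: sm_id].
Qed.

Lemma hmap0 A al a : hmap A al a 0 = 0 :> cV.
Proof. by rewrite /hmap !mulmx0 scaler0. Qed.

Lemma Hdom0 al a : a != 0 -> Hdom al a 0.
Proof. by rewrite /Hdom /= mulmx0 mxE add0r. Qed.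

Lemma hmap_jet A al v w : dv v (hmap A al 1) 0 = A *m v /\
  dv v (dv w (hmap A al 1)) 0 = - ((al *m v) 0 0 *: (A *m w) + (al *m w) 0 0 *: (A *m v)) :> cV.
Proof.
set h := hmap A al 1; pose s (z : cV) := (al *m z) 0 0 + 1.
have oU := @Hdom_open al 1; have U0 := @Hdom0 al 1 (oner_neq0 _).
have hs := hmap_sm A al 1.
have ds z : isd s z (fun v => (al *m v) 0 0).
  have [d e] := isd_add (isd_coord 0 0 (isd_lin z _ (@mulmx_lin1 R _ _ 1 al))) (isd_cst (1 : R) z).
  by split=> // x; rewrite e addr0.
have dA z : isd (fun z : cV => A *m z) z (fun v => A *m v).
  by apply: isd_lin; exact: mulmx_lin1.
have E z : Hdom al 1 z -> s z *: h z = A *m z.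
  by move=> Uz; rewrite /h /hmap scalerA mulfV // scale1r.
have E1 z v' : Hdom al 1 z -> (al *m v') 0 0 *: h z + s z *: dv v' h z = A *m v'.
  move=> Uz; transitivity (dv v' (fun z => s z *: h z) z).
    by have [_ ->] := isd_scale (ds z) (isd_sm hs Uz).
  by rewrite -(dA z).2; apply: (derive_eq_on v' oU Uz) => x Ux; rewrite E.
have s0 : s 0 = 1 by rewrite /s mulmx0 mxE add0r.
have D1 v' : dv v' h 0 = A *m v'.
  by have := E1 0 v' U0; rewrite s0 scale1r /h hmap0 scaler0 add0r.
split=> //.
have [_ e2] := isd_add (isd_scalec ((al *m w) 0 0) (isd_sm hs U0)) (isd_scale (ds 0) (isd_sm (sm_derive w hs) U0)).
have := e2 v; rewrite (derive_eq_on (g := fun=> A *m w) v oU U0); last by move=> x /E1.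
rewrite dv_cst s0 scale1r -/h !D1 => /esym/eqP; rewrite addrA addr_eq0 => /eqP.
by rewrite [X in X = _ -> _]addrC => ->; rewrite opprK.
Qed.

Lemma frame2_sm u : V u.1.1 -> sm (Hdom u.2 1) (frame2 G u).
Proof.
move=> Vu; have oU := @Hdom_open u.2 1; have hs := hmap_sm u.1.2 u.2 1.
apply: sm_sub'; first by apply: sm_add => //; exact: sm_cst.
apply: sm_scalec.
apply: (@sm_bilin _ _ _ _ _ _ (G u.1.1) (hmap u.1.2 u.2 1) (hmap u.1.2 u.2 1)) => //.
  by move=> x; exact: chrsym_lin hG _ _.
move=> x a v w; rewrite !(chrsym_sym hG _ x) //; exact: chrsym_lin hG _ _ _ _ _.
Qed.

Lemma frame2_0 u : frame2 G u 0 = u.1.1.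
Proof.
rewrite /frame2 hmap0 addr0; have [-> _ _ _ _] := linP (chrsym_lin hG u.1.1 0).
by rewrite scaler0 subr0.
Qed.

Lemma half (x : cV) : 2^-1 *: (x + x) = x.
Proof. by apply/matrixP => i j; rewrite !mxE; field. Qed.

(** With the value at 0 these derivatives determine the 2-jet; every later comparison of second
    order frames is a comparison of these two expressions. *)
Lemma frame2_jet u v w : V u.1.1 -> dv v (frame2 G u) 0 = u.1.2 *m v /\
  dv v (dv w (frame2 G u)) 0 = - ((u.2 *m v) 0 0 *: (u.1.2 *m w) + (u.2 *m w) 0 0 *: (u.1.2 *m v))
    - G u.1.1 (u.1.2 *m v) (u.1.2 *m w).
Proof.
move=> Vu; have oU := @Hdom_open u.2 1; have U0 := @Hdom0 u.2 1 (oner_neq0 _).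
set h := hmap u.1.2 u.2 1; have hs : sm (Hdom u.2 1) h := hmap_sm u.1.2 u.2 1.
have l1 x : linear (G u.1.1 x) := chrsym_lin hG u.1.1 x.
have l2 x : linear ((G u.1.1) ^~ x).
  by move=> a v' w'; rewrite !(chrsym_sym hG _ x) //; exact: l1.
have D z w' : Hdom u.2 1 z -> dv w' (frame2 G u) z = dv w' h z - G u.1.1 (h z) (dv w' h z).
  move=> Uz; have hz := isd_sm hs Uz.
  have [_ ->] := isd_sub (isd_add (isd_cst u.1.1 z) hz) (isd_scalec 2^-1 (isd_bil _ _ l1 l2 hz hz)).
  by rewrite add0r (chrsym_sym hG (dv w' h z)) // half.
have hz0 : h 0 = 0 by exact: hmap0.
have [h1 h2] := hmap_jet u.1.2 u.2 v w; have [h1w _] := hmap_jet u.1.2 u.2 w w.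
split; first by rewrite D // hz0; have [-> _ _ _ _] := linP (l2 (dv v h 0)); rewrite subr0.
rewrite (derive_eq_on v oU U0 (fun x => D x w)).
have h0 := isd_sm hs U0; have h0w := isd_sm (sm_derive w hs) U0.
have [_ ->] := isd_sub h0w (isd_bil _ _ l1 l2 h0 h0w).
rewrite hz0; have [-> _ _ _ _] := linP (l2 (dv v (dv w h) 0)).
by rewrite addr0 h1 h1w h2.
Qed.

(** * The normal Cartan connection *)

(** The condition on the canonical form is read on the 2-jet of [frame2], and normality is, by
    [Mt_trace] in the frame [A], the linear system satisfied by [schouten]. *)
Lemma omP_normal_cartan : normal_cartan Dn G (omP (schouten G)).
Proof.
have hP := schouten_lin hG; have smP := schouten_sm hG; split.
- by move=> X; apply/smooth_onP; exact: omP_sm.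
- by move=> u c X Y Du; rewrite (omP_lin hP Du.1).
- by move=> u [Vu uA]; exact: omP_bij.
- by move=> u a xi [Vu uA]; rewrite -dvE; exact: omP_fund.
- by move=> u X B beta b [Vu uA] uB b0; rewrite -dvE; exact: omP_equiv.
- move=> u X [Vu uA]; rewrite omPE //=; set v := invmx _ *m _; set C := invmx _ *m _.
  have Av : u.1.2 *m v = X.1.1 by rewrite mulmxA mulmxV // mul1mx.
  split=> [|w]; rewrite -?dvE -?dvF; first by rewrite (frame2_jet v v Vu).1 Av.
  rewrite (frame2_jet v w Vu).2 (frame2_jet _ w Vu).1 Av -(GmE hG).
  rewrite mulmxDl mulmxDr mul_scalar_mx -scalemxAr !mulmxA mulmxV // mul1mx !mulmxDl.
  have -> : X.1.1 *m u.2 *m w = (u.2 *m w) 0 0 *: X.1.1.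
    by rewrite -mulmxA {1}[u.2 *m w]mx11_scalar mul_mx_scalar.
  set a := (u.2 *m _ *m _) 0 0 *: _; set b := (u.2 *m w) 0 0 *: _; set c := chrmx _ _ _ *m _ *m w.
  set d := X.1.2 *m w; move: a b c d => a b c d.
  by apply/matrixP => i j; rewrite !mxE; ring.
- exists (fun u i j k l => (invmx u.1.2 *m Mt (schouten G) u.1.1 (u.1.2 *m evec k) (u.1.2 *m evec l) *m u.1.2) i j).
  move=> u [Vu uA]; pose W (i j : 'I_q) X Y := (invmx u.1.2 *m Mt (schouten G) u.1.1 (u.1.2 *m X) (u.1.2 *m Y) *m u.1.2) i j.
  have W1 i j Y : linear ((fun X => W i j X Y) : cV -> R^o).
    move=> a x x'; rewrite /W (mulmxDr u.1.2 (a *: x)) -(scalemxAr a u.1.2 x) (Mt_lin1 hP _ Vu).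
    move: (Mt _ _ _ _) => m1; move: (Mt _ _ _ _) => m2; rewrite mulmxDr -(scalemxAr a _ m1) mulmxDl -(scalemxAl a).
    by move: (_ *m _) (_ *m _) => m3 m4; rewrite !mxE.
  have W2 i j X : linear ((fun Y => W i j X Y) : cV -> R^o).
    move=> a x x'; rewrite /W (mulmxDr u.1.2 (a *: x)) -(scalemxAr a u.1.2 x) (Mt_lin2 hP _ Vu).
    move: (Mt _ _ _ _) => m1; move: (Mt _ _ _ _) => m2; rewrite mulmxDr -(scalemxAr a _ m1) mulmxDl -(scalemxAl a).
    by move: (_ *m _) (_ *m _) => m3 m4; rewrite !mxE.
  split.
  + by move=> i j k l; rewrite Mt_anti mulmxN mulNmx mxE.
  + move=> X Y i j; rewrite (curv_gl smP) // !omPE //=.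
    set x := invmx _ *m X.1.1; set y := invmx _ *m Y.1.1.
    have -> : X.1.1 = u.1.2 *m x by rewrite mulmxA mulmxV // mul1mx.
    have -> : Y.1.1 = u.1.2 *m y by rewrite mulmxA mulmxV // mul1mx.
    have E (x1 y1 : cV) : W i j x1 y1 = \sum_k \sum_l W i j (evec k) (evec l) * (x1 k 0 * y1 l 0).
      rewrite (lin_cV_sum x1 (W1 i j y1)); apply: eq_bigr => k _.
      rewrite (lin_cV_sum y1 (W2 i j (evec k))) mulr_sumr; apply: eq_bigr => l _; ring.
    have A (x1 y1 : cV) : W i j x1 y1 = - W i j y1 x1.
      by rewrite /W Mt_anti mulmxN mulNmx mxE.
    rewrite -/(W i j x y).
    (* Antisymmetry supplies the factor 1/2 of the definition, where each pair of indices is counted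
       in both orders. *)
    have -> : W i j x y = 2^-1 * (W i j x y - W i j y x) by rewrite (A y x) opprK; field.
    rewrite (E x y) (E y x); congr (_ * _); rewrite -sumrB; apply: eq_bigr => k _.
    by rewrite -sumrB; apply: eq_bigr => l _; rewrite mulrBr [y k 0 * _]mulrC [x l 0 * _]mulrC.
  + move=> j l.
    pose L x := Mt (schouten G) u.1.1 x (u.1.2 *m evec l) *m (u.1.2 *m evec j).
    have lL : linear L by move=> a x x'; rewrite /L (Mt_lin1 hP _ Vu) mulmxDl -scalemxAl.
    have e i : (invmx u.1.2 *m Mt (schouten G) u.1.1 (u.1.2 *m evec i) (u.1.2 *m evec l) *m u.1.2) i j =
      (invmx u.1.2 *m L (u.1.2 *m evec i)) i 0 by rewrite /L !mulmxA -[RHS]/((_ *m evec j) i 0) /evec -[in RHS]colE [RHS]mxE.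
    under eq_bigr do rewrite e.
    rewrite (trace_conj lL uA) (Mt_trace hP _ _ Vu).
    have := schouten_eq hG (u.1.2 *m evec j) (u.1.2 *m evec l) hq Vu; lra.
Qed.

Lemma curv_eq (om om' : form1) u X Y : Dn u -> 
  (forall u X, Dn u -> om u X = om' u X) -> curv om u X Y = curv om' u X Y.
Proof.
move=> Du e; rewrite /curv -!dvE !(derive_eq_on _ Dn_open Du (fun x Dx => e x _ Dx)).
by rewrite !e.
Qed.

(** On the section [A = 1, alpha = 0] the canonical form fixes all of [om] on [dy] except its [R^q*]
    part, called [P]. Equivariance and the values on fundamental fields extend the equality with
    [omP P] to the whole bundle, and normality then determines [P]. *)
Lemma normal_cartan_unique (om : form1) u X : normal_cartan Dn G om -> Dn u ->
  om u X = omP (schouten G) u X.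
Proof.
move=> [nsm nlin nbij nfund nequiv ncan nnorm].
pose u0 (y : cV) : slq := (y, 1%:M, 0).
have D0 y : V y -> Dn (u0 y) by move=> Vy; split=> //=; exact: unitmx1.
pose P y v : rV := (om (u0 y) (v, 0, 0)).2.
have lin u' : Dn u' -> linear (om u') by move=> Du' a x x'; exact: nlin.
have hP y : V y -> linear (P y).
  move=> Vy a x x'; rewrite /P -[RHS]/((a *: om (u0 y) (x, 0, 0) + om (u0 y) (x', 0, 0)).2).
  rewrite -(lin _ (D0 y Vy)); congr (om _ _).2.
  by rewrite -[RHS]/((a *: x + x', a *: 0 + 0), a *: 0 + 0) !scaler0 !addr0.
have smP v : sm V (fun y => P y v).
  have /smooth_onP h := nsm (v, 0, 0).
  apply: sm_snd; apply: (@sm_comp _ _ _ _ V Dn u0 (om ^~ (v, 0, 0))) h => //.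
  have oV := chrsym_open hG.
  by apply: sm_pair; [apply: sm_pair; [exact: sm_id|exact: sm_cst]|exact: sm_cst].
have base y v : V y -> om (u0 y) (v, 0, 0) = (v, chrmx G y v, P y v).
  move=> Vy; have [/= + h] := ncan _ (v, 0, 0) (D0 y Vy).
  rewrite /P; case: (om (u0 y) (v, 0, 0)) h => [[v' a] xi] /= h.
  rewrite -dvE (frame2_jet v' v' _).1 //= mul1mx => e; subst v'; congr (_, _, _).
  apply: lin_mulmx_ext => w; have := h w; rewrite -!dvE -dvF (frame2_jet v w _).2 //.
  rewrite (frame2_jet _ w _).1 //= !mul0mx !mxE !scale0r addr0 oppr0 sub0r !mul1mx (GmE hG) => /eqP.
  by rewrite eq_sym addrC subr_eq0 => /eqP.
have om_E u' X' : Dn u' -> om u' X' = omP P u' X'.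
  move=> Du'; have [Vu uA] := Du'; case: u' Du' Vu uA => [[y A] al] Du' Vu uA.
  have eu : (y, A, al) = Rh A al 1 (u0 y).
    by rewrite /Rh /= invr1 !scale1r mul1mx mul0mx add0r.
  have hor v : om (y, A, al) (v, 0, 0) = omP P (y, A, al) (v, 0, 0).
    have eX : (v, 0, 0) = dv (v, 0, 0) (Rh A al 1) (u0 y) by rewrite dv_Rh /= invr1 !scale1r !mul0mx.
    rewrite eu eX (omP_equiv P) ?unitmx1 ?oner_neq0 // {1}dvE nequiv ?oner_neq0 //; last exact: D0.
    congr (Ad _ _); rewrite base // omPE ?unitmx1 //= invmx1 !mul1mx mul0mx mulmx0 !mulmx1 !addr0 mul0mx mxE raddf0 subr0.
    by rewrite addr0.
  have ver (dA : 'M[R]_q) (da : rV) : om (y, A, al) (0, dA, da) = omP P (y, A, al) (0, dA, da).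
    pose a := invmx A *m dA; pose xi := da - al *m a.
    have e : (0, dA, da) = dv (1 : R) (fun t : R => Rh (1%:M + t *: a) (t *: xi) 1 (y, A, al)) 0.
      by rewrite dv_fund /= /a mulmxA mulmxV // mul1mx /xi addrC subrK.
    by rewrite e (omP_fund hP) // dvE nfund.
  have [_ D1 _ _ _] := linP (lin _ Du'); have [_ D2 _ _ _] := linP (omP_lin hP Vu).
  case: X' => [[dy dA] da].
  have -> : (dy, dA, da) = (dy, 0, 0) + (0, dA, da) :> slq.
    by rewrite -[RHS]/((dy + 0, 0 + dA), 0 + da) addr0 !add0r.
  by rewrite D1 D2 hor ver.
move=> Du; rewrite om_E //; have [Vu _] := Du.
suff E y v : V y -> P y v = schouten G y v.
  rewrite !omPE ?E //; exact: Du.2.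
move=> Vy; apply: (schouten_unique hG hq Vy (hP y Vy)) => j l.
have [K hK] := nnorm; have [K1 K2 K3] := hK _ (D0 y Vy).
(* On fields with [om]-values [e_k] and [e_l'] only two terms of the double sum survive; they are
   equal by antisymmetry of [K] and absorb the factor 1/2. *)
have MK i k l' j' : (Mt P y (evec k) (evec l')) i j' = K (u0 y) i j' k l'.
  have := K2 (hfield P (evec k) (u0 y)) (hfield P (evec l') (u0 y)) i j'.
  rewrite (curv_eq _ _ (D0 y Vy) om_E) (curv_gl smP); last exact: D0.
  rewrite !om_E ?(omP_hfield) ?unitmx1 //=; try exact: D0.
  rewrite invmx1 !mul1mx mulmx1 => ->.
  have -> : \sum_k0 \sum_l0 K (u0 y) i j' k0 l0 * (evec k k0 0 * evec l' l0 0 - evec l' k0 0 * evec k l0 0)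
     = K (u0 y) i j' k l' - K (u0 y) i j' l' k.
    have S a b : \sum_k0 \sum_l0 K (u0 y) i j' k0 l0 * (evec a k0 0 * evec b l0 0) = K (u0 y) i j' a b.
      rewrite (bigD1 a) //= (bigD1 b) //= !big1 ?addr0.
      - by rewrite !mxE !eqxx !mulr1.
      - by move=> k0 nk; apply: big1 => l0 _; rewrite !mxE (negbTE nk) mul0r mulr0.
      - by move=> l0 nl; rewrite !mxE (negbTE nl) !mulr0.
    rewrite -!S -sumrB; apply: eq_bigr => k0 _; rewrite -sumrB; apply: eq_bigr => l0 _; ring.
  by rewrite (K1 i j' l' k) opprK; field.
have := Mt_trace hP (evec j) (evec l) Vy.
have -> : \sum_i (Mt P y (evec i) (evec l) *m evec j) i 0 = \sum_i K (u0 y) i j i l.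
  by apply: eq_bigr => i _; rewrite -MK /evec -colE [LHS]mxE.
by rewrite K3; lra.
Qed.

End Cartan.

(** * Naturality of the horizontal fields *)

(** Smoothness of [G] in [y] is given for fixed arguments only, so the moving vector [w] is expanded
    in the canonical basis. *)
Lemma isd_chrmx (W : normedModType R) (U : set W) V G (f w : W -> cV) z df dw : chrsym V G ->
  open U -> U z -> (forall x, U x -> V (f x)) ->
  isd f z df -> isd w z dw ->
  isd (fun x => chrmx G (f x) (w x)) z
    (fun v => dv (df v) (chrmx G ^~ (w z)) (f z) + chrmx G (f z) (dw v)).
Proof.
move=> hG oU Uz fV hf hw; have Vf := fV z Uz.
have h1 : isd (fun x => \sum_k w x k 0 *: chrmx G (f x) (evec k)) z
    (fun v => \sum_k (dw v k 0 *: chrmx G (f z) (evec k) + w z k 0 *: dv (df v) (chrmx G ^~ (evec k)) (f z))).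
  apply: isd_sum => k; apply: isd_scale; first exact: isd_coord.
  exact: (isd_comp hf (isd_sm (chrmx_sm hG (evec k)) Vf)).
have E y v : V y -> chrmx G y v = \sum_k v k 0 *: chrmx G y (evec k).
  move=> Vy; rewrite [in LHS](cV_delta v); have [_ _ Z _ ->] := linP (chrmx_lin hG Vy).
  by apply: eq_bigr => k _; rewrite Z.
apply: (isd_eqf oU Uz _ (isd_eq h1 _)) => [x Ux|v]; first by rewrite E //; exact: fV.
rewrite big_split /= addrC -E //; congr (_ + _).
rewrite [in RHS](cV_delta (w z)); have [_ _ Z _ ->] := linP (chrmx_dlinr hG (df v) Vf).
by apply: eq_bigr => k _; rewrite Z.
Qed.

Section Pull.
Hypothesis hq : (2 <= q)%N.
Variables (V0 V : set cV) (G0 G : cV -> cV -> cV -> cV) (th : cV -> cV).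
Hypotheses (hG0 : chrsym V0 G0) (hG : chrsym V G) (hth : sm V0 th).
Hypothesis thV : forall y, V0 y -> V (th y).

Definition Jac (f : cV -> cV) (y : cV) : 'M[R]_q := \matrix_(i, j) dv (evec j) f y i 0.

Lemma JacE y v : V0 y -> Jac th y *m v = dv v th y.
Proof. by move=> Vy; exact: (lin_mxE v (derive_dir (sm_diff hth Vy))). Qed.

Lemma Jac_sm : sm V0 (Jac th).
Proof.
apply: sm_mx => [|i j]; first exact: chrsym_open hG0.
apply: (@sm_eq _ _ _ _ (fun y => dv (evec j) th y i 0)); first by move=> x _; rewrite mxE.
by apply: sm_coord; exact: sm_derive.
Qed.

Lemma dJacE y v w : V0 y -> dv v (Jac th) y *m w = dv v (dv w th) y.
Proof.
move=> Vy; have [_ e] := isd_mulmx (isd_sm Jac_sm Vy) (isd_cst w y).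
have := e v; rewrite mulmx0 addr0 => <-; apply: (derive_eq_on _ (chrsym_open hG0) Vy) => x Vx.
exact: JacE.
Qed.

Hypothesis uJ : forall y, V0 y -> Jac th y \in unitmx.
Hypothesis rel : forall y v w, V0 y ->
  Jac th y *m G0 y v w = G (th y) (Jac th y *m v) (Jac th y *m w) + dv v (dv w th) y.

Lemma rel_chrmx y v : V0 y ->
  Jac th y *m chrmx G0 y v = chrmx G (th y) (Jac th y *m v) *m Jac th y + dv v (Jac th) y.
Proof.
move=> Vy; apply: lin_mulmx_ext => w; rewrite mulmxDl -!mulmxA (GmE hG0) rel //.
by rewrite (GmE hG) dJacE.
Qed.

(** The derivative of [rel_chrmx] is antisymmetrized: the second derivatives of the Jacobian cancel,
    and the products involving its first derivatives are removed by [rel_chrmx] itself. *)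
Lemma curvmx_pull y X Y : V0 y ->
  Jac th y *m curvmx G0 y X Y = curvmx G (th y) (Jac th y *m X) (Jac th y *m Y) *m Jac th y.
Proof.
move=> Vy; have oV := chrsym_open hG0.
have hJ := isd_sm Jac_sm Vy; have ht := isd_sm hth Vy.
have D X' Y' : dv X' (Jac th) y *m chrmx G0 y Y' + Jac th y *m dv X' (chrmx G0 ^~ Y') y =
  (dv (Jac th y *m X') (chrmx G ^~ (Jac th y *m Y')) (th y) + chrmx G (th y) (dv X' (Jac th) y *m Y')) *m Jac th y
  + chrmx G (th y) (Jac th y *m Y') *m dv X' (Jac th) y + dv X' (dv Y' (Jac th)) y.
  have [_ e1] := isd_mulmx hJ (isd_sm (chrmx_sm hG0 Y') Vy).
  rewrite -e1 (derive_eq_on (g := fun y => chrmx G (th y) (Jac th y *m Y') *m Jac th y + dv Y' (Jac th) y) _ oV Vy).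
    have hJY : isd (fun y => Jac th y *m Y') y (fun v => dv v (Jac th) y *m Y').
      by apply: isd_eq (isd_mulmx hJ (isd_cst Y' y)) _ => v; rewrite mulmx0 addr0.
    have [_ ->] := isd_add (isd_mulmx (isd_chrmx hG oV Vy thV ht hJY) hJ) (isd_sm (sm_derive Y' Jac_sm) Vy).
    by rewrite /= -(JacE X' Vy).
  by move=> x Vx; exact: rel_chrmx.
have symJ : dv X (Jac th) y *m Y = dv Y (Jac th) y *m X.
  by rewrite !dJacE // (schwarz _ _ _ hth Vy).
have := D X Y; have := D Y X; rewrite symJ (schwarz X Y _ Jac_sm Vy).
have e X' Y' : Jac th y *m (chrmx G0 y X' *m chrmx G0 y Y') =
   chrmx G (th y) (Jac th y *m X') *m (chrmx G (th y) (Jac th y *m Y') *m Jac th y + dv Y' (Jac th) y)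
   + dv X' (Jac th) y *m chrmx G0 y Y'.
  by rewrite mulmxA rel_chrmx // mulmxDl -mulmxA rel_chrmx.
rewrite /curvmx mulmxDr !mulmxBr !e !mulmxDr !mulmxDl !mulNmx !mulmxA.
move: (Jac th y *m dv X _ _) (Jac th y *m dv Y _ _) => a b.
move: (dv X (Jac th) y *m _) (dv Y (Jac th) y *m _) => c d.
move: (dv (Jac th y *m X) _ _ *m _) (dv (Jac th y *m Y) _ _ *m _) => e1 e2.
move: (chrmx G (th y) (Jac th y *m X) *m dv _ _ _) (chrmx G (th y) (Jac th y *m Y) *m dv _ _ _) => e3 e4.
move: (chrmx G (th y) (Jac th y *m X) *m chrmx G (th y) (Jac th y *m Y) *m Jac th y)
  (chrmx G (th y) (Jac th y *m Y) *m chrmx G (th y) (Jac th y *m X) *m Jac th y)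
  (chrmx G (th y) (dv Y (Jac th) y *m X) *m Jac th y) (dv Y (dv X (Jac th)) y) => e5 e6 e7 e8 h1 h2.
have -> : a = e1 + e7 + e4 + e8 - c by rewrite -h2 addrAC subrr add0r.
have -> : b = e2 + e7 + e3 + e8 - d by rewrite -h1 addrAC subrr add0r.
by apply/matrixP => i j; rewrite !mxE; ring.
Qed.

Lemma ric_pull y Z Y : V0 y -> ric G0 y Z Y = ric G (th y) (Jac th y *m Z) (Jac th y *m Y).
Proof.
move=> Vy; pose L x := curvmx G (th y) x (Jac th y *m Y) *m (Jac th y *m Z).
have lL : linear L by move=> a x x'; rewrite /L (curvmx_lin1 hG _ (thV Vy)) mulmxDl -scalemxAl.
rewrite -[RHS](trace_conj lL (uJ Vy)); apply: eq_bigr => i _; congr (_ _ _).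
by rewrite /L mulmxA -curvmx_pull // !mulmxA mulVmx ?uJ // mul1mx.
Qed.

Lemma schouten_pull y X : V0 y -> schouten G0 y X = schouten G (th y) (Jac th y *m X) *m Jac th y.
Proof.
move=> Vy; apply: lin_mulmx_ext => Z; apply/matrixP => i j; rewrite !ord1.
by rewrite -mulmxA (schouten_mul hG0) // (schouten_mul hG _ _ (thV Vy)) !ric_pull.
Qed.

(** Action of [th] on second order frames. There is no change in [alpha] because the second
    derivative of [th] is exactly the inhomogeneous term in the transformation law of the
    Christoffel symbols. *)
Definition difflift (u : slq) : slq := (th u.1.1, Jac th u.1.1 *m u.1.2, u.2).

Lemma difflift_isd u : V0 u.1.1 -> isd difflift u (fun X => (dv X.1.1 th u.1.1,
   dv X.1.1 (Jac th) u.1.1 *m u.1.2 + Jac th u.1.1 *m X.1.2, X.2)).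
Proof.
move=> Vu; have h1 : isd (fun u : slq => u.1.1) u (fun X => X.1.1).
  by apply: isd_fst; apply: isd_fst; exact: isd_id.
have h2 : isd (fun u : slq => u.1.2) u (fun X => X.1.2).
  by apply: isd_snd; apply: isd_fst; exact: isd_id.
have h3 : isd (fun u : slq => u.2) u (fun X => X.2) by apply: isd_snd; exact: isd_id.
apply: isd_pair h3; apply: isd_pair; first exact: (isd_comp h1 (isd_sm hth Vu)).
exact: (isd_mulmx (isd_comp h1 (isd_sm Jac_sm Vu)) h2).
Qed.

Lemma hfield_pull u v : V0 u.1.1 ->
  dv (hfield G0 (schouten G0) v u) difflift u = hfield G (schouten G) v (difflift u).
Proof.
move=> Vu; rewrite (difflift_isd Vu).2 /hfield /difflift /=; congr (_, _, _).
- by rewrite -JacE // mulmxA.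
- rewrite !mulmxBr mulmxN -(scalemxAr ((u.2 *m v) 0 0)) (mulmxA _ (chrmx _ _ _)) rel_chrmx // mulmxDl -!mulmxA.
  by rewrite opprD addrCA; congr (_ + _); rewrite addrC subrK.
- by rewrite schouten_pull // -!mulmxA.
Qed.

End Pull.

(** * Projective changes of connection *)

Section Proj.
Hypothesis hq : (2 <= q)%N.
Variables (V : set cV) (G0 G : cV -> cV -> cV -> cV) (c : cV -> rV).
Hypotheses (hG0 : chrsym V G0) (hG : chrsym V G) (hc : sm V c).
Hypothesis rel : forall y v w, V y ->
  G0 y v w = G y v w + (c y *m v) 0 0 *: w + (c y *m w) 0 0 *: v.

Lemma rel_Gmp y v : V y -> chrmx G0 y v = chrmx G y v + v *m c y + ((c y *m v) 0 0)%:M.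
Proof.
move=> Vy; apply: lin_mulmx_ext => w; rewrite !mulmxDl (GmE hG0) rel // (GmE hG) mul_scalar_mx.
by rewrite -mulmxA {2}[c y *m w]mx11_scalar mul_mx_scalar addrAC.
Qed.

(** [nabla c - c (x) c], the change of the Schouten tensor. *)
Let D y X : rV := dv X c y - c y *m chrmx G y X - (c y *m X) 0 0 *: c y.

Lemma curvmx_proj y X Y : V y -> curvmx G0 y X Y = curvmx G y X Y
  - (X *m D y Y - Y *m D y X - ((D y X *m Y) 0 0 - (D y Y *m X) 0 0)%:M).
Proof.
move=> Vy; have oV := chrsym_open hG.
have hcs := isd_sm hc Vy.
have dG X' Y' : dv X' (chrmx G0 ^~ Y') y = dv X' (chrmx G ^~ Y') y + Y' *m dv X' c y + ((dv X' c y *m Y') 0 0)%:M.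
  rewrite (derive_eq_on (g := fun y => chrmx G y Y' + Y' *m c y + ((c y *m Y') 0 0)%:M) _ oV Vy); last first.
    by move=> x Vx; exact: rel_Gmp.
  have l : linear (fun r : rV => Y' *m r + ((r *m Y') 0 0)%:M : 'M[R]_q).
    move=> a x x'; rewrite mulmxDr mulmxDl -scalemxAr -scalemxAl.
    move: (_ *m _) (_ *m _) (_ *m _) (_ *m _) => m1 m2 m3 m4.
    by apply/matrixP => i j; rewrite !mxE; case: (i == j); rewrite ?mulr1n ?mulr0n; ring.
  have := isd_add (isd_sm (chrmx_sm hG Y') Vy) (isd_lincomp _ l hcs) => -[_].
  by move=> /(_ X'); rewrite !addrA => <-; congr (dv _ _ _); apply/funext => x; rewrite addrA.
have e (x z : cV) (r : rV) : x *m r *m z = (r *m z) 0 0 *: x.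
  by rewrite -mulmxA {1}[r *m z]mx11_scalar mul_mx_scalar.
have key X' Y' : chrmx G0 y X' *m chrmx G0 y Y' = chrmx G y X' *m chrmx G y Y' + (chrmx G y X' *m Y') *m c y
    + X' *m (c y *m chrmx G y Y') + ((c y *m Y') 0 0 *: (chrmx G y X' + X' *m c y + X' *m c y)
    + (c y *m X') 0 0 *: (chrmx G y Y' + Y' *m c y)) + ((c y *m X') 0 0 * (c y *m Y') 0 0)%:M.
  rewrite !rel_Gmp // !mulmxDl !mulmxDr !mul_scalar_mx !mul_mx_scalar scale_scalar_mx !mulmxA e -scalemxAl.
  move: (chrmx G y X' *m chrmx G y Y') (chrmx G y X' *m Y' *m c y) (X' *m c y *m chrmx G y Y') (X' *m c y) (Y' *m c y) => m1 m2 m3 m4 m5.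
  move: (chrmx G y X') (chrmx G y Y') ((_ *m _) 0 0) ((_ *m _) 0 0) => m6 m7 s t.
  by apply/matrixP => i j; rewrite !mxE; case: (i == j); rewrite ?mulr1n ?mulr0n; ring.
rewrite /curvmx !dG !key /D (chrmx_sym hG Y X Vy) !mulmxBr !mulmxBl -!scalemxAr -!scalemxAl -!(mulmxA (c y)) (chrmx_sym hG Y X Vy).
have e3 (m1 m2 : 'M[R]_1) (s : R) (m3 : 'M[R]_1) : (m1 - m2 - s *: m3) 0 0 = m1 0 0 - m2 0 0 - s * m3 0 0.
  by rewrite !mxE.
rewrite !e3.
move: (dv X (chrmx G ^~ Y) y) (dv Y (chrmx G ^~ X) y) (Y *m dv X c y) (X *m dv Y c y) => m1 m2 m3 m4.
move: (chrmx G y X *m chrmx G y Y) (chrmx G y Y *m chrmx G y X) (chrmx G y X *m Y *m c y) => m5 m6 m7.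
move: (X *m (c y *m chrmx G y Y)) (Y *m (c y *m chrmx G y X)) (X *m c y) (Y *m c y) (chrmx G y X) (chrmx G y Y) => m8 m9 m10 m11 m12 m13.
move: ((dv X c y *m Y) 0 0) ((dv Y c y *m X) 0 0) ((c y *m (_ *m _)) 0 0) ((c y *m X) 0 0) ((c y *m Y) 0 0) => s1 s2 s3 s4 s5.
by apply/matrixP => i j; rewrite !mxE; case: (i == j); rewrite ?mulr1n ?mulr0n; ring.
Qed.

(** By [curvmx_proj] the tensor [Mt] is the same for [G0] with [schouten G + D] as for [G] with
    [schouten G]: this is the invariance of the projective Weyl tensor. Hence [schouten G + D]
    solves the normality equations of [G0], and uniqueness concludes without computing any Ricci
    tensor. *)
Lemma schouten_proj y X : V y -> schouten G0 y X = schouten G y X + D y X.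
Proof.
move=> Vy; pose P y X := schouten G y X + D y X.
have lD : linear (D y).
  move=> a x x'; rewrite /D (derive_dirD _ _ (sm_diff hc Vy)) (derive_dirZ _ _ (sm_diff hc Vy)).
  rewrite (chrmx_lin hG Vy) !mulmxDr -!scalemxAr.
  move: (dv _ _ _) (dv _ _ _) (_ *m chrmx _ _ _) (_ *m chrmx _ _ _) (_ *m x) (_ *m x') => m1 m2 m3 m4 m5 m6.
  by apply/matrixP => i j; rewrite !mxE; ring.
have lP : linear (P y).
  move=> a x x'; rewrite /P (schouten_lin hG Vy) lD.
  move: (schouten _ _ _) (schouten _ _ _) (D _ _) (D _ _) => m1 m2 m3 m4.
  by apply/matrixP => i k; rewrite !mxE; ring.
apply/esym; apply: (schouten_unique hG0 hq Vy lP) => j l.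
have e Z Y i : Mt G0 (fun _ => P y) y (evec i) Y *m Z = Mt G (schouten G) y (evec i) Y *m Z.
  congr (_ *m _); rewrite /Mt curvmx_proj // /P; move: (D y) => Dy; rewrite !mulmxDr !mulmxDl.
  move: (curvmx _ _ _ _) (_ *m schouten G _ _) (_ *m schouten G _ _) (_ *m Dy _) (_ *m Dy _) => m1 m2 m3 m4 m5.
  move: (schouten G _ _ *m _) (schouten G _ _ *m _) (Dy _ *m _) (Dy _ *m _) => m6 m7 m8 m9.
  by apply/matrixP => a b; rewrite !mxE; case: (a == b); rewrite ?mulr1n ?mulr0n; ring.
have := Mt_trace G0 (V := V) (P := fun _ => P y) (fun _ _ => lP) (evec j) (evec l) Vy.
have := Mt_trace G (schouten_lin hG) (evec j) (evec l) Vy.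
have := schouten_eq hG (evec j) (evec l) hq Vy.
under eq_bigr do rewrite -e; move=> h1 -> h2; lra.
Qed.

(** The coordinates relative to [G] of the frame with coordinates [u] relative to [G0]: in the
    second derivative of [frame2], the change of Christoffel symbols has the same form as a change
    of [alpha] by [c A]. *)
Definition projlift (u : slq) : slq := (u.1, u.2 + c u.1.1 *m u.1.2).

Lemma projlift_isd u : V u.1.1 -> isd projlift u (fun X => (X.1,
   X.2 + (dv X.1.1 c u.1.1 *m u.1.2 + c u.1.1 *m X.1.2))).
Proof.
move=> Vu; have h1 : isd (fun u : slq => u.1.1) u (fun X => X.1.1).
  by apply: isd_fst; apply: isd_fst; exact: isd_id.
have h2 : isd (fun u : slq => u.1.2) u (fun X => X.1.2).
  by apply: isd_snd; apply: isd_fst; exact: isd_id.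
have h3 : isd (fun u : slq => u.2) u (fun X => X.2) by apply: isd_snd; exact: isd_id.
have h4 : isd (fun u : slq => u.1) u (fun X => X.1) by apply: isd_fst; exact: isd_id.
apply: isd_pair h4 _; apply: isd_add h3 _.
exact: (isd_mulmx (isd_comp h1 (isd_sm hc Vu)) h2).
Qed.

Lemma hfield_proj u v : V u.1.1 ->
  dv (hfield G0 (schouten G0) v u) projlift u = hfield G (schouten G) v (projlift u).
Proof.
move=> Vu; rewrite (projlift_isd Vu).2 /hfield /projlift /=; case: u Vu => [[y A] al] /= Vy.
have e (x : cV) (r : rV) (z : 'M[R]_(1, q)) : x *m r *m (x *m z) = (r *m x) 0 0 *: (x *m z).
  by rewrite mulmxA -(mulmxA x r x) {1}[r *m x]mx11_scalar mul_mx_scalar scalemxAl.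
have e1 : ((al + c y *m A) *m v) 0 0 = (al *m v) 0 0 + (c y *m (A *m v)) 0 0.
  by rewrite mulmxDl mxE mulmxA.
rewrite rel_Gmp // schouten_proj // /D e1; congr (_, _, _).
  rewrite !mulmxDl mulmxDr mul_scalar_mx !mulmxA scalerDl.
  move: (A *m v *m al) (A *m v *m c y *m A) (chrmx _ _ _ *m A) => m1 m2 m3.
  by apply/matrixP => i j; rewrite !mxE; ring.
rewrite !(mulmxDr, mulmxDl, mulmxN, mulNmx, mul_scalar_mx) -!scalemxAr -!scalemxAl !mulmxA.
have e2 : c y *m A *m v *m al = (c y *m A *m v) 0 0 *: al.
  by rewrite {1}[c y *m A *m v]mx11_scalar mul_scalar_mx.
have e3 : c y *m A *m v *m c y *m A = (c y *m A *m v) 0 0 *: (c y *m A).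
  by rewrite {1}[c y *m A *m v]mx11_scalar mul_scalar_mx scalemxAl.
rewrite e2 e3; move: (schouten _ _ _ *m A) (dv _ _ _ *m A) (c y *m chrmx _ _ _ *m A) (c y *m A) => m1 m2 m3 m4.
move: ((_ *m _) 0 0) ((_ *m _) 0 0) => s t.
by apply/matrixP => i j; rewrite !mxE; ring.
Qed.

End Proj.
End Chr.

Section Aux.
Context {R : realType}.

Lemma Cn_local (V W : normedModType R) n (U : set V) (f : V -> W) :
  (forall z, U z -> exists2 U' : set V, U' z & Cn n U' f) -> Cn n U f.
Proof.
elim: n f => [//|n IH] f h; split.
  by move=> z /h[U' Uz [d _]]; exact: d.
by move=> v; apply: IH => z /h[U' Uz [_ d]]; exists U' => //; exact: d.
Qed.

Lemma sm_local (V W : normedModType R) (U : set V) (f : V -> W) :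
  (forall z, U z -> exists U' : set V, [/\ U' z, U' `<=` U & sm U' f]) -> sm U f.
Proof.
move=> h; split.
  rewrite openE => z /h[U' [Uz s [oU' _]]]; apply: filterS s _; exact: open_nbhs_nbhs.
by move=> n; apply: Cn_local => z /h[U' [Uz s [_ c]]]; exists U'.
Qed.

Lemma open_cont (V W : normedModType R) (U : set V) (D : set W) (f : V -> W) :
  open U -> (forall z, U z -> {for z, continuous f}) -> open D -> open (U `&` f @^-1` D).
Proof.
move=> oU cf oD; rewrite openE => z [Uz Dz]; apply: filterI; first exact: open_nbhs_nbhs.
by apply: (cf z Uz); apply: open_nbhs_nbhs.
Qed.

Lemma surj_unit n (A : 'M[R]_n) : (forall w : 'cV[R]_n, exists v, A *m v = w) -> A \in unitmx.
Proof.
move=> h; have [g hg] := choice h.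
have [|//] := @mulmx1_unit _ _ A (\matrix_(i, j) g (evec j) i 0).
apply/matrixP => i j; have := congr1 (fun v : 'cV[R]_n => v i 0) (hg (evec j)).
rewrite !mxE eqxx andbT => <-; apply: eq_bigr => k _; by rewrite !mxE.
Qed.

End Aux.

(** * Foliated maps in adapted charts *)

Section Mor.
Context {R : realType} {p q : nat}.
Notation bmod := (bmod R p q).
Notation cV := 'cV[R]_q.
Implicit Types (M : folmfd R p q).

Lemma chartK M (i : idx M) m : udom i m -> par i (chart i m) = m.
Proof. by move=> [z dz <-]; rewrite parK. Qed.

Lemma chart_dom M (i : idx M) m : udom i m -> dom i (chart i m).
Proof. by move=> [z dz <-]; rewrite parK. Qed.

Lemma udom_par M (i : idx M) z : dom i z -> udom i (par i z).
Proof. by move=> dz; exists z. Qed.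

Lemma udom_mopen M (i : idx M) : mopen (udom i).
Proof. by move=> j; have [] := trans_smooth j i. Qed.

Lemma cover M (m : M) : exists i : idx M, udom i m.
Proof. by have [C _ /(_ m)[i _ h]] := second_countable M; exists i. Qed.

Lemma mopenT M : mopen [set: M].
Proof. by move=> i; rewrite preimage_setT setIT; exact: dom_open. Qed.

Lemma mopenI M (O O' : set M) : mopen O -> mopen O' -> mopen (O `&` O').
Proof.
move=> h h' i; rewrite preimage_setI.
have -> : dom i `&` (par i @^-1` O `&` par i @^-1` O') = (dom i `&` par i @^-1` O) `&` (dom i `&` par i @^-1` O').
  by apply/seteqP; split=> z [] => [? []|[] ? ? []].
exact: openI.
Qed.

Definition Dm M0 M (phi : M0 -> M) i j : set bmod := dom i `&` par i @^-1` (phi @^-1` udom j).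
Definition Tm M0 M (phi : M0 -> M) i j : bmod -> bmod := fun z => chart j (phi (par i z)).
Definition T2 M0 M (phi : M0 -> M) i j : bmod -> cV := fun z => (Tm phi i j z).2.
Definition Jt M0 M (phi : M0 -> M) i j (z : bmod) : 'M[R]_q :=
  \matrix_(a, b) dv (0, evec b) (T2 phi i j) z a 0.

(** The local properties shared by foliated local diffeomorphisms and by the identity map read in
    two charts, so that changes of chart and naturality have a common proof. *)
Record mor M0 M (phi : M0 -> M) : Prop := Mor {
  mor_sm : forall i j, sm (Dm phi i j) (Tm phi i j);
  mor_flat : forall i j z x, Dm phi i j z -> dv (x, 0) (T2 phi i j) z = 0;
  mor_unit : forall i j z, Dm phi i j z -> Jt phi i j z \in unitmx
}.

Lemma T2_flat_lin M0 M (phi : M0 -> M) i j z X : sm (Dm phi i j) (Tm phi i j) ->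
  (forall z x, Dm phi i j z -> dv (x, 0) (T2 phi i j) z = 0) -> Dm phi i j z ->
  dv X (T2 phi i j) z = Jt phi i j z *m X.2.
Proof.
move=> hs hf Dz; have h2 : sm (Dm phi i j) (T2 phi i j) by apply: sm_snd.
have d := sm_diff h2 Dz.
have l : linear (fun v : cV => dv (0, v) (T2 phi i j) z).
  move=> a v w; rewrite -(derive_dirZ _ _ d) -(derive_dirD _ _ d); congr (dv _ _ _).
  by rewrite -[RHS]/(a *: 0 + 0, a *: v + w) scaler0 addr0.
rewrite (lin_mxE X.2 l); case: X => x y /=.
have -> : (x, y) = (x, 0) + (0, y) :> bmod by rewrite -[RHS]/(x + 0, 0 + y) addr0 add0r.
by rewrite (derive_dirD _ _ d) hf // add0r.
Qed.

(** Invertibility of the transverse Jacobian does not go through the inverse preserving the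
    foliations: differentiating the [y] part of [T \o T' = id] shows that the [y] part of [dT] is
    onto, and it depends only on the transverse component. *)
Lemma local_diffeo_mor M0 M (phi : M0 -> M) : local_diffeo phi -> preserves_fol phi -> mor phi.
Proof.
move=> ld pf.
have hs i j : sm (Dm phi i j) (Tm phi i j).
  apply: sm_local => z [dz uz]; have [N [N' [phi' [[Nm mN mN'] [_ _ sN _]]]]] := ld (par i z).
  exists (dom i `&` par i @^-1` (N `&` phi @^-1` udom j)); split=> //.
    by move=> x [dx [_ ux]].
  exact/smooth_onP.
have hf i j z x : Dm phi i j z -> dv (x, 0) (T2 phi i j) z = 0.
  move=> Dz; have h2 : sm (Dm phi i j) (T2 phi i j) by apply: sm_snd.
  by apply: ((flatP _ _ _ h2).1 _ z x Dz) => z' [dz' uz']; exact: pf.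
split=> // i j z Dz; apply: surj_unit => w.
have [N [N' [phi' [[Om mO mO'] [im inv sO sO']]]]] := ld (par i z).
have [dz uz] := Dz.
have O'z : N' (phi (par i z)) by rewrite -im; exists (par i z).
pose D' := dom j `&` par j @^-1` (N' `&` phi' @^-1` udom i).
have hs' : sm D' (chart i \o phi' \o par j) by apply/smooth_onP; exact: sO'.
set z' := Tm phi i j z; set T' : bmod -> bmod := chart i \o phi' \o par j in hs'.
have pz' : par j z' = phi (par i z) by rewrite chartK.
have D'z : D' z'.
  split; first exact: chart_dom.
  by rewrite /preimage /= pz' inv //; split=> //; exact: udom_par.
have Tz' : T' z' = z by rewrite /T' /= pz' inv // parK.
have E x : D' x -> Tm phi i j (T' x) = x.
  move=> [dx [hx ux]]; rewrite /Tm /T' /= chartK //.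
  by move: hx; rewrite -im => -[m' Om' e]; rewrite -e inv // e parK.
have dT : differentiable (Tm phi i j) (T' z') by rewrite Tz'; exact: sm_diff (hs i j) Dz.
exists (dv (0, w) T' z').2.
rewrite -(T2_flat_lin _ (hs i j) (hf i j) Dz) -[in X in dv _ _ X]Tz'.
have <- : dv (0, w) (T2 phi i j \o T') z' = dv (dv (0, w) T' z') (T2 phi i j) (T' z').
  apply: derive_comp; first exact: sm_diff hs' D'z.
  by rewrite Tz'; apply: (sm_diff _ Dz); apply: sm_snd.
rewrite (derive_eq_on (g := fun x => x.2) (0, w) (sm_open hs') D'z).
  by rewrite derive_lin //; exact: linear_snd.
by move=> x D'x; rewrite /T2 /= E.
Qed.

Lemma mor_id M : mor (fun m : M => m).
Proof.
apply: local_diffeo_mor => [m|i j z dz uz]; last exact: (trans_fol (conj dz uz)).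
have h : smooth_map [set: M] (fun m : M => m).
  by move=> i j; rewrite setTI; exact: trans_smooth.
exists setT, setT, (fun m : M => m); split; split=> //; try exact: mopenT.
exact: image_id.
Qed.

Lemma mor_preim M0 M (phi : M0 -> M) O : mor phi -> mopen O -> mopen (phi @^-1` O).
Proof.
move=> hm mO i; rewrite openE => z [dz Oz]; have [j uj] := cover (phi (par i z)).
have oU := open_cont (sm_open (mor_sm hm i j)) (fun x Dx => sm_cont (mor_sm hm i j) Dx) (mO j).
apply: filterS (open_nbhs_nbhs (conj oU _)).
  by move=> x [[dx ux] [_]]; rewrite /preimage /Tm /= chartK.
split=> //; split; first exact: chart_dom.
by rewrite /preimage /Tm /= chartK.
Qed.

(** * Jets of transversal maps *)

Definition yc M (i : idx M) (f : cV -> M) : cV -> cV := fun z => (chart i (f z)).2.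

(** Smoothness near 0 in every chart. It passes to [phi \o f] and to [f \o h] by the chain rule and
    suffices for comparing jets. *)
Definition good M (f : cV -> M) := exists W : set cV,
  W 0 /\ forall i, sm (W `&` f @^-1` udom i) (chart i \o f).

Lemma transversal_good M (f : cV -> M) : transversal f -> good f.
Proof.
by move=> [W [W0 [oW h]]]; exists W; split=> // i; apply/smooth_onP; have [] := h i.
Qed.

(* equality of [r]-jets at 0; only for [1 <= r <= 2] *)
Definition jr (r : nat) (g g' : cV -> cV) : Prop :=
  [/\ g 0 = g' 0, forall v, dv v g 0 = dv v g' 0 &
      (1 < r)%N -> forall v w, dv v (dv w g) 0 = dv v (dv w g') 0].

Lemma jr_sym r g g' : jr r g g' -> jr r g' g.
Proof. by move=> [a b c]; split=> // ? ? *; rewrite c. Qed.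

Lemma jr_trans r g g' g'' : jr r g g' -> jr r g' g'' -> jr r g g''.
Proof.
move=> [a b c] [a' b' c']; split=> [|v|r1 v w]; first by rewrite a.
  by rewrite b.
by rewrite c // c'.
Qed.

Lemma jrW r r' g g' : (r' <= r)%N -> jr r g g' -> jr r' g g'.
Proof. by move=> h [a b c]; split=> // h'; apply: c; exact: leq_trans h' h. Qed.

Lemma jr_eq r (g g' : cV -> cV) (U : set cV) : open U -> U 0 -> (forall z, U z -> g z = g' z) -> jr r g g'.
Proof.
move=> oU U0 e; split=> [|v|_ v w]; first exact: e.
  exact: derive_eq_on oU U0 e.
by apply: (derive_eq_on _ oU U0) => x Ux; exact: derive_eq_on oU Ux e.
Qed.

Lemma jrP r g g' : (0 < r <= 2)%N -> jr r g g' <->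
  forall vs : seq cV, (size vs <= r)%N -> Defs.iterD vs g 0 = Defs.iterD vs g' 0.
Proof.
move=> /andP[r0 r2]; split=> [[a b c] vs|h].
  case: vs => [_|v [_|w [hr|x l hl]]].
  - exact: a.
  - by have := b v; rewrite !dvE.
  - by have := c hr v w; rewrite !dvE !dvF.
  - by exfalso; have := leq_trans hl r2.
split; first exact: (h [::]).
  by move=> v; rewrite !dvE; exact: (h [:: v]).
by move=> r1 v w; rewrite !dvF; exact: (h [:: v; w]).
Qed.

Lemma jr_comp r (U U' : set cV) (h g g' : cV -> cV) :
  sm U h -> U 0 -> (forall z, U z -> U' (h z)) -> sm U' g -> sm U' g' -> h 0 = 0 ->
  jr r g g' -> jr r (fun z => g (h z)) (fun z => g' (h z)).
Proof.
move=> sh U0 hU sg sg' h0 [a b c].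
have U'0 : U' (h 0) := hU 0 U0; have U'0' : U' 0 by rewrite -h0.
split=> [|v|r1 v w]; first by rewrite h0.
  rewrite (derive_comp _ (sm_diff sh U0) (sm_diff sg U'0)).
  by rewrite (derive_comp _ (sm_diff sh U0) (sm_diff sg' U'0)) h0 b.
rewrite (derive2_comp v w _ _ _ hU sh sg U0) (derive2_comp v w _ _ _ hU sh sg' U0) h0.
by rewrite c // b.
Qed.

Section Change.
Variables (M0 M : folmfd R p q) (phi : M0 -> M).
Hypothesis hphi : mor phi.
Variables (i : idx M0) (j : idx M).

Let T2s : sm (Dm phi i j) (T2 phi i j). Proof. by apply: sm_snd; exact: mor_sm. Qed.

Lemma T2_dv z X : Dm phi i j z -> dv X (T2 phi i j) z = Jt phi i j z *m X.2.
Proof. by move=> Dz; apply: T2_flat_lin => //; [exact: mor_sm|exact: mor_flat]. Qed.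

Lemma T2_dv2 z X Y : Dm phi i j z -> dv X (dv Y (T2 phi i j)) z =
  dv (0, X.2) (dv (0, Y.2) (T2 phi i j)) z.
Proof.
move=> Dz; have oD := sm_open T2s.
have e Z : forall x, Dm phi i j x -> dv Z (T2 phi i j) x = dv (0, Z.2) (T2 phi i j) x.
  by move=> x Dx; rewrite !T2_dv.
rewrite (derive_eq_on X oD Dz (e Y)) (schwarz _ _ _ T2s Dz) (derive_eq_on _ oD Dz (e X)).
by rewrite (schwarz _ _ _ T2s Dz).
Qed.

Lemma good_nbhs (f : cV -> M0) : good f -> udom i (f 0) -> udom j (phi (f 0)) ->
  exists U : set cV, [/\ U 0, sm U (chart i \o f),
   (forall z, U z -> udom i (f z)) & forall z, U z -> Dm phi i j (chart i (f z))].
Proof.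
move=> [W [W0 h]] ui uj; have hi := h i.
have oU := open_cont (sm_open hi) (fun x Dx => sm_cont hi Dx) (sm_open (mor_sm hphi i j)).
exists ((W `&` f @^-1` udom i) `&` (chart i \o f) @^-1` Dm phi i j); split.
- split=> //; split; first exact: chart_dom.
  by rewrite /preimage /= chartK.
- by apply: (sm_sub _ oU hi) => z [].
- by move=> z [[]].
- by move=> z [].
Qed.

(** The second order chain rule, in which the [x] component of [f] drops out because [T2] is
    constant along the leaves: the 2-jet of [y \o f] alone determines that of [y \o phi \o f]. *)
Lemma yc_change (f : cV -> M0) (z := chart i (f 0)) : good f -> udom i (f 0) -> udom j (phi (f 0)) ->
  [/\ forall v, dv v (yc j (phi \o f)) 0 = Jt phi i j z *m dv v (yc i f) 0 &
      forall v w, dv v (dv w (yc j (phi \o f))) 0 =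
        dv (0, dv v (yc i f) 0) (dv (0, dv w (yc i f) 0) (T2 phi i j)) z
        + Jt phi i j z *m dv v (dv w (yc i f)) 0].
Proof.
move=> gf ui uj; have [U [U0 sf fU TU]] := good_nbhs gf ui uj; have oU := sm_open sf.
have E x : U x -> yc j (phi \o f) x = (T2 phi i j \o (chart i \o f)) x.
  by move=> Ux; rewrite /yc /T2 /Tm /= chartK //; exact: fU.
have Y v x : U x -> (dv v (chart i \o f) x).2 = dv v (yc i f) x.
  by move=> Ux; have [_ ->] := isd_snd _ _ (isd_sm sf Ux).
have YY v w : (dv v (dv w (chart i \o f)) 0).2 = dv v (dv w (yc i f)) 0.
  have [_ <-] := isd_snd _ _ (isd_sm (sm_derive w sf) U0).
  by apply: (derive_eq_on _ oU U0) => x Ux; exact: Y.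
have Dz : Dm phi i j z := TU 0 U0.
split=> [v|v w].
  rewrite (derive_eq_on v oU U0 E) derive_comp; [|exact: sm_diff sf U0|exact: sm_diff T2s Dz].
  by rewrite T2_dv // Y.
have -> : dv v (dv w (yc j (phi \o f))) 0 = dv v (dv w (T2 phi i j \o (chart i \o f))) 0.
  by apply: (derive_eq_on _ oU U0) => x Ux; exact: derive_eq_on oU Ux E.
rewrite (derive2_comp v w _ _ _ TU sf T2s U0).
by rewrite T2_dv2 // [X in _ + X]T2_dv // !Y // YY.
Qed.

Lemma yc_change_jr r (f g : cV -> M0) : good f -> good g -> udom i (f 0) -> udom j (phi (f 0)) ->
  f 0 = g 0 -> jr r (yc i f) (yc i g) -> jr r (yc j (phi \o f)) (yc j (phi \o g)).
Proof.
move=> gf gg ui uj e [a b c]; have [h1 h2] := yc_change gf ui uj.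
have [h1' h2'] := yc_change gg (eq_ind _ (udom i) ui _ e) (eq_ind _ (fun m => udom j (phi m)) uj _ e).
split=> [|v|r1 v w]; first by rewrite /yc /= e.
  by rewrite h1 h1' b e.
by rewrite h2 h2' !b c // e.
Qed.

End Change.

Lemma good_pt M (f : cV -> M) (i : idx M) : good f -> udom i (f 0) ->
  exists U : set cV, [/\ U 0, sm U (chart i \o f) & forall z, U z -> udom i (f z)].
Proof.
by move=> [W [W0 h]] ui; exists (W `&` f @^-1` udom i); split=> // z [].
Qed.

Lemma yc_sm M (f : cV -> M) (i : idx M) : good f -> udom i (f 0) ->
  exists2 U : set cV, U 0 & sm U (yc i f).
Proof. by move=> gf /(good_pt gf)[U [U0 sU _]]; exists U => //; apply: sm_snd sU. Qed.

Lemma jet_eqP M r (f g : cV -> M) (i : idx M) : (0 < r <= 2)%N -> good f -> good g ->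
  udom i (f 0) -> jet_eq r f g <-> f 0 = g 0 /\ jr r (yc i f) (yc i g).
Proof.
move=> hr gf gg ui; split=> [[e h]|[e h]]; split=> //.
  by apply/jrP => // vs; exact: h.
move=> j uj; apply/jrP => //.
exact: (yc_change_jr (mor_id M) gf gg ui uj e h).
Qed.

(** A jet, which is a set of maps, described in one chart by its base point and by a model [g] of
    [y \o f]; equality of jets becomes equality of Taylor coefficients. *)
Definition jetset M r (i : idx M) (z : bmod) (g : cV -> cV) : jet M :=
  [set f | [/\ transversal f, f 0 = par i z & jr r (yc i f) g]].

Lemma jet_of_set M r (i : idx M) (f : cV -> M) : (0 < r <= 2)%N -> good f -> udom i (f 0) ->
  jet_of r f = jetset r i (chart i (f 0)) (yc i f).
Proof.
move=> hr gf ui; apply/seteqP; split=> g [tg h]; split=> //.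
- by have [-> _] := h; rewrite chartK //; have [<- _] := h.
- have [_ /jr_sym //] := (jet_eqP hr gf (transversal_good tg) ui).1 h.
have e : g 0 = f 0 by rewrite h chartK.
by apply/(jet_eqP hr gf (transversal_good tg) ui); split=> //; exact: jr_sym.
Qed.

Lemma jetset_jr M r (i : idx M) z g g' : jr r g g' -> jetset r i z g = jetset r i z g'.
Proof.
move=> h; apply/seteqP; split=> f [t e j]; split=> //; first exact: jr_trans h.
exact: jr_trans (jr_sym h).
Qed.

(** The class [jetset r' i z g] has to be inhabited, since the image of an empty set of maps would
    be empty. The order may drop from [r'] to [r], as for the projection to first order frames. *)
Lemma jmap_jetset M0 M r r' (F : (cV -> M0) -> (cV -> M)) (i : idx M0) (j : idx M) z z' g g' :
  (0 < r <= 2)%N -> dom j z' -> jetset r' i z g !=set0 ->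
  (forall f, jetset r' i z g f -> [/\ good (F f), F f 0 = par j z' & jr r (yc j (F f)) g']) ->
  jmap r F (jetset r' i z g) = jetset r j z' g'.
Proof.
move=> hr dz [f0 hf0] h; apply/seteqP; split=> f.
  move=> [f1 /h[g1 e1 j1] [tf]]; have uj : udom j (F f1 0) by rewrite e1; exact: udom_par.
  move=> /(jet_eqP hr g1 (transversal_good tf) uj)[e J]; split=> //; first by rewrite -e.
  by apply: jr_trans j1; exact: jr_sym.
move=> [tf e J]; exists f0 => //; have [g1 e1 j1] := h f0 hf0.
have uj : udom j (F f0 0) by rewrite e1; exact: udom_par.
split=> //; apply/(jet_eqP hr g1 (transversal_good tf) uj); split; first by rewrite e1 e.
by apply: jr_trans j1 (jr_sym J).
Qed.

Definition rep M (i : idx M) (x : 'cV[R]_p) (g : cV -> cV) : cV -> M := fun v => par i (x, g v).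

Lemma Jt_comp M0 M1 M (phi : M0 -> M1) (psi : M1 -> M) i j k z : mor phi -> mor psi ->
  Dm phi i j z -> Dm psi j k (Tm phi i j z) ->
  forall v, dv (0, v) (fun x => (chart k (psi (phi (par i x)))).2) z
   = Jt psi j k (Tm phi i j z) *m (Jt phi i j z *m v).
Proof.
move=> hp hs Dz Dz' v.
have sT := mor_sm hp i j; have sT' := mor_sm hs j k.
have oU := open_cont (sm_open sT) (fun x Dx => sm_cont sT Dx) (sm_open sT').
have E x : (Dm phi i j `&` Tm phi i j @^-1` Dm psi j k) x ->
    (chart k (psi (phi (par i x)))).2 = (T2 psi j k \o Tm phi i j) x.
  by move=> [[dx ux] _]; rewrite /T2 /Tm /= chartK.
rewrite (derive_eq_on _ oU (conj Dz Dz') E) derive_comp; [|exact: sm_diff sT Dz|]; last first.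
  by apply: (sm_diff _ Dz'); apply: sm_snd sT'.
rewrite (T2_dv hs) //; congr (_ *m _).
have [_ <-] := isd_snd _ _ (isd_sm sT Dz).
by rewrite -[LHS]/(dv (0, v) (T2 phi i j) z) (T2_dv hp).
Qed.

Lemma rep_good M (i : idx M) x g U : sm U g -> U 0 -> dom i (x, g 0) ->
  exists U' : set cV, [/\ U' 0, U' `<=` U, open U', (forall v, U' v -> dom i (x, g v)) &
   forall j, sm (U' `&` rep i x g @^-1` udom j) (chart j \o rep i x g)].
Proof.
move=> sg U0 d0.
have sp : sm U (fun v => (x, g v) : bmod).
  by apply: sm_pair => //; apply: sm_cst; exact: sm_open sg.
have oU := open_cont (sm_open sp) (fun z Uz => sm_cont sp Uz) (dom_open (i := i)).
exists (U `&` (fun v => (x, g v) : bmod) @^-1` dom i); split=> //; try by move=> v [].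
move=> j; pose D := Dm (fun m : M => m) i j.
have sT := mor_sm (mor_id M) i j.
have oD : open ((U `&` (fun v => (x, g v) : bmod) @^-1` dom i) `&` rep i x g @^-1` udom j).
  have -> : (U `&` (fun v => (x, g v) : bmod) @^-1` dom i) `&` rep i x g @^-1` udom j =
     U `&` (fun v => (x, g v) : bmod) @^-1` D.
    by apply/seteqP; split=> z; [move=> [[? ?] ?]|move=> [? [? ?]]].
  exact: (open_cont (sm_open sp) (fun z Uz => sm_cont sp Uz) (sm_open sT)).
apply: (@sm_comp _ _ _ _ _ D (fun v => (x, g v) : bmod) (Tm (fun m : M => m) i j)) => //.
  by move=> z [[_ dz] uz].
by apply: sm_sub sp => // z [[]].
Qed.

(** Invertibility of the Jacobian of [g] persists near 0, and in another chart it is multiplied by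
    an invertible transverse Jacobian, so the image stays complementary to the leaves. *)
Lemma rep_transversal M (i : idx M) x g U : sm U g -> U 0 -> dom i (x, g 0) ->
  (forall w, exists v, dv v g 0 = w) -> transversal (rep i x g).
Proof.
move=> sg U0 d0 sj.
have [U' [U'0 sU' oU' dU' sU'']] := rep_good sg U0 d0.
have sg' : sm U' g by apply: sm_sub sg.
pose J v : 'M[R]_q := \matrix_(a, b) dv (evec b) g v a 0.
have JE v w : U' v -> J v *m w = dv w g v.
  by move=> U'v; apply: (lin_mxE w (derive_dir (sm_diff sg' U'v))).
have sJ : sm U' J.
  apply: sm_mx => // a b; apply: (@sm_eq _ _ _ _ (fun v => dv (evec b) g v a 0)).
    by move=> v _; rewrite mxE.
  by apply: sm_coord; exact: sm_derive.
have uJ0 : J 0 \in unitmx.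
  apply: surj_unit => w; have [v <-] := sj w; exists v; exact: JE.
have oW : open (U' `&` J @^-1` [set A | A \in unitmx]).
  exact: (open_cont oU' (fun z Uz => sm_cont sJ Uz) (@unitmx_open R q)).
exists (U' `&` J @^-1` [set A | A \in unitmx]); split=> //; split=> // j.
have sV : sm ((U' `&` J @^-1` [set A | A \in unitmx]) `&` rep i x g @^-1` udom j) (chart j \o rep i x g).
  apply: sm_sub (sU'' j); first by move=> z [[]].
  have -> : (U' `&` J @^-1` [set A | A \in unitmx]) `&` rep i x g @^-1` udom j =
     (U' `&` rep i x g @^-1` udom j) `&` J @^-1` [set A | A \in unitmx].
    by apply/seteqP; split=> z [] => [[]|[]].
  apply: open_cont (sm_open (sU'' j)) _ (@unitmx_open R q) => z [U'z _]; exact: sm_cont sJ U'z.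
split; first exact/smooth_onP.
move=> z [[U'z /= uJ] uz].
have Dz : Dm (fun m : M => m) i j (x, g z) by split; [exact: dU'|].
pose T := Jt (fun m : M => m) i j (x, g z).
have uT : T \in unitmx := mor_unit (mor_id M) Dz.
have sp : isd (fun v => (x, g v) : bmod) z (fun v => (0, dv v g z)).
  by apply: isd_pair; [exact: isd_cst|exact: (isd_sm sg' U'z)].
have dE v : 'D_v (chart j \o rep i x g) z = dv (0, dv v g z) (Tm (fun m : M => m) i j) (x, g z).
  have [_ <-] := isd_comp sp (isd_sm (mor_sm (mor_id M) i j) Dz).
  by rewrite -dvE.
have dE2 v : ('D_v (chart j \o rep i x g) z).2 = T *m (J z *m v).
  rewrite dE; have [_ <-] := isd_snd _ _ (isd_sm (mor_sm (mor_id M) i j) Dz).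
  by rewrite -[LHS]/(dv _ (T2 (fun m : M => m) i j) _) (T2_dv (mor_id M)) // JE.
split.
  move=> [wx wy]; pose v := invmx (J z) *m (invmx T *m wy).
  exists v, (wx - ('D_v (chart j \o rep i x g) z).1).
  have e2 := dE2 v; rewrite /v mulKVmx // mulKVmx // in e2.
  move: e2; rewrite -/v; case: ('D_v _ z) => a b /= ->.
  by rewrite -[RHS]/(a + (wx - a), wy + 0) addr0 subrKC.
move=> v x' e; have := dE2 v; rewrite e /= => e2.
have v0 : v = 0.
  by rewrite -[v](mulKmx uJ) -[X in _ *m X](mulKmx uT) -e2 !mulmx0.
rewrite -e v0 derive0 //.
Qed.

Lemma yc_rep M (i : idx M) x g U : sm U g -> U 0 -> dom i (x, g 0) ->
  exists U' : set cV, [/\ U' 0, open U' & forall v, U' v -> yc i (rep i x g) v = g v].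
Proof.
move=> sg U0 d0; have [U' [U'0 sU' oU' dU' _]] := rep_good sg U0 d0.
by exists U'; split=> // v /dU' dv'; rewrite /yc /rep parK.
Qed.

Lemma jet_of_rep M r (i : idx M) x g U : (0 < r <= 2)%N -> sm U g -> U 0 -> dom i (x, g 0) ->
  jet_of r (rep i x g) = jetset r i (x, g 0) g.
Proof.
move=> hr sg U0 d0; have [W [W0 _ _ _ sW]] := rep_good sg U0 d0.
have gr : good (rep i x g) by exists W.
rewrite (jet_of_set hr gr (i := i)); last exact: udom_par.
rewrite /rep parK //; apply: jetset_jr.
by have [U' [U'0 oU' h]] := yc_rep sg U0 d0; apply: jr_eq oU' U'0 h.
Qed.

Lemma jetset_rep M r (i : idx M) x g U : sm U g -> U 0 -> dom i (x, g 0) ->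
  (forall w, exists v, dv v g 0 = w) -> jetset r i (x, g 0) g (rep i x g).
Proof.
move=> sg U0 d0 sj; split=> //; first exact: rep_transversal sg U0 d0 sj.
by have [U' [U'0 oU' h]] := yc_rep sg U0 d0; apply: jr_eq oU' U'0 h.
Qed.

Lemma jetset_inj M r (i : idx M) z z' g g' : dom i z -> dom i z' -> jetset r i z g !=set0 ->
  jetset r i z g = jetset r i z' g' -> z = z' /\ jr r g g'.
Proof.
move=> dz dz' [f hf] e; have [_ e1 j1] := hf; rewrite e in hf; have [_ e2 j2] := hf.
split; first by rewrite -(parK dz) -(parK dz') -e1 e2.
exact: jr_trans (jr_sym j1) j2.
Qed.

Lemma good_comp M (f : cV -> M) (h : cV -> cV) U : good f -> sm U h -> U 0 -> h 0 = 0 ->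
  good (f \o h).
Proof.
move=> [W [W0 sW]] sh U0 h0.
have oW : open W.
  rewrite openE => z Wz; have [i ui] := cover (f z).
  apply: (filterS (P := W `&` f @^-1` udom i)); first by move=> x [].
  by apply: open_nbhs_nbhs; split; [exact: sm_open (sW i)|].
have oU := open_cont (sm_open sh) (fun z Uz => sm_cont sh Uz) oW.
exists (U `&` h @^-1` W); split; first by rewrite /preimage /= h0.
move=> i.
apply: (@sm_comp _ _ _ _ _ (W `&` f @^-1` udom i) h (chart i \o f)) => //.
  by move=> z [[Uz Wz] uz].
apply: (sm_sub _ _ sh); first by move=> z [[]].
have -> : (U `&` h @^-1` W) `&` (f \o h) @^-1` udom i = U `&` h @^-1` (W `&` f @^-1` udom i).
  by apply/seteqP; split=> z [] => [[]|? []].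
exact: (open_cont (sm_open sh) (fun z Uz => sm_cont sh Uz) (sm_open (sW i))).
Qed.

Lemma good_mor M0 M (phi : M0 -> M) (f : cV -> M0) : mor phi -> good f -> good (phi \o f).
Proof.
move=> hm [W [W0 sW]]; exists W; split=> // j.
apply: sm_local => z [Wz uz]; have [i ui] := cover (f z).
have oU := open_cont (sm_open (sW i)) (fun x Ux => sm_cont (sW i) Ux) (sm_open (mor_sm hm i j)).
exists ((W `&` f @^-1` udom i) `&` (chart i \o f) @^-1` Dm phi i j); split.
- split=> //; split; first exact: chart_dom.
  by rewrite /preimage /= chartK.
- by move=> x [[Wx ux] [_]]; rewrite /preimage /= chartK.
- apply: (@sm_eq _ _ _ _ (fun x => Tm phi i j (chart i (f x)))).
    by move=> x [[Wx ux] _]; rewrite /Tm /= chartK.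
  apply: (@sm_comp _ _ _ _ _ (Dm phi i j) (chart i \o f) (Tm phi i j)) (mor_sm hm i j) => //.
    by move=> x [].
  by apply: sm_sub (sW i) => // x [].
Qed.

End Mor.

(** * Foliated connections in charts *)

Section Desc.
Context {R : realType} {p q : nat}.
Notation bmod := (bmod R p q).
Notation cV := 'cV[R]_q.
Implicit Types (M : folmfd R p q).

Lemma connected_const (T : topologicalType) (X : Type) (A : set T) (g : T -> X) :
  open A -> connected A -> (forall x, A x -> \forall y \near x, g y = g x) ->
  forall x y, A x -> A y -> g x = g y.
Proof.
move=> oA cA lc x y Ax Ay; pose B := [set z | A z /\ g z = g x].
have oB : open B.
  rewrite openE => z [Az e]; apply: filterS2 (lc z Az) (open_nbhs_nbhs (conj oA Az)) => t h At.
  by split=> //; rewrite h.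
have oB' : open [set z | A z /\ g z <> g x].
  rewrite openE => z [Az e]; apply: filterS2 (lc z Az) (open_nbhs_nbhs (conj oA Az)) => t h At.
  by split=> //; rewrite h.
have : B = A.
  apply: cA; first by exists x.
    by exists B => //; apply/seteqP; split=> z; [move=> [Az e]|move=> [_]].
  exists (~` [set z | A z /\ g z <> g x]); first exact: open_closedC.
  apply/seteqP; split=> z; first by move=> [Az e]; split=> // -[_ /(_ e)].
  by move=> [Az h]; split=> //; apply: contrapT => ne; apply: h.
by move=> e; move: Ay; rewrite -e => -[_ ->].
Qed.

Definition Vd M (i : idx M) : set cV := [set y | exists x, dom i (x, y)].

Lemma slice_open M (i : idx M) x : open [set y | dom i (x, y)].
Proof.
have -> : [set y | dom i (x, y)] = (fun y => (x, y)) @^-1` dom i by [].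
apply: open_comp (dom_open (i := i)) => y _.
by apply: sm_cont (sm_pair _ _ (sm_cst x openT) (sm_id _ openT)) I.
Qed.

Lemma slice_openx M (i : idx M) y : open [set x | dom i (x, y)].
Proof.
have -> : [set x | dom i (x, y)] = (fun x => (x, y)) @^-1` dom i by [].
apply: open_comp (dom_open (i := i)) => x _.
by apply: sm_cont (sm_pair _ _ (sm_id _ openT) (sm_cst y openT)) I.
Qed.

Lemma Vd_open M (i : idx M) : open (Vd i).
Proof.
rewrite openE => y [x dx]; apply: (filterS (P := [set y | dom i (x, y)])).
  by move=> y' d; exists x.
by apply: open_nbhs_nbhs; split; [exact: slice_open|].
Qed.

(* Plaques are connected, so a function locally constant along them descends to
   the local leaf space. *)
Definition desc M (i : idx M) (X : Type) (g : bmod -> X) (y : cV) : X :=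
  g (get [set x | dom i (x, y)], y).

Lemma descE M (i : idx M) (W : normedModType R) (g : bmod -> W) x y : findim W ->
  sm (dom i) g -> (forall z x, dom i z -> dv (x, 0) g z = 0) ->
  dom i (x, y) -> desc i g y = g (x, y).
Proof.
move=> fW sg fg d; rewrite /desc.
have dg : dom i (get [set x | dom i (x, y)], y) by apply: (@getPex _ [set x | dom i (x, y)]); exists x.
have lc x' : dom i (x', y) -> \forall t \near x', g (t, y) = g (x', y).
  by move=> dx'; apply: ((flatP _ _ _ sg).2 fg (x', y)).
by have -> := @connected_const 'cV[R]_p W _ (fun x => g (x, y)) (@slice_openx M i y) (@plaque_connected _ _ _ M i y) lc _ _ dg d.
Qed.

Lemma desc_sm M (i : idx M) (W : normedModType R) (g : bmod -> W) : findim W ->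
  sm (dom i) g -> (forall z x, dom i z -> dv (x, 0) g z = 0) -> sm (Vd i) (desc i g).
Proof.
move=> fW sg fg; apply: sm_local => y [x dx]; exists [set y | dom i (x, y)]; split=> //.
  by move=> y' d; exists x.
apply: (@sm_eq _ _ _ _ (fun y => g (x, y))); first by move=> y' d; rewrite (descE fW sg fg d).
apply: (sm_comp (U' := dom i) _ _ _ sg) => //.
by apply: sm_pair; [apply: sm_cst|apply: sm_id]; exact: slice_open.
Qed.

End Desc.

Section Fields.
Context {R : realType} {p q : nat}.
Notation bmod := (bmod R p q).
Notation cV := 'cV[R]_q.
Variable M : folmfd R p q.
Implicit Types (i j k : idx M) (m : M) (X Y : vf M) (O : set M).

Notation Di i O := (dom i `&` par i @^-1` O).
Notation Ti i j := (Tm (fun m : M => m) i j).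

Lemma vf_sm O X i : vfield O X -> sm (Di i O) (fun z => X i (par i z)).
Proof. by move=> [h _]; apply/smooth_onP; exact: h. Qed.

Lemma vf_compat O X i j m : vfield O X -> O m -> udom i m -> udom j m ->
  X j m = dv (X i m) (Ti i j) (chart i m).
Proof. by move=> [_ h] Om ui uj; rewrite dvE; exact: h. Qed.

Lemma Dm_chart i j m : udom i m -> udom j m -> Dm (fun m : M => m) i j (chart i m).
Proof. by move=> ui uj; split; [exact: chart_dom|rewrite /preimage /= chartK]. Qed.

Lemma brkE (X Y : vf M) i m : brk X Y i m =
  dv (X i m) (fun z => Y i (par i z)) (chart i m) - dv (Y i m) (fun z => X i (par i z)) (chart i m).
Proof. by rewrite /brk -!dvE. Qed.

Lemma brk0 (X Y : vf M) i m : dv (X i m) (fun z => Y i (par i z)) (chart i m) = 0 ->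
  dv (Y i m) (fun z => X i (par i z)) (chart i m) = 0 -> brk X Y i m = 0.
Proof. by rewrite brkE => -> ->; rewrite subr0. Qed.

Definition flat_vf O X := forall i z x, Di i O z -> dv (x, 0) (fun z => (X i (par i z)).2) z = 0.

(** In [[X, Y]] modulo the leaves, one term differentiates the vanishing transverse part of [Y], and
    the other differentiates that of [X] along the leaves. *)
Lemma flat_folvf O (X : vf M) : vfield O X -> flat_vf O X -> folvf O X.
Proof.
move=> vX fX; split=> // O' Y mO' sO' vY tY i m O'm ui.
have z0 : Di i O' (chart i m) by split; [exact: chart_dom|rewrite /preimage /= chartK].
have z1 : Di i O (chart i m) by case: z0 => d /sO'.
rewrite /brk -!dvE.
have pE (a b : bmod) : (a - b).2 = a.2 - b.2 by [].
rewrite pE.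
have [_ <-] := isd_snd _ _ (isd_sm (vf_sm i vY) z0).
have [_ <-] := isd_snd _ _ (isd_sm (vf_sm i vX) z1).
have -> : Y i m = ((Y i m).1, 0).
  by have := tY i m O'm ui; case: (Y i m) => a b /= ->.
rewrite fX // subr0 (derive_eq_on (g := fun=> 0) _ (mO' i) z0) ?dv_cst //.
by move=> z [dz Oz]; rewrite tY //; exact: udom_par.
Qed.

Definition cvf i (c : bmod) : vf M := fun j m => 'D_c (chart j \o par i) (chart i m).

Lemma cvfE i c j m : cvf i c j m = dv c (Ti i j) (chart i m).
Proof. by rewrite dvE. Qed.

Lemma cvf_self i c m : udom i m -> cvf i c i m = c.
Proof.
move=> ui; rewrite cvfE (derive_eq_on (g := fun z => z) _ (dom_open (i := i)) (chart_dom ui)).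
  by rewrite dvE derive_id.
by move=> z dz; rewrite /Tm parK.
Qed.

Lemma T_comp i j k z v : Dm (fun m : M => m) i j z -> Dm (fun m : M => m) i k z ->
  dv v (Ti i k) z = dv (dv v (Ti i j) z) (Ti j k) (Ti i j z).
Proof.
move=> [dz uj] [_ uk]; have sT := mor_sm (mor_id M) i j; have sT' := mor_sm (mor_id M) j k.
have oU := open_cont (sm_open sT) (fun x Dx => sm_cont sT Dx) (sm_open sT').
have Dz' : Dm (fun m : M => m) j k (Ti i j z) by apply: Dm_chart.
have E x : (Dm (fun m : M => m) i j `&` Ti i j @^-1` Dm (fun m : M => m) j k) x ->
    Ti i k x = (Ti j k \o Ti i j) x.
  by move=> [[dx ux] _]; rewrite /Tm /= chartK.
rewrite (derive_eq_on _ oU (conj (conj dz uj) Dz') E) derive_comp //.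
  exact: sm_diff sT _.
exact: sm_diff sT' Dz'.
Qed.

Lemma cvf_vfield i c : vfield (udom i) (cvf i c).
Proof.
split=> [j|j k m ui uj uk].
  apply/smooth_onP; have sT := mor_sm (mor_id M) j i.
  apply: (@sm_eq _ _ _ _ (fun z => dv c (Ti i j) (Ti j i z))).
    by move=> z _; rewrite cvfE.
  apply: (sm_comp _ _ sT (sm_derive c (mor_sm (mor_id M) i j))) => z [dz uz].
  by apply: Dm_chart => //; exact: udom_par.
rewrite !cvfE -dvE (@T_comp i j k) ?chartK //; try exact: Dm_chart.
by rewrite /Tm chartK.
Qed.

Lemma cvf_flat i c : flat_vf (udom i) (cvf i c).
Proof.
move=> j z x Dz; have sT := mor_sm (mor_id M) j i; have sT' := mor_sm (mor_id M) i j.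
have s2 : sm (Dm (fun m : M => m) i j) (T2 (fun m : M => m) i j) by apply: sm_snd.
have Dz' : Dm (fun m : M => m) i j (Ti j i z).
  by case: Dz => dz uz; apply: Dm_chart => //; exact: udom_par.
rewrite (derive_eq_on (g := dv c (T2 (fun m : M => m) i j) \o Ti j i) _ (sm_open sT) Dz); last first.
  move=> z' [dz' uz']; rewrite cvfE.
  have Dz'' : Dm (fun m : M => m) i j (Ti j i z') by apply: Dm_chart => //; exact: udom_par.
  by have [_ <-] := isd_snd _ _ (isd_sm sT' Dz'').
rewrite derive_comp; [|exact: sm_diff sT Dz|exact: sm_diff (sm_derive c s2) Dz'].
rewrite T2_dv2 //; last exact: mor_id.
have [_ <-] := isd_snd _ _ (isd_sm sT Dz).
rewrite -[X in dv (0, X)]/(dv (x, 0) (T2 (fun m : M => m) j i) z) (T2_dv (mor_id M)) // mulmx0.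
by rewrite dvE derive0.
Qed.

Lemma cvf_folvf i c : folvf (udom i) (cvf i c).
Proof. apply: flat_folvf; [exact: cvf_vfield|exact: cvf_flat]. Qed.

Lemma vfield_sub (O O' : set M) (X : vf M) : mopen O' -> O' `<=` O -> vfield O X -> vfield O' X.
Proof.
move=> mO' s vX; split=> [i|i j m /s Om]; last by have [_] := vX; apply.
apply/smooth_onP; apply: sm_sub (vf_sm i vX) => // z [dz Oz]; split=> //; exact: s.
Qed.

Lemma folvf_sub (O O' : set M) (X : vf M) : mopen O' -> O' `<=` O -> folvf O X -> folvf O' X.
Proof.
move=> mO' s [vX h]; split; first exact: vfield_sub vX.
by move=> O'' Y mO'' s'; apply: h => // m /s' /s.
Qed.

(** The bracket is tested against the coordinate fields tangent to the leaves, which exist only over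
    the chart; this is where foliated fields must be tested on smaller open sets. *)
Lemma folvf_flat O (X : vf M) : mopen O -> folvf O X -> flat_vf O X.
Proof.
move=> mO [vX h] i z x Dz; have [dz Oz] := Dz.
pose O' := O `&` udom i; have mO' : mopen O' by apply: mopenI => //; exact: udom_mopen.
have vY : vfield O' (cvf i (x, 0)).
  by apply: vfield_sub (cvf_vfield i (x, 0)) => // m [].
have ui : udom i (par i z) by exact: udom_par.
have tY : tangent_to_leaves O' (cvf i (x, 0)).
  move=> j m [Om ui'] uj; rewrite cvfE.
  have Dm' := Dm_chart ui' uj.
  have [_ <-] := isd_snd _ _ (isd_sm (mor_sm (mor_id M) i j) Dm').
  by rewrite -[LHS]/(dv (x, 0) (T2 (fun m : M => m) i j) _) (T2_dv (mor_id M)) // mulmx0.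
have := h O' _ mO' (fun m => @proj1 _ _) vY tY i (par i z) (conj Oz ui) ui.
rewrite /brk -!dvE cvf_self // parK //.
have pE (a b : bmod) : (a - b).2 = a.2 - b.2 by [].
rewrite pE.
rewrite (derive_eq_on (g := fun=> (x, 0)) (X i (par i z)) (dom_open (i := i)) dz); last first.
  by move=> z' dz'; rewrite cvf_self //; exact: udom_par.
have [_ <-] := isd_snd _ _ (isd_sm (vf_sm i vX) Dz).
by rewrite dv_cst sub0r => /eqP; rewrite oppr_eq0 => /eqP.
Qed.

Lemma folvf_add O (X Y : vf M) : mopen O -> folvf O X -> folvf O Y -> folvf O (addvf X Y).
Proof.
move=> mO fX fY; have [vX _] := fX; have [vY _] := fY; apply: flat_folvf.
  split=> [i|i j m Om ui uj].
    by apply/smooth_onP; apply: sm_add; exact: vf_sm.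
  rewrite /addvf (vf_compat vX Om ui uj) (vf_compat vY Om ui uj) -dvE.
  by rewrite derive_dirD //; apply: (sm_diff (mor_sm (mor_id M) i j)); exact: Dm_chart.
move=> i z x Dz.
have [_ e] := isd_add (isd_snd _ _ (isd_sm (vf_sm i vX) Dz)) (isd_snd _ _ (isd_sm (vf_sm i vY) Dz)).
have {}e : dv (x, 0) (fun z => (addvf X Y i (par i z)).2) z = _ := e (x, 0).
rewrite e; have [_ <-] := isd_snd _ _ (isd_sm (vf_sm i vX) Dz).
have [_ <-] := isd_snd _ _ (isd_sm (vf_sm i vY) Dz).
by rewrite (folvf_flat mO fX x Dz) (folvf_flat mO fY x Dz) addr0.
Qed.

Lemma basic_sm O f i : basic O f -> sm (Di i O) (f \o par i : bmod -> R).
Proof. by move=> /(_ i)[/smooth_onP]. Qed.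

Lemma basic_flat O f i z x : basic O f -> Di i O z -> dv (x, 0) (f \o par i : bmod -> R) z = 0.
Proof.
move=> bf Dz; have s := basic_sm i bf; have [_ h] := bf i.
exact: ((flatP _ _ _ s).1 h).
Qed.

(** On a set contained in one chart it is enough to check the conditions there: changes of chart
    send leaf directions to leaf directions. *)
Lemma basic_chart O (f : M -> R) i : mopen O -> O `<=` udom i ->
  sm (Di i O) (f \o par i : bmod -> R) ->
  (forall z x, Di i O z -> dv (x, 0) (f \o par i : bmod -> R) z = 0) -> basic O f.
Proof.
move=> mO sO sf ff j; have sT := mor_sm (mor_id M) j i.
have sD : Di j O `<=` Dm (fun m : M => m) j i by move=> z [dz Oz]; split=> //; exact: sO.
have TD z : Di j O z -> Di i O (Ti j i z).
  move=> Dz; have [dz uz] := sD z Dz; split; first exact: chart_dom.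
  by rewrite /preimage /Tm /= chartK //; case: Dz.
have E z : Di j O z -> (f \o par j) z = ((f \o par i) \o Ti j i) z.
  by move=> /sD[dz uz]; rewrite /Tm /= chartK.
have sfj : sm (Di j O) (f \o par j : bmod -> R).
  apply: sm_eq; first by move=> z Dz; apply/esym; exact: E.
  by apply: sm_comp TD _ sf => //; exact: sm_sub sT.
split; first exact/smooth_onP.
apply/(flatP _ _ _ sfj) => z x Dz.
rewrite (derive_eq_on _ (mO j) Dz E) derive_comp; [|exact: sm_diff sT (sD z Dz)|exact: sm_diff sf (TD z Dz)].
have -> : dv (x, 0) (Ti j i) z = ((dv (x, 0) (Ti j i) z).1, 0).
  have : (dv (x, 0) (Ti j i) z).2 = 0.
    have [_ <-] := isd_snd _ _ (isd_sm sT (sD z Dz)).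
    by rewrite -[LHS]/(dv (x, 0) (T2 (fun m : M => m) j i) _) (T2_dv (mor_id M)) ?mulmx0 //; exact: sD.
  by case: (dv _ _ _) => a b /= ->.
by rewrite ff //; exact: TD.
Qed.

Lemma folvf_scale O f (X : vf M) : mopen O -> basic O f -> folvf O X -> folvf O (scalevf f X).
Proof.
move=> mO bf fX; have [vX _] := fX; apply: flat_folvf.
  split=> [i|i j m Om ui uj].
    apply/smooth_onP; apply: (sm_scale (k := f \o par i)); first exact: basic_sm.
    exact: vf_sm.
  rewrite /scalevf (vf_compat vX Om ui uj) -dvE.
  by rewrite derive_dirZ //; apply: (sm_diff (mor_sm (mor_id M) i j)); exact: Dm_chart.
move=> i z x Dz.
have [_ e] := isd_scale (isd_sm (basic_sm i bf) Dz) (isd_snd _ _ (isd_sm (vf_sm i vX) Dz)).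
rewrite /scalevf /=; have := e (x, 0); rewrite /= => ->.
have [_ <-] := isd_snd _ _ (isd_sm (vf_sm i vX) Dz).
by rewrite (folvf_flat mO fX x Dz) (basic_flat _ bf) // scaler0 scale0r addr0.
Qed.

Lemma folvf0 O : mopen O -> folvf O (fun _ _ => 0).
Proof.
move=> mO; apply: flat_folvf.
  split=> [i|i j m Om ui uj]; first by apply/smooth_onP; apply: sm_cst; exact: mO.
  by rewrite derive0.
by move=> i z x Dz; rewrite dv_cst.
Qed.

Definition sumvf n (F : 'I_n -> vf M) : vf M := fun i m => \sum_a F a i m.

Lemma sumvfS n (F : 'I_n.+1 -> vf M) : sumvf F = addvf (F ord0) (sumvf (fun a => F (lift ord0 a))).
Proof. by apply/funext => i; apply/funext => m; rewrite /sumvf big_ord_recl. Qed.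

Lemma sumvf0 (F : 'I_0 -> vf M) : sumvf F = fun _ _ => 0.
Proof. by apply/funext => i; apply/funext => m; rewrite /sumvf big_ord0. Qed.

Lemma folvf_sum O n (F : 'I_n -> vf M) : mopen O -> (forall a, folvf O (F a)) -> folvf O (sumvf F).
Proof.
move=> mO; elim: n F => [|n IH] F h; first by rewrite sumvf0; exact: folvf0.
by rewrite sumvfS; apply: folvf_add => //; exact: IH.
Qed.

Section Conn.
Variable nab : conn M.
Hypothesis hn : is_folconn nab.

Lemma nab_suml O n (F : 'I_n -> vf M) (Y : vf M) i m : mopen O -> (forall a, folvf O (F a)) -> folvf O Y ->
  O m -> udom i m -> (nab O (sumvf F) Y i m).2 = \sum_a (nab O (F a) Y i m).2.
Proof.
move=> mO hF hY Om ui; elim: n F hF => [|n IH] F hF.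
  (* Additivity at [0 + 0] gives [nab 0 Y = 0]. *)
  rewrite sumvf0 big_ord0; have := nab_addl hn mO (folvf0 mO) (folvf0 mO) hY Om ui.
  have -> : addvf (fun _ _ => 0) (fun _ _ => 0) = (fun _ _ => 0) :> vf M.
    by apply/funext => ?; apply/funext => ?; rewrite /addvf addr0.
  rewrite /addvf; set a := nab _ _ _ _ _; rewrite -[(a + a).2]/(a.2 + a.2) => e.
  by apply: (addrI a.2); rewrite addr0.
set G := fun a => F (lift ord0 a); have hG a : folvf O (G a) := hF _.
have -> : (nab O (sumvf F) Y i m).2 = (nab O (F ord0) Y i m).2 + (nab O (sumvf G) Y i m).2.
  by rewrite sumvfS; have := nab_addl hn mO (hF ord0) (folvf_sum mO hG) hY Om ui; exact.
by rewrite big_ord_recl; congr (_ + _); exact: IH hG.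
Qed.

Lemma nab_sumr O n (F : 'I_n -> vf M) (Y : vf M) i m : mopen O -> (forall a, folvf O (F a)) -> folvf O Y ->
  O m -> udom i m -> (nab O Y (sumvf F) i m).2 = \sum_a (nab O Y (F a) i m).2.
Proof.
move=> mO hF hY Om ui; elim: n F hF => [|n IH] F hF.
  rewrite sumvf0 big_ord0; have := nab_addr hn mO hY (folvf0 mO) (folvf0 mO) Om ui.
  have -> : addvf (fun _ _ => 0) (fun _ _ => 0) = (fun _ _ => 0) :> vf M.
    by apply/funext => ?; apply/funext => ?; rewrite /addvf addr0.
  rewrite /addvf; set a := nab _ _ _ _ _; rewrite -[(a + a).2]/(a.2 + a.2) => e.
  by apply: (addrI a.2); rewrite addr0.
set G := fun a => F (lift ord0 a); have hG a : folvf O (G a) := hF _.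
have -> : (nab O Y (sumvf F) i m).2 = (nab O Y (F ord0) i m).2 + (nab O Y (sumvf G) i m).2.
  by rewrite sumvfS; have := nab_addr hn mO hY (hF ord0) (folvf_sum mO hG) Om ui; exact.
by rewrite big_ord_recl; congr (_ + _); exact: IH hG.
Qed.

Lemma dy_folvf i a : folvf (udom i) (dyvf i a).
Proof. exact: cvf_folvf. Qed.

Lemma dy_self i a m : udom i m -> dyvf i a i m = (0, evec a).
Proof. exact: cvf_self. Qed.

Lemma nab_dy O i a b m : mopen O -> O `<=` udom i -> O m ->
  (nab O (dyvf i a) (dyvf i b) i m).2 = \col_c christoffel nab i m c a b.
Proof.
move=> mO sO Om.
rewrite (nab_restr hn (udom_mopen (i:=i)) mO sO (dy_folvf i a) (dy_folvf i b) Om (sO m Om)).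
by apply/matrixP => c d; rewrite ord1 !mxE.
Qed.

Definition chris i (z : bmod) (c a b : 'I_q) : R := christoffel nab i (par i z) c a b.

Lemma chris_sm i c a b : sm (dom i) (fun z => chris i z c a b).
Proof.
have [v _] := nab_fol hn (udom_mopen (i:=i)) (dy_folvf i a) (dy_folvf i b).
have := vf_sm i v; have -> : dom i `&` par i @^-1` udom i = dom i.
  by apply/seteqP; split=> z; [move=> []|move=> dz; split=> //; exact: udom_par].
by move=> h; apply: sm_coord; apply: sm_snd h.
Qed.

Lemma chris_flat i c a b z x : dom i z -> dv (x, 0) (fun z => chris i z c a b) z = 0.
Proof.
move=> dz; have fv := nab_fol hn (udom_mopen (i:=i)) (dy_folvf i a) (dy_folvf i b).
have Dz : Di i (udom i) z by split=> //; exact: udom_par.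
have := folvf_flat (udom_mopen (i:=i)) fv x Dz.
have [_ e] := isd_coord c 0 (isd_snd _ _ (isd_sm (vf_sm i fv.1) Dz)).
have [_ E] := isd_snd _ _ (isd_sm (vf_sm i fv.1) Dz).
have {}e : dv (x, 0) (fun z => chris i z c a b) z = _ := e (x, 0).
by rewrite e -E => ->; rewrite mxE.
Qed.

Lemma nab_sym O (X Y : vf M) i m : mopen O -> folvf O X -> folvf O Y -> O m -> udom i m ->
  brk X Y i m = 0 -> (nab O X Y i m).2 = (nab O Y X i m).2.
Proof.
move=> mO hX hY Om ui b0; have := nab_torsion hn mO hX hY Om ui.
by rewrite /addvf b0 addr0.
Qed.

(** Coordinate fields commute because their components in their own chart are constant. *)
Lemma chris_sym i c a b m : udom i m -> christoffel nab i m c a b = christoffel nab i m c b a.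
Proof.
move=> ui; suff E : brk (dyvf i a) (dyvf i b) i m = 0.
  have H := nab_sym (udom_mopen (i:=i)) (dy_folvf i a) (dy_folvf i b) ui ui E.
  exact (f_equal (fun v : cV => v c 0) H).
have dz := chart_dom ui; have oD := dom_open (i := i).
have H b' v : dv v (fun z => dyvf i b' i (par i z)) (chart i m) = 0.
  rewrite (derive_eq_on (g := fun=> (0, evec b')) _ oD dz) ?dv_cst // => z d.
  by rewrite dy_self //; exact: udom_par.
exact: brk0 (H b _) (H a _).
Qed.

Lemma Gam_lin1 i m u : linear (Gam nab i m u).
Proof.
move=> k v w; apply/matrixP => c d; rewrite !mxE mulr_sumr -big_split; apply: eq_bigr => a _ /=.
by rewrite mulr_sumr -big_split; apply: eq_bigr => b _ /=; rewrite !mxE; ring.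
Qed.

Lemma Gam_lin2 i m v : linear (fun u => Gam nab i m u v).
Proof.
move=> k u w; apply/matrixP => c d; rewrite !mxE mulr_sumr -big_split; apply: eq_bigr => a _ /=.
by rewrite mulr_sumr -big_split; apply: eq_bigr => b _ /=; rewrite !mxE; ring.
Qed.

Lemma Gam_sym i m u v : udom i m -> Gam nab i m u v = Gam nab i m v u.
Proof.
move=> ui; apply/matrixP => c d; rewrite !mxE exchange_big /=; apply: eq_bigr => a _.
by apply: eq_bigr => b _; rewrite (chris_sym c b a ui); ring.
Qed.

Lemma Gam_evec i m a b : Gam nab i m (evec a) (evec b) = \col_c christoffel nab i m c a b.
Proof.
apply/matrixP => c d; rewrite !mxE (bigD1 a) //= (bigD1 b) //= !big1 ?addr0.
- by rewrite !mxE !eqxx !mulr1.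
- by move=> k nk; apply: big1 => l _; rewrite !mxE (negbTE nk) mulr0 mul0r.
- by move=> l nl; rewrite !mxE (negbTE nl) mulr0.
Qed.

Lemma Gam_sm i u v : sm (dom i) (fun z => Gam nab i (par i z) u v).
Proof.
have oD := dom_open (i := i).
apply: sm_mx => // c d; apply: (@sm_eq _ _ _ _ (fun z => \sum_a \sum_b chris i z c a b * u a 0 * v b 0)).
  by move=> z _; rewrite mxE.
apply: sm_sum => // a; apply: sm_sum => // b; apply: sm_mul; last exact: sm_cst.
by apply: sm_mul; [exact: chris_sm|exact: sm_cst].
Qed.

Lemma Gam_flat i u v z x : dom i z -> dv (x, 0) (fun z => Gam nab i (par i z) u v) z = 0.
Proof.
move=> dz; have h := isd_sm (Gam_sm i u v) dz; apply/matrixP => c d; rewrite ord1.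
have [_ <-] := isd_coord c 0 h.
rewrite (derive_eq_on (g := fun z => \sum_a \sum_b chris i z c a b * u a 0 * v b 0) _ (dom_open (i := i)) dz); last first.
  by move=> z' _; rewrite mxE.
have hc a b := isd_mul (isd_mul (isd_sm (chris_sm i c a b) dz) (isd_cst (u a 0) z)) (isd_cst (v b 0) z).
have [_ ->] := isd_sum (fun a => isd_sum (fun b => hc a b)).
rewrite mxE big1 // => a _; rewrite big1 // => b _.
by rewrite chris_flat // !mulr0 !mul0r !addr0 mul0r.
Qed.

Lemma NGamE i x y u v : dom i (x, y) -> NGam nab i y u v = Gam nab i (par i (x, y)) u v.
Proof.
move=> d; exact: (descE (g := fun z => Gam nab i (par i z) u v) _ (Gam_sm i u v) (@Gam_flat i u v) d).
Qed.

Lemma NGam_chrsym i : chrsym (Vd i) (NGam nab i).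
Proof.
split; first exact: Vd_open.
- by move=> y v; exact: Gam_lin1.
- by move=> y v w [x d]; rewrite !(NGamE _ _ d) Gam_sym //; exact: udom_par.
- move=> v w; exact: (desc_sm (g := fun z => Gam nab i (par i z) v w) _ (Gam_sm i v w) (@Gam_flat i v w)).
Qed.

End Conn.
End Fields.

(** * Transformation law of the Christoffel symbols *)

Section Rel.
Context {R : realType} {p q : nat}.
Notation bmod := (bmod R p q).
Notation cV := 'cV[R]_q.
Variables (M0 M : folmfd R p q) (phi : M0 -> M).
Hypothesis hphi : mor phi.

Lemma bilin_ext (f g : cV -> cV -> cV) : (forall u, linear (f u)) ->
  (forall v, linear (f^~ v)) -> (forall u, linear (g u)) -> (forall v, linear (g^~ v)) ->
  (forall c d, f (evec c) (evec d) = g (evec c) (evec d)) -> forall u v, f u v = g u v.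
Proof.
move=> f1 f2 g1 g2 h u v; rewrite [u]cV_delta.
have [_ _ fZ _ fs] := linP (f2 v); have [_ _ gZ _ gs] := linP (g2 v).
rewrite fs gs; apply: eq_bigr => c _; rewrite fZ gZ [v]cV_delta; congr (_ *: _).
have [_ _ fZ' _ fs'] := linP (f1 (evec c)); have [_ _ gZ' _ gs'] := linP (g1 (evec c)).
by rewrite fs' gs'; apply: eq_bigr => d _; rewrite fZ' gZ' h.
Qed.

Lemma Jt_sm i j : sm (Dm phi i j) (Jt phi i j).
Proof.
have h := sm_open (mor_sm hphi i j); apply: sm_mx => // a b.
apply: (@sm_eq _ _ _ _ (fun z => dv (0, evec b) (T2 phi i j) z a 0)).
  by move=> z _; rewrite mxE.
by apply: sm_coord; apply: sm_derive; apply: sm_snd; exact: mor_sm.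
Qed.

Lemma Jt_flat i j z x : Dm phi i j z -> dv (x, 0) (Jt phi i j) z = 0.
Proof.
move=> Dz; apply/matrixP => a b; rewrite [RHS]mxE.
have [_ <-] := isd_coord a b (isd_sm (Jt_sm i j) Dz).
have s2 : sm (Dm phi i j) (T2 phi i j) by apply: sm_snd; exact: mor_sm.
rewrite (derive_eq_on (g := fun z => dv (0, evec b) (T2 phi i j) z a 0) _ (sm_open s2) Dz); last first.
  by move=> z' _; rewrite mxE.
have [_ ->] := isd_coord a 0 (isd_sm (sm_derive (0, evec b) s2) Dz).
by rewrite T2_dv2 //= dvE derive0 mxE.
Qed.

Lemma dv_Jt i j z u v : Dm phi i j z ->
  dv u (Jt phi i j) z *m v = dv u (dv (0, v) (T2 phi i j)) z.
Proof.
move=> Dz; have h := isd_sm (Jt_sm i j) Dz.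
have s2 : sm (Dm phi i j) (T2 phi i j) by apply: sm_snd; exact: mor_sm.
rewrite (derive_eq_on (g := fun z => Jt phi i j z *m v) _ (sm_open s2) Dz); last first.
  by move=> z' Dz'; rewrite T2_dv.
by have [_ ->] := isd_mulmx h (isd_cst v z); rewrite mulmx0 addr0.
Qed.

Lemma Jt_trans i i' j j' m (v : cV) : udom i m -> udom i' m -> udom j (phi m) -> udom j' (phi m) ->
  Jt phi i' j' (chart i' m) *m (Jt (fun m : M0 => m) i i' (chart i m) *m v) =
  Jt (fun m : M => m) j j' (chart j (phi m)) *m (Jt phi i j (chart i m) *m v).
Proof.
move=> ui ui' uj uj'.
have D1 : Dm (fun m : M0 => m) i i' (chart i m) by exact: Dm_chart.
have D2 : Dm phi i j (chart i m) by split; [exact: chart_dom|rewrite /preimage /= chartK].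
have T1 : Tm (fun m : M0 => m) i i' (chart i m) = chart i' m by rewrite /Tm chartK.
have T2 : Tm phi i j (chart i m) = chart j (phi m) by rewrite /Tm chartK.
have D1' : Dm phi i' j' (chart i' m) by split; [exact: chart_dom|rewrite /preimage /= chartK].
have D2' : Dm (fun m : M => m) j j' (chart j (phi m)) by exact: Dm_chart.
have := Jt_comp (mor_id M0) hphi D1 (eq_ind_r _ D1' T1) v; rewrite T1 => <-.
by have := Jt_comp hphi (mor_id M) D2 (eq_ind_r _ D2' T2) v; rewrite T2 => <-.
Qed.

Lemma relNP O (X : vf M0) (X' : vf M) : relN phi O X X' <->
  forall i j m, O m -> udom i m -> udom j (phi m) ->
    (X' j (phi m)).2 = Jt phi i j (chart i m) *m (X i m).2.
Proof.
have E i j m v : udom i m -> udom j (phi m) ->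
    ('D_v (chart j \o phi \o par i) (chart i m)).2 = Jt phi i j (chart i m) *m v.2.
  move=> ui uj; have Dz : Dm phi i j (chart i m).
    by split; [exact: chart_dom|rewrite /preimage /= chartK].
  rewrite -dvE; have [_ <-] := isd_snd _ _ (isd_sm (mor_sm hphi i j) Dz).
  by rewrite -[LHS]/(dv v (T2 phi i j) (chart i m)) T2_dv.
by split=> h i j m Om ui uj; [rewrite (h i j m) // E|rewrite (h i j m) // -E].
Qed.

Section Pull.
Variables (nab0 : conn M0) (nab : conn M).
Hypotheses (hn0 : is_folconn nab0) (hn : is_folconn nab) (pc : is_pull_conn phi nab nab0).
Variables (i : idx M0) (j : idx M).

Let O0 : set M0 := udom i `&` phi @^-1` udom j.
Let mO0 : mopen O0.
Proof. by apply: mopenI; [exact: udom_mopen|apply: mor_preim => //; exact: udom_mopen]. Qed.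
Let Bz (z : bmod) : 'M[R]_q := invmx (Jt phi i j z).
Let B a c (m : M0) : R := Bz (chart i m) a c.
(** A foliated field on [M0] that is [phi]-related, modulo the leaves, to the coordinate field
    [d/dy^c] of chart [j]: its components are a column of the inverse transverse Jacobian. The
    hypothesis on the pullback connection can be applied to such related fields. *)
Let X c : vf M0 := sumvf (fun a => scalevf (B a c) (dyvf i a)).

Let DO0 z : (dom i `&` par i @^-1` O0) z <-> Dm phi i j z.
Proof. by split=> [[d [_ u]]|[d u]]; split=> //; split=> //; exact: udom_par. Qed.

Let unitJ z : Dm phi i j z -> Jt phi i j z \in unitmx := mor_unit hphi (z := z).

Let Bz_isd z : Dm phi i j z -> isd Bz z (fun v => - (Bz z *m dv v (Jt phi i j) z *m Bz z)).
Proof. move=> Dz; exact: (isd_inv (Jt_sm i j) unitJ Dz (isd_sm (Jt_sm i j) Dz)). Qed.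

Let B_basic a c : basic O0 (B a c).
Proof.
have sB : sm (Dm phi i j) (fun z => Bz z a c) by apply: sm_coord; exact: sm_invmx (Jt_sm i j) unitJ.
have E z : (dom i `&` par i @^-1` O0) z -> Bz z a c = (B a c \o par i) z.
  by move=> [dz _]; rewrite /B /= parK.
apply: (basic_chart (i := i) mO0) => [m []//||z x Dz].
  apply: (sm_eq E); apply: sm_sub sB; first by move=> z /DO0.
  exact: mO0.
have Dz' := (DO0 z).1 Dz.
rewrite -(derive_eq_on _ (@mO0 i) Dz E); have [_ ->] := isd_coord a c (Bz_isd Dz').
by rewrite Jt_flat // mulmx0 mul0mx oppr0 mxE.
Qed.

Let X_fol c : folvf O0 (X c).
Proof.
apply: (folvf_sum mO0) => a; apply: (folvf_scale mO0 (B_basic a c)).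
by apply: (folvf_sub mO0 _ (dy_folvf i a)) => m [].
Qed.

Lemma dyvfE (N : folmfd R p q) (k l : idx N) a m : udom k m -> udom l m ->
  (dyvf k a l m).2 = Jt (fun m : N => m) k l (chart k m) *m evec a.
Proof.
move=> uk ul; have Dz := Dm_chart uk ul; have -> : dyvf k a l m = cvf k (0, evec a) l m by [].
rewrite cvfE; have [_ <-] := isd_snd _ _ (isd_sm (mor_sm (mor_id N) k l) Dz).
exact: (T2_dv (mor_id N) (0, evec a) Dz).
Qed.

Let XE c l m : O0 m -> udom l m -> (X c l m).2 =
  Jt (fun m : M0 => m) i l (chart i m) *m (Bz (chart i m) *m evec c).
Proof.
move=> [ui _] ul; have sndE (n : nat) (F : 'I_n -> bmod) : (\sum_a F a).2 = \sum_a (F a).2.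
  by elim/big_rec2: _ => // a y1 y2 _ <-.
rewrite /X /sumvf sndE [Bz _ *m _]cV_delta mulmx_sumr; apply: eq_bigr => a _.
rewrite /scalevf -[LHS]/(B a c m *: (dyvf i a l m).2) dyvfE // -scalemxAr.
congr (_ *: _); rewrite /B !mxE (bigD1 c) //= !mxE !eqxx mulr1 big1 ?addr0 // => b nb.
by rewrite !mxE (negbTE nb) mulr0.
Qed.

Let X_rel c : relN phi O0 (X c) (dyvf j c).
Proof.
apply/relNP => k l m Om uk ul; have [ui uj] := Om.
have Di : Dm phi i j (chart i m) by split; [exact: chart_dom|rewrite /preimage /= chartK].
have -> := dyvfE c uj ul; have -> := XE c Om uk; rewrite (Jt_trans _ ui uk uj ul).
by rewrite mulKVmx //; exact: unitJ.
Qed.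

Let lieB a b d z : Dm phi i j z ->
  lie (dyvf i a) (B b d) i (par i z) = dv (0, evec a) (fun z => Bz z *m evec d) z b 0.
Proof.
move=> Dz; have [dz _] := Dz; have Dz' := (DO0 z).2 Dz.
have {1}<- := dy_self a (udom_par dz).
rewrite /lie parK // -dvE.
have K := isd_mulmx (Bz_isd Dz) (isd_cst (evec d) z).
have [_ ->] := K; have [_ <-] := isd_coord b 0 K.
apply: (derive_eq_on _ (@mO0 i) Dz') => x [dx _].
rewrite /B /= parK // mxE (bigD1 d) //= !mxE !eqxx mulr1 big1 ?addr0 // => e ne.
by rewrite !mxE (negbTE ne) mulr0.
Qed.

Let nabX c d z : Dm phi i j z -> (nab0 O0 (X c) (X d) i (par i z)).2 =
  dv (0, Bz z *m evec c) (fun z => Bz z *m evec d) z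
  + Gam nab0 i (par i z) (Bz z *m evec c) (Bz z *m evec d).
Proof.
move=> Dz; have [dz uz] := Dz; have ui := udom_par dz.
have Om : O0 (par i z) by have [] := (DO0 z).2 Dz.
have fO a : folvf O0 (dyvf i a) by apply: (folvf_sub mO0 _ (dy_folvf i a)) => m [].
have fS a e : folvf O0 (scalevf (B a e) (dyvf i a)) by exact: folvf_scale (fO a).
have BE a e : B a e (par i z) = (Bz z *m evec e) a 0.
  rewrite /B parK // mxE (bigD1 e) //= !mxE !eqxx mulr1 big1 ?addr0 // => b ne.
  by rewrite !mxE (negbTE ne) mulr0.
have K := isd_mulmx (Bz_isd Dz) (isd_cst (evec d) z).
rewrite (nab_suml hn0 mO0 (fun a => fS a c) (X_fol d) Om ui).
set F := fun v : cV => dv (0, v) (fun z => Bz z *m evec d) z + Gam nab0 i (par i z) v (Bz z *m evec d).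
have FL : linear F.
  move=> k v w; rewrite /F (Gam_lin2 _ _ _ _ k v w).
  have -> : (0, k *: v + w) = k *: (0, v) + (0, w) :> bmod.
    by rewrite -[RHS]/(k *: 0 + 0, k *: v + w) scaler0 addr0.
  rewrite (derive_dir K.1) // scalerDr addrACA //.
rewrite -[RHS]/(F (Bz z *m evec c)) [Bz z *m evec c in RHS]cV_delta.
have [_ _ FZ _ Fs] := linP FL; rewrite Fs; apply: eq_bigr => a _; rewrite FZ.
have -> : (nab0 O0 (scalevf (B a c) (dyvf i a)) (X d) i (par i z)).2 =
    B a c (par i z) *: (nab0 O0 (dyvf i a) (X d) i (par i z)).2.
  exact: (nab_scalel hn0 mO0 (B_basic a c) (fO a) (X_fol d) Om ui).
rewrite BE; congr (_ *: _).
rewrite (nab_sumr hn0 mO0 (fun b => fS b d) (fO a) Om ui).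
rewrite /F [dv _ _ _]cV_delta [Bz z *m evec d]cV_delta.
have [_ _ GZ _ Gs] := linP (Gam_lin1 nab0 i (par i z) (evec a)).
rewrite Gs -big_split; apply: eq_bigr => b _ /=; rewrite GZ Gam_evec.
have -> : (nab0 O0 (dyvf i a) (scalevf (B b d) (dyvf i b)) i (par i z)).2 =
    lie (dyvf i a) (B b d) i (par i z) *: (dyvf i b i (par i z)).2
    + B b d (par i z) *: (nab0 O0 (dyvf i a) (dyvf i b) i (par i z)).2.
  exact: (nab_leibniz hn0 mO0 (B_basic b d) (fO a) (fO b) Om ui).
have sO : O0 `<=` udom i by move=> m [].
by rewrite lieB // BE dy_self // (nab_dy hn0 a b mO0 sO Om).
Qed.

Let Gam_basis c d z : Dm phi i j z ->
  Gam nab j (phi (par i z)) (evec c) (evec d) = Jt phi i j z *m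
   (dv (0, Bz z *m evec c) (fun z => Bz z *m evec d) z
   + Gam nab0 i (par i z) (Bz z *m evec c) (Bz z *m evec d)).
Proof.
move=> Dz; have [dz uz] := Dz; have Om : O0 (par i z) by have [] := (DO0 z).2 Dz.
have sO : phi @` O0 `<=` udom j by move=> _ [m [_ h] <-].
have := pc mO0 (@udom_mopen _ _ _ M j) sO (X_fol c) (X_fol d) (dy_folvf j c) (dy_folvf j d) (@X_rel c) (@X_rel d).
move=> /relNP/(_ i j (par i z) Om (udom_par dz) uz).
by rewrite parK // -nabX // => <-; rewrite Gam_evec; apply/matrixP => e f; rewrite ord1 mxE.
Qed.

(** By [Gam_basis], the symbols of [nab] are those of [nab0] plus the derivative of the inverse
    Jacobian. Expanding this derivative as [- J^-1 dJ J^-1] brings in the second derivatives of the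
    transverse map. *)
Lemma Gam_rel z (u v : cV) : Dm phi i j z ->
  Jt phi i j z *m Gam nab0 i (par i z) u v =
  Gam nab j (phi (par i z)) (Jt phi i j z *m u) (Jt phi i j z *m v)
  + dv (0, u) (dv (0, v) (T2 phi i j)) z.
Proof.
move=> Dz; have uJ := unitJ Dz; have KB := Bz_isd Dz.
pose D w := dv ((0, w) : bmod) (Jt phi i j) z.
have DL : linear D.
  move=> k v' w; rewrite /D.
  have -> : (0, k *: v' + w) = k *: (0, v') + (0, w) :> bmod.
    by rewrite -[RHS]/(k *: 0 + 0, k *: v' + w) scaler0 addr0.
  by rewrite (derive_dir (sm_diff (Jt_sm i j) Dz)).
have E u' v' : Gam nab j (phi (par i z)) u' v' = Jt phi i j z *m
   (- (Bz z *m D (Bz z *m u') *m Bz z) *m v'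
   + Gam nab0 i (par i z) (Bz z *m u') (Bz z *m v')).
  move: u' v'; apply: bilin_ext.
  - exact: Gam_lin1.
  - exact: Gam_lin2.
  - move=> u' k x y; rewrite !(mulmxDr _ (k *: x) y) -!scalemxAr Gam_lin1.
    by rewrite addrACA -scalerDr mulmxDr -scalemxAr.
  - move=> v' k x y; rewrite (mulmxDr _ (k *: x) y) -scalemxAr DL Gam_lin2.
    move: (D (Bz z *m x)) => Dx; move: (D (Bz z *m y)) => Dy.
    rewrite (mulmxDr (Bz z)) (mulmxDl (Bz z *m _)) opprD (mulmxDl (- _)).
    rewrite -(scalemxAr k (Bz z)) -(scalemxAl k (Bz z *m Dx)) -scalerN -(scalemxAl k (- _)).
    by rewrite addrACA -scalerDr mulmxDr -scalemxAr.
  move=> c d; rewrite Gam_basis //; congr (_ *m (_ + _)).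
  have [_ ->] := isd_mulmx KB (isd_cst (evec d) z).
  by rewrite mulmx0 addr0.
rewrite E -dv_Jt // -/(D u) /Bz !mulKmx // mulmxDr addrC addrA -[LHS]add0r; congr (_ + _).
by rewrite mulNmx mulmxN -!mulmxA mulKVmx // mulKmx // subrr.
Qed.

End Pull.
End Rel.

(** * The bundle of projective frames in coordinates *)

Section Psi.
Context {R : realType} {p q : nat}.
Notation bmod := (bmod R p q).
Notation cV := 'cV[R]_q.
Notation slq := (slq R q).
Notation pm := (pmod R p q).

Lemma hmap_norm (A : 'M[R]_q) al a : a != 0 -> hmap A al a = hmap (a^-1 *: A) (a^-1 *: al) 1.
Proof.
move=> a0; apply/funext => z; rewrite /hmap -!scalemxAl scalerA [in RHS]mxE.
by congr (_ *: _); rewrite -invfM; congr (_^-1); field.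
Qed.

(** Homographies compose like matrices modulo scalars. The junk value of the inverse at 0 confines
    the identity to the domain of the inner one. *)
Lemma hmap_Rh (A B : 'M[R]_q) (al be : 'rV[R]_q) b z : b != 0 -> Hdom be b z ->
  hmap A al 1 (hmap B be b z) = hmap (b^-1 *: (A *m B)) (b^-1 *: (al *m B + be)) 1 z.
Proof.
rewrite /Hdom /= => b0; set d := (be *m z) 0 0 + b => d0.
rewrite /hmap -/d -!scalemxAr -!scalemxAl scalerA mulmxA scalerA mulmxDl mxE.
have -> : (b^-1 *: (al *m B *m z + be *m z)) 0 0 + 1 = b^-1 * d + b^-1 * (al *m B *m z) 0 0.
  by rewrite mxE [(_ + be *m z) 0 0]mxE /d; field.
rewrite mulmxA; congr (_ *: _); move: ((al *m B *m z) 0 0) => x.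
have -> : d^-1 * x + 1 = d^-1 * (x + d) by field.
have -> : b^-1 * d + b^-1 * x = b^-1 * (x + d) by ring.
by rewrite !invfM !invrK [d * _]mulrC mulfK // [b * _]mulrC mulfK.
Qed.

Variable M : folmfd R p q.
Implicit Types (i j : idx M).

Section One.
Variable nab : conn M.
Hypothesis hn : is_folconn nab.
Let hG i := NGam_chrsym hn i.

Lemma pdom_V i O w : Pdom i O w -> Vd i w.2.1.1.
Proof. by move=> [d _ _]; exists w.1. Qed.

Lemma pdom_T i O w : Pdom i O w -> Pdom i setT w.
Proof. by move=> [d _ u]; split. Qed.

Lemma frame_inh r i w : dom i (pbase w) -> w.2.1.2 \in unitmx ->
  jetset r i (pbase w) (frame2 (NGam nab i) w.2) (rep i w.1 (frame2 (NGam nab i) w.2)).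
Proof.
move=> d u; have Vw : Vd i w.2.1.1 by exists w.1.
have e := frame2_0 (hG i) w.2; rewrite /pbase -e.
apply: (jetset_rep r (frame2_sm (hG i) Vw)); first exact: Hdom0 (oner_neq0 _).
  by rewrite e.
by move=> v; exists (invmx w.2.1.2 *m v); rewrite (frame2_jet (hG i) _ v Vw).1 mulKVmx.
Qed.

Lemma pframe_jet i z : dom i z -> jet_of 2 (pframe nab i z) =
  jetset 2 i z (frame2 (NGam nab i) (z.2, 1%:M, 0)).
Proof.
move=> dz; set u : slq := (z.2, 1%:M, 0); have Vu : Vd i u.1.1 by exists z.1; case: z dz @u.
have -> : pframe nab i z = rep i z.1 (frame2 (NGam nab i) u).
  apply/funext => v; rewrite /rep /pframe /frame2 /u /=.
  have -> : hmap 1%:M 0 1 v = v by rewrite /hmap mul1mx mul0mx mxE add0r invr1 scale1r.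
  by rewrite (@NGamE _ _ _ _ nab hn i z.1) //; case: z dz @u Vu.
have e := frame2_0 (hG i) u; have U0 := @Hdom0 R q u.2 1 (oner_neq0 _).
rewrite (jet_of_rep _ (frame2_sm (hG i) Vu) U0) ?e //; case: z dz @u Vu e U0 => //.
Qed.

Lemma ract_jetset i z (u : slq) (B : 'M[R]_q) be b : dom i z -> u.1.1 = z.2 -> u.1.2 \in unitmx -> B \in unitmx -> b != 0 ->
  ract B be b (jetset 2 i z (frame2 (NGam nab i) u)) = jetset 2 i z (frame2 (NGam nab i) (Rh B be b u)).
Proof.
move=> dz uz uA uB b0; have Vu : Vd i u.1.1 by exists z.1; rewrite uz; case: z dz uz.
have ez : z = pbase (z.1, u) by rewrite /pbase /= uz; case: z dz uz.
have ne : jetset 2 i z (frame2 (NGam nab i) u) !=set0.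
  by exists (rep i z.1 (frame2 (NGam nab i) u)); rewrite ez; apply: frame_inh => //; rewrite -ez.
apply: (jmap_jetset _ dz ne) => // f [tf f0 jf].
have gf := transversal_good tf; have H0 := Hdom0 be b0; have sh := @hmap_sm R q B be b.
split; first exact: good_comp gf sh H0 (hmap0 _ _ _).
  by rewrite /= hmap0.
have ui : udom i (f 0) by rewrite f0; exact: udom_par.
have [U U0 sU] := yc_sm gf ui; have sg := frame2_sm (hG i) Vu.
have G0 := @Hdom0 R q u.2 1 (oner_neq0 _).
have oU := openI (sm_open sU) (sm_open sg).
have oW := open_cont (sm_open sh) (fun z Uz => sm_cont sh Uz) oU.
have W0 : (Hdom be b `&` hmap B be b @^-1` (U `&` Hdom u.2 1)) 0.
  by split=> //; rewrite /preimage /= hmap0.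
have sh' : sm (Hdom be b `&` hmap B be b @^-1` (U `&` Hdom u.2 1)) (hmap B be b).
  by apply: (sm_sub _ oW sh) => x [].
have sU' : sm (U `&` Hdom u.2 1) (yc i f) by apply: (sm_sub _ oU sU) => x [].
have sg' : sm (U `&` Hdom u.2 1) (frame2 (NGam nab i) u) by apply: (sm_sub _ oU sg) => x [].
apply: jr_trans (jr_comp sh' W0 _ sU' sg' (hmap0 _ _ _) jf) _; first by move=> x [].
apply: (jr_eq _ (@Hdom_open R q be b) H0) => x Hx.
by rewrite /frame2 /= hmap_Rh.
Qed.

Lemma psiE i w : dom i (pbase w) -> w.2.1.2 \in unitmx ->
  psi nab i w = jetset 2 i (pbase w) (frame2 (NGam nab i) w.2).
Proof.
move=> d u; rewrite /psi pframe_jet // ract_jetset ?unitmx1 ?oner_neq0 //.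
congr (jetset _ _ _ (frame2 _ _)); rewrite /Rh /= !invr1 !scale1r mul1mx mul0mx add0r.
by case: w d u => x [[y A] al].
Qed.

Lemma psi_ract i w (B : 'M[R]_q) be b : dom i (pbase w) -> w.2.1.2 \in unitmx -> B \in unitmx -> b != 0 ->
  ract B be b (psi nab i w) = psi nab i (w.1, Rh B be b w.2).
Proof.
move=> d u uB b0; rewrite psiE // ract_jetset // psiE //=.
by rewrite unitmxZ ?unitfE ?invr_eq0 // unitmx_mul u.
Qed.

Lemma PF_psi O u : PF nab O u <-> exists i w, Pdom i O w /\ u = psi nab i w.
Proof.
split=> [[i [z [A [al [a [dz Oz uA a0 ->]]]]]]|[i [w [[d Ow uA] ->]]]].
  exists i, (z.1, (z.2, a^-1 *: A, a^-1 *: al)).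
  have ez : pbase (z.1, (z.2, a^-1 *: A, a^-1 *: al)) = z by case: z dz Oz.
  split; last by rewrite /psi ez /ract /= hmap_norm.
  by split; rewrite ?ez //= unitmxZ // unitfE invr_eq0.
by exists i, (pbase w), w.2.1.2, w.2.2, 1; split=> //; exact: oner_neq0.
Qed.

Lemma p2_psi i w : dom i (pbase w) -> w.2.1.2 \in unitmx ->
  p2 (psi nab i w) = jet_of 1 (rep i w.1 (fun v => w.2.1.1 + w.2.1.2 *m v)).
Proof.
move=> d u; have Vw : Vd i w.2.1.1 by exists w.1.
have lA : sm [set: cV] (fun v => w.2.1.1 + w.2.1.2 *m v).
  apply: sm_add; first exact: (sm_cst _ openT).
  by apply: sm_mulmx; [exact: (sm_cst _ openT)|exact: (sm_id _ openT)].
rewrite psiE // (jet_of_rep _ lA) ?mulmx0 ?addr0 //.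
apply: (jmap_jetset _ d) => //; first by exists (rep i w.1 (frame2 (NGam nab i) w.2)); exact: frame_inh.
move=> f [tf f0 jf]; split=> //; first exact: transversal_good.
apply: jr_trans (jrW _ jf) _ => //; split=> [|v|//]; first by rewrite (frame2_0 (hG i)) mulmx0 addr0.
rewrite (frame2_jet (hG i) _ v Vw).1.
have [_ ->] := isd_add (isd_cst w.2.1.1 (0 : cV)) (isd_lin (0 : cV) _ (@mulmx_lin1 R _ _ _ w.2.1.2)).
by rewrite add0r.
Qed.

(** The 1-jet gives the base point and [A]; [alpha] is recovered from the second derivatives. *)
Lemma psi_inj i w w' : Pdom i setT w -> Pdom i setT w' -> psi nab i w = psi nab i w' -> w = w'.
Proof.
move=> pw pw'; have [d _ u] := pw; have [d' _ u'] := pw'.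
rewrite !psiE // => /(jetset_inj d d'); case; first by exists (rep i w.1 (frame2 (NGam nab i) w.2)); exact: frame_inh.
move=> eb [_ h1 h2]; have Vw := pdom_V pw; have Vw' := pdom_V pw'.
have [ex ey] : w.1 = w'.1 /\ w.2.1.1 = w'.2.1.1 by case: eb.
have eA : w.2.1.2 = w'.2.1.2.
  apply: lin_mulmx_ext => v; have := h1 v.
  by rewrite (frame2_jet (hG i) _ v Vw).1 (frame2_jet (hG i) _ v Vw').1.
have eal : w.2.2 = w'.2.2.
  apply/matrixP => a b; rewrite ord1 -(rV_evec w.2.2) -(rV_evec w'.2.2).
  (* On the diagonal the second derivative is [- 2 alpha_b A e_b] up to the Christoffel term, which
     is already known to agree. *)
  have := h2 isT (evec b) (evec b).
  rewrite (frame2_jet (hG i) _ _ Vw).2 (frame2_jet (hG i) _ _ Vw').2 ey eA => /addIr /oppr_inj e.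
  have {e} := congr1 (fun x => invmx w'.2.1.2 *m (2^-1 *: x)) e.
  rewrite !half -!scalemxAr !mulKmx // => /(congr1 (fun x : cV => x b 0)).
  by rewrite !mxE eqxx !mulr1.
case: w w' ex ey eA eal {pw pw' d d' u u' eb h1 h2 Vw Vw'} => x [[y A] al] [x' [[y' A'] al']] /=.
by move=> -> -> -> ->.
Qed.

End One.

End Psi.

(** * Action of foliated maps on projective frames *)

Section PsiMor.
Context {R : realType} {p q : nat}.
Notation bmod := (bmod R p q).
Notation cV := 'cV[R]_q.
Notation slq := (slq R q).
Notation pm := (pmod R p q).
Variables (M0 M : folmfd R p q) (phi : M0 -> M).
Hypothesis hphi : mor phi.
Variables (nab0 : conn M0) (nab : conn M).
Hypotheses (hn0 : is_folconn nab0) (hn : is_folconn nab) (pc : is_pull_conn phi nab nab0).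

Definition Phi i j (w : pm) : pm := let z' := Tm phi i j (pbase w) in
  (z'.1, (z'.2, Jt phi i j (pbase w) *m w.2.1.2, w.2.2)).

(** The second derivative of the transverse map, which enters the 2-jet of [phi \o f], cancels
    against the one in [Gam_rel]; hence [phi \o f] is again a frame of the bundle, with the same
    [alpha]. *)
Lemma psi_mor i j w : Pdom i setT w -> udom j (phi (par i (pbase w))) ->
  jmap 2 (fun f => phi \o f) (psi nab0 i w) = psi nab j (Phi i j w).
Proof.
move=> pw uj; have [d _ u] := pw; have Vw := pdom_V pw.
have Dz : Dm phi i j (pbase w) by [].
have eT : pbase (Phi i j w) = Tm phi i j (pbase w) by rewrite /pbase /=; case: (Tm _ _ _ _).
have uJ : (Phi i j w).2.1.2 \in unitmx by rewrite unitmx_mul u (mor_unit hphi).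
have d' : dom j (pbase (Phi i j w)) by rewrite eT; exact: chart_dom.
have Vw' : Vd j (Phi i j w).2.1.1 by exists (Phi i j w).1.
rewrite !psiE // eT; apply: jmap_jetset => //; first exact: chart_dom.
  by exists (rep i w.1 (frame2 (NGam nab0 i) w.2)); exact: frame_inh.
move=> f [tf f0 [j0 j1 j2]]; have gf := transversal_good tf.
split; first exact: good_mor.
  by rewrite /= f0 /Tm chartK.
have ui : udom i (f 0) by rewrite f0; exact: udom_par.
have uj' : udom j (phi (f 0)) by rewrite f0.
have [h1 h2] := yc_change hphi gf ui uj'; rewrite f0 parK // in h1 h2.
split=> [|v|_ v v'].
- by rewrite (frame2_0 (NGam_chrsym hn j)) /yc /= f0.
- by rewrite h1 j1 (frame2_jet (NGam_chrsym hn0 i) _ v Vw).1 (frame2_jet (NGam_chrsym hn j) _ v Vw').1 /= mulmxA.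
rewrite h2 !j1 j2 // (frame2_jet (NGam_chrsym hn0 i) v v Vw).1 (frame2_jet (NGam_chrsym hn0 i) v' v Vw).1.
rewrite (frame2_jet (NGam_chrsym hn0 i) _ _ Vw).2 (frame2_jet (NGam_chrsym hn j) _ _ Vw').2 /=.
have -> : NGam nab0 i w.2.1.1 = Gam nab0 i (par i (pbase w)).
  by apply/funext => a; apply/funext => b; exact: NGamE.
have -> : NGam nab j (Tm phi i j (pbase w)).2 = Gam nab j (phi (par i (pbase w))).
  apply/funext => a; apply/funext => b; rewrite (@NGamE _ _ _ _ nab hn j (Tm phi i j (pbase w)).1).
    by rewrite -surjective_pairing /Tm chartK.
  by rewrite -surjective_pairing -eT.
rewrite mulmxBr (Gam_rel hphi hn0 pc _ _ Dz) -!mulmxA mulmxN mulmxDr -!scalemxAr.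
move: (Gam _ _ _ _ _) (dv _ _ _) => g dd.
by rewrite addrC -[LHS]addrA; congr (_ + _); rewrite (opprD g dd) -addrA addNr addr0.
Qed.

End PsiMor.

Section Id.
Context {R : realType} {p q : nat}.
Variables (M : folmfd R p q) (nab : conn M).
Hypothesis hn : is_folconn nab.

(** Makes changes of chart a case of naturality. It rests on the compatibility of [nab] with
    restriction and with equality modulo the leaves. *)
Lemma pull_id : is_pull_conn (fun m : M => m) nab nab.
Proof.
have relE O X X' : vfield O X -> relN (fun m : M => m) O X X' <->
    forall i j m, O m -> udom i m -> udom j m -> (X' j m).2 = (X j m).2.
  move=> vX; split=> [/(relNP (mor_id M)) h i j m Om ui uj|h].
    rewrite (h i j m) // (vf_compat vX Om ui uj).
    have [_ <-] := isd_snd _ _ (isd_sm (mor_sm (mor_id M) i j) (Dm_chart ui uj)).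
    by rewrite -(T2_dv (mor_id M)) //; exact: Dm_chart.
  apply/(relNP (mor_id M)) => i j m Om ui uj; rewrite (h i j m) // (vf_compat vX Om ui uj).
  have [_ <-] := isd_snd _ _ (isd_sm (mor_sm (mor_id M) i j) (Dm_chart ui uj)).
  by rewrite -(T2_dv (mor_id M)) //; exact: Dm_chart.
move=> O O' X Y X' Y' mO mO' sO fX fY fX' fY' /relE hX /relE hY.
have sO' : O `<=` O' by move=> m Om; apply: sO; exists m.
apply/relE; first exact: (nab_fol hn mO fX fY).1.
move=> i j m Om ui uj.
have fX1 := folvf_sub mO sO' fX'; have fY1 := folvf_sub mO sO' fY'.
rewrite -(nab_restr hn mO' mO sO' fX' fY' Om uj).
apply: (nab_eqN hn mO fX1 fX fY1 fY _ _ Om uj).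
  by move=> k m' Om' uk; apply: (hX fX.1 k) => //.
by move=> k m' Om' uk; apply: (hY fY.1 k) => //.
Qed.

Lemma jmap_psi i w : Pdom i setT w -> jmap 2 (fun f => (fun m : M => m) \o f) (psi nab i w) = psi nab i w.
Proof.
move=> pw; have [d _ u] := pw; rewrite psiE //; apply: jmap_jetset => //.
  by exists (rep i w.1 (frame2 (NGam nab i) w.2)); exact: frame_inh.
by move=> f [tf f0 jf]; split=> //; exact: transversal_good.
Qed.

Lemma psi_chart i j w : Pdom i setT w -> udom j (par i (pbase w)) ->
  psi nab i w = psi nab j (Phi (fun m : M => m) i j w).
Proof.
by move=> pw uj; rewrite -{1}(jmap_psi pw) (psi_mor (mor_id M) hn hn pull_id pw uj).
Qed.

End Id.

(** * Derivatives along the Cartan connection *)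

Section hfield.
Context {R : realType} {q : nat}.
Notation cV := 'cV[R]_q.
Notation slq := (slq R q).
Variables (V : set cV) (G : cV -> cV -> cV -> cV).
Hypothesis hG : chrsym V G.

Lemma sm_param (U W : normedModType R) (D : set U) (L : cV -> cV -> W) (y g : U -> cV) : findim W ->
  (forall x, V x -> linear (L x)) -> (forall v, sm V (L^~ v)) ->
  (forall u, D u -> V (y u)) -> sm D y -> sm D g -> sm D (fun u => L (y u) (g u)).
Proof.
move=> fW lL sL hy sy sg.
(* [L] is smooth in its first argument only for a fixed second one, hence the expansion in the
   basis. *)
apply: (@sm_eq _ _ _ _ (fun u => \sum_j g u j 0 *: L (y u) (evec j))).
  move=> u Du; rewrite [g u in RHS]cV_delta; have [_ _ lZ _ lS] := linP (lL _ (hy _ Du)).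
  by rewrite lS; apply: eq_bigr => j _; rewrite lZ.
apply: sm_sum; first exact: sm_open sy.
move=> j; apply: sm_scale; first exact: sm_coord.
exact: (sm_comp _ hy sy (sL (evec j))).
Qed.

Lemma hfield_sm v : sm (Dn V) (hfield G (schouten G) v).
Proof.
have oD := Dn_open hG; have sy := sm_uy hG; have sA := sm_uA hG; have sl := sm_ual hG.
have cv : sm (Dn V) (fun _ : slq => v) by exact: (sm_cst _ oD).
have sAv : sm (Dn V) (fun u : slq => u.1.2 *m v) by exact: sm_mulmx.
have slv : sm (Dn V) (fun u : slq => (u.2 *m v) 0 0) by apply: sm_coord; exact: sm_mulmx.
have hy u : Dn V u -> V u.1.1 by case.
apply: sm_pair; first apply: sm_pair => //.
  apply: sm_sub'; last first.
    apply: (sm_mulmx (f := fun u => chrmx G u.1.1 (u.1.2 *m v))) => //.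
    by apply: (sm_param (L := chrmx G)) => //; [exact: chrmx_lin hG|exact: chrmx_sm hG].
  apply: sm_sub'; last exact: sm_scale.
  by apply: sm_opp; exact: sm_mulmx.
apply: sm_sub'; first by apply: sm_opp; exact: sm_scale.
apply: (sm_mulmx (f := fun u => schouten G u.1.1 (u.1.2 *m v))) => //.
by apply: (sm_param (L := schouten G)) => //; [exact: schouten_lin hG|exact: schouten_sm hG].
Qed.

Lemma hfield_lin u : V u.1.1 -> linear (fun v => hfield G (schouten G) v u).
Proof.
move=> Vu k v w; have [_ gD gZ _ _] := linP (chrmx_lin hG Vu); have [_ sD sZ _ _] := linP (schouten_lin hG Vu).
have e11 (a b : 'M[R]_1) : (k *: a + b) 0 0 = k * a 0 0 + b 0 0 by rewrite !mxE.
rewrite /hfield !(mulmxDr _ (k *: v) w) -!scalemxAr gD gZ sD sZ e11.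
rewrite -[RHS]/(k *: (u.1.2 *m v) + u.1.2 *m w, k *: _ + _, k *: _ + _); congr (_, _, _) => /=.
  move: (chrmx _ _ _) (chrmx _ _ _) => g1 g2; rewrite !mulmxDl -!scalemxAl.
  move: (_ *m u.2) (_ *m u.2) (g1 *m _) (g2 *m _) ((u.2 *m _) 0 0) ((u.2 *m _) 0 0) => a b c d e f.
  by apply/matrixP => i j; rewrite !mxE; ring.
move: (schouten _ _ _) (schouten _ _ _) => g1 g2; rewrite !mulmxDl -!scalemxAl.
move: (g1 *m _) (g2 *m _) ((u.2 *m _) 0 0) ((u.2 *m _) 0 0) => c d e f.
by apply/matrixP => i j; rewrite !mxE; ring.
Qed.

End hfield.

Section Omega.
Context {R : realType} {p q : nat}.
Notation bmod := (bmod R p q).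
Notation cV := 'cV[R]_q.
Notation slq := (slq R q).
Notation pm := (pmod R p q).
Hypothesis hq : (2 <= q)%N.
Variables (M : folmfd R p q) (nab : conn M).
Hypothesis hn : is_folconn nab.
Implicit Types (i j : idx M) (w : pm) (O : set M).

Definition hfld i (v : cV) (u : slq) : slq := hfield (NGam nab i) (schouten (NGam nab i)) v u.

(** The selected form is a normal Cartan connection by existence, and is then identified by
    uniqueness. *)
Lemma omegaE i u X : Ndom i u -> omega nab i u X = omP (NGam nab i) (schouten (NGam nab i)) u X.
Proof.
move=> Du; apply: (normal_cartan_unique hq (NGam_chrsym hn i)) => //.
apply: (@getPex _ [set om | normal_cartan (Ndom i) (NGam nab i) om]).
by exists (omP (NGam nab i) (schouten (NGam nab i))); exact: (omP_normal_cartan hq (NGam_chrsym hn i)).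
Qed.

Lemma Pdom_Ndom i O w : Pdom i O w -> Ndom i w.2.
Proof. by move=> [d _ u]; split=> //; exists w.1. Qed.

Lemma omegaF_hfld i w v x : Pdom i setT w -> omegaF nab i w (x, hfld i v w.2) = ((v, 0), 0).
Proof. by move=> pw; have [_ _ u] := pw; rewrite /omegaF omegaE; [exact: omP_hfield|exact: Pdom_Ndom pw]. Qed.

Lemma omegaF_uniq i w v X : Pdom i setT w -> omegaF nab i w X = ((v, 0), 0) -> X.2 = hfld i v w.2.
Proof.
move=> pw; have [_ _ uA] := pw; have [Vw _] := Pdom_Ndom pw; have hG := NGam_chrsym hn i.
rewrite -(omegaF_hfld v 0 pw) /omegaF !omegaE ?(Pdom_Ndom pw) // => e.
apply/eqP; rewrite -subr_eq0; apply/eqP.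
apply: (omP_inj hG (schouten_lin hG) uA Vw).
have [_ oD _ oN _] := linP (omP_lin hG (schouten_lin hG) Vw).
by rewrite oD oN e subrr.
Qed.

Lemma Pdom_open i O : mopen O -> open (Pdom i O).
Proof.
move=> mO; have -> : Pdom i O = (@pbase R p q @^-1` (dom i `&` par i @^-1` O)) `&`
    ((fun w : pm => w.2.1.2) @^-1` [set A | A \in unitmx]).
  by apply/seteqP; split=> w; [move=> [d o u]|move=> [[d o] u]].
have sb : sm [set: pm] (@pbase R p q) by apply: (sm_lin _ openT).
have sA : sm [set: pm] (fun w : pm => w.2.1.2) by apply: (sm_lin _ openT).
apply: openI; apply: open_comp.
- by move=> w _; exact: sm_cont sb I.
- exact: mO.
- by move=> w _; exact: sm_cont sA I.
- exact: unitmx_open.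
Qed.

Lemma folP O (F : jet M -> R) : foliated nab O F <-> forall i, sm (Pdom i O) (F \o psi nab i : pm -> R) /\
  forall w x, Pdom i O w -> dv (x, 0) (F \o psi nab i : pm -> R) w = 0.
Proof.
split=> h i; have [h1 h2] := h i.
  have s : sm (Pdom i O) (F \o psi nab i : pm -> R) by apply/smooth_onP.
  by split=> //; apply: (flatP _ _ _ s).1.
by split; [exact/smooth_onP|apply: (flatP _ _ _ h1).2].
Qed.

Lemma hfld_sm i O v : mopen O -> sm (Pdom i O) (fun w => (0, hfld i v w.2) : pm).
Proof.
move=> mO; have oP := Pdom_open (i:=i) mO; apply: sm_pair; first exact: (sm_cst _ oP).
apply: (@sm_comp _ _ _ _ _ (Ndom i) (fun w : pm => w.2) (hfld i v)) => //.
- by move=> w; exact: Pdom_Ndom.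
- by apply: sm_snd; exact: (sm_id _ oP).
- exact: hfield_sm (NGam_chrsym hn i) v.
Qed.

Lemma hfld_isd i O v w : Pdom i O w ->
  isd (fun w => (0, hfld i v w.2) : pm) w (fun X => (0, dv X.2 (hfld i v) w.2)).
Proof.
move=> pw; apply: isd_pair; first exact: isd_cst.
have h2 : isd (fun w : pm => w.2) w (fun X => X.2) by exact: isd_lin.
exact: isd_comp h2 (isd_sm (hfield_sm (NGam_chrsym hn i) v) (Pdom_Ndom pw)).
Qed.

End Omega.

Section NablaMor.
Context {R : realType} {p q : nat}.
Notation bmod := (bmod R p q).
Notation cV := 'cV[R]_q.
Notation slq := (slq R q).
Notation pm := (pmod R p q).
Variables (M0 M : folmfd R p q) (phi : M0 -> M).
Hypothesis hphi : mor phi.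
Variables (nab0 : conn M0) (nab : conn M).
Hypotheses (hn0 : is_folconn nab0) (hn : is_folconn nab) (pc : is_pull_conn phi nab nab0).
Variables (i : idx M0) (j : idx M).

Let U : set M0 := phi @^-1` udom j.
Let mU : mopen U.
Proof. by apply: mor_preim => //; exact: udom_mopen. Qed.

Let isd_pb w : isd (@pbase R p q) w (@pbase R p q).
Proof. exact: isd_lin. Qed.

Let T2s : sm (Dm phi i j) (T2 phi i j). Proof. by apply: sm_snd; exact: mor_sm. Qed.

Let PDm w : Pdom i U w -> Dm phi i j (pbase w).
Proof. by move=> [d u _]; split. Qed.

Lemma Phi_isd w : Pdom i U w -> isd (fun w => (Phi phi i j w).2) w (fun X =>
  (Jt phi i j (pbase w) *m X.2.1.1,
   dv (0, X.2.1.1) (Jt phi i j) (pbase w) *m w.2.1.2 + Jt phi i j (pbase w) *m X.2.1.2, X.2.2)).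
Proof.
move=> /PDm Dz; have hw := isd_id w.
have h1 := isd_comp (isd_pb w) (isd_sm T2s Dz).
have h2 := isd_comp (isd_pb w) (isd_sm (Jt_sm hphi i j) Dz).
have hA : isd (fun w : pm => w.2.1.2) w (fun X => X.2.1.2) by exact: isd_lin.
have hl : isd (fun w : pm => w.2.2) w (fun X => X.2.2) by exact: isd_lin.
apply: isd_eq (isd_pair (isd_pair h1 (isd_mulmx h2 hA)) hl) _ => X; congr (_, _, _).
  by rewrite T2_dv.
congr (_ *m _ + _).
have -> : pbase X = (X.1, 0) + (0, X.2.1.1) :> bmod by rewrite -[RHS]/(X.1 + 0, 0 + X.2.1.1) addr0 add0r.
by rewrite (derive_dirD _ _ (sm_diff (Jt_sm hphi i j) Dz)) Jt_flat // add0r.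
Qed.

Lemma Phi_sm : sm (Pdom i U) (Phi phi i j).
Proof.
have oP := Pdom_open (i:=i) mU; have sb : sm (Pdom i U) (@pbase R p q) by exact: sm_lin.
have sT : sm (Pdom i U) (fun w => Tm phi i j (pbase w)).
  by apply: (sm_comp _ PDm sb (mor_sm hphi i j)).
have sJ : sm (Pdom i U) (fun w => Jt phi i j (pbase w)).
  by apply: (sm_comp _ PDm sb (Jt_sm hphi i j)).
have s2 : sm (Pdom i U) (fun w : pm => w.2) by apply: sm_snd; exact: (sm_id _ oP).
have sA : sm (Pdom i U) (fun w : pm => w.2.1.2) by exact: sm_lin.
apply: sm_pair; first exact: sm_fst.
apply: sm_pair; last exact: sm_snd.
by apply: sm_pair; [exact: sm_snd|exact: sm_mulmx].
Qed.

(** Freezing [x] turns the transverse part of [phi] into a map [th] between open sets of [R^q] that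
    satisfies the transformation law, so [hfield_pull] applies. Its Jacobian is [Jt], which does not
    vary along the leaves. *)
Lemma Phi_hfld w v x : Pdom i U w ->
  (dv (x, hfld nab0 i v w.2) (Phi phi i j) w).2 = hfld nab j v (Phi phi i j w).2.
Proof.
move=> Pw; have [_ <-] := isd_snd _ _ (isd_sm Phi_sm Pw); rewrite (Phi_isd Pw).2.
have Dz := PDm Pw; set th := fun y : cV => T2 phi i j (w.1, y).
pose V0 : set cV := [set y | Dm phi i j (w.1, y)].
have oV0 : open V0.
  have -> : V0 = (fun y => (w.1, y)) @^-1` Dm phi i j by [].
  apply: open_comp (sm_open T2s) => y _.
  by apply: sm_cont (sm_pair _ _ (sm_cst w.1 openT) (sm_id _ openT)) I.
have line y : isd (fun y : cV => (w.1, y) : bmod) y (fun v => (0, v)).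
  by apply: isd_pair; [exact: isd_cst|exact: isd_id].
have sline : sm V0 (fun y : cV => (w.1, y) : bmod).
  by apply: sm_pair; [exact: (sm_cst _ oV0)|exact: (sm_id _ oV0)].
have sth : sm V0 th by apply: (sm_comp _ _ sline T2s).
have dth y a : V0 y -> dv a th y = dv (0, a) (T2 phi i j) (w.1, y).
  by move=> Vy; rewrite (isd_comp (line y) (isd_sm T2s Vy)).2.
have Jth y : V0 y -> Jac th y = Jt phi i j (w.1, y).
  by move=> Vy; apply/matrixP => a b; rewrite !mxE dth.
have dJth y a : V0 y -> dv a (Jac th) y = dv (0, a) (Jt phi i j) (w.1, y).
  move=> Vy; rewrite (derive_eq_on _ oV0 Vy Jth).
  by rewrite (isd_comp (line y) (isd_sm (Jt_sm hphi i j) Vy)).2.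
have sV : V0 `<=` Vd i by move=> y [d _]; exists w.1.
have h0 : chrsym V0 (NGam nab0 i).
  have [_ l s m] := NGam_chrsym hn0 i; split=> //.
    by move=> y v' w' /sV; exact: s.
  by move=> v' w'; apply: sm_sub (m v' w').
have rel y v' w' : V0 y -> Jac th y *m NGam nab0 i y v' w' =
    NGam nab j (th y) (Jac th y *m v') (Jac th y *m w') + dv v' (dv w' th) y.
  move=> Vy; rewrite Jth //; have [dy uy] := Vy.
  have -> : dv v' (dv w' th) y = dv (0, v') (dv (0, w') (T2 phi i j)) (w.1, y).
    rewrite (derive_eq_on _ oV0 Vy (dth^~ w')).
    by rewrite (isd_comp (line y) (isd_sm (sm_derive (0, w') T2s) Vy)).2.
  rewrite (NGamE hn0 _ _ dy) (Gam_rel hphi hn0 pc) //; congr (_ + _); rewrite /th /T2.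
  have d : dom j ((Tm phi i j (w.1, y)).1, (Tm phi i j (w.1, y)).2).
    by rewrite -surjective_pairing; exact: chart_dom.
  by rewrite (NGamE hn _ _ d) -surjective_pairing /Tm chartK.
have thV y : V0 y -> Vd j (th y).
  move=> [dy uy]; exists (Tm phi i j (w.1, y)).1.
  by rewrite /th /T2 -surjective_pairing; exact: chart_dom.
have uJ y : V0 y -> Jac th y \in unitmx by move=> Vy; rewrite Jth // (mor_unit hphi).
have Vw : V0 w.2.1.1 by [].
have := hfield_pull h0 (NGam_chrsym hn j) sth thV uJ rel v (u := w.2) Vw.
rewrite /hfld (difflift_isd h0 sth Vw).2 dJth // dth // Jth // T2_dv //.
have -> : difflift th w.2 = (Phi phi i j w).2 by rewrite /difflift Jth.
move=> <-; congr (_, _, _).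
Qed.

Lemma dv_mor (f : pm -> R) (D : set pm) w v x : sm D f -> Pdom i U w -> D (Phi phi i j w) ->
  (forall x, dv (x, 0) f (Phi phi i j w) = 0) ->
  dv (x, hfld nab0 i v w.2) (f \o Phi phi i j) w = dv (0, hfld nab j v (Phi phi i j w).2) f (Phi phi i j w).
Proof.
move=> sf Pw DP ff; rewrite derive_comp; [|exact: sm_diff Phi_sm Pw|exact: sm_diff sf DP].
have := Phi_hfld v x Pw; case: (dv _ _ _) => a b /= ->.
(* The component [a] along the leaves is uncontrolled, but foliated functions do not see it. *)
have -> : (a, hfld nab j v (Phi phi i j w).2) = (a, 0) + (0, hfld nab j v (Phi phi i j w).2) :> pm.
  by rewrite -[RHS]/(a + 0, 0 + _) addr0 add0r.
by rewrite (derive_dirD _ _ (sm_diff sf DP)) ff add0r.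
Qed.

End NablaMor.

Section Nabla.
Context {R : realType} {p q : nat}.
Notation bmod := (bmod R p q).
Notation cV := 'cV[R]_q.
Notation slq := (slq R q).
Notation pm := (pmod R p q).
Hypothesis hq : (2 <= q)%N.
Variables (M : folmfd R p q) (nab : conn M).
Hypothesis hn : is_folconn nab.
Implicit Types (i j : idx M) (w : pm) (O : set M) (F : jet M -> R).

Lemma psi_base i j w w' : Pdom i setT w -> Pdom j setT w' -> psi nab i w = psi nab j w' ->
  par i (pbase w) = par j (pbase w').
Proof.
move=> [d _ u] [d' _ u']; rewrite !psiE // => e.
have := frame_inh hn 2 d u; rewrite e => -[_ <- _].
by have [_ -> _] := frame_inh hn 2 d u.
Qed.

Lemma psi_eqP i j w w' : Pdom i setT w -> Pdom j setT w' -> psi nab i w = psi nab j w' ->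
  udom j (par i (pbase w)) /\ w' = Phi (fun m : M => m) i j w.
Proof.
move=> pw pw' e; have eb := psi_base pw pw' e.
have uj : udom j (par i (pbase w)) by rewrite eb; apply: udom_par; case: pw'.
split=> //; apply: (psi_inj hn pw'); last by rewrite -e; exact: psi_chart.
have [d _ u] := pw; have Dz : Dm (fun m : M => m) i j (pbase w) by [].
split=> //; last by rewrite /= unitmx_mul u (mor_unit (mor_id M)).
by rewrite /pbase /= -surjective_pairing; exact: chart_dom.
Qed.

(** The set from which [nabla] selects is a singleton: two charts are related by [Phi], which
    respects horizontal fields, and two lifts of [v] differ by a vector tangent to the leaves. *)
Lemma nabla_chart O F v i w : mopen O -> foliated nab O F -> Pdom i O w ->
  nabla nab v F (psi nab i w) = dv (0, hfld nab i v w.2) (F \o psi nab i : pm -> R) w.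
Proof.
move=> mO /folP fF pw; rewrite /nabla.
set S := [set _ | _].
have [d Od u] := pw; have pwT := pdom_T pw.
suff SE : S = [set dv (0, hfld nab i v w.2) (F \o psi nab i : pm -> R) w].
  by have := @getPex _ S; rewrite SE; apply; eexists.
apply/seteqP; split=> [d'|_ ->]; last first.
  exists i, w, (0, hfld nab i v w.2); split=> //; first exact: omegaF_hfld.
  by rewrite dvE.
move=> [j [w' [X [pw' e oX ->]]]] /=; rewrite -dvE.
have eX := omegaF_uniq hq hn pw' oX.
have [ui ew] := psi_eqP pw' pwT e.
rewrite ew; pose U : set M := udom i; pose O' := O `&` U.
have mO' : mopen O' by apply: mopenI => //; exact: udom_mopen.
have Ow' : O (par j (pbase w')) by rewrite (psi_base pw' pwT e).
have pw'' : Pdom j O' w' by case: pw'.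
have -> : X = (X.1, hfld nab j v w'.2) by rewrite -eX; case: (X).
have [sF ff] := fF i.
rewrite (derive_eq_on (g := (F \o psi nab i) \o Phi (fun m : M => m) j i) _ (Pdom_open (i:=j) mO') pw''); last first.
  move=> z [dz [Oz uz] zu] /=; congr F; apply: psi_chart => //.
have pwP : Pdom i O (Phi (fun m : M => m) j i w') by rewrite -ew.
apply: (dv_mor (mor_id M) hn hn (pull_id hn) v X.1 sF _ pwP) => [|x]; last exact: ff.
by case: pw'.
Qed.

Lemma nabla_fol O F v : mopen O -> foliated nab O F -> foliated nab O (nabla nab v F).
Proof.
move=> mO fF; apply/folP => i; have [sF ff] := (folP nab O F).1 fF i.
have E w : Pdom i O w -> dv (0, hfld nab i v w.2) (F \o psi nab i : pm -> R) w = (nabla nab v F \o psi nab i) w.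
  by move=> pw; rewrite /= (nabla_chart v mO fF pw).
have sX := hfld_sm hn i v mO.
split; first by apply: (sm_eq E); exact: sm_derive_vf.
move=> w x pw; rewrite -(derive_eq_on _ (sm_open sF) pw E).
rewrite (derive_vf _ _ _ sF sX pw) // (derive_eq_on (g := fun=> 0) _ (sm_open sF) pw); last first.
  by move=> z pz; exact: ff.
rewrite dv_cst add0r.
by rewrite (hfld_isd hn v pw).2 /= (dvE 0) derive0 (dvE 0) derive0.
Qed.

Lemma nabla_wd O F : mopen O -> foliated nab O F -> nabla_well_defined nab O F.
Proof.
move=> mO fF v; split; first exact: nabla_fol.
move=> i w pw; have pwT := pdom_T pw; split.
  by exists (0, hfld nab i v w.2); exact: omegaF_hfld.
move=> X oX; have eX := omegaF_uniq hq hn pwT oX; rewrite (nabla_chart v mO fF pw) -dvE.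
have [sF ff] := (folP nab O F).1 fF i.
have -> : X = (X.1, 0) + (0, hfld nab i v w.2).
  by rewrite -eX -[RHS]/(X.1 + 0, 0 + X.2) addr0 add0r; case: (X).
by rewrite (derive_dirD _ _ (sm_diff sF pw)) ff // add0r.
Qed.

End Nabla.

(** * Tensors as functions of words *)

Section Words.
Variables (R : comNzRingType) (q : nat).
Implicit Types (g h : seq 'I_q -> R) (s t : seq 'I_q) (A B P Q : 'M[R]_q).

(* Tensors are given by their components, indexed by words; [tact] and [dact] are the
   actions of matrices on them as elements of the group and of its Lie algebra. *)
Fixpoint wsum m h : R :=
  if m is m'.+1 then \sum_c wsum m' (fun t => h (c :: t)) else h [::].

Fixpoint tact B s g : R :=
  if s is a :: s' then \sum_c B c a * tact B s' (fun t => g (c :: t)) else g [::].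

Fixpoint dact A s g : R :=
  if s is b :: s' then \sum_c A c b * g (c :: s') + dact A s' (fun t => g (b :: t)) else 0.

Lemma sum_id_mx c d : \sum_b (1%:M : 'M[R]_q) c b * (1%:M : 'M[R]_q) d b = (c == d)%:R.
Proof.
rewrite (bigD1 c) //= !mxE eqxx mul1r big1 ?addr0; first by rewrite eq_sym.
by move=> b nb; rewrite mxE eq_sym (negbTE nb) mul0r.
Qed.

Lemma wsum_ext m h h' : (forall t, size t = m -> h t = h' t) -> wsum m h = wsum m h'.
Proof.
elim: m h h' => [|m IH] h h' e; first exact: e.
by apply: eq_bigr => c _; apply: IH => t st; apply: e; rewrite /= st.
Qed.

Lemma tuple_sum m (F : m.+1.-tuple 'I_q -> R) :
  \sum_t F t = \sum_c \sum_(t : m.-tuple 'I_q) F [tuple of c :: t].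
Proof.
rewrite (reindex (fun x : 'I_q * m.-tuple 'I_q => [tuple of x.1 :: x.2])) /=; last first.
  exists (fun t : m.+1.-tuple 'I_q => (thead t, [tuple of behead t])) => [[c t] _|t _] /=.
    by congr (_, _); apply: val_inj.
  by rewrite [t]tuple_eta; apply: val_inj.
by rewrite -(pair_bigA _ (fun c (t : m.-tuple 'I_q) => F [tuple of c :: t])).
Qed.

Lemma wsum_tuple m h : \sum_(t : m.-tuple 'I_q) h t = wsum m h.
Proof.
elim: m h => [|m IH] h.
  by rewrite (bigD1 [tuple]) //= big1 ?addr0 // => t /negP[]; apply/eqP; exact: tuple0.
rewrite tuple_sum; apply: eq_bigr => c _; exact: IH (fun t => h (c :: t)).
Qed.

Lemma wsum_lin n (k : 'I_n -> R) (h : 'I_n -> seq 'I_q -> R) m :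
  wsum m (fun t => \sum_i k i * h i t) = \sum_i k i * wsum m (h i).
Proof.
elim: m h => [//|m IH] h /=; under eq_bigr do rewrite IH.
by rewrite exchange_big; apply: eq_bigr => i _; rewrite mulr_sumr.
Qed.

Lemma wsumZ k h m : wsum m (fun t => k * h t) = k * wsum m h.
Proof. by elim: m h => [//|m IH] h /=; rewrite mulr_sumr; apply: eq_bigr => c _; rewrite IH. Qed.

Lemma wsumD h h' m : wsum m (fun t => h t + h' t) = wsum m h + wsum m h'.
Proof. by elim: m h h' => [//|m IH] h h' /=; rewrite -big_split; apply: eq_bigr => c _; rewrite IH. Qed.

Lemma wsum_sum n (h : 'I_n -> seq 'I_q -> R) m :
  wsum m (fun t => \sum_i h i t) = \sum_i wsum m (h i).
Proof. by elim: m h => [//|m IH] h /=; under eq_bigr do rewrite IH; rewrite exchange_big. Qed.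

Lemma wsum0 m h : (forall t, size t = m -> h t = 0) -> wsum m h = 0.
Proof.
elim: m h => [|m IH] h h0 /=; first exact: h0.
by rewrite big1 // => c _; apply: IH => t st; apply: h0; rewrite /= st.
Qed.

Lemma wsum_exch m n (F : seq 'I_q -> seq 'I_q -> R) :
  wsum m (fun s => wsum n (F s)) = wsum n (fun t => wsum m (F^~ t)).
Proof.
elim: m F => [//|m IH] F /=; rewrite wsum_sum; apply: eq_bigr => c _.
exact: (IH (fun s t => F (c :: s) t)).
Qed.

Lemma wsum_delta m h s : size s = m -> wsum m (fun t => (t == s)%:R * h t) = h s.
Proof.
elim: m s h => [|m IH] [|a s] h //=; first by rewrite mul1r.
move=> [sz]; rewrite (bigD1 a) //= -[RHS](IH s (fun t => h (a :: t)) sz) [X in _ + X]big1 ?addr0.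
  by apply: wsum_ext => t _; rewrite eqseq_cons eqxx.
move=> c /negbTE nc; apply: wsum0 => t _.
by rewrite eqseq_cons nc mul0r.
Qed.

Lemma tact_ext B s g g' : (forall t, size t = size s -> g t = g' t) -> tact B s g = tact B s g'.
Proof.
elim: s g g' => [|a s IH] g g' e; first exact: e.
by apply: eq_bigr => c _; congr (_ * _); apply: IH => t st; apply: e; rewrite /= st.
Qed.

Lemma tact_lin n (k : 'I_n -> R) (h : 'I_n -> seq 'I_q -> R) B s :
  tact B s (fun t => \sum_i k i * h i t) = \sum_i k i * tact B s (h i).
Proof.
elim: s h => [//|a s IH] h /=; under eq_bigr do rewrite IH mulr_sumr.
rewrite exchange_big; apply: eq_bigr => i _; rewrite mulr_sumr; apply: eq_bigr => c _.
by rewrite mulrCA.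
Qed.

Lemma tact1 s g : tact 1%:M s g = g s.
Proof.
elim: s g => [//|a s IH] g /=; rewrite (bigD1 a) //= IH mxE eqxx mul1r big1 ?addr0 // => c nc.
by rewrite mxE (negbTE nc) mul0r.
Qed.

Lemma dact_ext A s g g' : (forall t, size t = size s -> g t = g' t) -> dact A s g = dact A s g'.
Proof.
elim: s g g' => [//|b s IH] g g' e /=; congr (_ + _).
  by apply: eq_bigr => c _; rewrite e.
by apply: IH => t st; apply: e; rewrite /= st.
Qed.

Lemma dact_lin n (k : 'I_n -> R) (h : 'I_n -> seq 'I_q -> R) A s :
  dact A s (fun t => \sum_i k i * h i t) = \sum_i k i * dact A s (h i).
Proof.
elim: s h => [|b s IH] h /=; first by rewrite big1 // => i _; rewrite mulr0.
rewrite IH; under [in RHS]eq_bigr do rewrite mulrDr; rewrite big_split /=; congr (_ + _).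
under eq_bigr do rewrite mulr_sumr; rewrite exchange_big; apply: eq_bigr => i _.
by rewrite mulr_sumr; apply: eq_bigr => c _; rewrite mulrCA.
Qed.

Lemma dact_sum n (h : 'I_n -> seq 'I_q -> R) A s :
  dact A s (fun t => \sum_i h i t) = \sum_i dact A s (h i).
Proof.
have := dact_lin (fun=> 1) h A s; under [in RHS]eq_bigr do rewrite mul1r.
by move=> <-; apply: dact_ext => t _; apply: eq_bigr => i _; rewrite mul1r.
Qed.

Lemma dact_mx0 s h : dact 0 s h = 0.
Proof.
elim: s h => [//|b s IH] h /=; rewrite IH addr0 big1 // => c _.
by rewrite mxE mul0r.
Qed.

Lemma tact0 B s h : (forall t, size t = size s -> h t = 0) -> tact B s h = 0.
Proof.
elim: s h => [|b s IH] h h0 /=; first exact: h0.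
by rewrite big1 // => c _; rewrite IH ?mulr0 // => t st; apply: h0; rewrite /= st.
Qed.

Lemma tact_sum n (h : 'I_n -> seq 'I_q -> R) A s :
  tact A s (fun t => \sum_i h i t) = \sum_i tact A s (h i).
Proof.
have := tact_lin (fun=> 1) h A s; under [in RHS]eq_bigr do rewrite mul1r.
by move=> <-; apply: tact_ext => t _; apply: eq_bigr => i _; rewrite mul1r.
Qed.

Lemma prod_tact k (s : k.-tuple 'I_q) A h :
  \sum_(t : k.-tuple 'I_q) (\prod_(r < k) A (tnth s r) (tnth t r)) * h t = tact A^T s h.
Proof.
elim: k s h => [|k IH] s h.
  rewrite [s]tuple0 (bigD1 [tuple]) //= big_ord0 mul1r big1 ?addr0 // => t /negP[].
  by apply/eqP; exact: tuple0.
case/tupleP: s => a s; rewrite tuple_sum /=; apply: eq_bigr => c _; rewrite mxE -IH mulr_sumr.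
apply: eq_bigr => t _; rewrite big_ord_recl !tnth0 mulrA; congr (_ * _ * _).
by apply: eq_bigr => r _; rewrite !tnthS.
Qed.

(** The hypothesis says [P Q^T = 1]: contragredient actions preserve the full contraction. *)
Lemma pair_tact P Q m g h : (forall c d, \sum_b P c b * Q d b = (c == d)%:R) ->
  wsum m (fun t => tact P t g * tact Q t h) = wsum m (fun t => g t * h t).
Proof.
move=> e; elim: m g h => [//|m IH] g h /=.
pose K c d := wsum m (fun t => tact P t (fun t' => g (c :: t')) * tact Q t (fun t' => h (d :: t'))).
transitivity (\sum_b \sum_c \sum_d P c b * Q d b * K c d).
  apply: eq_bigr => b _; transitivity (wsum m (fun t => \sum_c P c b * (\sum_d Q d b *
      (tact P t (fun t' => g (c :: t')) * tact Q t (fun t' => h (d :: t')))))).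
    apply: wsum_ext => t _; rewrite mulr_suml; apply: eq_bigr => c _.
    by rewrite -mulrA; congr (_ * _); rewrite mulr_sumr; apply: eq_bigr => d _; rewrite mulrCA.
  rewrite wsum_lin; apply: eq_bigr => c _; rewrite wsum_lin mulr_sumr.
  by apply: eq_bigr => d _; rewrite mulrA.
rewrite exchange_big; apply: eq_bigr => c _ /=; rewrite exchange_big (bigD1 c) //= -mulr_suml e eqxx mul1r.
rewrite /K IH big1 ?addr0 // => d nd.
by rewrite -mulr_suml e eq_sym (negbTE nd) mul0r.
Qed.

Lemma pair_dact A m g h :
  wsum m (fun t => g t * dact A t h) = wsum m (fun t => dact A^T t g * h t).
Proof.
elim: m g h => [|m IH] g h /=; first by rewrite mulr0 mul0r.
transitivity (\sum_b (\sum_c A c b * wsum m (fun t => g (b :: t) * h (c :: t)) +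
    wsum m (fun t => dact A^T t (fun t' => g (b :: t')) * h (b :: t)))).
  apply: eq_bigr => b _; rewrite -IH -wsum_lin -wsumD; apply: wsum_ext => t _.
  by rewrite mulrDr mulr_sumr; congr (_ + _); apply: eq_bigr => c _; rewrite mulrCA.
rewrite big_split exchange_big -big_split; apply: eq_bigr => b _ /=.
rewrite -wsum_lin -wsumD; apply: wsum_ext => t _.
by rewrite mulrDl mulr_suml; congr (_ + _); apply: eq_bigr => c _; rewrite mxE mulrA.
Qed.

Definition symw m g := forall s t, size s = m -> perm_eq s t -> g s = g t.

Lemma symw_cons m g c : symw m.+1 g -> symw m (fun t => g (c :: t)).
Proof. by move=> sg s t sz p; apply: sg; rewrite /= ?sz ?perm_cons. Qed.

Lemma symw_swap m g c d t : symw m.+2 g -> size t = m -> g (c :: d :: t) = g (d :: c :: t).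
Proof.
move=> sg sz; apply: sg; first by rewrite /= sz.
by rewrite -cat1s -[d :: c :: t]cat1s -[c :: t]cat1s -[d :: t]cat1s !catA perm_cat2r perm_catC.
Qed.

Variable be : 'rV[R]_q.

Definition contr g t : R := \sum_c be 0 c * g (c :: t).

(** The [gl(q)] element produced by commuting [be] with the horizontal field of [e_b]. *)
Definition fmx b : 'M[R]_q := delta_mx b 0 *m be + (be 0 b)%:M.

Lemma fmxE b c d : fmx b c d = (c == b)%:R * be 0 d + be 0 b * (c == d)%:R.
Proof. by rewrite mxE mxE big_ord1 !mxE eqxx andbT mulr_natr. Qed.

(** Each of the [m] letters contributes two contractions: the rank one part of [fmx] exchanges the
    letter with [b], which symmetry undoes, and the scalar part contracts [b] with [be] directly. *)
Lemma sum_dact m g s : symw m.+1 g -> size s = m ->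
  \sum_b dact (fmx b)^T s (fun t => g (b :: t)) = (2 * m)%:R * contr g s.
Proof.
move=> sg sz; move: sg; rewrite -{m}sz; elim: s g => [|d s IH] g /= sg.
  by rewrite big1 // mul0r.
have swap b t : size t = size s -> g (b :: d :: t) = g (d :: b :: t) by exact: symw_swap sg.
have E : contr (fun t => g (d :: t)) s = contr g (d :: s) by apply: eq_bigr => c _; rewrite swap.
rewrite big_split /=.
have -> : \sum_b dact (fmx b)^T s (fun t => g (b :: d :: t)) = (2 * size s)%:R * contr g (d :: s).
  rewrite -E -IH; last exact: symw_cons sg.
  by apply: eq_bigr => b _; apply: dact_ext => t st; rewrite swap.
have -> : \sum_b \sum_c (fmx b)^T c d * g [:: b, c & s] = contr g (d :: s) + contr g (d :: s).
  rewrite -{1}E -big_split exchange_big /=.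
  transitivity (\sum_c (be 0 c * g [:: d, c & s] + \sum_b be 0 b * (d == c)%:R * g [:: b, c & s])).
    apply: eq_bigr => c _; rewrite (bigD1 d) //= mxE fmxE eqxx mul1r mulrDl -addrA; congr (_ + _).
    rewrite [RHS](bigD1 d) //=; congr (_ + _); apply: eq_bigr => b nb.
    by rewrite mxE fmxE eq_sym (negbTE nb) mul0r add0r.
  rewrite !big_split /=; congr (_ + _); rewrite exchange_big; apply: eq_bigr => b _ /=.
  rewrite (bigD1 d) //= eqxx mulr1 big1 ?addr0 // => c nc.
  by rewrite eq_sym (negbTE nc) mulr0 mul0r.
by rewrite -mulr2n -[_ *+ 2]mulr_natl -mulrDl -natrD mulnS.
Qed.

End Words.

(** * Infinitesimal equivariance *)

Section Vert.
Context {R : realType} {q : nat}.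
Notation cV := 'cV[R]_q.
Notation slq := (slq R q).
Variables (V : set cV) (G : cV -> cV -> cV -> cV).
Hypothesis hG : chrsym V G.

Lemma derive_eq_line (U W : normedModType R) (f g : U -> W) (z v : U) :
  (forall h : R, f (z + h *: v) = g (z + h *: v)) -> dv v f z = dv v g z.
Proof.
move=> e; have e0 : f z = g z by have := e 0; rewrite scale0r addr0.
rewrite !dvE /derive; suff -> : (fun h : R => h^-1 *: ((f \o shift z) (h *: v) - f z)) =
  (fun h : R => h^-1 *: ((g \o shift z) (h *: v) - g z)) by [].
by apply/funext => h /=; rewrite (addrC _ z) e e0.
Qed.

Lemma dv_hfield_vert v u (Xa : 'M[R]_q) (Xl : 'rV[R]_q) : V u.1.1 ->
  dv ((0, Xa), Xl) (hfield G (schouten G) v) u =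
  (Xa *m v,
   - (Xa *m v *m u.2 + u.1.2 *m v *m Xl) - ((Xl *m v) 0 0 *: u.1.2 + (u.2 *m v) 0 0 *: Xa)
     - (chrmx G u.1.1 (Xa *m v) *m u.1.2 + chrmx G u.1.1 (u.1.2 *m v) *m Xa),
   - ((Xl *m v) 0 0 *: u.2 + (u.2 *m v) 0 0 *: Xl)
     - (schouten G u.1.1 (Xa *m v) *m u.1.2 + schouten G u.1.1 (u.1.2 *m v) *m Xa)).
Proof.
move=> Vu; pose y := u.1.1.
pose g (u : slq) : slq := let A := u.1.2 in let al := u.2 in let av := (al *m v) 0 0 in
  (A *m v, - (A *m v *m al) - av *: A - chrmx G y (A *m v) *m A,
   - (av *: al) - schouten G y (A *m v) *m A).
(* The direction is vertical, so the base point is frozen and [G] need not be differentiated. *)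
have -> : dv ((0, Xa), Xl) (hfield G (schouten G) v) u = dv ((0, Xa), Xl) g u.
  by apply: derive_eq_line => h; rewrite /hfield /g /= scaler0 addr0.
have hA : isd (fun u : slq => u.1.2) u (fun X => X.1.2) by exact: isd_lin.
have hl : isd (fun u : slq => u.2) u (fun X => X.2) by exact: isd_lin.
have lv : linear (fun A : 'M[R]_q => A *m v) by move=> k a b; rewrite mulmxDl -scalemxAl.
have lv' : linear (fun A : 'rV[R]_q => A *m v) by move=> k a b; rewrite mulmxDl -scalemxAl.
have hAv : isd (fun u : slq => u.1.2 *m v) u (fun X => X.1.2 *m v) by exact: isd_lincomp lv hA.
have hlv : isd (fun u : slq => (u.2 *m v) 0 0) u (fun X => (X.2 *m v) 0 0).
  by apply: isd_coord; exact: isd_lincomp lv' hl.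
have hGA : isd (fun u : slq => chrmx G y (u.1.2 *m v)) u (fun X => chrmx G y (X.1.2 *m v)).
  exact: (isd_lincomp _ (chrmx_lin hG Vu) hAv).
have hSA : isd (fun u : slq => schouten G y (u.1.2 *m v)) u (fun X => schouten G y (X.1.2 *m v)).
  exact: (isd_lincomp _ (schouten_lin hG Vu) hAv).
have h2 := isd_sub (isd_sub (isd_opp (isd_mulmx hAv hl)) (isd_scale hlv hA)) (isd_mulmx hGA hA).
have h3 := isd_sub (isd_opp (isd_scale hlv hl)) (isd_mulmx hSA hA).
have [_ ->] : isd g u _ := isd_pair (isd_pair hAv h2) h3.
by [].
Qed.

Lemma dv_hfield_tr v u (be : 'rV[R]_q) : V u.1.1 ->
  let a := v *m be + ((be *m v) 0 0)%:M in
  dv ((0, 0), be) (hfield G (schouten G) v) u = - ((0, u.1.2 *m a), u.2 *m a).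
Proof.
move=> Vu a; rewrite dv_hfield_vert //; have [g0 _ _ _ _] := linP (chrmx_lin hG Vu).
have [s0 _ _ _ _] := linP (schouten_lin hG Vu).
rewrite !mul0mx g0 s0 !mul0mx !mulmx0 !scaler0 !addr0 !subr0 ?add0r /a !mulmxDr !mul_mx_scalar.
rewrite -[RHS]/(- 0, - (_ + _), - (_ + _)) oppr0 -opprD; congr (_, _, _); rewrite ?mulmxA //.
congr (- _); rewrite addrC; congr (_ + _).
by rewrite [in RHS](mx11_scalar (u.2 *m v)) mul_scalar_mx.
Qed.

(** The last summand is the derivative of the fundamental field of [a] along the horizontal one; the
    difference of the two, the bracket, is the horizontal field of [a v]. *)
Lemma dv_hfield_gl v u (a : 'M[R]_q) : V u.1.1 ->
  dv ((0, u.1.2 *m a), u.2 *m a) (hfield G (schouten G) v) u =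
  hfield G (schouten G) (a *m v) u
  + ((0, (hfield G (schouten G) v u).1.2 *m a), (hfield G (schouten G) v u).2 *m a).
Proof.
move=> Vu; rewrite dv_hfield_vert // /hfield /= -[RHS]/(_ + 0, _ + _, _ + _) addr0; congr (_, _, _).
- by rewrite mulmxA.
- rewrite !mulmxDl !mulNmx -!scalemxAl !mulmxA.
  move: (u.1.2 *m a *m v *m u.2) (u.1.2 *m v *m u.2 *m a) ((u.2 *m a *m v) 0 0 *: u.1.2)
    ((u.2 *m v) 0 0 *: (u.1.2 *m a)) (chrmx G u.1.1 (u.1.2 *m a *m v) *m u.1.2)
    (chrmx G u.1.1 (u.1.2 *m v) *m u.1.2 *m a) => a1 a2 a3 a4 a5 a6.
  by apply/matrixP => i j; rewrite !mxE; ring.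
rewrite !mulmxDl !mulNmx -!scalemxAl !mulmxA.
move: ((u.2 *m a *m v) 0 0 *: u.2) ((u.2 *m v) 0 0 *: (u.2 *m a))
  (schouten G u.1.1 (u.1.2 *m a *m v) *m u.1.2) (schouten G u.1.1 (u.1.2 *m v) *m u.1.2 *m a) => a1 a2 a3 a4.
by apply/matrixP => i j; rewrite !mxE; ring.
Qed.

Lemma hfield_Rh v u (B : 'M[R]_q) :
  let E := hfield G (schouten G) (B *m v) u in
  hfield G (schouten G) v (u.1.1, u.1.2 *m B, u.2 *m B) = (E.1.1, E.1.2 *m B, E.2 *m B).
Proof.
by move=> E; rewrite /E /hfield /= !mulmxDl !mulNmx -!scalemxAl !mulmxA.
Qed.

End Vert.

(** * Commutators of horizontal and vertical derivatives *)

Section Ops.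
Context {R : realType} {p q : nat}.
Notation bmod := (bmod R p q).
Notation cV := 'cV[R]_q.
Notation slq := (slq R q).
Notation pm := (pmod R p q).
Variables (M : folmfd R p q) (nab : conn M).
Hypothesis hn : is_folconn nab.
Variables (i : idx M) (O : set M).
Hypothesis mO : mopen O.
Notation D := (Pdom i O).
Implicit Types (f g : pm -> R) (w : pm) (h : seq 'I_q -> pm -> R).

(* In the parametrization [psi]: the derivatives along [omegaF^-1(v)] and along the
   fundamental fields of [gl(q)] and of [R^q*]. *)
Definition Dhor v f : pm -> R := fun w => dv (0, hfld nab i v w.2) f w.
Definition Dgl (a : 'M[R]_q) f : pm -> R := fun w => dv (0, ((0, w.2.1.2 *m a), w.2.2 *m a)) f w.
Definition Ddual (be : 'rV[R]_q) f : pm -> R := fun w => dv (0, ((0, 0), be)) f w.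

Let oD : open D. Proof. exact: Pdom_open. Qed.

Lemma Dhor_sm v f : sm D f -> sm D (Dhor v f).
Proof. by move=> sf; apply: sm_derive_vf => //; exact: hfld_sm. Qed.

Lemma LLf_sm a : sm D (fun w : pm => (0, ((0, w.2.1.2 *m a), w.2.2 *m a)) : pm).
Proof.
have sA : sm D (fun w : pm => w.2.1.2 *m a) by apply: sm_mulmx; [exact: sm_lin|exact: sm_cst].
have sl : sm D (fun w : pm => w.2.2 *m a) by apply: sm_mulmx; [exact: sm_lin|exact: sm_cst].
apply: sm_pair; first exact: (sm_cst _ oD).
apply: sm_pair => //; apply: sm_pair => //; exact: (sm_cst _ oD).
Qed.

Lemma Ddual_sm be f : sm D f -> sm D (Ddual be f).
Proof. by move=> sf; exact: sm_derive. Qed.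

Lemma dv_eq X f g w : (forall w, D w -> f w = g w) -> D w -> dv X f w = dv X g w.
Proof. by move=> e Dw; exact: derive_eq_on oD Dw e. Qed.

Lemma Dhor_lin f w : sm D f -> D w -> linear (fun v => Dhor v f w).
Proof.
move=> sf Dw k v v'; rewrite /Dhor; have [Vw _] := Pdom_Ndom Dw.
rewrite /hfld (hfield_lin (NGam_chrsym hn i) Vw k v v').
rewrite -(derive_dir (sm_diff sf Dw)); congr dv.
by rewrite -[RHS]/(k *: 0 + 0, _) scaler0 addr0.
Qed.

Lemma dv_sum n (k : 'I_n -> R) (F : 'I_n -> pm -> R) X w : (forall c, sm D (F c)) -> D w ->
  dv X (fun w => \sum_c k c * F c w) w = \sum_c k c * dv X (F c) w.
Proof.
move=> sF Dw; have [_ ->] := isd_sum (fun c => isd_mul (isd_cst (k c) w) (isd_sm (sF c) Dw)).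
by apply: eq_bigr => c _; rewrite mul0r add0r.
Qed.

Lemma sum_sm n (k : 'I_n -> R) (F : 'I_n -> pm -> R) : (forall c, sm D (F c)) ->
  sm D (fun w => \sum_c k c * F c w).
Proof. by move=> sF; apply: sm_sum => // c; apply: sm_mul => //; exact: (sm_cst _ oD). Qed.

Lemma tact_sm B s h : (forall t, sm D (h t)) -> sm D (fun w => tact B s (h^~ w)).
Proof. by elim: s h => [|a s IH] h sh //=; apply: sum_sm => c; exact: IH. Qed.

Lemma dv_tact B s h X w : (forall t, sm D (h t)) -> D w ->
  dv X (fun w => tact B s (h^~ w)) w = tact B s (fun t => dv X (h t) w).
Proof.
elim: s h => [//|a s IH] h sh Dw /=; rewrite dv_sum // => [|c]; last exact: tact_sm.
by apply: eq_bigr => c _; rewrite IH.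
Qed.

Lemma dact_sm B s h : (forall t, sm D (h t)) -> sm D (fun w => dact B s (h^~ w)).
Proof.
elim: s h => [|a s IH] h sh /=; first exact: (sm_cst _ oD).
by apply: sm_add; [exact: sum_sm|exact: IH].
Qed.

Lemma dv_dact B s h X w : (forall t, sm D (h t)) -> D w ->
  dv X (fun w => dact B s (h^~ w)) w = dact B s (fun t => dv X (h t) w).
Proof.
elim: s h => [|a s IH] h sh Dw /=; first by rewrite dv_cst.
have s1 : sm D (fun w => \sum_c B c a * h (c :: s) w) by exact: sum_sm.
have s2 : sm D (fun w => dact B s (fun t => h (a :: t) w)) by exact: dact_sm.
have [_ ->] := isd_add (isd_sm s1 Dw) (isd_sm s2 Dw).
by rewrite dv_sum // IH.
Qed.

Lemma wsum_sm m h : (forall t, sm D (h t)) -> sm D (fun w => wsum m (h^~ w)).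
Proof. by elim: m h => [|m IH] h sh //=; apply: sm_sum => // c; exact: IH. Qed.

Lemma dv_wsum m h X w : (forall t, sm D (h t)) -> D w ->
  dv X (fun w => wsum m (h^~ w)) w = wsum m (fun t => dv X (h t) w).
Proof.
elim: m h => [//|m IH] h sh Dw /=.
have s1 c : sm D (fun w => wsum m (fun t => h (c :: t) w)) by exact: wsum_sm.
have [_ ->] := isd_sum (fun c => isd_sm (s1 c) Dw).
by apply: eq_bigr => c _; rewrite IH.
Qed.

Lemma comm_BN be v f w : sm D f -> D w ->
  Ddual be (Dhor v f) w = Dhor v (Ddual be f) w - Dgl (v *m be + ((be *m v) 0 0)%:M) f w.
Proof.
move=> sf Dw; have sX := hfld_sm hn i v mO; have [Vw _] := Pdom_Ndom Dw.
rewrite /Ddual /Dhor (derive_vf _ _ _ sf sX Dw) // (hfld_isd hn v Dw).2 /=; congr (_ + _).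
rewrite /hfld (dv_hfield_tr (NGam_chrsym hn i)) // /Dgl -(derive_dirN _ (sm_diff sf Dw)); congr dv.
by rewrite -[RHS]/(- 0, _) oppr0.
Qed.

Lemma comm_LN a v f w : sm D f -> D w ->
  Dgl a (Dhor v f) w = Dhor v (Dgl a f) w + Dhor (a *m v) f w.
Proof.
move=> sf Dw; have sX := hfld_sm hn i v mO; have [Vw _] := Pdom_Ndom Dw.
have sL := LLf_sm a; have dF := sm_diff sf Dw.
rewrite /Dhor (derive_vf _ _ _ sf sL Dw) // /Dgl (derive_vf _ _ _ sf sX Dw) // (schwarz _ _ _ sf Dw) // -addrA; congr (_ + _).
rewrite -(derive_dirD _ _ dF); congr dv; rewrite (hfld_isd hn v Dw).2 /=.
have hA : isd (fun w : pm => w.2.1.2 *m a) w (fun X => X.2.1.2 *m a).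
  by apply: isd_lin => // k x y; rewrite mulmxDl -scalemxAl.
have hl : isd (fun w : pm => w.2.2 *m a) w (fun X => X.2.2 *m a).
  by apply: isd_lin => // k x y; rewrite mulmxDl -scalemxAl.
have [_ ->] := isd_pair (isd_cst (0 : 'cV[R]_p) w) (isd_pair (isd_pair (isd_cst (0 : cV) w) hA) hl).
rewrite /hfld (dv_hfield_gl (NGam_chrsym hn i)) // addrC -[RHS]/(0 + 0, _ + _) addr0; congr (_, _).
Qed.

End Ops.

Section Coef.
Variables (R : realType) (q k : nat).

Lemma Ckl0 : Ckl (R := R) (q := q) k 0 = 1.
Proof. by rewrite /Ckl big_geq // bin0 mulr1. Qed.

(* The recursion that makes [pair_Ddual_hders] and [Ddual_divs] cancel in the sum defining [Qloc]. *)
Lemma CklS l : (2 <= q)%N -> (l < k)%N ->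
  Ckl (R := R) (q := q) k l.+1 * (l.+1 * (q + 2 * k - l.+1))%:R = Ckl (R := R) (q := q) k l * ((k - l) * (k - l).-1)%:R.
Proof.
move=> hq lk; rewrite /Ckl big_nat_recr //=.
set P := \prod_(1 <= j < l.+1) _.
have e1 : k%:R - l.+1%:R = (k - l).-1%:R :> R by rewrite -natrB // subnS.
have e2 : q%:R + (2 * k)%:R - l.+1%:R = (q + 2 * k - l.+1)%:R :> R.
  by rewrite -natrD -natrB //; lia.
have n0 : (q + 2 * k - l.+1)%:R != 0 :> R by rewrite pnatr_eq0; lia.
have b : l.+1%:R * ('C(k, l.+1))%:R = (k - l)%:R * ('C(k, l))%:R :> R.
  by rewrite -!natrM mul_bin_left.
rewrite e1 e2 !natrM; transitivity (P * (k - l).-1%:R * (l.+1%:R * ('C(k, l.+1))%:R)).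
  by field.
by rewrite b; ring.
Qed.

End Coef.

(** * The [R^q*] derivative of iterated derivatives and divergences *)

Section Seqs.
Context {R : realType} {p q : nat}.
Notation bmod := (bmod R p q).
Notation cV := 'cV[R]_q.
Notation slq := (slq R q).
Notation pm := (pmod R p q).
Hypothesis hq : (2 <= q)%N.
Variables (M : folmfd R p q) (nab : conn M).
Hypothesis hn : is_folconn nab.
Variables (i : idx M) (O : set M).
Hypothesis mO : mopen O.
Notation D := (Pdom i O).
Notation Dhor := (Dhor nab i).
Implicit Types (f g : pm -> R) (w : pm) (h : seq 'I_q -> pm -> R).

(* the components of [nabla^m f] (before symmetrization) and of [Div^l S] *)
Fixpoint hders f (s : seq 'I_q) : pm -> R := if s is a :: s' then Dhor (evec a) (hders f s') else f.

Fixpoint divs h l (s : seq 'I_q) : pm -> R :=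
  if l is l'.+1 then fun w => \sum_j Dhor (evec j) (divs h l' (j :: s)) w else h s.

Lemma hders_sm f s : sm D f -> sm D (hders f s).
Proof. by move=> sf; elim: s => [//|a s IH] /=; exact: Dhor_sm. Qed.

Lemma divs_sm h l s : (forall t, sm D (h t)) -> sm D (divs h l s).
Proof.
move=> sh; elim: l s => [//|l IH] s /=; apply: sm_sum; first exact: Pdom_open.
by move=> j; exact: Dhor_sm.
Qed.

Lemma mx_evec (a : 'M[R]_q) b : a *m evec b = \sum_c a c b *: evec c.
Proof.
rewrite [LHS]cV_delta; apply: eq_bigr => c _; congr (_ *: _).
rewrite mxE (bigD1 b) //= mxE !eqxx mulr1 big1 ?addr0 // => d nd.
by rewrite mxE (negbTE nd) mulr0.
Qed.

Lemma Dhor_mx (a : 'M[R]_q) b f w : sm D f -> D w -> Dhor (a *m evec b) f w = \sum_c a c b * Dhor (evec c) f w.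
Proof.
move=> sf Dw; have [_ _ nZ _ nS] := linP (Dhor_lin hn sf Dw).
by rewrite mx_evec nS; apply: eq_bigr => c _; rewrite nZ.
Qed.

Lemma Dgl_sumD a n (F : 'I_n -> pm -> R) w : (forall c, sm D (F c)) -> D w ->
  Dgl a (fun w => \sum_c F c w) w = \sum_c Dgl a (F c) w.
Proof. by move=> sF Dw; rewrite /Dgl; have [_ ->] := isd_sum (fun c => isd_sm (sF c) Dw). Qed.

Lemma dv_sumD X n (F : 'I_n -> pm -> R) w : (forall c, sm D (F c)) -> D w ->
  dv X (fun w => \sum_c F c w) w = \sum_c dv X (F c) w.
Proof. by move=> sF Dw; have [_ ->] := isd_sum (fun c => isd_sm (sF c) Dw). Qed.

Section G.
Variable f : pm -> R.
Hypotheses (sf : sm D f) (Lf : forall a w, D w -> Dgl a f w = 0).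
Hypothesis Bf : forall be w, D w -> Ddual be f w = 0.

Let sG s : sm D (hders f s). Proof. exact: hders_sm. Qed.

Lemma hders_Dgl a s w : D w -> Dgl a (hders f s) w = dact a s (fun t => hders f t w).
Proof.
elim: s w => [|b s IH] w Dw /=; first exact: Lf.
rewrite (comm_LN hn mO) // Dhor_mx // addrC; congr (_ + _).
rewrite /Dhor (dv_eq (i:=i) mO _ IH Dw) (dv_dact (i:=i) mO) //.
Qed.

Variable be : 'rV[R]_q.

(** Induction on [m], peeling off the outermost derivative. Commuting it with [Ddual] leaves a
    [gl(q)] derivative that acts on the remaining word; [pair_dact] moves this action to [T], where
    [sum_dact] yields the coefficient [2 m], and [m (m - 1) + 2 m = (m + 1) m]. *)
Lemma pair_Ddual_hders m (T : seq 'I_q -> R) w : symw m T -> D w ->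
  wsum m (fun s => T s * Ddual be (hders f s) w) =
  - (m * m.-1)%:R * wsum m.-1 (fun t => contr be T t * hders f t w).
Proof.
elim: m T w => [|m IH] T w sT Dw; first by rewrite /= Bf // mulr0 mul0n oppr0 mul0r.
have e1 b s : Ddual be (hders f (b :: s)) w = Dhor (evec b) (Ddual be (hders f s)) w - dact (fmx be b) s (fun t => hders f t w).
  by rewrite [hders _ _]/= (comm_BN hn mO) // -hders_Dgl // rV_evec.
have sTb b : symw m (fun t => T (b :: t)) := symw_cons b sT.
transitivity (\sum_b (wsum m (fun s => T (b :: s) * Dhor (evec b) (Ddual be (hders f s)) w)
     - wsum m (fun s => dact (fmx be b)^T s (fun t => T (b :: t)) * hders f s w))).
  apply: eq_bigr => b _; rewrite -pair_dact -mulN1r -wsumZ -wsumD; apply: wsum_ext => s _.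
  by rewrite e1 mulrBr mulN1r.
rewrite sumrB.
have -> : \sum_b wsum m (fun s => dact (fmx be b)^T s (fun t => T (b :: t)) * hders f s w) =
    (2 * m)%:R * wsum m (fun t => contr be T t * hders f t w).
  by rewrite -wsum_sum -wsumZ; apply: wsum_ext => s sz; rewrite -mulr_suml (sum_dact be sT sz) mulrA.
have -> : \sum_b wsum m (fun s => T (b :: s) * Dhor (evec b) (Ddual be (hders f s)) w) =
    - (m * m.-1)%:R * wsum m (fun t => contr be T t * hders f t w).
  have E b : wsum m (fun s => T (b :: s) * Dhor (evec b) (Ddual be (hders f s)) w) =
     - (m * m.-1)%:R * wsum m.-1 (fun t => contr be (fun t => T (b :: t)) t * hders f (b :: t) w).
    have sB s : sm D (fun w => T (b :: s) * Ddual be (hders f s) w).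
      apply: sm_mul; first exact: (sm_cst _ (Pdom_open mO)).
      exact: Ddual_sm.
    (* The tensor [T] is constant, so the horizontal derivative can be taken outside the pairing,
       where the induction hypothesis holds on the whole domain. *)
    transitivity (Dhor (evec b) (fun w => wsum m (fun s => T (b :: s) * Ddual be (hders f s) w)) w).
      rewrite /Dhor (dv_wsum (i:=i) mO _ _ sB Dw); apply: wsum_ext => s _.
      have [_ ->] := isd_mul (isd_cst (T (b :: s)) w) (isd_sm (Ddual_sm be (sG s)) Dw).
      by rewrite mul0r add0r.
    rewrite /Dhor (dv_eq (i:=i) mO _ (fun w Dw => IH (fun t => T (b :: t)) w (sTb b) Dw) Dw).
    have sC t : sm D (fun w => contr be (fun t => T (b :: t)) t * hders f t w).
      by apply: sm_mul => //; exact: (sm_cst _ (Pdom_open mO)).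
    have [_ ->] := isd_mul (isd_cst (- (m * m.-1)%:R : R) w) (isd_sm (wsum_sm (i:=i) mO m.-1 sC) Dw).
    rewrite mul0r add0r (dv_wsum (i:=i) mO _ _ sC Dw); congr (_ * _); apply: wsum_ext => t _.
    have [_ ->] := isd_mul (isd_cst (contr be (fun t => T (b :: t)) t) w) (isd_sm (sG t) Dw).
    by rewrite mul0r add0r.
  under eq_bigr do rewrite E; rewrite -mulr_sumr.
  case: m sT {IH e1 sTb E} => [|m] sT; first by rewrite mul0n oppr0 !mul0r.
  congr (_ * _).
  apply: eq_bigr => b _; apply: wsum_ext => t sz; congr (_ * _); apply: eq_bigr => c _.
  by rewrite (symw_swap _ _ sT).
rewrite -mulrBl; congr (_ * _); rewrite -opprD -natrD; congr (- _%:R); case: m {IH sT e1 sTb} => //= m; lia.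
Qed.

End G.

Section T.
Variables (k : nat) (h : seq 'I_q -> pm -> R).
Hypotheses (sh : forall s, sm D (h s)) (Bh : forall be s w, D w -> Ddual be (h s) w = 0).
Hypothesis (Lh : forall a s w, D w -> Dgl a (h s) w = - dact a^T s (fun t => h t w)).
Hypothesis symfun : forall w, D w -> symw k (fun s => h s w).

Let sT l s : sm D (divs h l s). Proof. exact: divs_sm. Qed.

Lemma divs_sym l w : D w -> symw (k - l) (fun s => divs h l s w).
Proof.
elim: l w => [|l IH] w Dw s t; first by rewrite subn0; exact: symfun.
have [kl|lk] := leqP k l.
  (* For [l >= k] the truncated difference leaves only the empty word. *)
  have -> : (k - l.+1)%N = 0%N by lia.
  by case: s => // _ /perm_size; case: t.
move=> sz st; apply: eq_bigr => j _; apply: (dv_eq (i:=i) mO) => // w' Dw'.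
by apply: IH => //; rewrite ?perm_cons //= sz; lia.
Qed.

(** The index summed over in a divergence occurs once as a direction of derivation and once as an
    index of the tensor; its two contributions cancel and only the free indices are acted upon. *)
Lemma divs_Dgl a l s w : D w -> Dgl a (divs h l s) w = - dact a^T s (fun t => divs h l t w).
Proof.
elim: l s w => [|l IH] s w Dw /=; first exact: Lh.
have sN j t : sm D (Dhor (evec j) (divs h l t)) by exact: Dhor_sm.
rewrite Dgl_sumD // dact_sum -sumrN.
have E j : Dgl a (Dhor (evec j) (divs h l (j :: s))) w =
   (\sum_c a c j * Dhor (evec c) (divs h l (j :: s)) w - \sum_c a j c * Dhor (evec j) (divs h l (c :: s)) w)
   - dact a^T s (fun t => Dhor (evec j) (divs h l (j :: t)) w).
  rewrite (comm_LN hn mO) // Dhor_mx // addrC -addrA; congr (_ + _).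
  rewrite {1}/Dhor (dv_eq (i:=i) mO _ (fun w Dw => IH (j :: s) w Dw) Dw).
  have [_ ->] := isd_opp (isd_sm (dact_sm (i:=i) mO a^T (j :: s) (sT l)) Dw).
  rewrite (dv_dact (i:=i) mO) //= opprD; congr (- _ - _).
  by apply: eq_bigr => c _; rewrite mxE.
under eq_bigr do rewrite E; rewrite big_split /= sumrB -[RHS]add0r; congr (_ + _).
by rewrite exchange_big subrr.
Qed.

Variable be : 'rV[R]_q.

(** The step from [l] to [l + 1] adds [q + 1], from the matrix [fmx] acting on the contracted index,
    and [2 (k - l - 1)], from the remaining letters by [sum_dact]. This gives [l (q + 2k - l) + (q +
    1) + 2 (k - l - 1) = (l + 1) (q + 2k - l - 1)]. *)
Lemma Ddual_divs l s w : (l <= k)%N -> size s = (k - l)%N -> D w ->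
  Ddual be (divs h l s) w = (l * (q + 2 * k - l))%:R * contr be (fun t => divs h l.-1 t w) s.
Proof.
elim: l s w => [|l IH] s w lk sz Dw; first by rewrite mul0n mul0r; exact: Bh.
have sN j t : sm D (Dhor (evec j) (divs h l t)) by exact: Dhor_sm.
have symT : symw (size s).+1 (fun t => divs h l t w).
  by have := divs_sym (l:=l) Dw; have -> : (size s).+1 = (k - l)%N by lia.
set K := (l * (q + 2 * k - l))%:R : R.
rewrite /= {1}/Ddual (dv_sumD _ _ Dw) //.
have E j : dv (0, (0, 0, be)) (Dhor (evec j) (divs h l (j :: s))) w =
   K * (\sum_c be 0 c * Dhor (evec j) (divs h l.-1 (c :: j :: s)) w)
   + (\sum_c fmx be j j c * divs h l (c :: s) w
   + dact (fmx be j)^T s (fun t => divs h l (j :: t) w)).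
  rewrite -/(Ddual be _ w) (comm_BN hn mO) // rV_evec -/(fmx be j) divs_Dgl // opprK.
  congr (_ + _); last by rewrite /=; congr (_ + _); apply: eq_bigr => c _; rewrite mxE.
  have IH' w' : D w' -> Ddual be (divs h l (j :: s)) w' = K * (\sum_c be 0 c * divs h l.-1 (c :: j :: s) w').
    by move=> Dw'; rewrite IH //=; lia.
  rewrite {1}/Dhor (dv_eq (i:=i) mO _ IH' Dw).
  have [_ ->] := isd_mul (isd_cst K w) (isd_sm (sum_sm (i:=i) mO (be 0) (fun c => sT l.-1 (c :: j :: s))) Dw).
  by rewrite mul0r add0r (dv_sum (i:=i) (O:=O)).
under eq_bigr do rewrite E; rewrite !big_split /= -mulr_sumr.
rewrite (sum_dact be symT erefl).
have -> : \sum_j \sum_c fmx be j j c * divs h l (c :: s) w = (q.+1)%:R * contr be (fun t => divs h l t w) s.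
  have E1 j : \sum_c fmx be j j c * divs h l (c :: s) w =
     contr be (fun t => divs h l t w) s + be 0 j * divs h l (j :: s) w.
    transitivity (\sum_c (be 0 c * divs h l (c :: s) w + (c == j)%:R * (be 0 j * divs h l (c :: s) w))).
      by apply: eq_bigr => c _; rewrite fmxE eqxx mul1r mulrDl (eq_sym j c) [RHS]addrC [in RHS]mulrA [(c == j)%:R * be 0 j]mulrC addrC.
    rewrite big_split /=; congr (_ + _); rewrite (bigD1 j) //= eqxx mul1r big1 ?addr0 // => c nc.
    by rewrite (negbTE nc) mul0r.
  under eq_bigr do rewrite E1; rewrite big_split /= -/(contr be (fun t => divs h l t w) s).
  by rewrite sumr_const card_ord -mulr_natl -natr1; ring.
have -> : K * (\sum_j \sum_c be 0 c * Dhor (evec j) (divs h l.-1 [:: c, j & s]) w) =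
   K * contr be (fun t => divs h l t w) s.
  rewrite /K; case: l lk sz {IH sN symT K E} => [|l] lk sz; first by rewrite mul0n !mul0r.
  congr (_ * _); rewrite exchange_big; apply: eq_bigr => c _ /=; rewrite -mulr_sumr; congr (_ * _).
  apply: eq_bigr => j _; apply: (dv_eq (i:=i) mO) => // w' Dw'.
  have := divs_sym (l:=l) Dw'; have -> : (k - l)%N = (size s).+2 by lia.
  by move=> /symw_swap; apply.
rewrite -!mulrDl /K -!natrD; congr (_%:R * _); rewrite sz.
have -> : k = (l.+1 + (k - l.+1))%N by lia.
move: (k - l.+1)%N => n; clear; nia.
Qed.

Section Q.
Variable f : pm -> R.
Hypotheses (sf : sm D f) (Lf : forall a w, D w -> Dgl a f w = 0).
Hypothesis Bf : forall be w, D w -> Ddual be f w = 0.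

Definition Qloc w : R := \sum_(l < k.+1) Ckl (R := R) (q := q) k l *
  wsum (k - l) (fun t => divs h l t w * hders f t w).

Lemma pair_sm l : sm D (fun w => wsum (k - l) (fun t => divs h l t w * hders f t w)).
Proof. by apply: (wsum_sm (i:=i) mO) => t; apply: sm_mul => //; exact: hders_sm. Qed.

Lemma Qloc_sm : sm D Qloc.
Proof. by apply: (sum_sm (i:=i) mO) => l; exact: pair_sm. Qed.

(** Differentiating the divergence in the term [l + 1] and the function in the term [l] produces the
    same contraction [X l], with coefficients matched by [CklS]. *)
Lemma Ddual_Qloc w : D w -> Ddual be Qloc w = 0.
Proof.
move=> Dw; have sG t := hders_sm t sf.
pose X l := wsum (k - l.+1) (fun t => contr be (fun t => divs h l t w) t * hders f t w).
have E l : (l <= k)%N -> Ddual be (fun w => wsum (k - l) (fun t => divs h l t w * hders f t w)) w =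
   (l * (q + 2 * k - l))%:R * wsum (k - l) (fun t => contr be (fun t => divs h l.-1 t w) t * hders f t w)
   - ((k - l) * (k - l).-1)%:R * X l.
  move=> lk; rewrite /Ddual (dv_wsum (i:=i) mO) //; last by move=> t; exact: sm_mul.
  rewrite /X subnS -mulNr -(pair_Ddual_hders sf Lf Bf be (divs_sym (l:=l) Dw) Dw) -wsumZ -wsumD.
  apply: wsum_ext => t sz; have [_ ->] := isd_mul (isd_sm (sT l t) Dw) (isd_sm (sG t) Dw).
  by rewrite -/(Ddual be _ w) -/(Ddual be (hders f t) w) Ddual_divs // mulrA.
rewrite /Ddual (dv_sum (i:=i) (O:=O) (fun l : 'I_k.+1 => Ckl (R := R) (q := q) k l)) // => [|l]; last exact: pair_sm.
transitivity (\sum_(l < k.+1) (Ckl (R := R) (q := q) k l * ((l * (q + 2 * k - l))%:R *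
     wsum (k - l) (fun t => contr be (fun t => divs h l.-1 t w) t * hders f t w))
   - Ckl (R := R) (q := q) k l * ((k - l) * (k - l).-1)%:R * X l)).
  apply: eq_bigr => l _; rewrite -/(Ddual be (fun w => wsum (k - l) (fun t => divs h l t w * hders f t w)) w).
  by rewrite E; [rewrite mulrBr !mulrA|rewrite -ltnS].
(* The second sum vanishes at [l = k] and the first at [l = 0]; with these terms removed and the
   index shifted, the two sums run over the same [k] terms. *)
rewrite sumrB [X in _ - X]big_ord_recr /= subnn mul0n mulr0 mul0r addr0.
rewrite big_ord_recl /= mul0n mul0r mulr0 add0r -sumrB big1 // => l _.
by rewrite /bump /= add1n mulrA -CklS // subrr.
Qed.

End Q.
End T.
End Seqs.

(** * Changes of coordinates *)

Section Flat.
Context {R : realType} {p q : nat}.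
Notation pm := (pmod R p q).
Variables (M : folmfd R p q) (nab : conn M).
Hypothesis hn : is_folconn nab.
Variables (i : idx M) (O : set M).
Hypothesis mO : mopen O.
Notation D := (Pdom i O).

Definition flat (f : pm -> R) := forall w x, D w -> dv (x, 0) f w = 0.

Lemma Dhor_flat v f : sm D f -> flat f -> flat (Dhor nab i v f).
Proof.
move=> sf ff w x Dw; rewrite /Dhor (derive_vf _ _ _ sf (hfld_sm hn i v mO) Dw) //.
rewrite (dv_eq (i:=i) mO (g := fun=> 0) _ _ Dw); last by move=> z Dz; exact: ff.
by rewrite dv_cst add0r (hfld_isd hn v Dw).2 /= (dvE 0) derive0 (dvE 0) derive0.
Qed.

Lemma hders_flat f s : sm D f -> flat f -> flat (hders nab i f s).
Proof.
move=> sf ff; elim: s => [//|a s IH] /=; apply: Dhor_flat => //; exact: hders_sm.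
Qed.

Lemma sum_flat n (k : 'I_n -> R) (F : 'I_n -> pm -> R) : (forall c, sm D (F c)) ->
  (forall c, flat (F c)) -> flat (fun w => \sum_c k c * F c w).
Proof.
move=> sF fF w x Dw; rewrite (dv_sum (i:=i) (O:=O)) // big1 // => c _.
by rewrite fF // mulr0.
Qed.

Lemma sumD_flat n (F : 'I_n -> pm -> R) : (forall c, sm D (F c)) ->
  (forall c, flat (F c)) -> flat (fun w => \sum_c F c w).
Proof. by move=> sF fF w x Dw; rewrite (dv_sumD _ sF Dw) big1 // => c _; rewrite fF. Qed.

Lemma mul_flat f g : sm D f -> sm D g -> flat f -> flat g -> flat (fun w => f w * g w).
Proof.
move=> sf sg ff fg w x Dw; have [_ ->] := isd_mul (isd_sm sf Dw) (isd_sm sg Dw).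
by rewrite ff // fg // mul0r mulr0 addr0.
Qed.

Lemma wsum_flat m (h : seq 'I_q -> pm -> R) : (forall t, sm D (h t)) ->
  (forall t, flat (h t)) -> flat (fun w => wsum m (h^~ w)).
Proof.
elim: m h => [|m IH] h sh fh /=; first exact: fh.
apply: sumD_flat => c; last exact: IH.
exact: (wsum_sm (i:=i) mO).
Qed.

Lemma tact_flat B s (h : seq 'I_q -> pm -> R) : (forall t, sm D (h t)) ->
  (forall t, flat (h t)) -> flat (fun w => tact B s (h^~ w)).
Proof.
elim: s h => [|b s IH] h sh fh /=; first exact: fh.
apply: sum_flat => c; last exact: IH.
exact: (tact_sm (i:=i) mO).
Qed.

Lemma divs_flat h l s : (forall t, sm D (h t)) -> (forall t, flat (h t)) -> flat (divs nab i h l s).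
Proof.
move=> sh fh; elim: l s => [//|l IH] s /=; apply: sumD_flat => c.
  by apply: Dhor_sm => //; exact: divs_sm.
by apply: Dhor_flat => //; exact: divs_sm.
Qed.

Lemma Qloc_flat k h f : (forall t, sm D (h t)) -> (forall t, flat (h t)) -> sm D f -> flat f ->
  flat (Qloc nab i k h f).
Proof.
move=> sh fh sf ff; apply: sum_flat => l.
  by apply: (wsum_sm (i:=i) mO) => t; apply: sm_mul; [exact: divs_sm|exact: hders_sm].
apply: wsum_flat => t; first by apply: sm_mul; [exact: divs_sm|exact: hders_sm].
by apply: mul_flat; [exact: divs_sm|exact: hders_sm|exact: divs_flat|exact: hders_flat].
Qed.

End Flat.

(** * Maps intertwining the horizontal derivatives *)

Section Transf.
Context {R : realType} {p q : nat}.
Notation pm := (pmod R p q).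
Variables (M0 M : folmfd R p q) (nab0 : conn M0) (nab : conn M).
Hypotheses (hn0 : is_folconn nab0) (hn : is_folconn nab).
Variables (i0 : idx M0) (i : idx M) (O0 : set M0) (O : set M).
Hypotheses (mO0 : mopen O0) (mO : mopen O).
Notation D0 := (Pdom i0 O0).
Notation D := (Pdom i O).
Variables (Phi : pm -> pm) (A B : 'M[R]_q).
Hypothesis DPhi : forall w, D0 w -> D (Phi w).
Hypothesis NPhi : forall f, sm D f -> flat i O f -> forall v w, D0 w ->
  Dhor nab0 i0 v (f \o Phi) w = Dhor nab i (A *m v) f (Phi w).
Hypothesis AB : forall c d, \sum_b B c b * A d b = (c == d)%:R.

Section G.
Variables (f0 f : pm -> R).
Hypotheses (sf : sm D f) (ff : flat i O f) (ef : forall w, D0 w -> f0 w = f (Phi w)).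

Lemma hders_transf s w : D0 w -> hders nab0 i0 f0 s w = tact A s (fun t => hders nab i f t (Phi w)).
Proof.
have sG t : sm D (hders nab i f t) by exact: hders_sm.
have fG t : flat i O (hders nab i f t) by exact: hders_flat.
elim: s w => [|b s IH] w Dw /=; first exact: ef.
have -> : Dhor nab0 i0 (evec b) (hders nab0 i0 f0 s) w =
    Dhor nab0 i0 (evec b) ((fun w => tact A s (fun t => hders nab i f t w)) \o Phi) w.
  exact: (dv_eq (i:=i0) mO0).
rewrite NPhi //; [|exact: (tact_sm (i:=i) mO)|exact: tact_flat].
rewrite (Dhor_mx hn (O:=O)); [|exact: (tact_sm (i:=i) mO)|exact: DPhi].
apply: eq_bigr => c _; congr (_ * _).
by rewrite {1}/Dhor (dv_tact (i:=i) mO _ _ _ sG (DPhi Dw)).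
Qed.

End G.

Section T.
Variables (h0 h : seq 'I_q -> pm -> R).
Hypotheses (sh : forall s, sm D (h s)) (fh : forall s, flat i O (h s)).
Hypothesis eh : forall s w, D0 w -> h0 s w = tact B s (fun t => h t (Phi w)).

Lemma divs_transf l s w : D0 w -> divs nab0 i0 h0 l s w = tact B s (fun t => divs nab i h l t (Phi w)).
Proof.
have sT l' t : sm D (divs nab i h l' t) by exact: divs_sm.
have fT l' t : flat i O (divs nab i h l' t) by exact: divs_flat.
elim: l s w => [|l IH] s w Dw /=; first exact: eh.
pose F c w := tact B s (fun t => divs nab i h l (c :: t) w).
have sF c : sm D (F c) by exact: (tact_sm (i:=i) mO).
have E j : Dhor nab0 i0 (evec j) (divs nab0 i0 h0 l (j :: s)) w =
    \sum_d \sum_c B c j * A d j * Dhor nab i (evec d) (F c) (Phi w).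
  have -> : Dhor nab0 i0 (evec j) (divs nab0 i0 h0 l (j :: s)) w =
      Dhor nab0 i0 (evec j) ((fun w => \sum_c B c j * F c w) \o Phi) w.
    by apply: (dv_eq (i:=i0) mO0) => // w' Dw'; rewrite IH.
  rewrite NPhi //; [|exact: (sum_sm (i:=i) mO)|by apply: sum_flat => // c; exact: tact_flat].
  rewrite (Dhor_mx hn (O:=O)); [|exact: (sum_sm (i:=i) mO)|exact: DPhi].
  apply: eq_bigr => d _; rewrite {1}/Dhor (dv_sum (i:=i) (O:=O) _ _ sF (DPhi Dw)) mulr_sumr.
  by apply: eq_bigr => c _; rewrite mulrA [A d j * _]mulrC.
under eq_bigr do rewrite E; rewrite tact_sum exchange_big; apply: eq_bigr => d _ /=.
rewrite exchange_big (bigD1 d) //= -mulr_suml AB eqxx mul1r big1 ?addr0 => [|c nc].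
  by rewrite {1}/Dhor (dv_tact (i:=i) mO _ _ _ (fun t => sT l (d :: t)) (DPhi Dw)).
by rewrite -mulr_suml AB (negbTE nc) mul0r.
Qed.

(** Iterated derivatives are transformed by [A] and divergences by the contragredient [B], so their
    pairing is unchanged. Translations, projective changes and foliated maps are all obtained by a
    choice of [Phi], [A] and [B]. *)
Lemma Qloc_transf k f0 f w : sm D f -> flat i O f -> (forall w, D0 w -> f0 w = f (Phi w)) -> D0 w ->
  Qloc nab0 i0 k h0 f0 w = Qloc nab i k h f (Phi w).
Proof.
move=> sf ff ef Dw; apply: eq_bigr => l _; congr (_ * _); rewrite -[RHS](pair_tact _ _ _ AB).
by apply: wsum_ext => t _; rewrite divs_transf // (hders_transf sf ff ef).
Qed.

End T.
End Transf.

Section Instances.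
Context {R : realType} {p q : nat}.
Notation pm := (pmod R p q).

Definition glact (B : 'M[R]_q) (w : pm) : pm := (w.1, ((w.2.1.1, w.2.1.2 *m B), w.2.2 *m B)).

Lemma glact_Dhor (M : folmfd R p q) (nab : conn M) i O (B : 'M[R]_q) : is_folconn nab ->
  B \in unitmx -> forall f, sm (Pdom i O) f -> forall v w, Pdom i O w ->
  Dhor nab i v (f \o glact B) w = Dhor nab i (invmx B *m v) f (glact B w).
Proof.
move=> hn uB f sf v w Dw; have DR : Pdom i O (glact B w).
  by case: Dw => d o u; split=> //=; rewrite unitmx_mul u.
have lB : linear (glact B).
  move=> k x y; rewrite /glact /= !mulmxDl -!scalemxAl.
  by case: x => x1 [[x2 x3] x4]; case: y => y1 [[y2 y3] y4].
have hB : isd (glact B) w (glact B) by exact: isd_lin.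
have [Vw _] := Pdom_Ndom Dw.
rewrite /Dhor derive_comp; [|exact: hB.1|exact: sm_diff sf DR].
rewrite hB.2; congr dv; rewrite /glact /= /hfld; congr (_, _).
by rewrite (hfield_Rh (NGam nab i) _ w.2) mulKVmx.
Qed.

Hypothesis hq : (2 <= q)%N.

Definition projact (c : 'cV[R]_q -> 'rV[R]_q) (w : pm) : pm := (w.1, projlift c w.2).

Lemma projlift_Dhor (M : folmfd R p q) (nab nab' : conn M) i O c : is_folconn nab -> is_folconn nab' ->
  sm (Vd i) c -> (forall y v v', Vd i y -> NGam nab i y v v' =
     NGam nab' i y v v' + (c y *m v) 0 0 *: v' + (c y *m v') 0 0 *: v) ->
  forall f, sm (Pdom i O) f -> forall v w, Pdom i O w ->
  Dhor nab i v (f \o projact c) w = Dhor nab' i v f (projact c w).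
Proof.
move=> hn hn' sc hc f sf v w Dw; have [Vw _] := Pdom_Ndom Dw.
have DT : Pdom i O (projact c w) by [].
have h1 : isd (fun w : pm => w.1) w (fun X => X.1) by exact: isd_lin.
have h2 : isd (fun w : pm => w.2) w (fun X => X.2) by exact: isd_lin.
have [dT eT] : isd (projact c) w _ := isd_pair h1 (isd_comp h2 (projlift_isd sc Vw)).
have := hfield_proj hq (NGam_chrsym hn i) (NGam_chrsym hn' i) sc hc v Vw.
rewrite (projlift_isd sc Vw).2 => E.
have E' : dv (0, hfld nab i v w.2) (projact c) w = (0, hfld nab' i v (projact c w).2) by rewrite eT /hfld -E.
apply: etrans (derive_comp (0, hfld nab i v w.2) dT (sm_diff sf DT)) _.
exact (congr1 (fun X => dv X f (projact c w)) E').
Qed.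

Lemma Phi_Dhor (M0 M : folmfd R p q) (phi : M0 -> M) nab0 nab (O : set M) i j : mor phi ->
  is_folconn nab0 -> is_folconn nab -> is_pull_conn phi nab nab0 ->
  forall f, sm (Pdom j O) f -> flat j O f -> forall v w, Pdom i (phi @^-1` (O `&` udom j)) w ->
  Dhor nab0 i v (f \o Phi phi i j) w = Dhor nab j v f (Phi phi i j w).
Proof.
move=> hp hn0 hn pc f sf ff v w Dw.
have DP : Pdom j O (Phi phi i j w).
  have [d [? u] uA] := Dw; have Dz : Dm phi i j (pbase w) by [].
  have e : pbase (Phi phi i j w) = Tm phi i j (pbase w) by rewrite /pbase -surjective_pairing.
  split; rewrite ?e; [exact: chart_dom|by rewrite /Tm chartK|].
  by rewrite /= unitmx_mul uA (mor_unit hp).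
have Dw' : Pdom i (phi @^-1` udom j) w by case: Dw => d [] ? ? ?.
apply: (dv_mor hp hn0 hn pc v 0 sf Dw' DP) => x; exact: ff.
Qed.

End Instances.

(** * Pullbacks of symbols and functions *)

Section TactB.
Context {R : realType} {q : nat} {V : normedModType R}.
Variables (D : set V) (B : V -> 'M[R]_q).
Hypotheses (fV : findim V) (oD : open D) (sB : sm D B).

Lemma tactB_sm s (g : seq 'I_q -> V -> R) : (forall t, sm D (g t)) ->
  sm D (fun w => tact (B w) s (g^~ w)).
Proof.
elim: s g => [|b s IH] g sg //=; apply: sm_sum => // c; apply: sm_mul; last exact: IH.
exact: sm_coord.
Qed.

(** Leibniz rule over the letters of the word: each occurrence of [B] contributes [- B Q], and the
    sum over the positions is the infinitesimal action of [Q]. *)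
Lemma dv_tactB s (g : seq 'I_q -> V -> R) X Q w : (forall t, sm D (g t)) -> D w ->
  dv X B w = - (B w *m Q) -> (forall t, dv X (g t) w = 0) ->
  dv X (fun w => tact (B w) s (g^~ w)) w = - dact Q s (fun t => tact (B w) t (g^~ w)).
Proof.
move=> sg Dw dB; elim: s g sg => [|b s IH] g sg dg /=; first by rewrite dg oppr0.
have sT c : sm D (fun w => tact (B w) s (fun t => g (c :: t) w)) by exact: tactB_sm.
have hB c := isd_coord c b (isd_sm sB Dw).
have [_ ->] := isd_sum (fun c => isd_mul (hB c) (isd_sm (sT c) Dw)).
rewrite big_split /= opprD dact_lin -!sumrN; congr (_ + _).
  rewrite dB; under eq_bigr do rewrite mxE mxE mulNr mulr_suml.
  rewrite !sumrN; congr (- _); rewrite exchange_big; apply: eq_bigr => e _ /=.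
  by rewrite mulr_sumr; apply: eq_bigr => c _; rewrite mulrAC mulrC mulrA.
by apply: eq_bigr => c _; rewrite IH // mulrN.
Qed.

End TactB.

Section Symbol.
Context {R : realType} {p q : nat}.
Notation bmod := (bmod R p q).
Notation cV := 'cV[R]_q.
Notation pm := (pmod R p q).
Variables (M : folmfd R p q) (k : nat) (S : jet M -> @tens R q).
Hypothesis hS : is_symbol k S.
Variable i : idx M.

Definition lin_frame (w : pm) : cV -> M := rep i w.1 (fun v => w.2.1.1 + w.2.1.2 *m v).

(** A symbol is unconstrained on words of length other than [k]; the value 0 there allows smoothness
    and equivariance to be stated for all words. *)
Definition symfun s (w : pm) : R := if size s == k then S (jet_of 1 (lin_frame w)) s else 0.

Definition symcomp t (z : bmod) : R := if size t == k then S (dyframe i (par i z)) t else 0.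

Notation D := (Pdom i setT).

Let oD : open D. Proof. exact: Pdom_open (@mopenT _ _ _ M). Qed.

Lemma lin_frame_tr w : D w -> transversal (lin_frame w).
Proof.
move=> [d _ u]; have lA : sm [set: cV] (fun v => w.2.1.1 + w.2.1.2 *m v).
  apply: sm_add; first exact: (sm_cst _ openT).
  by apply: sm_mulmx; [exact: (sm_cst _ openT)|exact: (sm_id _ openT)].
apply: (rep_transversal lA) => //; first by rewrite mulmx0 addr0.
move=> v; exists (invmx w.2.1.2 *m v).
have [_ ->] := isd_add (isd_cst w.2.1.1 (0 : cV)) (isd_lin (0 : cV) _ (@mulmx_lin1 R _ _ _ w.2.1.2)).
by rewrite add0r mulKVmx.
Qed.

(** Regularity of a symbol is given only along the coordinate frames; equivariance carries it to
    every frame. *)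
Lemma symhE s w : D w -> symfun s w = tact (invmx w.2.1.2)^T s (fun t => symcomp t (pbase w)).
Proof.
move=> Dw; rewrite /symfun; case: ifP => [/eqP sz|/eqP sz]; last first.
  by rewrite tact0 // => t st; rewrite /symcomp st ifF //; apply/eqP.
pose s' := Tuple (introT eqP sz); rewrite -[in LHS]/(val s').
have [d _ u] := Dw.
rewrite (symbol_equiv hS s' (lin_frame_tr Dw) (A := invmx w.2.1.2)) ?unitmx_inv //.
rewrite -[s in RHS]/(val s') -prod_tact; apply: eq_bigr => t _; congr (_ * _).
rewrite /symcomp size_tuple eqxx; congr (S (jet_of 1 _) _); apply/funext => v /=.
by rewrite /lin_frame /rep mulKVmx // parK.
Qed.

Lemma symcomp_sm t : sm (dom i) (symcomp t) /\ forall z x, dom i z -> dv (x, 0) (symcomp t) z = 0.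
Proof.
have Du z : dom i z <-> (dom i `&` par i @^-1` udom i) z.
  by split=> [dz|[]//]; split=> //; exact: udom_par.
have [sz|ns] := eqVneq (size t) k; last first.
  have -> : symcomp t = fun=> 0 by apply/funext => z; rewrite /symcomp (negbTE ns).
  by split=> [|z x _]; [exact: (sm_cst _ (dom_open (i:=i)))|rewrite dv_cst].
have -> : symcomp t = fun z => S (dyframe i (par i z)) t by apply/funext => z; rewrite /symcomp sz eqxx.
have bS := symbol_fol hS i (Tuple (introT eqP sz)); split.
  by apply: (sm_sub _ (dom_open (i:=i)) (basic_sm i bS)) => z /Du.
by move=> z x /Du Dz; exact: (basic_flat x bS Dz).
Qed.

Let sb t : sm D (fun w => symcomp t (pbase w)).
Proof.
apply: (sm_comp (U' := dom i) _ _ _ (symcomp_sm t).1) => //; first by move=> w [].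
exact: sm_lin.
Qed.

Let db t X w : D w -> X.2.1.1 = 0 -> dv X (fun w => symcomp t (pbase w)) w = 0.
Proof.
move=> [dw _ _] X0; have hp : isd (@pbase R p q) w (@pbase R p q) by exact: isd_lin.
have [_ ->] := isd_comp hp (isd_sm (symcomp_sm t).1 dw).
by rewrite /pbase X0 (symcomp_sm t).2.
Qed.

Let Bt (w : pm) : 'M[R]_q := (invmx w.2.1.2)^T.

Let Bt_isd w : D w -> isd Bt w (fun X => - (invmx w.2.1.2 *m X.2.1.2 *m invmx w.2.1.2)^T).
Proof.
move=> Dw; have sA : sm D (fun w : pm => w.2.1.2) by exact: sm_lin.
have hA : isd (fun w : pm => w.2.1.2) w (fun X => X.2.1.2) by exact: isd_lin.
have uA w' : D w' -> w'.2.1.2 \in unitmx by case.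
have lT : linear (@trmx R q q) by move=> a x y; rewrite linearP.
have [dB eB] := isd_lincomp _ lT (isd_inv sA uA Dw hA); split=> // X.
by rewrite /Bt eB linearN.
Qed.

Let Bt_sm : sm D Bt.
Proof.
have sA : sm D (fun w : pm => w.2.1.2) by exact: sm_lin.
have sI : sm D (fun w : pm => invmx w.2.1.2) by apply: sm_invmx => // w [].
apply: sm_mx => // a b; apply: (@sm_eq _ _ _ _ (fun w => invmx w.2.1.2 b a)).
  by move=> w _; rewrite mxE.
exact: sm_coord.
Qed.

Lemma symfun_sm s : sm D (symfun s).
Proof.
apply: (@sm_eq _ _ _ _ (fun w => tact (Bt w) s (fun t => symcomp t (pbase w)))).
  by move=> w Dw; rewrite symhE.
exact: tactB_sm.
Qed.

(** A vector without component along [y] differentiates only the matrix acting on the components, as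
    these are constant along the leaves. *)
Let dv_symfun s X Q w : D w -> X.2.1.1 = 0 ->
  (invmx w.2.1.2 *m X.2.1.2 *m invmx w.2.1.2)^T = Bt w *m Q ->
  dv X (symfun s) w = - dact Q s (fun t => symfun t w).
Proof.
move=> Dw X0 hQ.
rewrite (derive_eq_on (g := fun w => tact (Bt w) s (fun t => symcomp t (pbase w))) _ oD Dw); last first.
  by move=> w' Dw'; rewrite symhE.
rewrite (dv_tactB (B := Bt) oD Bt_sm s sb Dw (Q := Q)) => [||t]; last exact: db.
- by congr (- _); apply: dact_ext => t _; rewrite symhE.
- by rewrite (Bt_isd Dw).2 hQ.
Qed.

Lemma symfun_Dgl a s w : D w -> Dgl a (symfun s) w = - dact a^T s (fun t => symfun t w).
Proof.
move=> Dw; apply: dv_symfun => //=.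
by rewrite mulmxA mulVmx ?mul1mx ?trmx_mul //; case: Dw.
Qed.

Lemma symfun_Ddual be s w : D w -> Ddual be (symfun s) w = 0.
Proof.
move=> Dw; rewrite /Ddual (dv_symfun s (Q := 0)) //=; first by rewrite dact_mx0 oppr0.
by rewrite !mulmx0 mul0mx trmx0.
Qed.

Lemma symfun_flat s w x : D w -> dv (x, 0) (symfun s) w = 0.
Proof.
move=> Dw; rewrite (dv_symfun s (Q := 0)) //=; first by rewrite dact_mx0 oppr0.
by rewrite !mulmx0 mul0mx trmx0.
Qed.

Lemma symfun_sym w : D w -> symw k (fun s => symfun s w).
Proof.
move=> Dw s t sz st; rewrite /symfun -(perm_size st) sz eqxx.
exact: (symbol_sym hS (lin_frame_tr Dw) sz st).
Qed.

End Symbol.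

(** * The operators on the bundle in coordinates *)

Section Link.
Context {R : realType} {p q : nat}.
Notation bmod := (bmod R p q).
Notation cV := 'cV[R]_q.
Notation pm := (pmod R p q).
Hypothesis hq : (2 <= q)%N.
Variables (M : folmfd R p q) (nab : conn M).
Hypothesis hn : is_folconn nab.
Implicit Types (i : idx M) (w : pm) (O : set M).

Lemma fol_of_chart O (F : jet M -> R) (g : idx M -> pm -> R) :
  (forall i w, Pdom i O w -> F (psi nab i w) = g i w) ->
  (forall i, sm (Pdom i O) (g i)) -> (forall i, flat i O (g i)) -> foliated nab O F.
Proof.
move=> e sg fg; apply/folP => i; have e' w : Pdom i O w -> g i w = (F \o psi nab i) w.
  by move=> Dw; rewrite /= e.
split=> [|w x Dw]; first exact: sm_eq e' (sg i).
by rewrite -(derive_eq_on _ (sm_open (sg i)) Dw e') fg.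
Qed.

Section Fun.
Variables (O : set M) (f : M -> R).
Hypotheses (mO : mopen O) (bf : basic O f).

Definition pullf i w : R := f (par i (pbase w)).

Lemma pullf_dv i w X : Pdom i O w -> dv X (pullf i) w = dv (pbase X) (f \o par i : bmod -> R) (pbase w).
Proof.
move=> [d ow _]; have hp : isd (@pbase R p q) w (@pbase R p q) by exact: isd_lin.
by have [_ ->] := isd_comp hp (isd_sm (basic_sm i bf) (conj d ow)).
Qed.

Lemma pullf_sm i : sm (Pdom i O) (pullf i).
Proof.
apply: (sm_comp (U' := dom i `&` par i @^-1` O) (f := f \o par i) _ _ _ (basic_sm i bf)) => //.
  by move=> w [].
exact: (sm_lin _ (Pdom_open (i:=i) mO)).
Qed.

Lemma pullf_flat i : flat i O (pullf i).
Proof.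
move=> w x Dw; rewrite pullf_dv // (basic_flat x bf) //; by case: Dw.
Qed.

Lemma pullf_Dgl i a w : Pdom i O w -> Dgl a (pullf i) w = 0.
Proof. by move=> Dw; rewrite /Dgl pullf_dv // dvE derive0. Qed.

Lemma pullf_Ddual i be w : Pdom i O w -> Ddual be (pullf i) w = 0.
Proof. by move=> Dw; rewrite /Ddual pullf_dv // dvE derive0. Qed.

Lemma pull_funE i w : Pdom i setT w -> pull_fun f (psi nab i w) = pullf i w.
Proof.
move=> [d _ u]; rewrite /pull_fun psiE //.
set S := [set _ | _]; suff -> : S = [set pullf i w].
  by have := @getPex _ [set pullf i w]; apply; eexists.
apply/seteqP; split=> [_ [g [_ e _] ->]|_ ->] /=; first by rewrite e.
have := frame_inh hn 2 d u; set g := rep _ _ _ => hg.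
by exists g => //; have [_ -> _] := hg.
Qed.

Lemma nabs_chart s i w : Pdom i O w ->
  foldr (nabla nab) (pull_fun f) [seq evec a | a <- s] (psi nab i w) = hders nab i (pullf i) s w.
Proof.
elim: s i w => [|a s IH] i w Dw /=; first by rewrite pull_funE //; exact: pdom_T Dw.
have fol := fol_of_chart IH (fun i => hders_sm hn mO s (pullf_sm i)) (fun i => hders_flat hn mO s (pullf_sm i) (@pullf_flat i)).
rewrite (nabla_chart hq hn (evec a) mO fol Dw).
by apply: (dv_eq (i:=i) mO) => // w' Dw'; rewrite /= IH.
Qed.

End Fun.

Section Sym.
Variables (k : nat) (S : jet M -> @tens R q).
Hypothesis hS : is_symbol k S.

Lemma pull_symE i w s : Pdom i setT w -> size s = k -> pull_sym S (psi nab i w) s = symfun k S i s w.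
Proof. by move=> [d _ u] sz; rewrite /pull_sym /symfun sz eqxx /= p2_psi. Qed.

Lemma Div_chart l s i w : (size s + l)%N = k -> Pdom i setT w ->
  iter l (Div nab) (pull_sym S) (psi nab i w) s = divs nab i (symfun k S i) l s w.
Proof.
elim: l s i w => [|l IH] s i w sz Dw; first by rewrite /= pull_symE //; rewrite addn0 in sz.
rewrite iterS /Div /=; apply: eq_bigr => j _.
have szj : (size (j :: s) + l)%N = k by rewrite /= addSn -addnS.
have fol := fol_of_chart (F := fun u => iter l (Div nab) (pull_sym S) u (j :: s))
  (fun i w Dw => IH (j :: s) i w szj Dw)
  (fun i => divs_sm hn (@mopenT _ _ _ M) l (j :: s) (symfun_sm hS i))
  (fun i => divs_flat hn (@mopenT _ _ _ M) l (j :: s) (symfun_sm hS i) (fun t w x => @symfun_flat _ _ _ _ _ _ hS i t w x)).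
rewrite (nabla_chart hq hn (evec j) (@mopenT _ _ _ M) fol Dw).
by apply: (dv_eq (i:=i) (@mopenT _ _ _ M)) => // w' Dw'; rewrite /= IH.
Qed.

(** Each permutation in the symmetrized derivative is undone by reindexing the words, the divergence
    being symmetric; the [m!] equal sums cancel the factor [1 / m!]. *)
Lemma QsumE O f i w : mopen O -> basic O f -> Pdom i O w ->
  Qsum nab k S f (psi nab i w) = Qloc nab i k (symfun k S i) (pullf f i) w.
Proof.
move=> mO bf Dw; have DwT := pdom_T Dw; apply: eq_bigr => -[l /= lk] _; congr (_ * _).
set m := (k - l)%N; rewrite -wsum_tuple.
have szt (t : m.-tuple 'I_q) : (size t + l)%N = k by rewrite size_tuple /m; lia.
pose T := iter l (Div nab) (pull_sym S) (psi nab i w).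
pose G s := hders nab i (pullf f i) s w.
pose tp (t : m.-tuple 'I_q) (s : {perm 'I_m}) := [tuple tnth t (s j) | j < m].
have nE (t : m.-tuple 'I_q) : nablak nab (pull_fun f) (fun j => evec (tnth t j)) (psi nab i w) =
    (m`!)%:R^-1 * \sum_(s : {perm 'I_m}) G (tp t s).
  rewrite /nablak; congr (_ * _); apply: eq_bigr => s _.
  rewrite /G -(nabs_chart mO bf (tp t s) Dw); congr (foldr _ _ _ _).
  by rewrite /tp /= -map_comp.
have Tsym : symw m (fun s => divs nab i (symfun k S i) l s w).
  have h0 w' (Dw' : Pdom i setT w') := symfun_sym hS Dw'.
  exact: (@divs_sym _ _ _ hq _ nab _ _ (@mopenT _ _ _ M) _ _ h0 l _ DwT).
have TE (t : m.-tuple 'I_q) s : T t = divs nab i (symfun k S i) l (tp t s) w.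
  rewrite /T (Div_chart (szt t) DwT); apply: Tsym; first by rewrite size_tuple.
  by rewrite perm_sym; apply/tuple_permP; exists s.
transitivity (\sum_(t : m.-tuple 'I_q) (m`!)%:R^-1 * \sum_(s : {perm 'I_m}) T t * G (tp t s)).
  by apply: eq_bigr => t _; rewrite nE -mulr_sumr mulrCA.
rewrite -mulr_sumr exchange_big /=.
transitivity ((m`!)%:R^-1 * \sum_(s : {perm 'I_m})
   (\sum_(t : m.-tuple 'I_q) divs nab i (symfun k S i) l t w * G t)).
  congr (_ * _); apply: eq_bigr => s _; rewrite [RHS](reindex (fun t => tp t s)) /=.
    by apply: eq_bigr => t _; rewrite (TE t s).
  exists (fun t => tp t (s^-1)%g) => t _; apply: eq_from_tnth => j; rewrite !tnth_mktuple.
    by rewrite permKV.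
  by rewrite permK.
set X := \sum_(t : m.-tuple 'I_q) divs nab i (symfun k S i) l t w * G t.
have -> : \sum_(s : {perm 'I_m}) X = (m`!)%:R * X by rewrite sumr_const card_Sn mulr_natl.
by rewrite mulrA mulVf ?mul1r // pnatr_eq0 -lt0n fact_gt0.
Qed.

End Sym.
End Link.

(** * Descent to the base *)

Section Quant.
Context {R : realType} {p q : nat}.
Notation bmod := (bmod R p q).
Notation cV := 'cV[R]_q.
Notation pm := (pmod R p q).
Hypothesis hq : (2 <= q)%N.
Variables (M : folmfd R p q) (nab : conn M).
Hypothesis hn : is_folconn nab.
Variables (k : nat) (S : jet M -> @tens R q).
Hypothesis hS : is_symbol k S.
Implicit Types (i j : idx M) (w : pm) (O : set M).

Lemma Pdom_sub i O : Pdom i O `<=` Pdom i setT.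
Proof. by move=> w; exact: pdom_T. Qed.

Lemma symfun_smO i O s : mopen O -> sm (Pdom i O) (symfun k S i s).
Proof. by move=> mO; apply: (sm_sub _ _ (symfun_sm hS i s)); [exact: Pdom_sub|exact: Pdom_open]. Qed.

Lemma symfun_flatO i O s : flat i O (symfun k S i s).
Proof. by move=> w x /Pdom_sub Dw; exact: symfun_flat. Qed.

Lemma symfun_glact i B s w : Pdom i setT w -> B \in unitmx ->
  symfun k S i s w = tact B^T s (fun t => symfun k S i t (glact B w)).
Proof.
move=> Dw uB; rewrite /symfun; case: ifP => [/eqP sz|ns]; last by rewrite tact0 // => t ->; rewrite ns.
pose s' := Tuple (introT eqP sz); rewrite -[s]/(val s') -prod_tact.
rewrite (symbol_equiv hS s' (lin_frame_tr Dw) uB); apply: eq_bigr => t _; congr (_ * _).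
rewrite size_tuple eqxx; congr (S (jet_of 1 _) _); apply/funext => v /=.
by rewrite /lin_frame /rep /= mulmxA.
Qed.

Section Fun.
Variables (O : set M) (f : M -> R).
Hypotheses (mO : mopen O) (bf : basic O f).

Local Notation Qi i := (Qloc nab i k (symfun k S i) (pullf f i)).

Let shO i s : sm (Pdom i O) (symfun k S i s). Proof. exact: symfun_smO. Qed.

Lemma Qi_sm i : sm (Pdom i O) (Qi i).
Proof.
by apply: (Qloc_sm hn mO k (shO i)); exact: pullf_sm.
Qed.

Lemma Qi_flat i : flat i O (Qi i).
Proof.
apply: (Qloc_flat hn mO k (shO i)); [exact: symfun_flatO|exact: pullf_sm|exact: pullf_flat].
Qed.

(** The horizontal fields are transformed by [B^-1] and the components of the symbol by [B^T], which
    are contragredient to each other. *)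
Lemma Qi_glact i B w : Pdom i O w -> B \in unitmx -> Qi i (glact B w) = Qi i w.
Proof.
move=> Dw uB; apply/esym.
have DR w' : Pdom i O w' -> Pdom i O (glact B w').
  by case=> d ow u; split=> //=; rewrite unitmx_mul u.
have ort c d : \sum_b B^T c b * invmx B d b = (c == d)%:R.
  transitivity ((invmx B *m B) d c); last by rewrite mulVmx // mxE eq_sym.
  by rewrite mxE; apply: eq_bigr => b _; rewrite mxE mulrC.
apply: (Qloc_transf hn mO mO DR _ ort (shO i)) => //.
- by move=> g sg _ v w' Dw'; exact: glact_Dhor hn uB _ sg v w' Dw'.
- exact: symfun_flatO.
- by move=> s w' /Pdom_sub Dw'; exact: symfun_glact.
- exact: pullf_sm.
- exact: pullf_flat.
Qed.

(** All of the line [alpha + s be] lies in the domain, so the vanishing derivative of [Ddual_Qloc]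
    integrates to an equality. *)
Lemma Qi_shift i be w : Pdom i O w -> Qi i (w.1, (w.2.1, w.2.2 + be)) = Qi i w.
Proof.
move=> Dw; pose v : pm := (0, ((0, 0), be)).
have Ds (s : R) : Pdom i O (w + s *: v).
  have -> : w + s *: v = (w.1, (w.2.1, w.2.2 + s *: be)).
    case: w Dw => x [[y A] al] Dw.
    by rewrite -[LHS]/(x + s *: 0, (y + s *: 0, A + s *: 0, al + s *: be)) !scaler0 !addr0.
  by case: Dw.
have -> : (w.1, (w.2.1, w.2.2 + be)) = w + v.
  case: w {Dw Ds} => x [[y A] al].
  by rewrite -[RHS]/(x + 0, (y + 0, A + 0, al + be)) !addr0.
apply: dv_line0 => s.
  by move=> _; exact: sm_diff (Qi_sm i) (Ds s).
apply: (Ddual_Qloc hq hn mO (shO i) _ _ _ be (pullf_sm mO bf i) _ _ (Ds s)).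
- by move=> be' s' w' /Pdom_sub; exact: symfun_Ddual.
- by move=> a s' w' /Pdom_sub; exact: symfun_Dgl.
- by move=> w' /Pdom_sub; exact: symfun_sym.
- by move=> a w' Dw'; exact: (pullf_Dgl bf _ Dw').
- by move=> be' w' Dw'; exact: (pullf_Ddual bf _ Dw').
Qed.

Lemma Qi_base i w w' : Pdom i O w -> Pdom i O w' -> pbase w = pbase w' -> Qi i w = Qi i w'.
Proof.
move=> Dw Dw' e; have [_ _ u] := Dw; have [_ _ u'] := Dw'.
(* Translation by [B] makes the two linear frames agree; what remains is a shift in [R^q*]. *)
pose B := invmx w.2.1.2 *m w'.2.1.2.
have uB : B \in unitmx by rewrite unitmx_mul unitmx_inv u.
rewrite -(Qi_glact Dw uB) -(Qi_shift (w'.2.2 - w.2.2 *m B)); last first.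
  by case: Dw => d ow _; split=> //=; rewrite unitmx_mul u.
congr (Qi i _); rewrite /glact /= addrC subrK /B mulmxA mulmxV // mul1mx.
by case: w w' e {Dw Dw' u u' B uB} => x [[y A] al] [x' [[y' A'] al']] /= [-> ->].
Qed.

(** A local section of the bundle: the projective frames adapted to the chart, at which the
    descended function is evaluated. *)
Definition sect (z : bmod) : pm := (z.1, ((z.2, 1%:M), 0)).

Lemma sect_D i z : dom i z -> O (par i z) -> Pdom i O (sect z).
Proof. by move=> d oz; split; rewrite /= ?unitmx1 // /pbase /= -surjective_pairing. Qed.

Lemma psi_lies i w m : Pdom i setT w -> lies_over (psi nab i w) m -> m = par i (pbase w).
Proof. by move=> [d _ u] [g]; rewrite psiE // => -[_ -> _]. Qed.

(** [quant] selects among the values at all frames above the point. Brought into chart [i], those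
    frames have the same base coordinates, so [Qi_base] leaves a single value. *)
Lemma quantE i w : Pdom i O w -> quant nab k S f (par i (pbase w)) = Qi i w.
Proof.
move=> Dw; have [d ow u] := Dw; rewrite /quant; set Z := [set _ | _].
suff -> : Z = [set Qi i w] by have := @getPex _ [set Qi i w]; apply; eexists.
apply/seteqP; split=> [_ [v [/(PF_psi nab _ _)[j [w' [Dw' ->]]] lv ->]]|_ ->] /=; last first.
  exists (psi nab i w); split; last by rewrite (QsumE hq hn hS mO bf Dw).
    by apply/(PF_psi nab _ _); exists i, w; split=> //; exact: pdom_T Dw.
  have := frame_inh hn 2 d u; set g := rep _ _ _ => hg; exists g; first by rewrite psiE.
  by have [_ -> _] := hg.
have em := psi_lies Dw' lv.
have ui : udom i (par j (pbase w')) by rewrite -em; exact: udom_par.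
rewrite (psi_chart hn Dw' ui).
have [d' _ u'] := Dw'; have Dz : Dm (fun m : M => m) j i (pbase w') by [].
have e : pbase (Phi (fun m : M => m) j i w') = pbase w.
  by rewrite /pbase /= -surjective_pairing /Tm -em parK.
have Dw'' : Pdom i O (Phi (fun m : M => m) j i w').
  by split; rewrite ?e //= unitmx_mul u' (mor_unit (mor_id M)).
by rewrite (QsumE hq hn hS mO bf Dw''); exact: Qi_base.
Qed.

Lemma Qsum_fol : foliated nab O (Qsum nab k S f).
Proof.
apply: (fol_of_chart (g := fun i => Qi i)) => [i w Dw|i|i].
- have := QsumE hq hn hS mO bf Dw; exact.
- exact: Qi_sm.
- exact: Qi_flat.
Qed.

Lemma Qsum_Hinv : Hinvariant nab O (Qsum nab k S f).
Proof.
move=> u B be b /(PF_psi nab _ _)[i [w [Dw ->]]] uB b0; have [d ow uA] := Dw.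
rewrite (psi_ract hn) //; have Dw' : Pdom i O (w.1, Rh B be b w.2).
  by split=> //=; rewrite unitmxZ ?unitfE ?invr_eq0 // unitmx_mul uA.
rewrite (QsumE hq hn hS mO bf Dw) (QsumE hq hn hS mO bf Dw').
exact: Qi_base.
Qed.

Lemma quant_pull u : PF nab O u -> pull_fun (quant nab k S f) u = Qsum nab k S f u.
Proof.
move=> /(PF_psi nab _ _)[i [w [Dw ->]]].
by rewrite (pull_funE hn) ?(QsumE hq hn hS mO bf Dw) /pullf ?quantE //; exact: pdom_T Dw.
Qed.

Lemma sect_isd z : isd sect z (fun X => (X.1, ((X.2, 0), 0))).
Proof.
have h1 : isd (fun z : bmod => z.1) z (fun X => X.1) by exact: isd_lin.
have h2 : isd (fun z : bmod => z.2) z (fun X => X.2) by exact: isd_lin.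
exact: isd_pair h1 (isd_pair (isd_pair h2 (isd_cst (1%:M : 'M[R]_q) z)) (isd_cst (0 : 'rV[R]_q) z)).
Qed.

Lemma sect_sm U : open U -> sm U sect.
Proof.
move=> oU; apply: sm_pair; first exact: sm_lin.
apply: sm_pair; last exact: sm_cst.
by apply: sm_pair; [exact: sm_lin|exact: sm_cst].
Qed.

Lemma sect_fun i (g : pm -> R) (D := dom i `&` par i @^-1` O) : sm (Pdom i O) g -> flat i O g ->
  sm D (fun z => g (sect z)) /\ forall z x, D z -> dv (x, 0) (fun z => g (sect z)) z = 0.
Proof.
move=> sg fg; have dyder z : D z -> Pdom i O (sect z) by case; exact: sect_D.
split=> [|z x Dz]; first exact: (sm_comp _ dyder (sect_sm (@mO i)) sg).
have [_ ->] := isd_comp (sect_isd z) (isd_sm sg (dyder z Dz)).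
by rewrite /= fg //; exact: dyder.
Qed.

Lemma quant_sect i z : dom i z -> O (par i z) -> quant nab k S f (par i z) = Qi i (sect z).
Proof.
move=> dz Oz; rewrite -quantE; last exact: sect_D.
by rewrite /sect /pbase /= -surjective_pairing.
Qed.

Lemma quant_basic : basic O (quant nab k S f).
Proof.
move=> i; have [s fl] := sect_fun (Qi_sm i) (@Qi_flat i).
have E z : (dom i `&` par i @^-1` O) z -> Qi i (sect z) = (quant nab k S f \o par i) z.
  by move=> [dz Oz]; rewrite /= quant_sect.
have sq := sm_eq E s; split; first exact/smooth_onP.
apply/(flatP _ _ _ sq) => z x Dz.
by rewrite -(derive_eq_on _ (@mO i) Dz E) fl.
Qed.

End Fun.
End Quant.

(** * Expansion in partial derivatives *)

Section Coefs.
Context {R : realType} {p q : nat}.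
Notation bmod := (bmod R p q).
Notation cV := 'cV[R]_q.
Notation pm := (pmod R p q).
Hypothesis hq : (2 <= q)%N.
Variables (M : folmfd R p q) (nab : conn M).
Hypothesis hn : is_folconn nab.
Variable i : idx M.
Implicit Types (w : pm) (O : set M).
Notation Dhor := (Dhor nab i).
Notation D := (Pdom i setT).
Let mT : mopen [set: M] := @mopenT _ _ _ M.

(* [wcoef s t] is the coefficient of the [t]-th partial derivative in
   [nabla_{s_1} ... nabla_{s_m}]. *)
Fixpoint wcoef (s t : seq 'I_q) : pm -> R :=
  if s is b :: s' then fun w => Dhor (evec b) (wcoef s' t) w
    + (if t is d :: t' then w.2.1.2 d b * wcoef s' t' w else 0)
  else fun=> (t == [::])%:R.

Let entry_sm d b : sm D (fun w : pm => w.2.1.2 d b).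
Proof. by apply: sm_coord; apply: sm_lin => //; exact: Pdom_open. Qed.

Let entry_flat d b : flat i setT (fun w : pm => w.2.1.2 d b).
Proof.
move=> w x Dw; have hA : isd (fun w : pm => w.2.1.2) w (fun X => X.2.1.2) by exact: isd_lin.
by have [_ ->] := isd_coord d b hA; rewrite mxE.
Qed.

Lemma wcoef_sm s t : sm D (wcoef s t).
Proof.
have oD := Pdom_open (i:=i) mT.
elim: s t => [|b s IH] t /=; first exact: (sm_cst _ oD).
apply: sm_add; first exact: (Dhor_sm hn mT).
by case: t => [|d t]; [exact: (sm_cst _ oD)|exact: sm_mul].
Qed.

Lemma wcoef_flat s t : flat i setT (wcoef s t).
Proof.
elim: s t => [|b s IH] t w x Dw /=; first by rewrite dv_cst.
have s1 := Dhor_sm hn mT (evec b) (wcoef_sm s t).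
have f1 : dv (x, 0) (Dhor (evec b) (wcoef s t)) w = 0 by apply: (Dhor_flat hn mT) => //; exact: wcoef_sm.
case: t s1 f1 => [|d t] s1 f1.
  by have [_ ->] := isd_add (isd_sm s1 Dw) (isd_cst (0 : R) w); rewrite f1 addr0.
have [_ ->] := isd_add (isd_sm s1 Dw) (isd_sm (sm_mul (entry_sm d b) (wcoef_sm s t)) Dw).
by rewrite f1 add0r (mul_flat (entry_sm d b) (wcoef_sm s t) (@entry_flat d b) (IH t)).
Qed.

Lemma wcoef_big s t : (size s < size t)%N -> wcoef s t = fun=> 0.
Proof.
elim: s t => [|b s IH] [|d t] //= st; apply/funext => w.
by rewrite /Dhor IH ?dv_cst ?(ltnW st) // add0r IH // mulr0.
Qed.

Lemma wcoef_top s t w : w.2.1.2 = 1%:M -> size t = size s -> wcoef s t w = (s == t)%:R.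
Proof.
move=> w1; elim: s t => [|b s IH] [|d t] //= [st].
rewrite /Dhor wcoef_big ?dv_cst ?add0r /=; last by rewrite st.
rewrite w1 mxE IH // eqseq_cons eq_sym -natrM mulnb; congr (_%:R).
Qed.

Section Fun.
Variables (O : set M) (f : M -> R).
Hypotheses (mO : mopen O) (bf : basic O f).

Definition dyder (t : seq 'I_q) : bmod -> R :=
  Defs.iterD [seq (0, evec a) : bmod | a <- t] (f \o par i : bmod -> R).

Lemma DDS d t : dyder (d :: t) = dv (0, evec d) (dyder t).
Proof. by rewrite dvF. Qed.

Lemma dyder_sm t : sm (dom i `&` par i @^-1` O) (dyder t).
Proof. by elim: t => [|d t IH]; [exact: basic_sm|rewrite DDS; exact: sm_derive]. Qed.

Let sP t : sm (Pdom i O) (fun w => dyder t (pbase w)).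
Proof.
apply: (sm_comp _ _ _ (dyder_sm t)) => //; first by move=> w [].
by apply: sm_lin => //; exact: Pdom_open.
Qed.

Let swcoef s t : sm (Pdom i O) (wcoef s t).
Proof. by apply: sm_sub (wcoef_sm s t); [move=> w; exact: pdom_T|exact: Pdom_open]. Qed.

Let Dhor_dyder b t w : Pdom i O w -> Dhor (evec b) (fun w => dyder t (pbase w)) w =
  \sum_d w.2.1.2 d b * dyder (d :: t) (pbase w).
Proof.
move=> Dw; have [dw ow _] := Dw.
have hp : isd (@pbase R p q) w (@pbase R p q) by exact: isd_lin.
have dF := sm_diff (dyder_sm t) (conj dw ow).
rewrite /Dhor; have [_ ->] := isd_comp hp (isd_sm (dyder_sm t) (conj dw ow)).
have l : linear (fun v : cV => dv ((0, v) : bmod) (dyder t) (pbase w)).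
  move=> a u v; rewrite -(derive_dir dF); congr dv.
  by rewrite -[RHS]/(a *: 0 + 0, a *: u + v) scaler0 addr0.
have [_ _ lZ _ lS] := linP l.
rewrite -[LHS]/(dv ((0, w.2.1.2 *m evec b) : bmod) (dyder t) (pbase w)) mx_evec lS.
by apply: eq_bigr => d _; rewrite lZ DDS.
Qed.

(** By the Leibniz rule a horizontal derivative either hits the coefficient or adds one partial
    derivative, through the matrix [A]. The bound [n] on the order is arbitrary, so that it can stay
    fixed in the induction. *)
Lemma hders_wcoef n s w : Pdom i O w -> (size s < n)%N -> hders nab i (pullf f i) s w =
  \sum_(m < n) wsum m (fun t => wcoef s t w * dyder t (pbase w)).
Proof.
elim: s n w => [|b s IH] [//|n] w Dw sn.
  rewrite big_ord_recl /= mul1r big1 ?addr0 // => m _ /=.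
  by rewrite big1 // => c _; apply: wsum0 => t _; rewrite mul0r.
have sT t : sm (Pdom i O) (fun w => wcoef s t w * dyder t (pbase w)) by exact: sm_mul.
have sW m : sm (Pdom i O) (fun w => wsum m (fun t => wcoef s t w * dyder t (pbase w))).
  exact: (wsum_sm (i:=i) mO).
rewrite [hders _ _ _ _]/= {1}/Dhor (dv_eq (i:=i) mO _ (fun w Dw => IH n.+1 w Dw (ltnW sn)) Dw).
rewrite (dv_sumD _ (fun m : 'I_n.+1 => sW m) Dw).
pose X m := wsum m (fun t => Dhor (evec b) (wcoef s t) w * dyder t (pbase w)).
pose Z m := wsum m (fun t => wcoef s t w * \sum_d w.2.1.2 d b * dyder (d :: t) (pbase w)).
have E m : dv (0, hfld nab i (evec b) w.2) (fun w => wsum m (fun t => wcoef s t w * dyder t (pbase w))) w = X m + Z m.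
  rewrite (dv_wsum (i:=i) mO _ _ sT Dw) /X /Z -wsumD; apply: wsum_ext => t _.
  have [_ ->] := isd_mul (isd_sm (swcoef s t) Dw) (isd_sm (sP t) Dw).
  by rewrite -[X in _ + _ * X]/(Dhor (evec b) (fun w => dyder t (pbase w)) w) Dhor_dyder.
under eq_bigr do rewrite E; rewrite big_split /= [X in _ + X]big_ord_recr /=.
(* Here a partial derivative of order [n] would be raised to [n + 1], but the coefficients of words
   longer than [s] are zero. *)
have -> : Z n = 0.
  apply: wsum0 => t tn.
  by rewrite wcoef_big ?mul0r // tn.
rewrite addr0 [RHS](eq_bigr (fun m : 'I_n.+1 => X m + wsum m (fun t =>
   (if t is d :: t' then w.2.1.2 d b * wcoef s t' w else 0) * dyder t (pbase w)))); last first.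
  by move=> m _; rewrite /X -wsumD; apply: wsum_ext => t _; rewrite mulrDl.
rewrite big_split /=; congr (_ + _); rewrite big_ord_recl /= mul0r add0r; apply: eq_bigr => m _ /=.
rewrite -wsum_sum; apply: wsum_ext => t _; rewrite mulr_sumr; apply: eq_bigr => d _.
by rewrite mulrCA mulrA.
Qed.

End Fun.

Section Op.
Variables (k : nat) (S : jet M -> @tens R q).
Hypothesis hS : is_symbol k S.

Definition opcoef t w : R := \sum_(l < k.+1) Ckl (R := R) (q := q) k l *
  wsum (k - l) (fun s => divs nab i (symfun k S i) l s w * wcoef s t w).

Let sTc l s t : sm D (fun w => divs nab i (symfun k S i) l s w * wcoef s t w).
Proof. by apply: sm_mul; [apply: (divs_sm hn mT) => t'; exact: symfun_sm|exact: wcoef_sm]. Qed.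

Lemma opcoef_sm t : sm D (opcoef t).
Proof. by apply: (sum_sm (i:=i) mT) => l; apply: (wsum_sm (i:=i) mT). Qed.

Lemma opcoef_flat t : flat i setT (opcoef t).
Proof.
apply: sum_flat => l; first by apply: (wsum_sm (i:=i) mT).
apply: (wsum_flat mT) => // s; apply: mul_flat.
- by apply: (divs_sm hn mT) => t'; exact: symfun_sm.
- exact: wcoef_sm.
- by apply: (divs_flat hn mT) => t'; [exact: symfun_sm|move=> w x Dw; exact: symfun_flat].
- exact: wcoef_flat.
Qed.

Lemma opcoef_basic t : basic (udom i) (fun m => opcoef t (sect (chart i m))).
Proof.
have [s fl] := sect_fun mT (opcoef_sm t) (@opcoef_flat t).
have sD : (dom i `&` par i @^-1` udom i) `<=` (dom i `&` par i @^-1` setT) by move=> z [].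
have E z : (dom i `&` par i @^-1` udom i) z ->
    opcoef t (sect z) = ((fun m => opcoef t (sect (chart i m))) \o par i) z.
  by move=> [dz _]; rewrite /= parK.
have mU : mopen (udom i) := @udom_mopen _ _ _ M i.
apply: (basic_chart (i := i) mU) => // [|z x Dz].
  by apply: (sm_eq E); apply: (sm_sub sD (@mU i) s).
by rewrite -(derive_eq_on _ (@mU i) Dz E) fl //; exact: sD.
Qed.

(** The term with [Div^l] involves derivatives of order at most [k - l], so only [l = 0] reaches
    order [k]; at [A = 1] its leading coefficient is a Kronecker symbol. *)
Lemma opcoef_top t z : size t = k -> dom i z -> opcoef t (sect z) = S (dyframe i (par i z)) t.
Proof.
move=> tk dz; rewrite /opcoef big_ord_recl /= Ckl0 mul1r big1 ?addr0 => [|l _].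
  rewrite subn0; transitivity (wsum k (fun s => (s == t)%:R * symfun k S i s (sect z))).
    by apply: wsum_ext => s sk; rewrite wcoef_top ?tk // mulrC.
  rewrite wsum_delta // /symfun tk eqxx; congr (S (jet_of 1 _) _); apply/funext => v.
  by rewrite /lin_frame /rep /= mul1mx parK.
rewrite -[RHS](mulr0 (Ckl (R := R) (q := q) k (lift ord0 l))); congr (_ * _).
apply: wsum0 => s sk.
by rewrite wcoef_big ?mulr0 // tk sk /= /bump /=; have := ltn_ord l; lia.
Qed.

Lemma quant_op (O : set M) (f : M -> R) m : mopen O -> basic O f -> O m -> udom i m ->
  quant nab k S f m = \sum_(t : k.-tuple 'I_q) S (dyframe i m) t * dys i t f m +
    \sum_(r < k) \sum_(t : r.-tuple 'I_q) opcoef t (sect (chart i m)) * dys i t f m.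
Proof.
move=> mO bf Om ui; set z := chart i m; have dz : dom i z := chart_dom ui.
have em : par i z = m := chartK ui; have Oz : O (par i z) by rewrite em.
rewrite -{1}em (quant_sect hq hn hS mO bf dz Oz); set w := sect z.
have Dw : Pdom i O w by exact: sect_D.
have pw : pbase w = z by rewrite /pbase /w /sect /= -surjective_pairing.
have -> : Qloc nab i k (symfun k S i) (pullf f i) w =
    \sum_(r < k.+1) wsum r (fun t => opcoef t w * dyder f t z).
  transitivity (\sum_(l < k.+1) Ckl (R := R) (q := q) k l * \sum_(r < k.+1)
      wsum r (fun t => wsum (k - l) (fun s => divs nab i (symfun k S i) l s w * wcoef s t w) * dyder f t z)).
    apply: eq_bigr => l _; congr (_ * _).
    transitivity (wsum (k - l) (fun s => \sum_(r < k.+1) wsum r (fun t =>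
        dyder f t z * (divs nab i (symfun k S i) l s w * wcoef s t w)))).
      apply: wsum_ext => s sk; rewrite (hders_wcoef mO bf (n := k.+1) Dw); last by rewrite sk ltnS leq_subr.
      rewrite mulr_sumr; apply: eq_bigr => r _; rewrite -wsumZ; apply: wsum_ext => t _.
      by rewrite pw [RHS]mulrC -mulrA.
    rewrite wsum_sum; apply: eq_bigr => r _; rewrite wsum_exch; apply: wsum_ext => t _.
    by rewrite wsumZ mulrC.
  transitivity (\sum_(l < k.+1) \sum_(r < k.+1) Ckl (R := R) (q := q) k l * wsum r (fun t =>
      wsum (k - l) (fun s => divs nab i (symfun k S i) l s w * wcoef s t w) * dyder f t z)).
    by apply: eq_bigr => l _; rewrite mulr_sumr.
  rewrite exchange_big; apply: eq_bigr => r _ /=; rewrite -wsum_lin; apply: wsum_ext => t _.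
  by rewrite /opcoef mulr_suml; apply: eq_bigr => l _; rewrite mulrA.
rewrite big_ord_recr /= addrC; congr (_ + _).
  by rewrite -wsum_tuple; apply: eq_bigr => t _; rewrite opcoef_top ?size_tuple // em.
by apply: eq_bigr => r _; rewrite -wsum_tuple.
Qed.

End Op.
End Coefs.

(** * Projective invariance *)

Section Proj.
Context {R : realType} {p q : nat}.
Notation bmod := (bmod R p q).
Notation cV := 'cV[R]_q.
Notation pm := (pmod R p q).
Hypothesis hq : (2 <= q)%N.
Variables (M : folmfd R p q) (nab nab' : conn M).
Hypotheses (hn : is_folconn nab) (hn' : is_folconn nab').
Variable alpha : idx M -> M -> bmod -> R.
Hypothesis ha : basic_form alpha.
Hypothesis hp : forall (O : set M) X Y, mopen O -> folvf O X -> folvf O Y ->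
    eqN O (nab' O X Y) (addvf (nab O X Y)
      (fun i m => alpha i m (X i m) *: Y i m + alpha i m (Y i m) *: X i m)).

Lemma proj_at O (X Y : vf M) i m (x y : bmod) : mopen O -> folvf O X -> folvf O Y -> O m -> udom i m ->
  X i m = x -> Y i m = y ->
  (nab' O X Y i m).2 = (nab O X Y i m).2 + alpha i m x *: y.2 + alpha i m y *: x.2.
Proof. by move=> mO fX fY Om ui <- <-; rewrite -addrA; exact: (hp mO fX fY Om ui). Qed.

Lemma proj_Gam i m (u v : cV) : udom i m ->
  Gam nab' i m u v = Gam nab i m u v + alpha i m (0, u) *: v + alpha i m (0, v) *: u.
Proof.
move=> ui; have [al _] := ha.
have pairL (k : R) (a b : cV) : (0, k *: a + b) = k *: (0, a) + (0, b) :> bmod.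
  by rewrite -[RHS]/(k *: 0 + 0, k *: a + b) scaler0 addr0.
move: u v; apply: (bilin_ext (f := Gam nab' i m)
   (g := fun u v => Gam nab i m u v + alpha i m (0, u) *: v + alpha i m (0, v) *: u)).
- exact: Gam_lin1.
- exact: Gam_lin2.
- move=> u k a b; rewrite Gam_lin1 pairL al //; apply/matrixP => c d.
  by move: (Gam _ _ _ _ _) (Gam _ _ _ _ _) => g1 g2; rewrite !mxE; ring.
- move=> v k a b; rewrite Gam_lin2 pairL al //; apply/matrixP => c d.
  by move: (Gam _ _ _ _ _) (Gam _ _ _ _ _) => g1 g2; rewrite !mxE; ring.
move=> a b; have := proj_at (@udom_mopen _ _ _ M i) (dy_folvf i a) (dy_folvf i b) ui ui (dy_self a ui) (dy_self b ui).
rewrite !Gam_evec => e.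
have nE (n : conn M) : \col_c christoffel n i m c a b = (n (udom i) (dyvf i a) (dyvf i b) i m).2.
  by apply/matrixP => c d; rewrite ord1 mxE.
by rewrite !nE e.
Qed.

Let arow i (z : bmod) : 'rV[R]_q := \row_b alpha i (par i z) (0, evec b).

Let arow_sm i : sm (dom i) (arow i).
Proof.
have [_ [sa _]] := ha; apply: sm_mx => [|a b]; first exact: dom_open.
apply: (@sm_eq _ _ _ _ (fun z => alpha i (par i z) (0, evec b))).
  by move=> z _; rewrite mxE.
exact/smooth_onP.
Qed.

(** In the condition on [d alpha], the term differentiating [alpha] of a leaf direction vanishes
    identically, which leaves the derivative of the transverse components along the leaf. *)
Let arow_flat i z x : dom i z -> dv (x, 0) (arow i) z = 0.
Proof.
move=> dz; have [_ [sa [_ [a0 acl]]]] := ha; apply/matrixP => a b; rewrite [RHS]mxE.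
have [_ <-] := isd_coord a b (isd_sm (arow_sm i) dz); have oD := dom_open (i := i).
rewrite (derive_eq_on (g := fun z => alpha i (par i z) (0, evec b)) _ oD dz); last by move=> z' _; rewrite mxE.
have := acl i z x (0, evec b) dz; rewrite -!dvE.
rewrite (derive_eq_on (g := fun=> 0) (0, evec b) oD dz); last by move=> z' dz'; rewrite a0 //; exact: udom_par.
by rewrite dv_cst subr0.
Qed.

Let cc i : cV -> 'rV[R]_q := desc i (arow i).

Let ccE i z v : dom i z -> (cc i z.2 *m v) 0 0 = alpha i (par i z) (0, v).
Proof.
move=> dz; have -> : cc i z.2 = arow i z.
  by rewrite /cc (descE _ (arow_sm i) (@arow_flat i) (x := z.1)) -?surjective_pairing.
have [al _] := ha; have ui := udom_par dz.
have l : linear (fun v : cV => alpha i (par i z) (0, v)).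
  move=> k a b; rewrite -(al i (par i z)) //; congr (alpha _ _ _).
  by rewrite -[RHS]/(k *: 0 + 0, k *: a + b) scaler0 addr0.
rewrite (lin_cV_sum v l) mxE; apply: eq_bigr => b _.
by rewrite mxE mulrC.
Qed.

Let rel i y v v' : Vd i y -> NGam nab' i y v v' =
  NGam nab i y v v' + (cc i y *m v) 0 0 *: v' + (cc i y *m v') 0 0 *: v.
Proof.
move=> [x d]; rewrite (NGamE hn' _ _ d) (NGamE hn _ _ d) (proj_Gam v v' (udom_par d)).
by rewrite -(ccE v d) -(ccE v' d).
Qed.

(** The change of connection intertwines the horizontal derivatives and moves each point within its
    fibre by a shift of [alpha]; [Qi_base] then discards the shift. *)
Lemma quant_proj k (S : jet M -> @tens R q) (O : set M) f m : is_symbol k S -> mopen O -> basic O f -> O m ->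
  quant nab' k S f m = quant nab k S f m.
Proof.
move=> hS mO bf Om; have [i ui] := cover m; set z := chart i m.
have dz : dom i z := chart_dom ui; have em : par i z = m := chartK ui.
have Oz : O (par i z) by rewrite em.
have Dw := sect_D dz Oz.
rewrite -em (quant_sect hq hn' hS mO bf dz Oz) (quant_sect hq hn hS mO bf dz Oz).
have scc : sm (Vd i) (cc i) by exact: (desc_sm _ (arow_sm i) (@arow_flat i)).
have DT w : Pdom i O w -> Pdom i O (projact (cc i) w) by [].
rewrite -[RHS](Qi_base hq hn hS mO bf (DT _ Dw) Dw) //.
apply: (Qloc_transf hn mO mO DT _ (@sum_id_mx R q) (fun s => symfun_smO hS i s mO)) => //.
- move=> g sg _ v w' Dw'; rewrite mul1mx.
  exact: (projlift_Dhor hq hn' hn scc (@rel i) sg v Dw').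
- by move=> s; exact: symfun_flatO.
- by move=> s w' _; rewrite tact1.
- exact: (pullf_sm mO bf i).
- exact: (pullf_flat bf).
Qed.

End Proj.

(** * Naturality *)

Section Frames.
Context {R : realType} {p q : nat}.
Notation bmod := (bmod R p q).
Notation cV := 'cV[R]_q.
Notation pm := (pmod R p q).

Section OneFrame.
Variable M : folmfd R p q.
Implicit Types (i : idx M) (f : cV -> M) (w : pm).

Lemma lin_frame_sm w : sm [set: cV] (fun v => w.2.1.1 + w.2.1.2 *m v).
Proof.
apply: sm_add; first exact: (sm_cst _ openT).
by apply: sm_mulmx; [exact: (sm_cst _ openT)|exact: (sm_id _ openT)].
Qed.

Lemma lin_frame_dv w v : dv v (fun v => w.2.1.1 + w.2.1.2 *m v) 0 = w.2.1.2 *m v.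
Proof.
have [_ ->] := isd_add (isd_cst w.2.1.1 (0 : cV)) (isd_lin (0 : cV) _ (@mulmx_lin1 R _ _ _ w.2.1.2)).
by rewrite add0r.
Qed.

Lemma lin_frame_jet i w : dom i (pbase w) ->
  jet_of 1 (lin_frame i w) = jetset 1 i (pbase w) (fun v => w.2.1.1 + w.2.1.2 *m v).
Proof.
move=> d; rewrite (jet_of_rep _ (lin_frame_sm w)) ?mulmx0 ?addr0 //.
Qed.

Lemma jet_of_lin i f w : good f -> udom i (f 0) -> chart i (f 0) = pbase w ->
  (forall v, dv v (yc i f) 0 = w.2.1.2 *m v) -> jet_of 1 f = jet_of 1 (lin_frame i w).
Proof.
move=> gf ui e hd; rewrite (jet_of_set _ gf ui) // e lin_frame_jet; last by rewrite -e; exact: chart_dom.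
apply: jetset_jr; split=> // [|v].
  by rewrite mulmx0 addr0 /yc e.
by rewrite hd lin_frame_dv.
Qed.

(** Transversality makes the [y] part of the differential onto, hence invertible. Thus the 1-jet of
    any transversal map is that of a [lin_frame], on which symbols are computed. *)
Lemma transversal_lin i f : transversal f -> udom i (f 0) ->
  exists w, [/\ Pdom i setT w, chart i (f 0) = pbase w & forall v, dv v (yc i f) 0 = w.2.1.2 *m v].
Proof.
move=> tf ui; have gf := transversal_good tf.
have [U [U0 sf fU]] := good_pt gf ui.
have Y v : (dv v (chart i \o f) 0).2 = dv v (yc i f) 0.
  by have [_ ->] := isd_snd _ _ (isd_sm sf U0).
have [U' U'0 sy] := yc_sm gf ui.
pose J : 'M[R]_q := \matrix_(a, b) dv (evec b) (yc i f) 0 a 0.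
have JE v : J *m v = dv v (yc i f) 0.
  exact: (lin_mxE v (derive_dir (sm_diff sy U'0))).
exists ((chart i (f 0)).1, (((chart i (f 0)).2, J), 0)); split=> //; last first.
  by rewrite /pbase /= -surjective_pairing.
split=> //=; first by rewrite /pbase /= -surjective_pairing; exact: chart_dom.
apply: surj_unit => y.
have [W [W0 [oW h]]] := tf; have [_ hz] := h i; have [sj _] := hz 0 (conj W0 ui).
have [v [x e]] := sj (0, y); exists v; rewrite JE -Y.
by move: (congr1 snd e); rewrite -dvE /= addr0.
Qed.

Lemma lin_frame_glact i (B : 'M[R]_q) w : lin_frame i w \o mulmx B = lin_frame i (glact B w).
Proof. by apply/funext => v; rewrite /lin_frame /rep /= mulmxA. Qed.

Lemma jet_of_lin_glact i f w (B : 'M[R]_q) : good f -> udom i (f 0) -> chart i (f 0) = pbase w ->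
  (forall v, dv v (yc i f) 0 = w.2.1.2 *m v) -> jet_of 1 (f \o mulmx B) = jet_of 1 (lin_frame i (glact B w)).
Proof.
move=> gf ui e hd; have sB : sm [set: cV] (mulmx B).
  by apply: sm_mulmx; [exact: (sm_cst _ openT)|exact: (sm_id _ openT)].
apply: jet_of_lin.
- exact: (good_comp gf sB I (mulmx0 _ _)).
- by rewrite /= mulmx0.
- by rewrite /= mulmx0.
move=> v; have [U U0 sy] := yc_sm gf ui.
have hB : isd (mulmx B) (0 : cV) (mulmx B) by apply: isd_lin; exact: mulmx_lin1.
rewrite -[yc i _]/(yc i f \o mulmx B) derive_comp; [|exact: hB.1|by rewrite mulmx0; exact: sm_diff sy U0].
by rewrite hB.2 mulmx0 hd mulmxA.
Qed.

Lemma dyframe_sect i z : dom i z -> dyframe i (par i z) = jet_of 1 (lin_frame i (sect z)).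
Proof.
by move=> dz; congr (jet_of 1 _); apply/funext => v; rewrite /lin_frame /rep /= mul1mx parK.
Qed.

Lemma basic_local (O : set M) (f : M -> R) :
  (forall m, O m -> exists N : set M, [/\ N m, N `<=` O, mopen N & basic N f]) -> basic O f.
Proof.
move=> h i; split.
  apply/smooth_onP; apply: sm_local => z [dz Oz]; have [N [Nz sO mN bN]] := h _ Oz.
  exists (dom i `&` par i @^-1` N); split=> //; first by move=> z' [dz' Oz']; split=> //; exact: sO.
  by apply/smooth_onP; have [] := bN i.
move=> z [dz Oz]; have [N [Nz sO mN bN]] := h _ Oz.
by have [_] := bN i; apply.
Qed.

End OneFrame.

Section Nat.
Variables (M0 M : folmfd R p q) (phi : M0 -> M).
Hypothesis hphi : mor phi.
Variables (k : nat) (S : jet M -> @tens R q).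
Hypothesis hS : is_symbol k S.
Implicit Types (i : idx M0) (j : idx M) (w : pm).

Lemma Phi_Pdom i j (O : set M) w : Pdom i (phi @^-1` (O `&` udom j)) w -> Pdom j O (Phi phi i j w).
Proof.
move=> [d [Ow u] uA]; have Dz : Dm phi i j (pbase w) by [].
have e : pbase (Phi phi i j w) = Tm phi i j (pbase w) by rewrite /pbase -surjective_pairing.
split; rewrite ?e; [exact: chart_dom|by rewrite /preimage /Tm /= chartK|].
by rewrite /= unitmx_mul uA (mor_unit hphi).
Qed.

Lemma jmap_lin i j w : Pdom i setT w -> udom j (phi (par i (pbase w))) ->
  jmap 1 (fun f => phi \o f) (jet_of 1 (lin_frame i w)) = jet_of 1 (lin_frame j (Phi phi i j w)).
Proof.
move=> Dw uj; have [d _ u] := Dw.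
have DP : Pdom j setT (Phi phi i j w) by apply: Phi_Pdom; split.
have [d' _ _] := DP; have eT : pbase (Phi phi i j w) = Tm phi i j (pbase w).
  by rewrite /pbase -surjective_pairing.
have ne : jet_of 1 (lin_frame i w) (lin_frame i w) by split=> //; exact: lin_frame_tr.
rewrite !lin_frame_jet // in ne *; apply: jmap_jetset => //; first by exists (lin_frame i w).
move=> f [tf f0 [j0 j1 _]]; have gf := transversal_good tf.
have ui : udom i (f 0) by rewrite f0; exact: udom_par.
have uj' : udom j (phi (f 0)) by rewrite f0.
split; first exact: good_mor.
  by rewrite /= f0 eT /Tm chartK.
have [h1 _] := yc_change hphi gf ui uj'; rewrite f0 parK // in h1.
split=> // [|v].
  by rewrite mulmx0 addr0 /yc /= f0.
by rewrite h1 j1 !lin_frame_dv mulmxA.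
Qed.

Lemma symfun_pull i j s w : Pdom i setT w -> udom j (phi (par i (pbase w))) ->
  symfun k (pull_symbol phi S) i s w = symfun k S j s (Phi phi i j w).
Proof. by move=> Dw uj; rewrite /symfun /pull_symbol (jmap_lin Dw uj). Qed.

(** The conditions are transported by [Phi], which acts on linear frames by the transverse Jacobian
    on the left and so commutes with [GL(q)] acting on the right. *)
Lemma pull_symbolP : is_symbol k (pull_symbol phi S).
Proof.
split=> [f s t tf sk st|f B s tf uB|i s].
- have [i ui] := cover (f 0); have [w [Dw e hd]] := transversal_lin tf ui.
  rewrite (jet_of_lin (transversal_good tf) ui e hd); have [j uj] := cover (phi (par i (pbase w))).
  rewrite /pull_symbol (jmap_lin Dw uj); apply: (symbol_sym hS) => //.
  by apply: lin_frame_tr; apply: Phi_Pdom; have [] := Dw.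
- have gf := transversal_good tf.
  have [i ui] := cover (f 0); have [w [Dw e hd]] := transversal_lin tf ui.
  rewrite (jet_of_lin gf ui e hd); have [j uj] := cover (phi (par i (pbase w))).
  have DB : Pdom i setT (glact B w) by case: Dw => d _ u; split=> //=; rewrite unitmx_mul u.
  have DP : Pdom j setT (Phi phi i j w) by apply: Phi_Pdom; have [] := Dw.
  rewrite /pull_symbol (jmap_lin Dw uj) (symbol_equiv hS s (lin_frame_tr DP) uB).
  apply: eq_bigr => t _; congr (_ * S _ _); rewrite (jet_of_lin_glact B gf ui e hd) (jmap_lin DB uj).
  rewrite lin_frame_glact; congr (jet_of 1 (lin_frame j _)).
  by rewrite /glact /Phi /= mulmxA.
apply: basic_local => m um; have [j uj] := cover (phi m).
have mU : mopen (udom i) := @udom_mopen _ _ _ M0 i.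
have mV : mopen (phi @^-1` udom j) by apply: mor_preim => //; exact: (@udom_mopen _ _ _ M j).
exists (udom i `&` phi @^-1` udom j).
have mO := mopenI mU mV; split=> //.
have sP : sm (Pdom i (phi @^-1` udom j)) (fun w => symfun k S j s (Phi phi i j w)).
  apply: (sm_comp _ _ (Phi_sm hphi i j) (symfun_sm hS j s)) => w Dw; apply: Phi_Pdom.
  by case: Dw => d u uA; split.
have fP : flat i (phi @^-1` udom j) (fun w => symfun k S j s (Phi phi i j w)).
  move=> w x Dw; have DP : Pdom j setT (Phi phi i j w) by apply: Phi_Pdom; case: Dw => d u uA; split.
  have [_ ->] := isd_comp (isd_sm (Phi_sm hphi i j) Dw) (isd_sm (symfun_sm hS j s) DP).
  have [_ e2] := isd_snd _ _ (isd_sm (Phi_sm hphi i j) Dw).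
  move: (e2 (x, 0)); rewrite (Phi_isd hphi Dw).2 /= mulmx0 (dvE 0) derive0 mul0mx mulmx0 addr0.
  case: (dv (x, 0) (Phi phi i j) w) => a b /= <-.
  exact: symfun_flat.
have [s1 f1] := sect_fun mV sP fP.
have sD : (dom i `&` par i @^-1` (udom i `&` phi @^-1` udom j)) `<=` (dom i `&` par i @^-1` (phi @^-1` udom j)).
  by move=> z [dz [_ uz]].
have E z : (dom i `&` par i @^-1` (udom i `&` phi @^-1` udom j)) z ->
    symfun k S j s (Phi phi i j (sect z)) = ((fun m => pull_symbol phi S (dyframe i m) s) \o par i) z.
  move=> [dz [_ uz]]; have Dz : Pdom i setT (sect z) by exact: sect_D.
  have ez : pbase (sect z) = z by rewrite /pbase /= -surjective_pairing.
  rewrite -symfun_pull ?ez // /symfun size_tuple eqxx /=; congr (pull_symbol phi S _ _).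
  by rewrite dyframe_sect.
apply: (basic_chart (i := i) mO) => [z []//||z x Dz].
  by apply: (sm_eq E); apply: (sm_sub sD (@mO i) s1).
by rewrite -(derive_eq_on _ (@mO i) Dz E) f1 //; exact: sD.
Qed.

Section Conn.
Hypothesis hq : (2 <= q)%N.
Variables (nab0 : conn M0) (nab : conn M).
Hypotheses (hn0 : is_folconn nab0) (hn : is_folconn nab) (pc : is_pull_conn phi nab nab0).

Lemma basic_pull i j (O : set M) f : mopen O -> basic O f ->
  basic (udom i `&` phi @^-1` (O `&` udom j)) (f \o phi).
Proof.
move=> mO bf; have mU : mopen (udom i) := @udom_mopen _ _ _ M0 i.
have mV : mopen (phi @^-1` (O `&` udom j)).
  by apply: mor_preim => //; apply: mopenI => //; exact: (@udom_mopen _ _ _ M j).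
have mI := mopenI mU mV; set O1 := udom i `&` _ in mI *.
have sT := mor_sm hphi i j.
have sD : (dom i `&` par i @^-1` O1) `<=` Dm phi i j by move=> z [dz [_ [_ uz]]].
have TD z : (dom i `&` par i @^-1` O1) z -> (dom j `&` par j @^-1` O) (Tm phi i j z).
  by move=> [dz [_ [Oz uz]]]; split; [exact: chart_dom|rewrite /preimage /Tm /= chartK].
have E z : (dom i `&` par i @^-1` O1) z -> (f \o par j) (Tm phi i j z) = ((f \o phi) \o par i) z.
  by move=> [dz [_ [Oz uz]]]; rewrite /Tm /= chartK.
have sT1 : sm (dom i `&` par i @^-1` O1) (Tm phi i j) by exact: (sm_sub sD (@mI i) sT).
apply: (basic_chart (i := i) mI) => [z []//||z x Dz].
  by apply: (sm_eq E); apply: (sm_comp _ TD sT1 (basic_sm j bf)).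
rewrite -(derive_eq_on _ (@mI i) Dz E).
have [_ ->] := isd_comp (isd_sm sT1 Dz) (isd_sm (basic_sm j bf) (TD z Dz)).
have e2 : (dv (x, 0) (Tm phi i j) z).2 = 0.
  have [_ <-] := isd_snd _ _ (isd_sm sT1 Dz).
  exact: (mor_flat hphi _ (sD z Dz)).
move: e2; case: (dv (x, 0) (Tm phi i j) z) => a b /= ->.
exact: (basic_flat a bf (TD z Dz)).
Qed.

Lemma quant_nat (O : set M) f m : mopen O -> basic O f -> O (phi m) ->
  quant nab0 k (pull_symbol phi S) (f \o phi) m = quant nab k S f (phi m).
Proof.
move=> mO bf Om; have [i ui] := cover m; have [j uj] := cover (phi m).
have mU : mopen (udom i) := @udom_mopen _ _ _ M0 i.
have mV : mopen (phi @^-1` (O `&` udom j)).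
  by apply: mor_preim => //; apply: mopenI => //; exact: (@udom_mopen _ _ _ M j).
(* The value at [m] may be computed on any open neighbourhood where the function is basic, here one
   mapped by [phi] into a single chart. *)
have mI := mopenI mU mV; set O1 := udom i `&` _ in mI *.
have bfp : basic O1 (f \o phi) by exact: basic_pull.
set z := chart i m; have dz : dom i z := chart_dom ui; have em : par i z = m := chartK ui.
have Oz : O1 (par i z) by rewrite em.
have Dw := sect_D dz Oz; set w := sect z in Dw.
have ez : pbase w = z by rewrite /pbase /= -surjective_pairing.
have D1 w' : Pdom i O1 w' -> Pdom i (phi @^-1` (O `&` udom j)) w'.
  by move=> [d [_ ow] u]; split.
have DT w' : Pdom i O1 w' -> Pdom j O (Phi phi i j w') by move=> /D1; exact: Phi_Pdom.
have DP := DT _ Dw.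
rewrite -{1}em (quant_sect hq hn0 pull_symbolP mI bfp dz Oz).
have -> : phi m = par j (pbase (Phi phi i j w)).
  by rewrite /pbase /= -surjective_pairing /Tm ez em chartK.
rewrite (quantE hq hn hS mO bf DP).
apply: (Qloc_transf hn mI mO DT _ (@sum_id_mx R q) (fun s => symfun_smO hS j s mO)) => //.
- move=> g sg fg v w' Dw'; rewrite mul1mx.
  exact: (Phi_Dhor hphi hn0 hn pc sg fg v (D1 _ Dw')).
- by move=> s; exact: symfun_flatO.
- move=> s w' Dw'; rewrite tact1; apply: symfun_pull; first exact: pdom_T Dw'.
  by have [_ [_ []]] := Dw'.
- exact: (pullf_sm mO bf j).
- exact: (pullf_flat bf).
- move=> w' Dw'; rewrite /pullf /= /pbase /= -surjective_pairing /Tm chartK //.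
  by have [_ [_ []]] := Dw'.
Qed.

End Conn.
End Nat.
End Frames.

Unset Implicit Arguments.
Set Strict Implicit.
Set Printing Implicit Defensive.

Theorem theorem15 (R : realType) (p q : nat) (hq : (2 <= q)%N)
  (M : folmfd R p q) (nab : conn M) (hnab : is_folconn nab)
  (k : nat) (S : jet M -> @tens R q) (hS : is_symbol k S) :
  (* the operators on foliated functions do not depend on the choices *)
  (forall (O : set M) (F : jet M -> R), mopen O ->
     foliated nab O F -> nabla_well_defined nab O F) /\
  (* well-defined *)
  (forall (O : set M) (f : M -> R), mopen O -> basic O f ->
     [/\ foliated nab O (Qsum nab k S f),
         Hinvariant nab O (Qsum nab k S f),
         basic O (quant nab k S f) &
         forall u, PF nab O u ->
           pull_fun (quant nab k S f) u = Qsum nab k S f u]) /\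
  (* quantization *)
  (forall i : idx M, exists a : seq 'I_q -> M -> R,
     (forall t, basic (udom i) (a t)) /\
     forall (O : set M) (f : M -> R) (m : M), mopen O -> basic O f ->
       O m -> udom i m ->
       quant nab k S f m =
         \sum_(t : k.-tuple 'I_q) S (dyframe i m) t * dys i t f m +
         \sum_(r < k) \sum_(t : r.-tuple 'I_q) a t m * dys i t f m) /\
  (* projectively invariant *)
  (forall nab' : conn M, is_folconn nab' -> proj_equiv nab nab' ->
     forall (O : set M) (f : M -> R) (m : M), mopen O -> basic O f -> O m ->
       quant nab' k S f m = quant nab k S f m) /\
  (* natural *)
  (forall (M0 : folmfd R p q) (phi : M0 -> M) (nab0 : conn M0),
     local_diffeo phi -> preserves_fol phi ->
     is_folconn nab0 -> is_pull_conn phi nab nab0 ->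
     forall (O : set M) (f : M -> R) (m : M0), mopen O -> basic O f ->
       O (phi m) ->
       quant nab0 k (pull_symbol phi S) (f \o phi) m = quant nab k S f (phi m)).
Proof.
split; first by move=> O F mO fF; exact: (nabla_wd hq hnab mO fF).
split.
  move=> O f mO bf; split.
  - exact: (Qsum_fol hq hnab hS mO bf).
  - exact: (Qsum_Hinv hq hnab hS mO bf).
  - exact: (quant_basic hq hnab hS mO bf).
  - by move=> u; exact: (quant_pull hq hnab hS mO bf).
split.
  move=> i; exists (fun t m => opcoef nab i k S t (sect (chart i m))).
  split; first by move=> t; exact: (opcoef_basic hnab i hS t).
  by move=> O f m mO bf Om ui; exact: (quant_op hq hnab hS mO bf Om ui).
split.
  move=> nab' hn' [alpha ha hp] O f m mO bf Om.
  exact: (quant_proj hq hnab hn' ha hp hS mO bf Om).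
move=> M0 phi nab0 ld pf hn0 pc O f m mO bf Om.
exact: (quant_nat (local_diffeo_mor ld pf) hS hq hn0 hnab pc mO bf Om).
Qed.
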